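(* Let $x>0$, $0<\theta<1$, and let $\nu\in\mathbb{C}\setminus\mathbb{Z}$ with $\Re(\nu)\geq 0$. Let $N$ be any integer with $N\geq\lfloor\frac{\Re(\nu)+1}{2}\rfloor$, and suppose $x\notin\{(n-\theta)r:\ n,r\in\mathbb{N}\}$. Then \begin{align*} &8\pi x^{\nu/2}\sum_{n=1}^{\infty}n^{\nu/2}K_{\nu}(4\pi\sqrt{nx})\sum_{d\mid n}d^{-\nu}\sin(2\pi d\theta) =\frac{1}{\cos(\frac{\pi\nu}{2})}\zeta(\nu+1)\bigl(\zeta(1,\theta)-\zeta(1,1-\theta)\bigr)x^{\nu}\\ &\quad-\frac{\pi}{2\sin(\frac{\pi\nu}{2})}\bigl(\zeta(1-\nu,\theta)-\zeta(1-\nu,1-\theta)\bigr)+\frac{1}{2x\cos(\frac{\pi\nu}{2})}\bigl(\zeta(-\nu,\theta)-\zeta(-\nu,1-\theta)\bigr)\\ &\quad-\frac{1}{\cos(\frac{\pi\nu}{2})}\sum_{j=1}^{N}\zeta(2j)\bigl(\zeta(2j-\nu,\theta)-\zeta(2j-\nu,1-\theta)\bigr)x^{2j-1}\\ &\quad-\frac{1}{\cos(\frac{\pi\nu}{2})}x^{2N+1}\sum_{d=1}^{\infty}d^{-\nu-1}\sum_{m=0}^{\infty}\left\{\frac{(d(m+\theta))^{\nu+1-2N}-x^{\nu+1-2N}}{(m+\theta)\bigl(d^2(m+\theta)^2-x^2\bigr)}-\frac{(d(m+1-\theta))^{\nu+1-2N}-x^{\nu+1-2N}}{(m+1-\theta)\bigl(d^2(m+1-\theta)^2-x^2\bigr)}\right\}.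 \end{align*}
   Context: $K_\nu$ denotes the modified Bessel function of the second kind of order $\nu$. $\zeta(s,\alpha)$ is the Hurwitz zeta function ($\sum_{n\ge0}(n+\alpha)^{-s}$ for $\Re s>1$, meromorphically continued to $\mathbb{C}$ with only pole at $s=1$), $\zeta(s)$ the Riemann zeta function; $\zeta(1,\theta)-\zeta(1,1-\theta)$ is understood as $\lim_{s\to1}(\zeta(s,\theta)-\zeta(s,1-\theta))$. $\mathbb{N}=\{1,2,\dots\}$.
   Formalization: If x = d(m+θ) for some d ≥ 1, m ≥ 0 (not excluded by the hypothesis, e.g. x = θ irrational), the first fraction in the last double sum is 0/0; it is then taken to be its limiting value, i.e. the removable singularity is filled by continuity. *)

(* Defs.v *)
From Stdlib Require Import Reals List ZArith.
From Coquelicot Require Import Coquelicot.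
Open Scope R_scope.

Definition cpow (b : R) (s : C) : C :=
  (exp (Re s * ln b) * cos (Im s * ln b), exp (Re s * ln b) * sin (Im s * ln b)).

Definition Ccos (z : C) : C := (cos (Re z) * cosh (Im z), - (sin (Re z) * sinh (Im z))).
Definition Csin (z : C) : C := (sin (Re z) * cosh (Im z), cos (Re z) * sinh (Im z)).

Definition Cis_series (a : nat -> C) (l : C) : Prop :=
  @is_series C_AbsRing C_NormedModule a l.

Definition C_differentiable (f : C -> C) (z : C) : Prop :=
  @ex_derive C_AbsRing C_NormedModule f z.

(* Zh is (the) Hurwitz zeta function: for 0 < a <= 1, Zh(.,a) equals
   sum_{n>=0} (n+a)^{-s} for Re s > 1 and is holomorphic on C \ {1}
   (i.e. it is the meromorphic continuation, unique by the identity theorem).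
   The Riemann zeta function is zeta(s) = Zh s 1. *)
Definition is_hurwitz_zeta (Zh : C -> R -> C) : Prop :=
  forall a : R, 0 < a <= 1 ->
    (forall s : C, 1 < Re s -> Cis_series (fun n => cpow (INR n + a) (Copp s)) (Zh s a)) /\
    (forall s : C, s <> RtoC 1 -> C_differentiable (fun w => Zh w a) s).

(* K_nu(z) = int_0^oo exp(-z cosh t) cosh(nu t) dt  (z > 0, nu complex);
   cosh((a+ib)t) = cosh(at)cos(bt) + i sinh(at)sin(bt). *)
Definition BesselK (nu : C) (z : R) : C :=
  (real (Lim (fun T => RInt (fun t => exp (- z * cosh t) * (cosh (Re nu * t) * cos (Im nu * t))) 0 T) p_infty),
   real (Lim (fun T => RInt (fun t => exp (- z * cosh t) * (sinh (Re nu * t) * sin (Im nu * t))) 0 T) p_infty)).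

Definition Csum_list (l : list C) : C := fold_right Cplus (RtoC 0) l.

Definition divisor_sum (n : nat) (f : nat -> C) : C :=
  Csum_list (map f (filter (fun d => Nat.eqb (n mod d) 0) (seq 1 n))).

Definition Csum_1_to (N : nat) (f : nat -> C) : C := Csum_list (map f (seq 1 N)).

(* The function y |-> (y^e - x^e) / (y (y^2 - x^2)) for y > 0, x > 0,
   extended continuously at its removable singularity y = x
   (value e x^(e-1) / (2 x^2)). *)
Definition qfun (e : C) (x y : R) : C :=
  if Req_EM_T y x then Cmult e (Cdiv (cpow x (Cminus e (RtoC 1))) (RtoC (2 * x ^ 2)))
  else Cdiv (Cminus (cpow y e) (cpow x e)) (RtoC (y * (y ^ 2 - x ^ 2))).

(* The summand of the inner double series, for d >= 1, m >= 0:
   ((d(m+t))^e - x^e)/((m+t)(d^2(m+t)^2 - x^2))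
   - ((d(m+1-t))^e - x^e)/((m+1-t)(d^2(m+1-t)^2 - x^2)),
   written as d*qfun(d(m+t)) - d*qfun(d(m+1-t)). *)
Definition inner_term (e : C) (x t : R) (d m : nat) : C :=
  Cminus (Cmult (RtoC (INR d)) (qfun e x (INR d * (INR m + t))))
         (Cmult (RtoC (INR d)) (qfun e x (INR d * (INR m + 1 - t)))).

(* Main.v *)
Require Import Defs.
From Stdlib Require Import Reals List ZArith Lra Lia Psatz ClassicalEpsilon.
From Coquelicot Require Import Coquelicot.
Open Scope R_scope.

(* Substituting u = e^t in the Bessel integral turns 8 pi (kx/d)^(nu/2) K_nu(4 pi sqrt(dkx)) into
   4 pi int_0^oo u^(nu-1) exp(-2 pi (d u + k x/u)) du, so the left-hand side is
     4 pi int_0^oo u^(nu-1) S(u) / (exp(2 pi x/u) - 1) du,   S(u) = sum_d sin(2 pi d theta) exp(-2 pi d u).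
   The partial fractions of the cotangent give
     1/(exp(2 pi v) - 1) = -1/2 + 1/(2 pi v) + (1/pi) sum_(d >= 1) v/(v^2 + d^2),
     2 pi S(u) = sum_(m >= 0) (a/(a^2 + u^2) - a'/(a'^2 + u^2)),   a = m + theta, a' = m + 1 - theta,
   and also int_0^oo u^(p-1)/(1 + u^2) du = (pi/2)/sin(pi p/2).
   The first expansion splits the integral into Mellin transforms of S and, after expanding 1/(x^2 + d^2 u^2)
   to order N in x, into the double series.  The Mellin transforms are zeta values, since
     zeta(s,theta) - zeta(s,1-theta) = 4 cos(pi s/2) int_0^oo u^(-s) S(u) du   (Re s < 1):
   this is computed termwise for 1 < Re s < 2 with S(u) - S(0) and continued through two overlapping strips; as the
   zeta function is only assumed complex differentiable, uniqueness of the continuation rests on Goursat's lemma.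
   All this needs Re nu > 0 and |Re nu - 2N| < 1.  The remaining lines Re nu = 0 and Re nu = 2N - 1 follow by
   continuity in nu, and larger N by comparing consecutive remainders. *)

(** Writing u = e^t turns each integral over (0, oo) into one over the whole line of a continuous
    function bounded by M exp(-c |t|). One interchange theorem, [lint_series], then does nearly all
    termwise integration: the constants M must be summable in the index for one common rate c. Most
    estimates exist to supply such a bound, since the obvious ones fail: a single a/(a^2 + u^2) is
    only O(1/a), so a and a' are kept together, or a small power is moved from the decay in u to the
    decay in the index. The double series is not estimated at first. For fixed d and m the quotient
    [qfun] comes out of the Mellin transform of a product of two rational factors, by partial
    fractions. The piece x^(nu-1-2N)/a left over by them sums over m, in pairs, to a multiple of
    zeta(1,theta) - zeta(1,1-theta): this is the origin of the term with zeta(nu+1). The condition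
    |Re nu - 2N| < 1 says that p = nu + 1 - 2N lies in the strip 0 < Re p < 2 where the transform of
    1/(1 + u^2) converges. Uniform bounds for the double series enter only to reach the boundary of
    that strip. *)

Lemma C_ext (z w : C) : Re z = Re w -> Im z = Im w -> z = w.
Proof. destruct z, w; simpl; intros -> ->; reflexivity. Qed.

Lemma Cmod_le_abs (z : C) : Cmod z <= Rabs (Re z) + Rabs (Im z).
Proof.
  unfold Cmod. apply Rsqr_incr_0_var.
  2: pose proof (Rabs_pos (Re z)); pose proof (Rabs_pos (Im z)); lra.
  rewrite Rsqr_sqrt by nra. unfold Rsqr, Re, Im.
  pose proof (Rabs_pos (fst z)); pose proof (Rabs_pos (snd z)).
  rewrite <- (pow2_abs (fst z)), <- (pow2_abs (snd z)).
  nra.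
Qed.

Lemma Im_le_Cmod (z : C) : Rabs (Im z) <= Cmod z.
Proof. eapply Rle_trans; [apply Rmax_r | apply Rmax_Cmod]. Qed.

Lemma Cmod_sub_sym (z w : C) : Cmod (z - w) = Cmod (w - z).
Proof. rewrite <- Cmod_opp. f_equal. ring. Qed.

Lemma Cmod_triangle_sub (z w y : C) : Cmod (z - y) <= Cmod (z - w) + Cmod (w - y).
Proof. replace (z - y)%C with ((z - w) + (w - y))%C by ring. apply Cmod_triangle. Qed.

Lemma Cmod_triangle_inv (z w : C) : Cmod z - Cmod w <= Cmod (z - w).
Proof.
  pose proof (Cmod_triangle (z - w) w) as H.
  replace (z - w + w)%C with z in H by ring. lra.
Qed.

Lemma Cmod_RtoC_pos (r : R) : 0 <= r -> Cmod (RtoC r) = r.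
Proof. intro H. rewrite Cmod_R. now apply Rabs_pos_eq. Qed.

(** * Sequences and series *)

Fixpoint csum (a : nat -> C) (n : nat) : C :=
  match n with O => RtoC 0 | S k => (csum a k + a k)%C end.

Fixpoint rsum (a : nat -> R) (n : nat) : R :=
  match n with O => 0 | S k => rsum a k + a k end.

(** Sequential convergence for [Cmod]. Continuity in a complex variable is phrased through it too,
    so that limits in nu and limits of partial sums share one set of rules. *)
Definition ccvg (u : nat -> C) (l : C) : Prop :=
  forall eps, 0 < eps -> exists N, forall n, (N <= n)%nat -> Cmod (u n - l) < eps.

Definition cser (a : nat -> C) (l : C) : Prop := ccvg (csum a) l.

Definition rser (a : nat -> R) (l : R) : Prop := is_lim_seq (rsum a) l.

Lemma csum_ext a b n : (forall k, (k < n)%nat -> a k = b k) -> csum a n = csum b n.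
Proof.
  induction n; simpl; intro H; [easy|]. rewrite IHn, H; auto.
Qed.

Lemma csum_plus a b n : csum (fun k => (a k + b k)%C) n = (csum a n + csum b n)%C.
Proof. induction n; simpl; [ring|rewrite IHn; ring]. Qed.

Lemma csum_scal c a n : csum (fun k => (c * a k)%C) n = (c * csum a n)%C.
Proof. induction n; simpl; [ring|rewrite IHn; ring]. Qed.

Lemma csum_split a n m : csum a (n + m) = (csum a n + csum (fun k => a (n + k)%nat) m)%C.
Proof.
  induction m; simpl; [rewrite Nat.add_0_r; ring|].
  rewrite Nat.add_succ_r; simpl. rewrite IHm; ring.
Qed.

Lemma csum_first a n : csum a (S n) = (a 0%nat + csum (fun k => a (S k)) n)%C.
Proof. induction n; [simpl; ring|]. change (csum a (S (S n))) with (csum a (S n) + a (S n))%C.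
  rewrite IHn; simpl; ring. Qed.

Lemma csum_rev a n : csum a n = csum (fun k => a (n - 1 - k)%nat) n.
Proof.
  induction n; [easy|]. rewrite (csum_first (fun k => a (S n - 1 - k)%nat)).
  simpl csum at 1. rewrite IHn.
  replace (S n - 1 - 0)%nat with n by lia. rewrite Cplus_comm. f_equal.
  apply csum_ext; intros k Hk. f_equal; lia.
Qed.

Lemma csum_mod_le a M n : (forall k, (k < n)%nat -> Cmod (a k) <= M k) -> Cmod (csum a n) <= rsum M n.
Proof.
  induction n; simpl; intro H; [rewrite Cmod_0; lra|].
  eapply Rle_trans; [apply Cmod_triangle|]. apply Rplus_le_compat; auto.
Qed.

Lemma rsum_split a n m : rsum a (n + m) = rsum a n + rsum (fun k => a (n + k)%nat) m.
Proof.
  induction m; simpl; [rewrite Nat.add_0_r; ring|].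
  rewrite Nat.add_succ_r; simpl. rewrite IHm; ring.
Qed.

Lemma rsum_scal c a n : rsum (fun k => c * a k) n = c * rsum a n.
Proof. induction n; simpl; [ring|rewrite IHn; ring]. Qed.

Lemma rsum_pos a n : (forall k, 0 <= a k) -> 0 <= rsum a n.
Proof. intro H; induction n; simpl; [lra|]. specialize (H n); lra. Qed.

Lemma ccvg_unique u l l' : ccvg u l -> ccvg u l' -> l = l'.
Proof.
  intros H H'. destruct (Req_dec (Cmod (l - l')) 0) as [E|E].
  - apply Cmod_eq_0 in E. replace l with ((l - l') + l')%C by ring. rewrite E; ring.
  - pose proof (Cmod_ge_0 (l - l')).
    destruct (H (Cmod (l - l') / 2)) as [N HN]; [lra|].
    destruct (H' (Cmod (l - l') / 2)) as [N' HN']; [lra|].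
    specialize (HN (max N N') ltac:(lia)). specialize (HN' (max N N') ltac:(lia)).
    pose proof (Cmod_triangle_sub l (u (max N N')) l') as H1.
    rewrite (Cmod_sub_sym l (u _)) in H1. lra.
Qed.

Lemma ccvg_ext u v l : (forall n, u n = v n) -> ccvg u l -> ccvg v l.
Proof. intros E H eps He. destruct (H eps He) as [N HN]. exists N; intros n Hn. rewrite <- E; auto. Qed.

Lemma ccvg_ext_ev u v l N0 : (forall n, (N0 <= n)%nat -> u n = v n) -> ccvg u l -> ccvg v l.
Proof.
  intros E H eps He. destruct (H eps He) as [N HN]. exists (max N N0); intros n Hn.
  rewrite <- E by lia. apply HN; lia.
Qed.

Lemma ccvg_const l : ccvg (fun _ => l) l.
Proof. intros eps He; exists O; intros. replace (l - l)%C with (RtoC 0) by ring. rewrite Cmod_0; auto. Qed.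

Lemma ccvg_plus u v l l' : ccvg u l -> ccvg v l' -> ccvg (fun n => (u n + v n)%C) (l + l')%C.
Proof.
  intros H H' eps He. destruct (H (eps/2)) as [N HN]; [lra|]. destruct (H' (eps/2)) as [N' HN']; [lra|].
  exists (max N N'); intros n Hn. specialize (HN n ltac:(lia)); specialize (HN' n ltac:(lia)).
  replace (u n + v n - (l + l'))%C with ((u n - l) + (v n - l'))%C by ring.
  pose proof (Cmod_triangle (u n - l) (v n - l')); lra.
Qed.

Lemma ccvg_scal c u l : ccvg u l -> ccvg (fun n => (c * u n)%C) (c * l)%C.
Proof.
  intros H eps He. pose proof (Cmod_ge_0 c).
  destruct (H (eps / (Cmod c + 1))) as [N HN]; [apply Rdiv_lt_0_compat; lra|].
  exists N; intros n Hn. specialize (HN n Hn).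
  replace (c * u n - c * l)%C with (c * (u n - l))%C by ring. rewrite Cmod_mult.
  apply Rmult_lt_compat_l with (r := Cmod c + 1) in HN; [|lra].
  replace ((Cmod c + 1) * (eps / (Cmod c + 1))) with eps in HN by (field; lra).
  pose proof (Cmod_ge_0 (u n - l)). nra.
Qed.

Lemma ccvg_opp u l : ccvg u l -> ccvg (fun n => (- u n)%C) (- l)%C.
Proof.
  intro H. apply (ccvg_scal (-(1))%C) in H.
  replace (-l)%C with (-(1) * l)%C by ring. eapply ccvg_ext; [|exact H]. intro n; simpl; ring.
Qed.

Lemma ccvg_minus u v l l' : ccvg u l -> ccvg v l' -> ccvg (fun n => (u n - v n)%C) (l - l')%C.
Proof. intros H H'. apply ccvg_plus; [auto|now apply ccvg_opp]. Qed.

Lemma ccvg_bounded u l : ccvg u l -> exists M N, 0 < M /\ forall n, (N <= n)%nat -> Cmod (u n) <= M.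
Proof.
  intros H. destruct (H 1 Rlt_0_1) as [N HN]. exists (Cmod l + 1), N. split.
  - pose proof (Cmod_ge_0 l); lra.
  - intros n Hn. specialize (HN n Hn). pose proof (Cmod_triangle_inv (u n) l). lra.
Qed.

Lemma ccvg_mult u v l l' : ccvg u l -> ccvg v l' -> ccvg (fun n => (u n * v n)%C) (l * l')%C.
Proof.
  intros H H'. destruct (ccvg_bounded _ _ H) as (M & N0 & HM & HB).
  assert (H1 : ccvg (fun n => (u n * (v n - l'))%C) 0).
  { intros eps He. destruct (H' (eps / M)) as [N HN]; [apply Rdiv_lt_0_compat; lra|].
    exists (max N N0); intros n Hn. specialize (HN n ltac:(lia)); specialize (HB n ltac:(lia)).
    replace (u n * (v n - l') - 0)%C with (u n * (v n - l'))%C by ring. rewrite Cmod_mult.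
    apply Rmult_lt_compat_l with (r := M) in HN; [|lra].
    replace (M * (eps / M)) with eps in HN by (field; lra).
    pose proof (Cmod_ge_0 (u n)); pose proof (Cmod_ge_0 (v n - l')). nra. }
  apply (ccvg_scal l') in H. pose proof (ccvg_plus _ _ _ _ H1 H) as H2.
  replace (l * l')%C with (0 + l' * l)%C by ring. eapply ccvg_ext; [|exact H2]. intro n; simpl; ring.
Qed.

Lemma ccvg_inv u (l : C) : l <> RtoC 0 -> ccvg u l -> ccvg (fun n => (/ u n)%C) (/ l)%C.
Proof.
  intros Hl H eps He. assert (Hl' : 0 < Cmod l) by (apply (proj1 (Cmod_gt_0 l)); exact Hl).
  destruct (H (Rmin (Cmod l / 2) (eps * Cmod l * Cmod l / 2))) as [N HN].
  { apply Rmin_glb_lt; [lra|]. apply Rmult_lt_0_compat; [|lra]. repeat apply Rmult_lt_0_compat; auto. }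
  exists N; intros n Hn. specialize (HN n Hn).
  pose proof (Rlt_le_trans _ _ _ HN (Rmin_l _ _)) as H1.
  pose proof (Rlt_le_trans _ _ _ HN (Rmin_r _ _)) as H2.
  pose proof (Cmod_triangle_inv l (u n)) as H3. rewrite Cmod_sub_sym in H3.
  assert (Hu : Cmod l / 2 < Cmod (u n)) by lra.
  assert (Hu0 : u n <> RtoC 0). { apply (proj2 (Cmod_gt_0 (u n))). lra. }
  replace (/ u n - / l)%C with ((l - u n) / (u n * l))%C by (field; auto).
  rewrite Cmod_div by (apply Cmult_neq_0; auto). rewrite Cmod_sub_sym, Cmod_mult.
  apply Rmult_lt_reg_r with (Cmod (u n) * Cmod l); [apply Rmult_lt_0_compat; lra|].
  unfold Rdiv. rewrite Rmult_assoc, Rinv_l, Rmult_1_r.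
  2: apply Rmult_integral_contrapositive_currified; lra.
  eapply Rlt_trans; [exact H2|].
  assert (0 < eps * Cmod l) by (apply Rmult_lt_0_compat; auto).
  nra.
Qed.

Lemma ccvg_of_le u l (v : nat -> R) : (forall n, Cmod (u n - l) <= v n) -> is_lim_seq v 0 -> ccvg u l.
Proof.
  intros H Hv eps He. apply is_lim_seq_spec in Hv. destruct (Hv (mkposreal _ He)) as [N HN].
  exists N; intros n Hn. specialize (HN n Hn). simpl in HN. specialize (H n).
  rewrite Rminus_0_r in HN. pose proof (Rle_abs (v n)). lra.
Qed.

Lemma ccvg_Re u l : ccvg u l -> is_lim_seq (fun n => Re (u n)) (Re l).
Proof.
  intros H. apply is_lim_seq_spec. intros eps. destruct (H eps (cond_pos eps)) as [N HN].
  exists N; intros n Hn. eapply Rle_lt_trans; [|apply (HN n Hn)].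
  eapply Rle_trans; [|apply re_le_Cmod]. apply Req_le. f_equal.
Qed.

Lemma ccvg_Im u l : ccvg u l -> is_lim_seq (fun n => Im (u n)) (Im l).
Proof.
  intros H. apply is_lim_seq_spec. intros eps. destruct (H eps (cond_pos eps)) as [N HN].
  exists N; intros n Hn. eapply Rle_lt_trans; [|apply (HN n Hn)].
  eapply Rle_trans; [|apply Im_le_Cmod]. apply Req_le. f_equal.
Qed.

Lemma ccvg_RI u l : is_lim_seq (fun n => Re (u n)) (Re l) -> is_lim_seq (fun n => Im (u n)) (Im l) -> ccvg u l.
Proof.
  intros H H' eps He. apply is_lim_seq_spec in H. apply is_lim_seq_spec in H'.
  assert (He2 : 0 < eps / 2) by lra.
  destruct (H (mkposreal _ He2)) as [N HN]. destruct (H' (mkposreal _ He2)) as [N' HN'].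
  exists (max N N'); intros n Hn. specialize (HN n ltac:(lia)); specialize (HN' n ltac:(lia)). simpl in *.
  eapply Rle_lt_trans; [apply Cmod_le_abs|].
  replace (Re (u n - l)) with (Re (u n) - Re l) by reflexivity.
  replace (Im (u n - l)) with (Im (u n) - Im l) by reflexivity. lra.
Qed.

Lemma ccvg_cauchy u : (forall eps, 0 < eps -> exists N, forall n m, (N <= n)%nat -> (N <= m)%nat -> Cmod (u n - u m) < eps) ->
  exists l, ccvg u l.
Proof.
  intros H.
  assert (H1 : Cauchy_crit (fun n => Re (u n))).
  { intros eps He. destruct (H eps He) as [N HN]. exists N; intros n m Hn Hm.
    unfold Rdist. eapply Rle_lt_trans; [|apply (HN n m); auto]. eapply Rle_trans; [|apply re_le_Cmod]. apply Req_le. f_equal. }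
  assert (H2 : Cauchy_crit (fun n => Im (u n))).
  { intros eps He. destruct (H eps He) as [N HN]. exists N; intros n m Hn Hm.
    unfold Rdist. eapply Rle_lt_trans; [|apply (HN n m); auto]. eapply Rle_trans; [|apply Im_le_Cmod]. apply Req_le. f_equal. }
  destruct (Rcomplete.R_complete _ H1) as [l1 L1]. destruct (Rcomplete.R_complete _ H2) as [l2 L2].
  exists (l1, l2). apply ccvg_RI; simpl; now apply is_lim_seq_Reals.
Qed.

(** [sum_n] includes the term of index n while [csum] stops before it, so the partial sums differ by
    a shift of one. *)
Lemma sum_n_csum (a : nat -> C) n : @sum_n C_AbelianMonoid a n = csum a (S n).
Proof.
  induction n; [rewrite sum_O; simpl; ring|]. rewrite sum_Sn, IHn. reflexivity.
Qed.

Lemma Cis_series_cser a l : Cis_series a l <-> cser a l.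
Proof.
  split; intro H.
  - intros eps He.
    assert (He2 : 0 < eps) by auto.
    pose proof (proj1 (filterlim_locally_ball_norm (K := C_AbsRing) (U := C_NormedModule) (F := eventually) _ _) H) as H0.
    destruct (H0 (mkposreal _ He2)) as [N HN].
    exists (S N); intros n Hn. destruct n; [lia|]. specialize (HN n ltac:(lia)).
    rewrite sum_n_csum in HN. unfold ball_norm in HN. simpl in HN. exact HN.
  - apply (proj2 (filterlim_locally_ball_norm (K := C_AbsRing) (U := C_NormedModule) (F := eventually) _ _)).
    intros eps. destruct (H eps (cond_pos eps)) as [N HN]. exists N; intros n Hn.
    unfold ball_norm. rewrite sum_n_csum. apply HN; lia.
Qed.

Lemma cser_ext a b l : (forall n, a n = b n) -> cser a l -> cser b l.
Proof. intros E. apply ccvg_ext. intro n. apply csum_ext; auto. Qed.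

Lemma cser_plus a b l l' : cser a l -> cser b l' -> cser (fun n => (a n + b n)%C) (l + l')%C.
Proof. intros H H'. eapply ccvg_ext; [|apply (ccvg_plus _ _ _ _ H H')]. intro; simpl; now rewrite csum_plus. Qed.

Lemma cser_scal c a l : cser a l -> cser (fun n => (c * a n)%C) (c * l)%C.
Proof. intros H. eapply ccvg_ext; [|apply (ccvg_scal c _ _ H)]. intro; simpl; now rewrite csum_scal. Qed.

Lemma cser_minus a b l l' : cser a l -> cser b l' -> cser (fun n => (a n - b n)%C) (l - l')%C.
Proof.
  intros H H'. apply (cser_scal (-(1))%C) in H'. pose proof (cser_plus _ _ _ _ H H') as H1.
  replace (l - l')%C with (l + -(1) * l')%C by ring. eapply cser_ext; [|exact H1]. intro; simpl; ring.
Qed.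

Lemma cser_unique a l l' : cser a l -> cser a l' -> l = l'.
Proof. apply ccvg_unique. Qed.

Lemma cser_finite (a : nat -> C) N : (forall k, (N <= k)%nat -> a k = RtoC 0) -> cser a (csum a N).
Proof.
  intros H. apply ccvg_ext_ev with (u := fun _ => csum a N) (N0 := N); [|apply ccvg_const].
  intros n Hn. replace n with (N + (n - N))%nat by lia. rewrite csum_split.
  rewrite (csum_ext (fun k => a (N + k)%nat) (fun _ => RtoC 0)); [|intros; apply H; lia].
  replace (csum (fun _ => RtoC 0) (n - N)) with (RtoC 0); [ring|].
  induction (n - N)%nat as [|q IH]; simpl; [easy|]. rewrite <- IH; ring.
Qed.

Lemma cser_csum (a : nat -> nat -> C) l n : (forall k, (k < n)%nat -> cser (a k) (l k)) ->
  cser (fun j => csum (fun k => a k j) n) (csum l n).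
Proof.
  induction n; intro H; simpl.
  - apply (cser_finite (fun _ => RtoC 0) 0). auto.
  - apply cser_plus; [apply IHn; auto|apply H; auto].
Qed.

Lemma cser_RtoC a l : rser a l -> cser (fun n => RtoC (a n)) (RtoC l).
Proof.
  intro H. assert (E : forall n, csum (fun n => RtoC (a n)) n = RtoC (rsum a n)).
  { induction n; simpl; [easy|]. rewrite IHn. now rewrite RtoC_plus. }
  apply ccvg_RI; simpl.
  - eapply is_lim_seq_ext; [|exact H]. intro n. now rewrite E.
  - eapply is_lim_seq_ext; [|apply is_lim_seq_const]. intro n. now rewrite E.
Qed.

Lemma Re_csum a n : Re (csum a n) = rsum (fun k => Re (a k)) n.
Proof. induction n; simpl; [easy|]. now rewrite <- IHn. Qed.

Lemma cser_Re a l : cser a l -> rser (fun n => Re (a n)) (Re l).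
Proof. intros H. eapply is_lim_seq_ext; [|apply (ccvg_Re _ _ H)]. intro n; apply Re_csum. Qed.

Lemma rser_ge a l n : (forall k, 0 <= a k) -> rser a l -> rsum a n <= l.
Proof.
  intros Ha H. assert (H1 : Rbar_le (rsum a n) l); [|exact H1].
  apply (is_lim_seq_le_loc (fun _ => rsum a n) (rsum a)); [|apply is_lim_seq_const|exact H].
  exists n; intros m Hm. replace m with (n + (m - n))%nat by lia. rewrite rsum_split.
  pose proof (rsum_pos (fun k => a (n + k)%nat) (m - n) (fun k => Ha _)); lra.
Qed.

Lemma rser_bounded a B : (forall k, 0 <= a k) -> (forall n, rsum a n <= B) -> exists l, rser a l.
Proof.
  intros Ha HB. destruct (ex_finite_lim_seq_incr (rsum a) B) as [l Hl]; auto.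
  - intro n; simpl; specialize (Ha n); lra.
  - exists l; exact Hl.
Qed.

Lemma rser_scal c a l : rser a l -> rser (fun n => c * a n) (c * l).
Proof.
  intro H. eapply is_lim_seq_ext; [intro n; symmetry; apply rsum_scal|].
  apply (is_lim_seq_scal_l _ c l H).
Qed.

Lemma cser_abs a M l : (forall k, Cmod (a k) <= M k) -> rser M l -> exists s, cser a s.
Proof.
  intros H HM. assert (HM0 : forall k, 0 <= M k) by (intro k; eapply Rle_trans; [apply Cmod_ge_0|apply H]).
  apply ccvg_cauchy. intros eps He.
  apply is_lim_seq_spec in HM. assert (He2 : 0 < eps / 2) by lra.
  destruct (HM (mkposreal _ He2)) as [N HN]. exists N.
  assert (G : forall n m, (N <= n)%nat -> (n <= m)%nat -> Cmod (csum a m - csum a n) < eps).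
  { intros n m Hn Hm. replace m with (n + (m - n))%nat by lia. rewrite csum_split.
    replace (csum a n + csum (fun k => a (n + k)%nat) (m - n) - csum a n)%C with (csum (fun k => a (n + k)%nat) (m - n)) by ring.
    eapply Rle_lt_trans; [apply csum_mod_le with (M := fun k => M (n + k)%nat); intros; apply H|].
    pose proof (HN n Hn) as H1. pose proof (HN m ltac:(lia)) as H2. simpl in H1, H2.
    replace m with (n + (m - n))%nat in H2 by lia. rewrite rsum_split in H2.
    apply Rabs_def2 in H1. apply Rabs_def2 in H2. lra. }
  intros n m Hn Hm. destruct (Nat.le_ge_cases n m).
  - rewrite Cmod_sub_sym. apply G; auto.
  - apply G; auto.
Qed.

Lemma ccvg_mod_le u l B N0 : ccvg u l -> (forall n, (N0 <= n)%nat -> Cmod (u n) <= B) -> Cmod l <= B.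
Proof.
  intros H HB. apply Rnot_lt_le; intro Hl.
  destruct (H (Cmod l - B)) as [N HN]; [lra|].
  specialize (HN (max N N0) ltac:(lia)). specialize (HB (max N N0) ltac:(lia)).
  pose proof (Cmod_triangle_inv l (u (max N N0))) as H1. rewrite Cmod_sub_sym in H1. lra.
Qed.

(** Used pointwise in t with the majorant M_k exp(-c |t|): the remainder of a series of functions
    then inherits the rate c, with a constant that tends to 0. *)
Lemma cser_tail a l M s n : (forall k, Cmod (a k) <= M k) -> rser M s -> cser a l ->
  Cmod (l - csum a n) <= s - rsum M n.
Proof.
  intros H HM Hl. assert (HM0 : forall k, 0 <= M k) by (intro k; eapply Rle_trans; [apply Cmod_ge_0|apply H]).
  apply ccvg_mod_le with (u := fun m => (csum a m - csum a n)%C) (N0 := n).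
  - apply ccvg_minus; [exact Hl|apply ccvg_const].
  - intros m Hm. replace m with (n + (m - n))%nat by lia. rewrite csum_split.
    replace (csum a n + csum (fun k => a (n + k)%nat) (m - n) - csum a n)%C with (csum (fun k => a (n + k)%nat) (m - n)) by ring.
    eapply Rle_trans; [apply csum_mod_le with (M := fun k => M (n + k)%nat); intros; apply H|].
    pose proof (rser_ge M s m HM0 HM) as H1.
    replace m with (n + (m - n))%nat in H1 by lia. rewrite rsum_split in H1. lra.
Qed.

Lemma cser_mod_le a l M s : (forall k, Cmod (a k) <= M k) -> rser M s -> cser a l -> Cmod l <= s.
Proof.
  intros H HM Hl. pose proof (cser_tail a l M s 0 H HM Hl) as H1. simpl in H1.
  replace (l - 0)%C with l in H1 by ring. lra.
Qed.

Lemma ccvg_csum (a : nat -> nat -> C) b m : (forall k, (k < m)%nat -> ccvg (fun n => a n k) (b k)) ->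
  ccvg (fun n => csum (a n) m) (csum b m).
Proof.
  induction m; intro H; simpl; [apply ccvg_const|]. apply ccvg_plus; [apply IHm; auto|apply H; auto].
Qed.

(** Dominated convergence for series: beyond an index K the majorant leaves less than eps/3 for both
    series, and finitely many terms converge together. The limit series comes with its convergence,
    which is how the cotangent series, the Lambert series and the limiting double series are
    obtained. *)
Lemma tannery (a : nat -> nat -> C) (A : nat -> C) b M s :
  (forall n k, Cmod (a n k) <= M k) -> rser M s ->
  (forall k, ccvg (fun n => a n k) (b k)) -> (forall n, cser (a n) (A n)) ->
  exists B, cser b B /\ ccvg A B.
Proof.
  intros H HM Hb HA.
  assert (Hb' : forall k, Cmod (b k) <= M k).
  { intro k. apply ccvg_mod_le with (u := fun n => a n k) (N0 := O); auto. }
  destruct (cser_abs b M s Hb' HM) as [B HB]. exists B; split; [exact HB|].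
  intros eps He. pose proof HM as HM'. apply is_lim_seq_spec in HM'. assert (He2 : 0 < eps / 3) by lra.
  destruct (HM' (mkposreal _ He2)) as [K HK]. specialize (HK K (le_n _)). simpl in HK.
  apply Rabs_def2 in HK.
  destruct (ccvg_csum a b K (fun k _ => Hb k) (eps / 3) He2) as [N HN].
  exists N; intros n Hn. specialize (HN n Hn).
  pose proof (cser_tail (a n) (A n) M s K (H n) HM (HA n)) as H1.
  pose proof (cser_tail b B M s K Hb' HM HB) as H2.
  replace (A n - B)%C with ((A n - csum (a n) K) + (csum (a n) K - csum b K) - (B - csum b K))%C by ring.
  eapply Rle_lt_trans; [apply Cmod_triangle|]. rewrite Cmod_opp.
  eapply Rle_lt_trans; [apply Rplus_le_compat_r, Cmod_triangle|]. lra.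
Qed.

(* Telescoping: by the mean value theorem (k+1)^(-d) - (k+2)^(-d) >= d (k+2)^(-1-d). *)
Lemma rser_pseries d : 0 < d -> exists l, rser (fun k => Rpower (INR (S k)) (- 1 - d)) l.
Proof.
  intro Hd.
  assert (P : forall y, 0 < Rpower (INR (S y)) (-1 - d)) by (intro; apply exp_pos).
  assert (Tele : forall n, rsum (fun k => Rpower (INR (S (S k))) (-1 - d)) n
     <= / d * (1 - Rpower (INR (S n)) (- d))).
  { induction n.
    - simpl rsum. replace (INR 1) with 1 by reflexivity. unfold Rpower. rewrite ln_1, Rmult_0_r, exp_0. lra.
    - change (rsum (fun k => Rpower (INR (S (S k))) (-1 - d)) (S n)) with
        (rsum (fun k => Rpower (INR (S (S k))) (-1 - d)) n + Rpower (INR (S (S n))) (-1 - d)).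
      destruct (MVT_cor2 (fun y => Rpower y (- d)) (fun y => (- d) * Rpower y (- d - 1)) (INR (S n)) (INR (S (S n)))) as (c & Hc & Hc2).
      + apply lt_INR; lia.
      + intros c Hc. apply derivable_pt_lim_power. pose proof (pos_INR n). rewrite S_INR in Hc. lra.
      + pose proof (pos_INR n). rewrite S_INR in Hc2.
        replace (INR (S (S n)) - INR (S n)) with 1 in Hc by (rewrite (S_INR (S n)); ring).
        assert (Rpower (INR (S (S n))) (-1 - d) <= Rpower c (- d - 1)).
        { replace (- d - 1) with (-1 - d) by ring. unfold Rpower.
          assert (ln c <= ln (INR (S (S n)))). { apply ln_le; [lra|]. apply Rlt_le. apply Hc2. }
          destruct (Req_dec ((-1 - d) * ln (INR (S (S n)))) ((-1 - d) * ln c)) as [->|N]; [lra|].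
          apply Rlt_le, exp_increasing. nra. }
        assert (Hk : Rpower (INR (S (S n))) (-1 - d) <= / d * (Rpower (INR (S n)) (- d) - Rpower (INR (S (S n))) (- d))).
        { apply Rmult_le_reg_l with d; [auto|]. rewrite <- Rmult_assoc, Rinv_r, Rmult_1_l by lra.
          rewrite Rmult_1_r in Hc. nra. }
        lra. }
  apply rser_bounded with (1 + / d).
  - intro; apply Rlt_le, P.
  - intro n. destruct n.
    + simpl. pose proof (Rinv_0_lt_compat _ Hd); lra.
    + change (S n) with (1 + n)%nat. rewrite rsum_split.
      change (rsum (fun k => Rpower (INR (S k)) (-1 - d)) 1) with (0 + Rpower (INR 1) (-1 - d)).
      replace (INR 1) with 1 by reflexivity.
      replace (Rpower 1 (-1 - d)) with 1 by (unfold Rpower; now rewrite ln_1, Rmult_0_r, exp_0).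
      specialize (Tele n). change (fun k => Rpower (INR (S (1 + k))) (-1 - d)) with (fun k => Rpower (INR (S (S k))) (-1 - d)).
      pose proof (exp_pos ((- d) * ln (INR (S n)))) as E. fold (Rpower (INR (S n)) (- d)) in E.
      pose proof (Rinv_0_lt_compat _ Hd). nra.
Qed.

Lemma rser_inv_sqr : exists l, rser (fun k => / (INR (S k) ^ 2)) l.
Proof.
  destruct (rser_pseries 1 Rlt_0_1) as [l Hl]. exists l.
  assert (E : forall k, Rpower (INR (S k)) (-1 - 1) = / (INR (S k) ^ 2)).
  { intro k. replace (-1 - 1) with (- INR 2) by (simpl; ring). rewrite Rpower_Ropp, Rpower_pow; auto.
    apply lt_0_INR; lia. }
  eapply is_lim_seq_ext; [|exact Hl]. intro n. induction n as [|n IH]; [easy|]. cbn [rsum]. rewrite IH. now rewrite E.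
Qed.

(** * Integrals of complex-valued functions on the line *)

(** Continuity on all of R: the integrands below are continuous everywhere, so that integrability on
    a segment is never an issue and only decay at infinity remains. *)
Definition ccont (f : R -> C) : Prop :=
  forall t, continuous (fun t => Re (f t)) t /\ continuous (fun t => Im (f t)) t.

Definition CInt (f : R -> C) (a b : R) : C :=
  (RInt (fun t => Re (f t)) a b, RInt (fun t => Im (f t)) a b).

Lemma cont_ex_RInt (f : R -> R) a b : (forall t, continuous f t) -> ex_RInt f a b.
Proof. intro H. apply (ex_RInt_continuous (V := R_CompleteNormedModule) f a b). intros; apply H. Qed.

Lemma ccont_const c : ccont (fun _ => c).
Proof. intro t; split; apply continuous_const. Qed.

Lemma ccont_ext f g : (forall t, f t = g t) -> ccont f -> ccont g.
Proof.
  intros E H t. destruct (H t) as [H1 H2]. split.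
  - eapply continuous_ext; [|exact H1]. intro; simpl; now rewrite E.
  - eapply continuous_ext; [|exact H2]. intro; simpl; now rewrite E.
Qed.

Lemma ccont_plus f g : ccont f -> ccont g -> ccont (fun t => (f t + g t)%C).
Proof.
  intros H H' t. destruct (H t) as [H1 H2]. destruct (H' t) as [H3 H4]. split.
  - exact (continuous_plus (fun t => Re (f t)) (fun t => Re (g t)) t H1 H3).
  - exact (continuous_plus (fun t => Im (f t)) (fun t => Im (g t)) t H2 H4).
Qed.

Lemma ccont_mult f g : ccont f -> ccont g -> ccont (fun t => (f t * g t)%C).
Proof.
  intros H H' t. destruct (H t) as [H1 H2]. destruct (H' t) as [H3 H4]. split.
  - apply (continuous_minus (fun t => Re (f t) * Re (g t)) (fun t => Im (f t) * Im (g t))).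
    + exact (continuous_mult (fun t => Re (f t)) (fun t => Re (g t)) t H1 H3).
    + exact (continuous_mult (fun t => Im (f t)) (fun t => Im (g t)) t H2 H4).
  - apply (continuous_plus (fun t => Re (f t) * Im (g t)) (fun t => Im (f t) * Re (g t))).
    + exact (continuous_mult (fun t => Re (f t)) (fun t => Im (g t)) t H1 H4).
    + exact (continuous_mult (fun t => Im (f t)) (fun t => Re (g t)) t H2 H3).
Qed.

Lemma ccont_opp f : ccont f -> ccont (fun t => (- f t)%C).
Proof.
  intros H. apply ccont_ext with (fun t => (-(1) * f t)%C); [intro; ring|].
  apply ccont_mult; [apply ccont_const|exact H].
Qed.

Lemma ccont_minus f g : ccont f -> ccont g -> ccont (fun t => (f t - g t)%C).
Proof. intros. apply ccont_plus; [auto|now apply ccont_opp]. Qed.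

Lemma ccont_RtoC (f : R -> R) : (forall t, continuous f t) -> ccont (fun t => RtoC (f t)).
Proof. intros H t; split; [exact (H t)|apply continuous_const]. Qed.

Lemma ccont_comp f (g : R -> R) : ccont f -> (forall t, continuous g t) -> ccont (fun t => f (g t)).
Proof.
  intros H Hg t. destruct (H (g t)) as [H1 H2]. split.
  - apply (continuous_comp g (fun t => Re (f t))); auto.
  - apply (continuous_comp g (fun t => Im (f t))); auto.
Qed.

Lemma CInt_ext f g a b : (forall t, Rmin a b < t < Rmax a b -> f t = g t) -> CInt f a b = CInt g a b.
Proof.
  intros E. unfold CInt. f_equal; apply RInt_ext; intros t Ht; now rewrite E.
Qed.

Lemma CInt_plus f g a b : ccont f -> ccont g -> CInt (fun t => (f t + g t)%C) a b = (CInt f a b + CInt g a b)%C.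
Proof.
  intros H H'. apply C_ext; simpl.
  - apply (RInt_plus (fun t => Re (f t)) (fun t => Re (g t))); apply cont_ex_RInt; intro t; [apply H|apply H'].
  - apply (RInt_plus (fun t => Im (f t)) (fun t => Im (g t))); apply cont_ex_RInt; intro t; [apply H|apply H'].
Qed.

Lemma RInt_lin2 f g a b x y : (forall t, continuous f t) -> (forall t, continuous g t) ->
  RInt (fun t => x * f t + y * g t) a b = x * RInt f a b + y * RInt g a b.
Proof.
  intros Hf Hg. rewrite (RInt_plus (fun t => x * f t) (fun t => y * g t)).
  - assert (E1 : RInt (fun t => x * f t) a b = x * RInt f a b) by (apply (RInt_scal f a b x); now apply cont_ex_RInt).
    assert (E2 : RInt (fun t => y * g t) a b = y * RInt g a b) by (apply (RInt_scal g a b y); now apply cont_ex_RInt).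
    now rewrite E1, E2.
  - apply (ex_RInt_scal f a b x); now apply cont_ex_RInt.
  - apply (ex_RInt_scal g a b y); now apply cont_ex_RInt.
Qed.

Lemma CInt_scal c f a b : ccont f -> CInt (fun t => (c * f t)%C) a b = (c * CInt f a b)%C.
Proof.
  intros H. apply C_ext; simpl.
  - transitivity (RInt (fun t => fst c * Re (f t) + (- snd c) * Im (f t)) a b).
    + apply RInt_ext; intros; unfold Re, Im; simpl; ring.
    + rewrite RInt_lin2; [ring| |]; intro t; apply H.
  - transitivity (RInt (fun t => fst c * Im (f t) + snd c * Re (f t)) a b).
    + apply RInt_ext; intros; unfold Re, Im; simpl; ring.
    + rewrite RInt_lin2; [ring| |]; intro t; apply H.
Qed.

Lemma CInt_opp f a b : ccont f -> CInt (fun t => (- f t)%C) a b = (- CInt f a b)%C.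
Proof.
  intros H. rewrite <- (CInt_ext (fun t => (-(1) * f t)%C)); [|intros; ring].
  rewrite CInt_scal by auto. ring.
Qed.

Lemma CInt_minus f g a b : ccont f -> ccont g -> CInt (fun t => (f t - g t)%C) a b = (CInt f a b - CInt g a b)%C.
Proof. intros H H'. unfold Cminus. rewrite CInt_plus, CInt_opp; auto. now apply ccont_opp. Qed.

Lemma CInt_Chasles f a b c : ccont f -> (CInt f a b + CInt f b c)%C = CInt f a c.
Proof.
  intros H. apply C_ext; simpl.
  - apply (RInt_Chasles (fun t => Re (f t))); apply cont_ex_RInt; intro t; apply H.
  - apply (RInt_Chasles (fun t => Im (f t))); apply cont_ex_RInt; intro t; apply H.
Qed.

Lemma CInt_point f a : CInt f a a = RtoC 0.
Proof. apply C_ext; simpl; apply (RInt_point (V := R_CompleteNormedModule)). Qed.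

Lemma CInt_swap f a b : ccont f -> CInt f b a = (- CInt f a b)%C.
Proof.
  intro H. pose proof (CInt_Chasles f a b a H) as E. rewrite CInt_point in E.
  replace (CInt f b a) with ((CInt f a b + CInt f b a) - CInt f a b)%C by ring. rewrite E. ring.
Qed.

Lemma CInt_comp_lin f (u v a b : R) : ccont f -> (CInt (fun t => f (u * t + v)%R) a b * u)%C = CInt f (u * a + v) (u * b + v).
Proof.
  intros H.
  assert (Hc : ccont (fun t => f (u * t + v))).
  { apply ccont_comp; auto. intro t. apply (ex_derive_continuous (fun t => u * t + v)). auto_derive; auto. }
  rewrite Cmult_comm, <- CInt_scal by auto. apply C_ext; simpl.
  - rewrite <- (RInt_comp_lin (fun t => Re (f t)) u v a b).
    + apply RInt_ext; intros. unfold Re. simpl. unfold scal; simpl; unfold mult; simpl. ring.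
    + apply cont_ex_RInt; intro t; apply H.
  - rewrite <- (RInt_comp_lin (fun t => Im (f t)) u v a b).
    + apply RInt_ext; intros. unfold Im. simpl. unfold scal; simpl; unfold mult; simpl. ring.
    + apply cont_ex_RInt; intro t; apply H.
Qed.

Lemma CInt_shift f v a b : ccont f -> CInt (fun t => f (t + v)) a b = CInt f (a + v) (b + v).
Proof.
  intro H. pose proof (CInt_comp_lin f 1 v a b H) as E. rewrite !Rmult_1_l in E. rewrite <- E.
  rewrite Cmult_1_r. apply CInt_ext; intros. now rewrite Rmult_1_l.
Qed.

Lemma CInt_reflect f a b : ccont f -> CInt (fun t => f (- t)) a b = CInt f (- b) (- a).
Proof.
  intro H. pose proof (CInt_comp_lin f (-1) 0 a b H) as E.
  replace (-1 * a + 0) with (- a) in E by ring. replace (-1 * b + 0) with (- b) in E by ring.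
  rewrite (CInt_swap f (- a) (- b)) by auto. rewrite <- E.
  rewrite <- (CInt_ext (fun t => f (- t)) (fun t => f (-1 * t + 0)) a b); [|intros; f_equal; ring].
  replace (RtoC (-1)) with (-(1))%C by (apply C_ext; simpl; ring). ring.
Qed.

Lemma CInt_derive (F f : R -> C) a b : ccont f ->
  (forall t, is_derive (fun t => Re (F t)) t (Re (f t))) ->
  (forall t, is_derive (fun t => Im (F t)) t (Im (f t))) -> CInt f a b = (F b - F a)%C.
Proof.
  intros H H1 H2. apply C_ext; simpl; apply is_RInt_unique.
  - apply (is_RInt_derive (fun t => Re (F t))); intros; [apply H1|apply H].
  - apply (is_RInt_derive (fun t => Im (F t))); intros; [apply H2|apply H].
Qed.

(* The factor 2 comes from |z| <= |Re z| + |Im z|; no sharp constant is ever needed. *)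
Lemma CInt_le f (g : R -> R) a b G : ccont f -> a <= b -> (forall t, a <= t <= b -> Cmod (f t) <= g t) ->
  is_RInt g a b G -> Cmod (CInt f a b) <= 2 * G.
Proof.
  intros H Hab Hg HG. eapply Rle_trans; [apply Cmod_le_abs|].
  replace (2 * G) with (G + G) by ring. apply Rplus_le_compat.
  - apply (norm_RInt_le (fun t => Re (f t)) g a b (Re (CInt f a b)) G); auto.
    + intros t Ht. eapply Rle_trans; [apply re_le_Cmod|auto].
    + apply (RInt_correct (fun t => Re (f t))). apply cont_ex_RInt; intro; apply H.
  - apply (norm_RInt_le (fun t => Im (f t)) g a b (Im (CInt f a b)) G); auto.
    + intros t Ht. eapply Rle_trans; [apply Im_le_Cmod|auto].
    + apply (RInt_correct (fun t => Im (f t))). apply cont_ex_RInt; intro; apply H.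
Qed.

Lemma CInt_le_const f B a b : ccont f -> a <= b -> (forall t, a <= t <= b -> Cmod (f t) <= B) ->
  Cmod (CInt f a b) <= 2 * ((b - a) * B).
Proof.
  intros H Hab HB. apply (CInt_le f (fun _ => B) a b); auto.
  apply (is_RInt_const (V := R_NormedModule) a b B).
Qed.

(** * The complex exponential *)

Definition cexp (z : C) : C := (exp (Re z) * cos (Im z), exp (Re z) * sin (Im z)).

Lemma cpow_cexp b s : cpow b s = cexp (s * ln b)%C.
Proof.
  unfold cpow, cexp. destruct s as [p q]. unfold Re, Im; simpl.
  replace (p * ln b - q * 0) with (p * ln b) by ring. replace (p * 0 + q * ln b) with (q * ln b) by ring. easy.
Qed.

Lemma cexp_plus z w : cexp (z + w) = (cexp z * cexp w)%C.
Proof.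
  unfold cexp. destruct z as [a b], w as [c d]. unfold Re, Im; simpl.
  rewrite exp_plus, cos_plus, sin_plus. apply C_ext; simpl; ring.
Qed.

Lemma cexp_0 : cexp 0 = RtoC 1.
Proof. unfold cexp; simpl. rewrite exp_0, cos_0, sin_0. apply C_ext; simpl; ring. Qed.

Lemma cexp_RtoC (r : R) : cexp r = RtoC (exp r).
Proof. unfold cexp; simpl. rewrite cos_0, sin_0. apply C_ext; simpl; ring. Qed.

Lemma Cmod_cexp z : Cmod (cexp z) = exp (Re z).
Proof.
  unfold Cmod, cexp; simpl.
  replace (exp (Re z) * cos (Im z) * (exp (Re z) * cos (Im z) * 1) + exp (Re z) * sin (Im z) * (exp (Re z) * sin (Im z) * 1))
    with ((exp (Re z))² * ((sin (Im z))² + (cos (Im z))²)) by (unfold Rsqr; ring).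
  rewrite sin2_cos2, Rmult_1_r. apply sqrt_Rsqr. apply Rlt_le, exp_pos.
Qed.

Lemma cexp_neq_0 z : cexp z <> RtoC 0.
Proof. apply (proj2 (Cmod_gt_0 _)). rewrite Cmod_cexp. apply exp_pos. Qed.

Lemma cexp_opp z : cexp (- z) = (/ cexp z)%C.
Proof.
  assert (E : (cexp (-z) * cexp z)%C = RtoC 1). { rewrite <- cexp_plus. replace (-z + z)%C with (RtoC 0) by ring. apply cexp_0. }
  pose proof (cexp_neq_0 z). replace (cexp (-z)) with ((cexp (-z) * cexp z) * / cexp z)%C by (field; auto).
  rewrite E. ring.
Qed.

Lemma is_derive_cexp_Re (p q : C) t : is_derive (fun t : R => Re (cexp (p * t + q))) t (Re (p * cexp (p * t + q))).
Proof.
  destruct p as [a b], q as [c d]. unfold cexp, Re, Im; simpl. auto_derive; [auto|unfold Rminus; ring].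
Qed.

Lemma is_derive_cexp_Im (p q : C) t : is_derive (fun t : R => Im (cexp (p * t + q))) t (Im (p * cexp (p * t + q))).
Proof.
  destruct p as [a b], q as [c d]. unfold cexp, Re, Im; simpl. auto_derive; [auto|unfold Rminus; ring].
Qed.

Lemma ccont_cexp (p q : C) : ccont (fun t : R => cexp (p * t + q)).
Proof.
  intro t; split; apply (ex_derive_continuous (V := R_NormedModule)); eexists; [apply is_derive_cexp_Re|apply is_derive_cexp_Im].
Qed.

Lemma ccont_cexp0 (p : C) : ccont (fun t : R => cexp (p * t)).
Proof. eapply ccont_ext; [|apply (ccont_cexp p 0)]. intro t; simpl. f_equal. ring. Qed.

Lemma CInt_cexp (p : C) (a b : R) : p <> RtoC 0 -> CInt (fun t : R => cexp (p * t)) a b = ((cexp (p * b) - cexp (p * a)) / p)%C.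
Proof.
  intro Hp. assert (E : (p * CInt (fun t : R => cexp (p * t)) a b)%C = (cexp (p * b) - cexp (p * a))%C).
  { rewrite <- CInt_scal by apply ccont_cexp0. apply (CInt_derive (fun t : R => cexp (p * t))).
    - apply ccont_mult; [apply ccont_const|apply ccont_cexp0].
    - intro t. pose proof (is_derive_cexp_Re p 0 t) as H. replace (p * t + 0)%C with (p * t)%C in H by ring.
      eapply is_derive_ext; [|exact H]. intro s; cbv beta. replace (p * s + 0)%C with (p * s)%C by ring. reflexivity.
    - intro t. pose proof (is_derive_cexp_Im p 0 t) as H. replace (p * t + 0)%C with (p * t)%C in H by ring.
      eapply is_derive_ext; [|exact H]. intro s; cbv beta. replace (p * s + 0)%C with (p * s)%C by ring. reflexivity. }
  rewrite <- E. field; auto.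
Qed.

Lemma exp_le x y : x <= y -> exp x <= exp y.
Proof. intros [H| ->]; [apply Rlt_le, exp_increasing; auto|lra]. Qed.

Lemma Re_le_Cmod z : Re z <= Cmod z.
Proof. eapply Rle_trans; [apply Rle_abs|apply re_le_Cmod]. Qed.

(** cexp z - 1 is the integral of z cexp(z t) over [0,1]; the factor 2 is the one lost in
    [CInt_le_const]. *)
Lemma cexp_m1_le z : Cmod (cexp z - 1) <= 2 * (Cmod z * exp (Cmod z)).
Proof.
  assert (E : CInt (fun t : R => (z * cexp (z * t))%C) 0 1 = (cexp z - 1)%C).
  { destruct (Ceq_dec z 0) as [->|Hz].
    - rewrite (CInt_ext _ (fun _ => RtoC 0)); [|intros; ring].
      rewrite cexp_0. apply C_ext; simpl; rewrite RInt_const; unfold scal; simpl; unfold mult; simpl; ring.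
    - rewrite CInt_scal by apply ccont_cexp0. rewrite CInt_cexp by auto.
      replace (z * 1)%C with z by ring. replace (z * 0)%C with (RtoC 0) by ring. rewrite cexp_0. field; auto. }
  rewrite <- E. eapply Rle_trans.
  - apply CInt_le_const with (B := Cmod z * exp (Cmod z)); [|lra|].
    + apply ccont_mult; [apply ccont_const|apply ccont_cexp0].
    + intros t Ht. rewrite Cmod_mult, Cmod_cexp. apply Rmult_le_compat_l; [apply Cmod_ge_0|].
      apply exp_le. destruct z as [a b]; simpl. rewrite Rmult_0_r, Rminus_0_r.
      pose proof (Re_le_Cmod (a, b)) as H; simpl in H. pose proof (Cmod_ge_0 (a, b)).
      destruct (Rle_dec 0 a); nra.
  - lra.
Qed.

(** cexp z - 1 - z is the integral of z (cexp(z t) - 1) over [0,1], and the first order bound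
    applies inside. *)
Lemma cexp_m2_le z : Cmod (cexp z - 1 - z) <= 4 * (Cmod z ^ 2 * exp (Cmod z)).
Proof.
  assert (E : CInt (fun t : R => (z * (cexp (z * t) - 1))%C) 0 1 = (cexp z - 1 - z)%C).
  { destruct (Ceq_dec z 0) as [->|Hz].
    - rewrite (CInt_ext _ (fun _ => RtoC 0)); [|intros; ring].
      rewrite cexp_0. apply C_ext; simpl; rewrite RInt_const; unfold scal; simpl; unfold mult; simpl; ring.
    - rewrite CInt_scal by (apply ccont_minus; [apply ccont_cexp0|apply ccont_const]).
      rewrite CInt_minus by (apply ccont_cexp0 || apply ccont_const). rewrite CInt_cexp by auto.
      replace (CInt (fun _ => RtoC 1) 0 1) with (RtoC 1).
      2: apply C_ext; simpl; rewrite RInt_const; unfold scal; simpl; unfold mult; simpl; ring.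
      replace (z * 1)%C with z by ring. replace (z * 0)%C with (RtoC 0) by ring. rewrite cexp_0. field; auto. }
  rewrite <- E. eapply Rle_trans.
  - apply CInt_le_const with (B := 2 * (Cmod z ^ 2 * exp (Cmod z))); [|lra|].
    + apply ccont_mult; [apply ccont_const|]. apply ccont_minus; [apply ccont_cexp0|apply ccont_const].
    + intros t Ht. rewrite Cmod_mult.
      assert (H : Cmod (cexp (z * t) - 1) <= 2 * (Cmod z * exp (Cmod z))).
      { eapply Rle_trans; [apply cexp_m1_le|]. rewrite Cmod_mult, Cmod_R, Rabs_pos_eq by lra.
        pose proof (Cmod_ge_0 z). assert (Cmod z * t <= Cmod z) by nra.
        apply Rmult_le_compat_l; [lra|]. apply Rmult_le_compat; [nra|apply Rlt_le, exp_pos|auto|now apply exp_le]. }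
      apply Rmult_le_compat_l with (r := Cmod z) in H; [|apply Cmod_ge_0]. simpl. lra.
  - lra.
Qed.

(** * Integrals over the whole line *)

(** The two ends tend to infinity independently, which makes the integral invariant under
    translation; a symmetric limit would not be so in general. *)
Definition is_lint (f : R -> C) (l : C) : Prop :=
  ccont f /\ forall eps, 0 < eps -> exists T, forall a b, a <= - T -> T <= b -> Cmod (CInt f a b - l) < eps.

(** A total function, evaluated along symmetric integer ends. Its value is meaningful only once some
    [is_lint] is known, by [is_lint_lint]. *)
Definition lint (f : R -> C) : C :=
  (real (Lim_seq (fun n => Re (CInt f (- INR n) (INR n)))), real (Lim_seq (fun n => Im (CInt f (- INR n) (INR n))))).

Lemma is_lint_seq f l : is_lint f l -> ccvg (fun n => CInt f (- INR n) (INR n)) l.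
Proof.
  intros [_ H] eps He. destruct (H eps He) as [T HT]. exists (Z.to_nat (up T)). intros n Hn.
  assert (T <= INR n).
  { destruct (archimed T) as [HT1 _]. apply Rlt_le. eapply Rlt_le_trans; [exact HT1|].
    rewrite INR_IZR_INZ. apply IZR_le. lia. }
  apply HT; lra.
Qed.

Lemma is_lint_unique f l l' : is_lint f l -> is_lint f l' -> l = l'.
Proof. intros H H'. eapply ccvg_unique; [apply (is_lint_seq _ _ H)|apply (is_lint_seq _ _ H')]. Qed.

Lemma is_lint_lint f l : is_lint f l -> lint f = l.
Proof.
  intro H. pose proof (is_lint_seq _ _ H) as H'. apply C_ext.
  - exact (f_equal real (is_lim_seq_unique _ _ (ccvg_Re _ _ H'))).
  - exact (f_equal real (is_lim_seq_unique _ _ (ccvg_Im _ _ H'))).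
Qed.

Lemma is_lint_ext f g l : (forall t, f t = g t) -> is_lint f l -> is_lint g l.
Proof.
  intros E [Hc H]. split; [now apply ccont_ext with f|]. intros eps He. destruct (H eps He) as [T HT].
  exists T; intros a b Ha Hb. rewrite <- (CInt_ext f g); auto.
Qed.

Lemma is_lint_plus f g l l' : is_lint f l -> is_lint g l' -> is_lint (fun t => (f t + g t)%C) (l + l')%C.
Proof.
  intros [Hf H] [Hg H']. split; [now apply ccont_plus|]. intros eps He.
  destruct (H (eps / 2)) as [T HT]; [lra|]. destruct (H' (eps / 2)) as [T' HT']; [lra|].
  exists (Rmax T T'). intros a b Ha Hb. pose proof (Rmax_l T T'). pose proof (Rmax_r T T').
  rewrite CInt_plus by auto. specialize (HT a b ltac:(lra) ltac:(lra)). specialize (HT' a b ltac:(lra) ltac:(lra)).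
  replace (CInt f a b + CInt g a b - (l + l'))%C with ((CInt f a b - l) + (CInt g a b - l'))%C by ring.
  eapply Rle_lt_trans; [apply Cmod_triangle|]. lra.
Qed.

Lemma is_lint_scal c f l : is_lint f l -> is_lint (fun t => (c * f t)%C) (c * l)%C.
Proof.
  intros [Hf H]. split; [apply ccont_mult; auto; apply ccont_const|]. intros eps He.
  pose proof (Cmod_ge_0 c). destruct (H (eps / (Cmod c + 1))) as [T HT]; [apply Rdiv_lt_0_compat; lra|].
  exists T. intros a b Ha Hb. specialize (HT a b Ha Hb). rewrite CInt_scal by auto.
  replace (c * CInt f a b - c * l)%C with (c * (CInt f a b - l))%C by ring. rewrite Cmod_mult.
  apply Rmult_lt_compat_l with (r := Cmod c + 1) in HT; [|lra].
  replace ((Cmod c + 1) * (eps / (Cmod c + 1))) with eps in HT by (field; lra).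
  pose proof (Cmod_ge_0 (CInt f a b - l)). nra.
Qed.

Lemma is_lint_minus f g l l' : is_lint f l -> is_lint g l' -> is_lint (fun t => (f t - g t)%C) (l - l')%C.
Proof.
  intros H H'. apply (is_lint_scal (-(1))%C) in H'. pose proof (is_lint_plus _ _ _ _ H H') as H1.
  replace (l - l')%C with (l + -(1) * l')%C by ring. eapply is_lint_ext; [|exact H1]. intro; simpl; ring.
Qed.

Lemma is_lint_zero : is_lint (fun _ => RtoC 0) 0.
Proof.
  split; [apply ccont_const|]. intros eps He. exists 0. intros a b _ _.
  replace (CInt (fun _ => RtoC 0) a b) with (RtoC 0).
  - replace (0 - 0)%C with (RtoC 0) by ring. now rewrite Cmod_0.
  - apply C_ext; simpl; rewrite RInt_const; unfold scal; simpl; unfold mult; simpl; ring.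
Qed.

Lemma is_lint_csum (f : nat -> R -> C) l n : (forall k, (k < n)%nat -> is_lint (f k) (l k)) ->
  is_lint (fun t => csum (fun k => f k t) n) (csum l n).
Proof. induction n; intro H; simpl; [apply is_lint_zero|apply is_lint_plus; auto]. Qed.

Lemma is_lint_shift f l v : is_lint f l -> is_lint (fun t => f (t + v)) l.
Proof.
  intros [Hf H]. split.
  - apply ccont_comp; auto. intro t. apply (ex_derive_continuous (fun t => t + v)). auto_derive; auto.
  - intros eps He. destruct (H eps He) as [T HT]. exists (T + Rabs v). intros a b Ha Hb.
    rewrite CInt_shift by auto. pose proof (Rle_abs v). pose proof (Rle_abs (- v)) as H1. rewrite Rabs_Ropp in H1. apply HT; lra.
Qed.

Lemma is_lint_reflect f l : is_lint f l -> is_lint (fun t => f (- t)) l.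
Proof.
  intros [Hf H]. split.
  - apply ccont_comp; auto. intro t. apply (ex_derive_continuous (fun t => - t)). auto_derive; auto.
  - intros eps He. destruct (H eps He) as [T HT]. exists T. intros a b Ha Hb.
    rewrite CInt_reflect by auto. apply HT; lra.
Qed.

(** In the variable u = e^t: a Mellin integrand that is O(min(u, 1/u)^c). *)
Definition exp_bounded (f : R -> C) (M c : R) : Prop := forall t, Cmod (f t) <= M * exp (- c * Rabs t).

Lemma exp_bounded_pos f M c : exp_bounded f M c -> 0 <= M.
Proof.
  intro H. specialize (H 0). rewrite Rabs_R0, Rmult_0_r, exp_0 in H. pose proof (Cmod_ge_0 (f 0)); lra.
Qed.

Lemma exp_bounded_tail f M c a b : 0 < c -> ccont f -> exp_bounded f M c -> 0 <= a <= b ->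
  Cmod (CInt f a b) <= 2 * (M / c * exp (- c * a)).
Proof.
  intros Hc Hf H Hab. pose proof (exp_bounded_pos _ _ _ H) as HM.
  eapply Rle_trans.
  - apply (CInt_le f (fun t => M * exp (- c * t)) a b (M / c * exp (- c * a) - M / c * exp (- c * b))); [auto|lra| |].
    + intros t Ht. specialize (H t). rewrite Rabs_pos_eq in H by lra. auto.
    + replace (M / c * exp (- c * a) - M / c * exp (- c * b)) with
        (minus ((fun t => - M / c * exp (- c * t)) b) ((fun t => - M / c * exp (- c * t)) a)).
      * apply (is_RInt_derive (fun t => - M / c * exp (- c * t))).
        -- intros t _. auto_derive; [auto|field; lra].
        -- intros t _. apply (ex_derive_continuous (fun t => M * exp (- c * t))). auto_derive; auto.
      * unfold minus, plus, opp; simpl. field; lra.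
  - pose proof (exp_pos (- c * b)). assert (0 <= M / c) by (apply Rdiv_le_0_compat; lra). nra.
Qed.

Lemma exp_bounded_reflect f M c : exp_bounded f M c -> exp_bounded (fun t => f (- t)) M c.
Proof. intros H t. specialize (H (- t)). now rewrite Rabs_Ropp in H. Qed.

Lemma exp_bounded_tail_neg f M c a b : 0 < c -> ccont f -> exp_bounded f M c -> a <= b <= 0 ->
  Cmod (CInt f a b) <= 2 * (M / c * exp (c * b)).
Proof.
  intros Hc Hf H Hab.
  assert (Hf' : ccont (fun t => f (- t))).
  { apply ccont_comp; auto. intro t. apply (ex_derive_continuous (fun t => - t)). auto_derive; auto. }
  pose proof (exp_bounded_tail (fun t => f (- t)) M c (- b) (- a) Hc Hf' (exp_bounded_reflect _ _ _ H) ltac:(lra)) as H1.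
  rewrite CInt_reflect in H1 by auto. rewrite !Ropp_involutive in H1.
  now replace (- c * - b) with (c * b) in H1 by ring.
Qed.

Lemma exp_bounded_CInt_le f M c a b : 0 < c -> ccont f -> exp_bounded f M c -> a <= 0 <= b -> Cmod (CInt f a b) <= 4 * (M / c).
Proof.
  intros Hc Hf H Hab. rewrite <- (CInt_Chasles f a 0 b) by auto.
  eapply Rle_trans; [apply Cmod_triangle|].
  pose proof (exp_bounded_tail f M c 0 b Hc Hf H ltac:(lra)) as H1.
  pose proof (exp_bounded_tail_neg f M c a 0 Hc Hf H ltac:(lra)) as H2.
  rewrite Rmult_0_r, exp_0 in H1, H2. lra.
Qed.

(** The integral of exp(-c |t|) over the line is 2/c, doubled by the passage to components in
    [CInt_le]. *)
Lemma is_lint_le f l M c : 0 < c -> exp_bounded f M c -> is_lint f l -> Cmod l <= 4 * (M / c).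
Proof.
  intros Hc H Hl. apply ccvg_mod_le with (u := fun n => CInt f (- INR n) (INR n)) (N0 := O).
  - now apply is_lint_seq.
  - intros n _. destruct Hl as [Hf _]. apply exp_bounded_CInt_le; auto. pose proof (pos_INR n); lra.
Qed.

Lemma exp_tail_small K c eps : 0 < c -> 0 < eps -> exists T, 0 <= T /\ forall t, T <= t -> K * exp (- c * t) < eps.
Proof.
  (* The inequality exp(c t) > c t suffices, hence a threshold of the form K/(c eps). *)
  intros Hc He. exists (Rmax 0 (K / (c * eps))). split; [apply Rmax_l|]. intros t Ht.
  pose proof (Rle_trans _ _ _ (Rmax_l _ _) Ht) as Ht0. pose proof (Rle_trans _ _ _ (Rmax_r _ _) Ht) as HtK.
  assert (HcE : 0 < c * eps) by (apply Rmult_lt_0_compat; auto).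
  assert (Kt : K <= c * eps * t). { apply Rmult_le_compat_l with (r := c * eps) in HtK; [|lra].
    replace (c * eps * (K / (c * eps))) with K in HtK by (field; lra). lra. }
  replace (- c * t) with (- (c * t)) by ring. rewrite exp_Ropp.
  assert (Hx : c * t < exp (c * t)).
  { destruct (Rle_lt_or_eq_dec 0 (c * t)) as [H|H]; [nra| |].
    - pose proof (exp_ineq1 (c * t) ltac:(lra)). lra.
    - rewrite <- H, exp_0. lra. }
  pose proof (exp_pos (c * t)). apply Rmult_lt_reg_r with (exp (c * t)); auto.
  rewrite Rmult_assoc, Rinv_l by lra. nra.
Qed.

Lemma ex_lint f M c : 0 < c -> ccont f -> exp_bounded f M c -> exists l, is_lint f l.
Proof.
  intros Hc Hf H.
  assert (Cau : forall eps, 0 < eps -> exists T, 0 <= T /\ forall a b a' b', a <= - T -> T <= b -> a' <= - T -> T <= b' ->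
    Cmod (CInt f a b - CInt f a' b') < eps).
  (* Each of the two segments differs from [-T, T] by two tails of at most 2 (M/c) exp(-c T), hence
     the 8. *)
  { intros eps He. destruct (exp_tail_small (8 * (M / c)) c eps Hc He) as (T & HT0 & HT).
    exists T. split; auto. specialize (HT T (Rle_refl _)).
    assert (G : forall a b, a <= - T -> T <= b -> Cmod (CInt f a b - CInt f (- T) T) <= 4 * (M / c * exp (- c * T))).
    { intros a b Ha Hb. replace (CInt f a b - CInt f (- T) T)%C with (CInt f a (- T) + CInt f T b)%C.
      - eapply Rle_trans; [apply Cmod_triangle|].
        pose proof (exp_bounded_tail f M c T b Hc Hf H ltac:(lra)) as H1.
        pose proof (exp_bounded_tail_neg f M c a (- T) Hc Hf H ltac:(lra)) as H2.
        replace (c * - T) with (- c * T) in H2 by ring. lra.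
      - rewrite <- (CInt_Chasles f a (- T) b), <- (CInt_Chasles f (- T) T b) by auto. ring. }
    intros a b a' b' Ha Hb Ha' Hb'. pose proof (G a b Ha Hb) as G1. pose proof (G a' b' Ha' Hb') as G2.
    rewrite Cmod_sub_sym in G2. pose proof (Cmod_triangle_sub (CInt f a b) (CInt f (- T) T) (CInt f a' b')). lra. }
  assert (exists l, ccvg (fun n => CInt f (- INR n) (INR n)) l) as [l Hl].
  { apply ccvg_cauchy. intros eps He. destruct (Cau eps He) as (T & HT0 & HT).
    exists (Z.to_nat (up T)). 
    assert (G : forall n, (Z.to_nat (up T) <= n)%nat -> T <= INR n).
    { intros n Hn. destruct (archimed T) as [HT1 _]. apply Rlt_le. eapply Rlt_le_trans; [exact HT1|].
      rewrite INR_IZR_INZ. apply IZR_le. lia. }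
    intros n m Hn Hm. pose proof (G n Hn). pose proof (G m Hm). apply HT; lra. }
  exists l. split; auto. intros eps He. destruct (Cau (eps / 2)) as (T & HT0 & HT); [lra|].
  exists T. intros a b Ha Hb. destruct (Hl (eps / 2)) as [N HN]; [lra|].
  set (n := max N (Z.to_nat (up T))). specialize (HN n ltac:(lia)).
  assert (T <= INR n).
  { destruct (archimed T) as [HT1 _]. apply Rlt_le. eapply Rlt_le_trans; [exact HT1|].
    rewrite INR_IZR_INZ. apply IZR_le. lia. }
  specialize (HT a b (- INR n) (INR n) ltac:(lra) ltac:(lra) ltac:(lra) ltac:(lra)).
  pose proof (Cmod_triangle_sub (CInt f a b) (CInt f (- INR n) (INR n)) l). lra.
Qed.

Lemma lint_correct f M c : 0 < c -> ccont f -> exp_bounded f M c -> is_lint f (lint f).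
Proof. intros Hc Hf H. destruct (ex_lint f M c Hc Hf H) as [l Hl]. now rewrite (is_lint_lint _ _ Hl). Qed.

(** The remainder after n terms is at most (s - rsum M n) exp(-c |t|), so its integral is at most
    4/c times the remainder of the numerical series. For this the rate c has to be common to all
    k. *)
Lemma lint_series (fk : nat -> R -> C) f lk M s c : 0 < c -> (forall k, is_lint (fk k) (lk k)) ->
  (forall k, exp_bounded (fk k) (M k) c) -> rser M s -> ccont f -> (forall t, cser (fun k => fk k t) (f t)) ->
  exists l, is_lint f l /\ cser lk l.
Proof.
  intros Hc Hl HM Hs Hf Hser.
  assert (HM0 : forall k, 0 <= M k) by (intro k; apply (exp_bounded_pos _ _ _ (HM k))).
  assert (Rem : forall n, exp_bounded (fun t => (f t - csum (fun k => fk k t) n)%C) (s - rsum M n) c).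
  { intros n t. pose proof (cser_tail (fun k => fk k t) (f t) (fun k => exp (- c * Rabs t) * M k) (exp (- c * Rabs t) * s) n) as H.
    rewrite rsum_scal in H. rewrite <- Rmult_minus_distr_l in H. rewrite Rmult_comm. apply H.
    - intro k. rewrite Rmult_comm. apply HM.
    - now apply rser_scal.
    - apply Hser. }
  assert (Hfd : exp_bounded f s c).
  { intro t. specialize (Rem O t). simpl in Rem. replace (f t - 0)%C with (f t) in Rem by ring. now rewrite Rminus_0_r in Rem. }
  destruct (ex_lint f s c Hc Hf Hfd) as [l Hll]. exists l; split; auto.
  apply ccvg_of_le with (v := fun n => 4 * ((s - rsum M n) / c)).
  - intro n. rewrite Cmod_sub_sym. apply (is_lint_le (fun t => (f t - csum (fun k => fk k t) n)%C)); auto.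
    apply is_lint_minus; auto. apply is_lint_csum; auto.
  - replace (Finite 0) with (Rbar_mult 4 (Rbar_mult (s - s) (/ c))) by (simpl; f_equal; field; lra).
    apply is_lim_seq_scal_l. apply is_lim_seq_scal_r.
    apply is_lim_seq_minus'; [apply is_lim_seq_const|exact Hs].
Qed.

(** * Goursat's lemma and uniqueness of continuation in a strip *)

(** Continuity relative to a set P, so that one notion serves in the plane, in an open strip and in
    a closed rectangle. *)
Definition ccontat (P : C -> Prop) (f : C -> C) (z : C) : Prop :=
  forall u : nat -> C, (forall n, P (u n)) -> ccvg u z -> ccvg (fun n => f (u n)) (f z).

(* Caratheodory's form of differentiability at z, relative to P. *)
Definition cdiff (P : C -> Prop) (f : C -> C) (z : C) : Prop :=
  exists phi : C -> C, ccontat P phi z /\ forall w, P w -> f w = (f z + (w - z) * phi w)%C.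

Lemma ccontat_const P c z : ccontat P (fun _ => c) z.
Proof. intros u _ _. apply ccvg_const. Qed.

Lemma ccontat_plus P f g z : ccontat P f z -> ccontat P g z -> ccontat P (fun w => (f w + g w)%C) z.
Proof. intros Hf Hg u Hu H. apply ccvg_plus; auto. Qed.

Lemma ccontat_mult P f g z : ccontat P f z -> ccontat P g z -> ccontat P (fun w => (f w * g w)%C) z.
Proof. intros Hf Hg u Hu H. apply ccvg_mult; auto. Qed.

Lemma cdiff_ccontat P f z : cdiff P f z -> ccontat P f z.
Proof.
  intros (phi & Hphi & E) u Hu H.
  apply ccvg_ext with (fun n => (f z + (u n - z) * phi (u n))%C); [intro; now rewrite (E (u n))|].
  assert (G : ccvg (fun n => (f z + (u n - z) * phi (u n))%C) (f z + (z - z) * phi z)%C).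
  { apply ccvg_plus; [apply ccvg_const|]. apply ccvg_mult; [|apply Hphi; auto].
    apply ccvg_minus; [auto|apply ccvg_const]. }
  now replace (f z + (z - z) * phi z)%C with (f z) in G by ring.
Qed.

Lemma cdiff_const P c z : cdiff P (fun _ => c) z.
Proof. exists (fun _ => RtoC 0). split; [apply ccontat_const|]. intros; ring. Qed.

Lemma cdiff_id P z : cdiff P (fun w => w) z.
Proof. exists (fun _ => RtoC 1). split; [apply ccontat_const|]. intros; ring. Qed.

Lemma cdiff_plus P f g z : cdiff P f z -> cdiff P g z -> cdiff P (fun w => (f w + g w)%C) z.
Proof.
  intros (p & Hp & Ep) (q & Hq & Eq). exists (fun w => (p w + q w)%C). split; [now apply ccontat_plus|].
  intros w Hw. rewrite (Ep w Hw), (Eq w Hw). ring.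
Qed.

Lemma cdiff_mult P f g z : cdiff P f z -> cdiff P g z -> cdiff P (fun w => (f w * g w)%C) z.
Proof.
  intros Hf Hg. pose proof (cdiff_ccontat _ _ _ Hg) as Cg. destruct Hf as (p & Hp & Ep). destruct Hg as (q & Hq & Eq).
  exists (fun w => (p w * g w + f z * q w)%C). split.
  - apply ccontat_plus; apply ccontat_mult; auto. apply ccontat_const.
  - intros w Hw. rewrite (Ep w Hw), (Eq w Hw). ring.
Qed.

Lemma cdiff_minus P f g z : cdiff P f z -> cdiff P g z -> cdiff P (fun w => (f w - g w)%C) z.
Proof.
  intros (p & Hp & Ep) (q & Hq & Eq). exists (fun w => (p w + (-(1)) * q w)%C). split.
  - apply ccontat_plus; auto. apply ccontat_mult; auto. apply ccontat_const.
  - intros w Hw. rewrite (Ep w Hw), (Eq w Hw). ring.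
Qed.

Lemma cdiff_mono (P Q : C -> Prop) f z : (forall w, Q w -> P w) -> cdiff P f z -> cdiff Q f z.
Proof.
  intros H (p & Hp & Ep). exists p. split; [|auto]. intros u Hu. apply Hp. auto.
Qed.

Lemma cdiff_ext (P : C -> Prop) f g z : P z -> (forall w, P w -> f w = g w) -> cdiff P f z -> cdiff P g z.
Proof.
  intros Hz E (p & Hp & Ep). exists p. split; [auto|]. intros w Hw. rewrite <- !E; auto.
Qed.

(* The quotient (exp D - 1)/D, continued by 1 at D = 0. *)
Definition cexp1 (D : C) : C := if Ceq_dec D 0 then RtoC 1 else ((cexp D - 1) / D)%C.

Lemma cexp1_spec D : cexp D = (1 + D * cexp1 D)%C.
Proof.
  unfold cexp1. destruct (Ceq_dec D 0) as [->|H].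
  - rewrite cexp_0. ring.
  - field; auto.
Qed.

Lemma cexp1_cont u : ccvg u 0 -> ccvg (fun n => cexp1 (u n)) 1.
Proof.
  intros H eps He. destruct (H (Rmin 1 (eps / (4 * exp 1)))) as [N HN].
  { apply Rmin_glb_lt; [lra|]. apply Rdiv_lt_0_compat; auto. pose proof (exp_pos 1); lra. }
  exists N; intros n Hn. specialize (HN n Hn). replace (u n - 0)%C with (u n) in HN by ring.
  unfold cexp1. destruct (Ceq_dec (u n) 0) as [E|E].
  - replace (1 - 1)%C with (RtoC 0) by ring. rewrite Cmod_0; auto.
  - replace ((cexp (u n) - 1) / u n - 1)%C with ((cexp (u n) - 1 - u n) / u n)%C by (field; auto).
    rewrite Cmod_div by auto. pose proof (proj1 (Cmod_gt_0 _) E) as Hp.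
    pose proof (cexp_m2_le (u n)) as Hb. pose proof (Rlt_le_trans _ _ _ HN (Rmin_l _ _)) as H1.
    pose proof (Rlt_le_trans _ _ _ HN (Rmin_r _ _)) as H2.
    assert (exp (Cmod (u n)) <= exp 1) by (apply exp_le; lra).
    pose proof (exp_pos 1). pose proof (exp_pos (Cmod (u n))).
    apply Rmult_lt_reg_r with (Cmod (u n)); auto. unfold Rdiv. rewrite Rmult_assoc, Rinv_l, Rmult_1_r by lra.
    apply Rmult_lt_compat_r with (r := 4 * exp 1) in H2; [|lra].
    replace (eps / (4 * exp 1) * (4 * exp 1)) with eps in H2 by (field; lra).
    eapply Rle_lt_trans; [exact Hb|]. simpl. rewrite Rmult_1_r.
    assert (Cmod (u n) * exp (Cmod (u n)) <= Cmod (u n) * exp 1) by (apply Rmult_le_compat_l; lra).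
    nra.
Qed.

Lemma cdiff_cexp P g z : cdiff P g z -> cdiff P (fun w => cexp (g w)) z.
Proof.
  intros Hg. pose proof (cdiff_ccontat _ _ _ Hg) as Cg. destruct Hg as (p & Hp & Ep).
  (* With D = g w - g z, the increment of cexp(g) is cexp(g z) D cexp1(D), and D = (w - z) p(w). *)
  exists (fun w => (cexp (g z) * (p w * cexp1 (g w - g z)))%C). split.
  - intros u Hu H. replace (cexp1 (g z - g z)) with (RtoC 1).
    2: unfold cexp1; replace (g z - g z)%C with (RtoC 0) by ring; destruct (Ceq_dec 0 0); easy.
    apply ccvg_mult; [apply ccvg_const|]. apply ccvg_mult; [apply Hp; auto|].
    apply cexp1_cont. replace (RtoC 0) with (g z - g z)%C by ring. apply ccvg_minus; [apply Cg; auto|apply ccvg_const].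
  - intros w Hw. replace (g w) with (g z + (g w - g z))%C at 1 by ring. rewrite cexp_plus.
    rewrite (cexp1_spec (g w - g z)). rewrite (Ep w Hw). ring.
Qed.

(** If no del worked, countable choice would give points of P within 1/(n+1) of z that violate the
    bound, against sequential continuity. *)
Lemma ccontat_eps P f z : ccontat P f z -> forall eps, 0 < eps -> exists del, 0 < del /\
  forall w, P w -> Cmod (w - z) < del -> Cmod (f w - f z) < eps.
Proof.
  intros H eps He. apply NNPP. intro N.
  assert (G : forall n : nat, exists w, P w /\ Cmod (w - z) < / (INR n + 1) /\ ~ Cmod (f w - f z) < eps).
  { intro n. apply NNPP. intro N2. apply N. exists (/ (INR n + 1)). split.
    - apply Rinv_0_lt_compat. pose proof (pos_INR n); lra.
    - intros w Pw Hw. apply NNPP. intro N3. apply N2. exists w; auto. }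
  destruct (choice _ G) as [u Hu].
  destruct (H u) with (eps := eps) as [N0 HN0]; auto.
  - intro n; apply Hu.
  - apply ccvg_of_le with (v := fun n => / (INR n + 1)).
    + intro n. apply Rlt_le, Hu.
    + replace (Finite 0) with (Rbar_inv p_infty) by reflexivity. apply is_lim_seq_inv; [|easy].
      apply is_lim_seq_plus with (l1 := p_infty) (l2 := Finite 1); [apply is_lim_seq_INR|apply is_lim_seq_const|easy].
  - destruct (Hu N0) as (_ & _ & Hc). apply Hc. apply HN0. lia.
Qed.

Lemma eps_ccontat (P : C -> Prop) f z : (forall eps, 0 < eps -> exists del, 0 < del /\
  forall w, P w -> Cmod (w - z) < del -> Cmod (f w - f z) < eps) -> ccontat P f z.
Proof.
  intros H u Hu Hz eps He. destruct (H eps He) as (del & Hd & G). destruct (Hz del Hd) as [N HN].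
  exists N; intros n Hn. apply G; auto.
Qed.

Lemma cdiff_of_quotient (P : C -> Prop) f z l : (forall eps, 0 < eps -> exists del, 0 < del /\
  forall w, P w -> Cmod (w - z) < del -> Cmod (f w - f z - l * (w - z)) <= eps * Cmod (w - z)) -> cdiff P f z.
Proof.
  intros H. exists (fun w => if Ceq_dec w z then l else ((f w - f z) / (w - z))%C). split.
  - apply eps_ccontat. intros eps He. destruct (H (eps / 2)) as (del & Hd & G); [lra|].
    exists del; split; auto. intros w Hw Hwd. specialize (G w Hw Hwd).
    destruct (Ceq_dec z z) as [_|N]; [|easy]. destruct (Ceq_dec w z) as [->|N].
    + replace (l - l)%C with (RtoC 0) by ring. rewrite Cmod_0; auto.
    + assert (Hn : (w - z)%C <> RtoC 0). { intro E. apply N. replace w with ((w - z) + z)%C by ring. rewrite E; ring. }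
      replace ((f w - f z) / (w - z) - l)%C with ((f w - f z - l * (w - z)) / (w - z))%C by (field; auto).
      rewrite Cmod_div by auto. pose proof (proj1 (Cmod_gt_0 _) Hn) as Hp.
      apply Rmult_lt_reg_r with (Cmod (w - z)); auto. unfold Rdiv. rewrite Rmult_assoc, Rinv_l, Rmult_1_r by lra. nra.
  - intros w _. destruct (Ceq_dec w z) as [->|N]; [ring|].
    assert (Hn : (w - z)%C <> RtoC 0). { intro E. apply N. replace w with ((w - z) + z)%C by ring. rewrite E; ring. }
    field; auto.
Qed.

Lemma C_differentiable_cdiff f z : C_differentiable f z -> cdiff (fun _ => True) f z.
Proof.
  intros [l [_ H]]. apply cdiff_of_quotient with l. intros eps He.
  specialize (H z (fun P HP => HP) (mkposreal _ He)). destruct H as [del Hd]. exists del. split; [apply cond_pos|].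
  intros w _ Hw. specialize (Hd w Hw).
  replace (l * (w - z))%C with ((w - z) * l)%C by ring. exact Hd.
Qed.

(** The integral of F(z) dz counterclockwise around the rectangle [a,b] x [c,d]. *)
Definition rint (F : C -> C) (a b c d : R) : C :=
  (CInt (fun t => F (t, c)) a b + Ci * CInt (fun t => F (b, t)) c d
   - CInt (fun t => F (t, d)) a b - Ci * CInt (fun t => F (a, t)) c d)%C.

(** Continuity along horizontal and vertical lines only: this is all that integrals over the sides
    of rectangles require. *)
Definition ccont2 (F : C -> C) : Prop := (forall c, ccont (fun t => F (t, c))) /\ (forall a, ccont (fun t => F (a, t))).

Lemma ccont2_plus F G : ccont2 F -> ccont2 G -> ccont2 (fun w => (F w + G w)%C).
Proof.
  intros [H1 H2] [H3 H4].
  split; intro; [apply (ccont_plus _ _ (H1 _) (H3 _))|apply (ccont_plus _ _ (H2 _) (H4 _))].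
Qed.

Lemma ccont2_mult F G : ccont2 F -> ccont2 G -> ccont2 (fun w => (F w * G w)%C).
Proof.
  intros [H1 H2] [H3 H4].
  split; intro; [apply (ccont_mult _ _ (H1 _) (H3 _))|apply (ccont_mult _ _ (H2 _) (H4 _))].
Qed.

Lemma ccont2_const c : ccont2 (fun _ => c).
Proof. split; intro; apply ccont_const. Qed.

Lemma ccont2_id : ccont2 (fun w => w).
Proof.
  split; intros p t; split; simpl.
  - apply continuous_id.
  - apply continuous_const.
  - apply continuous_const.
  - apply continuous_id.
Qed.

Lemma rint_split_v F a m b c d : ccont2 F -> rint F a b c d = (rint F a m c d + rint F m b c d)%C.
Proof.
  intros [H1 H2]. unfold rint. rewrite <- (CInt_Chasles (fun t => F (t, c)) a m b (H1 c)).
  rewrite <- (CInt_Chasles (fun t => F (t, d)) a m b (H1 d)). ring.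
Qed.

Lemma rint_split_h F a b c m d : ccont2 F -> rint F a b c d = (rint F a b c m + rint F a b m d)%C.
Proof.
  intros [H1 H2]. unfold rint. rewrite <- (CInt_Chasles (fun t => F (a, t)) c m d (H2 a)).
  rewrite <- (CInt_Chasles (fun t => F (b, t)) c m d (H2 b)). ring.
Qed.

Lemma rint_plus F G a b c d : ccont2 F -> ccont2 G -> rint (fun w => (F w + G w)%C) a b c d = (rint F a b c d + rint G a b c d)%C.
Proof.
  intros [H1 H2] [H3 H4]. unfold rint.
  rewrite !(CInt_plus (fun t => F (t, _)) (fun t => G (t, _))), !(CInt_plus (fun t => F (_, t)) (fun t => G (_, t))) by auto. ring.
Qed.

(** An affine function has the primitive p w + q w^2/2, and the four sides telescope. *)
Lemma rint_affine p q a b c d : rint (fun w => (p + q * w)%C) a b c d = RtoC 0.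
Proof.
  assert (K : ccont2 (fun w => (p + q * w)%C)).
  { apply ccont2_plus; [apply ccont2_const|apply ccont2_mult; [apply ccont2_const|apply ccont2_id]]. }
  destruct K as [K1 K2].
  set (Phi := fun w : C => (p * w + q * (w * w) * (/2)%R)%C).
  assert (E1 : forall c, CInt (fun t => (p + q * (t, c))%C) a b = (Phi (b, c) - Phi (a, c))%C).
  { intro y. apply (CInt_derive (fun t => Phi (t, y)) (fun t => (p + q * (t, y))%C)); [apply K1| |];
    intro t; destruct p as [p1 p2], q as [q1 q2]; unfold Phi, Re, Im; simpl; auto_derive; auto; field. }
  assert (E2 : forall x, (Ci * CInt (fun t => (p + q * (x, t))%C) c d)%C = (Phi (x, d) - Phi (x, c))%C).
  { intro x. rewrite <- CInt_scal by apply K2.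
    apply (CInt_derive (fun t => Phi (x, t)) (fun t => (Ci * (p + q * (x, t)))%C)).
    - apply ccont_mult; [apply ccont_const|apply K2].
    - intro t; destruct p as [p1 p2], q as [q1 q2]; unfold Phi, Re, Im; simpl; auto_derive; auto; field.
    - intro t; destruct p as [p1 p2], q as [q1 q2]; unfold Phi, Re, Im; simpl; auto_derive; auto; field. }
  unfold rint. rewrite !E1, !E2. ring.
Qed.

Lemma rint_le F B a b c d : ccont2 F -> a <= b -> c <= d ->
  (forall x y, a <= x <= b -> c <= y <= d -> Cmod (F (x, y)) <= B) ->
  Cmod (rint F a b c d) <= 4 * (((b - a) + (d - c)) * B).
Proof.
  intros [H1 H2] Hab Hcd HB. unfold rint.
  pose proof (CInt_le_const (fun t => F (t, c)) B a b (H1 c) Hab ltac:(intros; apply HB; lra)) as G1.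
  pose proof (CInt_le_const (fun t => F (t, d)) B a b (H1 d) Hab ltac:(intros; apply HB; lra)) as G2.
  pose proof (CInt_le_const (fun t => F (a, t)) B c d (H2 a) Hcd ltac:(intros; apply HB; lra)) as G3.
  pose proof (CInt_le_const (fun t => F (b, t)) B c d (H2 b) Hcd ltac:(intros; apply HB; lra)) as G4.
  unfold Cminus.
  eapply Rle_trans; [apply Cmod_triangle|]. rewrite Cmod_opp, Cmod_mult, Cmod_Ci, Rmult_1_l.
  eapply Rle_trans; [apply Rplus_le_compat_r, Cmod_triangle|]. rewrite Cmod_opp.
  eapply Rle_trans; [apply Rplus_le_compat_r, Rplus_le_compat_r, Cmod_triangle|]. rewrite Cmod_mult, Cmod_Ci, Rmult_1_l.
  lra.
Qed.

Section Bisection.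
Variables (F : C -> C) (a0 c0 W H K : R).

Fixpoint corner (n : nat) : R * R :=
  match n with
  | O => (a0, c0)
  | S k => let (a, c) := corner k in
           let w := W / 2 ^ (S k) in let h := H / 2 ^ (S k) in
           let big := fun a c => Rlt_dec (K / 4 ^ (S k)) (Cmod (rint F a (a + w) c (c + h))) in
           if big a c then (a, c) else if big (a + w) c then (a + w, c)
           else if big a (c + h) then (a, c + h) else (a + w, c + h)
  end.

Lemma corner_step n (HW : 0 <= W) (HH : 0 <= H) :
  (fst (corner n) <= fst (corner (S n)) <= fst (corner n) + W / 2 ^ (S n)) /\
  (snd (corner n) <= snd (corner (S n)) <= snd (corner n) + H / 2 ^ (S n)).
Proof.
  assert (0 <= W / 2 ^ (S n)). { apply Rdiv_le_0_compat; [auto|apply pow_lt; lra]. }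
  assert (0 <= H / 2 ^ (S n)). { apply Rdiv_le_0_compat; [auto|apply pow_lt; lra]. }
  cbn [corner]. destruct (corner n) as [a c]. cbv zeta.
  repeat match goal with |- context [Rlt_dec ?x ?y] => destruct (Rlt_dec x y) end; cbn [fst snd]; lra.
Qed.

(** The integral over a rectangle is the sum of those over its quarters, so one quarter carries at
    least a fourth of the modulus. The last quarter is not tested: it must be the one when the other
    three fail. *)
Lemma corner_big n : ccont2 F -> K < Cmod (rint F a0 (a0 + W) c0 (c0 + H)) ->
  K / 4 ^ n < Cmod (rint F (fst (corner n)) (fst (corner n) + W / 2 ^ n) (snd (corner n)) (snd (corner n) + H / 2 ^ n)).
Proof.
  intros HF HK. induction n.
  - simpl. now rewrite !Rdiv_1_r.
  - cbn [corner]. destruct (corner n) as [a c]. cbn [fst snd] in IHn. cbv zeta.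
    set (w := W / 2 ^ (S n)). set (h := H / 2 ^ (S n)).
    replace (W / 2 ^ n) with (w + w) in IHn.
    2: unfold w; simpl; field; apply pow_nonzero; lra.
    replace (H / 2 ^ n) with (h + h) in IHn.
    2: unfold h; simpl; field; apply pow_nonzero; lra.
    replace (K / 4 ^ n) with (4 * (K / 4 ^ (S n))) in IHn.
    2: simpl; field; apply pow_nonzero; lra.
    rewrite <- !Rplus_assoc in IHn.
    rewrite (rint_split_v F a (a + w)) in IHn by auto.
    rewrite (rint_split_h F a (a + w) c (c + h)), (rint_split_h F (a + w) (a + w + w) c (c + h)) in IHn by auto.
    destruct (Rlt_dec (K / 4 ^ S n) (Cmod (rint F a (a + w) c (c + h)))) as [G1|G1]; [exact G1|].
    destruct (Rlt_dec (K / 4 ^ S n) (Cmod (rint F (a + w) (a + w + w) c (c + h)))) as [G2|G2]; [exact G2|].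
    destruct (Rlt_dec (K / 4 ^ S n) (Cmod (rint F a (a + w) (c + h) (c + h + h)))) as [G3|G3]; [exact G3|].
    cbn [fst snd]. apply Rnot_le_lt. intro G4. apply Rnot_lt_le in G1, G2, G3.
    pose proof (Cmod_triangle (rint F a (a + w) c (c + h) + rint F a (a + w) (c + h) (c + h + h))
      (rint F (a + w) (a + w + w) c (c + h) + rint F (a + w) (a + w + w) (c + h) (c + h + h))) as T1.
    pose proof (Cmod_triangle (rint F a (a + w) c (c + h)) (rint F a (a + w) (c + h) (c + h + h))) as T2.
    pose proof (Cmod_triangle (rint F (a + w) (a + w + w) c (c + h)) (rint F (a + w) (a + w + w) (c + h) (c + h + h))) as T3.
    lra.
Qed.
End Bisection.

Lemma nested_point (a : nat -> R) W : (forall n, a n <= a (S n) <= a n + W / 2 ^ (S n)) ->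
  exists u, forall n, a n <= u <= a n + W / 2 ^ n.
Proof.
  intros Ha.
  assert (Hb : forall n, a (S n) + W / 2 ^ (S n) <= a n + W / 2 ^ n).
  { intro n. specialize (Ha n). replace (W / 2 ^ n) with (W / 2 ^ S n + W / 2 ^ S n); [lra|].
    simpl; field; apply pow_nonzero; lra. }
  assert (M : forall n m, (n <= m)%nat -> a n <= a m /\ a m + W / 2 ^ m <= a n + W / 2 ^ n).
  { intros n m Hm. induction Hm; [lra|]. specialize (Ha m); specialize (Hb m). lra. }
  assert (W0 : forall m, 0 <= W / 2 ^ m).
  { intro m. pose proof (Ha m). replace (W / 2 ^ m) with (2 * (W / 2 ^ S m)); [lra|]. simpl; field; apply pow_nonzero; lra. }
  destruct (ex_finite_lim_seq_incr a (a O + W / 2 ^ O)) as [u Hu].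
  - intro n; apply Ha.
  - intro n. destruct (M O n ltac:(lia)). specialize (W0 n). lra.
  - exists u. intro n. split.
    + apply (is_lim_seq_le_loc (fun _ => a n) a (a n) u); [|apply is_lim_seq_const|exact Hu].
      exists n; intros m Hm. apply M; auto.
    + apply (is_lim_seq_le_loc a (fun _ => a n + W / 2 ^ n) u (a n + W / 2 ^ n)); [|exact Hu|apply is_lim_seq_const].
      exists n; intros m Hm. destruct (M n m Hm). specialize (W0 m). lra.
Qed.

Lemma pow2_inv_small (S0 eps : R) : 0 < eps -> exists n, S0 / 2 ^ n < eps.
Proof.
  intro He. destruct (Rle_dec S0 0) as [H|H].
  - exists O. simpl. lra.
  - destruct (pow_lt_1_zero (/ 2) ltac:(rewrite Rabs_pos_eq; lra) (eps / S0)) as [N HN].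
    + apply Rdiv_lt_0_compat; lra.
    + exists N. specialize (HN N (le_n _)). rewrite Rabs_pos_eq in HN by (apply pow_le; lra).
      rewrite pow_inv in HN. apply Rmult_lt_compat_l with (r := S0) in HN; [|lra].
      replace (S0 * (eps / S0)) with eps in HN by (field; lra). exact HN.
Qed.

(* Quadrisection: corner n is the lower left corner of a 2^n times smaller rectangle whose integral exceeds K/4^n. *)
Lemma goursat F a b c d : ccont2 F -> a <= b -> c <= d ->
  (forall x y, a <= x <= b -> c <= y <= d -> cdiff (fun w => a <= Re w <= b /\ c <= Im w <= d) F (x, y)) ->
  rint F a b c d = RtoC 0.
Proof.
  intros HF Hab Hcd Hd. apply NNPP. intro N.
  set (W := b - a). set (H := d - c). set (K := Cmod (rint F a b c d) / 2).
  assert (HK : 0 < K). { unfold K. pose proof (proj1 (Cmod_gt_0 _) N). lra. }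
  assert (HK2 : K < Cmod (rint F a (a + W) c (c + H))).
  { unfold W, H. replace (a + (b - a)) with b by ring. replace (c + (d - c)) with d by ring. unfold K in *. lra. }
  assert (HW : 0 <= W) by (unfold W; lra). assert (HH : 0 <= H) by (unfold H; lra).
  pose (cn := corner F a c W H K).
  destruct (nested_point (fun n => fst (cn n)) W) as [u Hu]. { intro n; apply corner_step; auto. }
  destruct (nested_point (fun n => snd (cn n)) H) as [v Hv]. { intro n; apply corner_step; auto. }
  assert (Hin : forall n, a <= fst (cn n) /\ fst (cn n) + W / 2 ^ n <= b /\ c <= snd (cn n) /\ snd (cn n) + H / 2 ^ n <= d).
  { induction n.
    - unfold cn; simpl. unfold W, H. lra.
    - destruct (corner_step F a c W H K n HW HH) as [G1 G2]. fold (cn (S n)) in *. fold (cn n) in *.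
      replace (W / 2 ^ n) with (W / 2 ^ S n + W / 2 ^ S n) in IHn by (simpl; field; apply pow_nonzero; lra).
      replace (H / 2 ^ n) with (H / 2 ^ S n + H / 2 ^ S n) in IHn by (simpl; field; apply pow_nonzero; lra).
      lra. }
  assert (Hu0 : a <= u <= b). { specialize (Hu O). destruct (Hin O) as (? & ? & ? & ?). lra. }
  assert (Hv0 : c <= v <= d). { specialize (Hv O). destruct (Hin O) as (? & ? & ? & ?). lra. }
  destruct (Hd u v Hu0 Hv0) as (phi & Hphi & E).
  set (S0 := W + H). assert (HS0 : 0 <= S0) by (unfold S0; lra).
  (* On the n-th rectangle, of half perimeter S0/2^n, a variation of phi below eps makes the first
     order remainder at most eps S0/2^n and its integral at most 4 eps (S0/2^n)^2. For this eps that
     is at most K/4^n; the + 1 allows S0 = 0. *)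
  destruct (ccontat_eps _ _ _ Hphi (K / (4 * S0 ^ 2 + 1))) as (del & Hdel & G).
  { apply Rdiv_lt_0_compat; [auto|]. pose proof (pow2_ge_0 S0); lra. }
  destruct (pow2_inv_small S0 del Hdel) as [n Hn].
  pose proof (corner_big F a c W H K n HF HK2) as Big. fold (cn n) in Big.
  destruct (Hin n) as (I1 & I2 & I3 & I4). specialize (Hu n). specialize (Hv n). cbv beta in Hu, Hv.
  set (x := fst (cn n)) in *. set (y := snd (cn n)) in *.
  assert (P2 : 0 < 2 ^ n) by (apply pow_lt; lra).
  assert (W2 : 0 <= W / 2 ^ n) by (apply Rdiv_le_0_compat; lra).
  assert (H2 : 0 <= H / 2 ^ n) by (apply Rdiv_le_0_compat; lra).
  (* Subtracting the affine part of F at the common point of the rectangles leaves their boundary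
     integrals unchanged. *)
  set (l := phi (u, v)). set (p := (F (u, v) - l * (u, v))%C).
  set (r := fun w => (F w + (- p + (- l) * w))%C).
  assert (Hr : ccont2 r).
  { apply ccont2_plus; auto. apply ccont2_plus; [apply ccont2_const|apply ccont2_mult; [apply ccont2_const|apply ccont2_id]]. }
  assert (Er : rint F x (x + W / 2 ^ n) y (y + H / 2 ^ n) = rint r x (x + W / 2 ^ n) y (y + H / 2 ^ n)).
  { unfold r. rewrite rint_plus, rint_affine; auto; [ring|].
    apply ccont2_plus; [apply ccont2_const|apply ccont2_mult; [apply ccont2_const|apply ccont2_id]]. }
  rewrite Er in Big.
  assert (SE : W / 2 ^ n + H / 2 ^ n = S0 / 2 ^ n) by (unfold S0; field; lra).
  pose proof (rint_le r (K / (4 * S0 ^ 2 + 1) * (S0 / 2 ^ n)) x (x + W / 2 ^ n) y (y + H / 2 ^ n) Hr ltac:(lra) ltac:(lra)) as Bd.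
  assert (Bd1 : Cmod (rint r x (x + W / 2 ^ n) y (y + H / 2 ^ n)) <= 4 * ((S0 / 2 ^ n) * (K / (4 * S0 ^ 2 + 1) * (S0 / 2 ^ n)))).
  { rewrite <- SE at 1. replace (W / 2 ^ n + H / 2 ^ n) with (x + W / 2 ^ n - x + (y + H / 2 ^ n - y)) by ring.
    apply Bd. intros s t Hs Ht.
    assert (Hw : a <= Re (s, t) <= b /\ c <= Im (s, t) <= d) by (simpl; lra).
    unfold r, p. rewrite (E (s, t) Hw).
    replace (F (u, v) + ((s, t) - (u, v)) * phi (s, t) + (- (F (u, v) - l * (u, v)) + - l * (s, t)))%C
      with ((phi (s, t) - l) * ((s, t) - (u, v)))%C by ring.
    assert (Hdist : Cmod ((s, t) - (u, v)) <= S0 / 2 ^ n).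
    { eapply Rle_trans; [apply Cmod_le_abs|]. simpl. rewrite <- SE.
      apply Rplus_le_compat; apply Rabs_le; lra. }
    rewrite Cmod_mult. apply Rmult_le_compat; try apply Cmod_ge_0; auto.
    apply Rlt_le, G; auto. lra. }
  assert (K / 4 ^ n < K / 4 ^ n); [|lra].
  eapply Rlt_le_trans; [exact Big|]. eapply Rle_trans; [exact Bd1|].
  replace (4 ^ n) with (2 ^ n * 2 ^ n) by (rewrite <- Rpow_mult_distr; f_equal; lra).
  replace (4 * (S0 / 2 ^ n * (K / (4 * S0 ^ 2 + 1) * (S0 / 2 ^ n)))) with (K / (2 ^ n * 2 ^ n) * ((4 * S0 ^ 2) / (4 * S0 ^ 2 + 1))).
  2: field; split; [lra|pose proof (pow2_ge_0 S0); simpl in *; nra].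
  rewrite <- (Rmult_1_r (K / (2 ^ n * 2 ^ n))) at 2. apply Rmult_le_compat_l.
  - apply Rdiv_le_0_compat; [lra|]. apply Rmult_lt_0_compat; auto.
  - pose proof (pow2_ge_0 S0). apply Rmult_le_reg_r with (4 * S0 ^ 2 + 1); [lra|]. unfold Rdiv. rewrite Rmult_assoc, Rinv_l; lra.
Qed.

Lemma ccont_eps f : (forall t eps, 0 < eps -> exists del, 0 < del /\ forall s, Rabs (s - t) < del -> Cmod (f s - f t) < eps) -> ccont f.
Proof.
  intros H t. split; apply filterlim_locally; intros eps; destruct (H t eps (cond_pos eps)) as (del & Hd & G);
    exists (mkposreal _ Hd); intros s Hs; specialize (G s Hs).
  - eapply Rle_lt_trans; [|exact G]. apply (re_le_Cmod (f s - f t)).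
  - eapply Rle_lt_trans; [|exact G]. apply (Im_le_Cmod (f s - f t)).
Qed.

Lemma ccont_eps_inv f t eps : ccont f -> 0 < eps -> exists del, 0 < del /\ forall s, Rabs (s - t) < del -> Cmod (f s - f t) < eps.
Proof.
  intros H He. destruct (H t) as [H1 H2]. assert (He2 : 0 < eps / 2) by lra.
  pose proof (proj1 (filterlim_locally _ _) H1 (mkposreal _ He2)) as [d1 D1].
  pose proof (proj1 (filterlim_locally _ _) H2 (mkposreal _ He2)) as [d2 D2].
  exists (Rmin d1 d2). split; [apply Rmin_glb_lt; apply cond_pos|]. intros s Hs.
  pose proof (D1 s (Rlt_le_trans _ _ _ Hs (Rmin_l _ _))) as B1. pose proof (D2 s (Rlt_le_trans _ _ _ Hs (Rmin_r _ _))) as B2.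
  change (Rabs (Re (f s) - Re (f t)) < eps / 2) in B1. change (Rabs (Im (f s) - Im (f t)) < eps / 2) in B2.
  eapply Rle_lt_trans; [apply Cmod_le_abs|].
  change (Re (f s - f t)) with (Re (f s) - Re (f t)). change (Im (f s - f t)) with (Im (f s) - Im (f t)). lra.
Qed.

Lemma continuous_bounded (f : R -> R) a b : (forall t, continuous f t) -> a <= b -> exists B, forall t, a <= t <= b -> f t <= B.
Proof.
  intros H Hab. destruct (continuity_ab_maj f a b Hab) as (M & HM & _).
  - intros c _. apply continuity_pt_filterlim. apply H.
  - exists (f M). exact HM.
Qed.

Lemma ccont_bounded f a b : ccont f -> a <= b -> exists B, 0 < B /\ forall t, a <= t <= b -> Cmod (f t) <= B.
Proof.
  intros H Hab.
  destruct (continuous_bounded (fun t => Rabs (Re (f t))) a b) as [B1 HB1]; auto.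
  { intro t. apply (continuous_comp (fun t => Re (f t)) Rabs); [apply H|apply continuous_Rabs]. }
  destruct (continuous_bounded (fun t => Rabs (Im (f t))) a b) as [B2 HB2]; auto.
  { intro t. apply (continuous_comp (fun t => Im (f t)) Rabs); [apply H|apply continuous_Rabs]. }
  pose proof (HB1 a ltac:(lra)). pose proof (HB2 a ltac:(lra)).
  pose proof (Rabs_pos (Re (f a))). pose proof (Rabs_pos (Im (f a))).
  exists (B1 + B2 + 1). split; [lra|]. intros t Ht. eapply Rle_trans; [apply Cmod_le_abs|].
  specialize (HB1 t Ht). specialize (HB2 t Ht). lra.
Qed.

(* exp(- n t^2) concentrates at 0, so its moments against a continuous g cannot decay like exp(-n) unless g(0) = 0. *)
Lemma gauss_concentration g T C0 : ccont g -> 0 < T ->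
  (forall n : nat, Cmod (CInt (fun t => (g t * RtoC (exp (- INR n * t ^ 2)))%C) (- T) T) <= C0 * exp (- INR n)) ->
  g 0 = RtoC 0.
Proof.
  intros Hg HT Hn. apply NNPP. intro N0.
  set (c := Cmod (g 0) ^ 2). assert (Hc : 0 < c). { unfold c. pose proof (proj1 (Cmod_gt_0 _) N0). nra. }
  (* The factor conj(g 0) makes the value at 0 real and positive, so that real integrals can be
     compared. *)
  set (k := fun t => (Cconj (g 0) * g t)%C).
  assert (Hk : ccont k) by (apply ccont_mult; [apply ccont_const|auto]).
  assert (k0 : k 0 = RtoC c). { unfold k, c. rewrite Cmult_comm.  rewrite <- Cmod2_conj. now rewrite RtoC_pow. }
  destruct (ccont_eps_inv k 0 (c / 2) Hk ltac:(lra)) as (d0 & Hd0 & Gd0).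
  set (d := Rmin (Rmin d0 T) 1 / 2).
  assert (Hd : 0 < d /\ d < d0 /\ d < T /\ d < 1).
  { unfold d. pose proof (Rmin_l (Rmin d0 T) 1). pose proof (Rmin_r (Rmin d0 T) 1).
    pose proof (Rmin_l d0 T). pose proof (Rmin_r d0 T).
    assert (0 < Rmin (Rmin d0 T) 1) by (repeat apply Rmin_glb_lt; lra). lra. }
  destruct Hd as (D1 & D2 & D3 & D4).
  destruct (ccont_bounded k (- T) T Hk ltac:(lra)) as (B & HB0 & HB).
  assert (Hclose : forall t, Rabs t <= d -> c / 2 <= Re (k t)).
  { intros t Ht. specialize (Gd0 t). rewrite Rminus_0_r in Gd0. specialize (Gd0 ltac:(lra)). rewrite k0 in Gd0.
    pose proof (Rle_lt_trans _ _ _ (re_le_Cmod _) Gd0) as G. change (Re (k t - c)) with (Re (k t) - c) in G.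
    apply Rabs_def2 in G. lra. }
  (* The interval |t| <= d/2 contributes at least (c/2) d exp(-n d^2/4). Between d/2 and d the
     integrand is nonnegative; beyond d it is O(exp(-n d^2)), and so is the assumed bound because d
     < 1. *)
  assert (Key : forall n : nat, (c / 2) * d * exp (- INR n * (d / 2) ^ 2) <= (2 * T * B + Cmod (g 0) * Rabs C0) * exp (- INR n * d ^ 2)).
  { intro n. set (q := fun t => (g t * RtoC (exp (- INR n * t ^ 2)))%C).
    assert (Ce : forall t, continuous (fun t => exp (- INR n * t ^ 2)) t).
    { intro t. apply (ex_derive_continuous (fun t => exp (- INR n * t ^ 2))). auto_derive; auto. }
    assert (Hq : ccont q). { apply ccont_mult; auto. apply ccont_RtoC, Ce. }
    set (h := fun t => Re (k t) * exp (- INR n * t ^ 2)).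
    assert (Hh : forall t, continuous h t).
    { intro t. apply (continuous_mult (fun t => Re (k t)) (fun t => exp (- INR n * t ^ 2))); [apply Hk|apply Ce]. }
    assert (E : Re (Cconj (g 0) * CInt q (- T) T) = RInt h (- T) T).
    { rewrite <- CInt_scal by auto. unfold CInt. cbn [Re fst]. apply RInt_ext. intros t _.
      unfold h, k, q. unfold Re. simpl. ring. }
    assert (Up : RInt h (- T) T <= Cmod (g 0) * Rabs C0 * exp (- INR n)).
    { rewrite <- E. eapply Rle_trans; [apply Re_le_Cmod|]. rewrite Cmod_mult, Cmod_conj, Rmult_assoc.
      apply Rmult_le_compat_l; [apply Cmod_ge_0|]. eapply Rle_trans; [apply Hn|].
      apply Rmult_le_compat_r; [apply Rlt_le, exp_pos|apply Rle_abs]. }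
    assert (En : exp (- INR n) <= exp (- INR n * d ^ 2)).
    { apply exp_le. pose proof (pos_INR n). assert (d ^ 2 <= 1) by nra. nra. }
    assert (Low : forall t, - T <= t <= T -> d / 2 <= Rabs t -> - B * exp (- INR n * d ^ 2) <= h t).
    { intros t Ht Ha. unfold h. pose proof (exp_pos (- INR n * t ^ 2)) as Ep. pose proof (exp_pos (- INR n * d ^ 2)) as Ep2.
      destruct (Rle_dec (Rabs t) d) as [L|L].
      - specialize (Hclose t L). nra.
      - assert (exp (- INR n * t ^ 2) <= exp (- INR n * d ^ 2)).
        { apply exp_le. pose proof (pos_INR n). assert (d ^ 2 <= t ^ 2) by (rewrite <- (pow2_abs t); nra). nra. }
        assert (- B <= Re (k t)).
        { specialize (HB t Ht). pose proof (re_le_Cmod (k t)) as H1. pose proof (Rle_abs (- Re (k t))) as H2. rewrite Rabs_Ropp in H2. lra. }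
        nra. }
    assert (Ch : RInt h (- T) T = RInt h (- T) (- (d / 2)) + RInt h (- (d / 2)) (d / 2) + RInt h (d / 2) T).
    { pose proof (RInt_Chasles h (- T) (- (d / 2)) (d / 2)) as C1. pose proof (RInt_Chasles h (- T) (d / 2) T) as C2.
      unfold plus in C1, C2; simpl in C1, C2. rewrite C1, C2; auto; now apply cont_ex_RInt. }
    assert (L1 : (- (d / 2) - - T) * (- B * exp (- INR n * d ^ 2)) <= RInt h (- T) (- (d / 2))).
    { replace ((- (d / 2) - - T) * (- B * exp (- INR n * d ^ 2))) with (RInt (fun _ => - B * exp (- INR n * d ^ 2)) (- T) (- (d / 2)))
        by (rewrite RInt_const; reflexivity).
      apply RInt_le; [lra|apply ex_RInt_const|now apply cont_ex_RInt|]. intros t Ht. apply Low; [lra|]. rewrite Rabs_left; lra. }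
    assert (L3 : (T - d / 2) * (- B * exp (- INR n * d ^ 2)) <= RInt h (d / 2) T).
    { replace ((T - d / 2) * (- B * exp (- INR n * d ^ 2))) with (RInt (fun _ => - B * exp (- INR n * d ^ 2)) (d / 2) T)
        by (rewrite RInt_const; reflexivity).
      apply RInt_le; [lra|apply ex_RInt_const|now apply cont_ex_RInt|]. intros t Ht. apply Low; [lra|]. rewrite Rabs_pos_eq; lra. }
    assert (L2 : (d / 2 - - (d / 2)) * (c / 2 * exp (- INR n * (d / 2) ^ 2)) <= RInt h (- (d / 2)) (d / 2)).
    { replace ((d / 2 - - (d / 2)) * (c / 2 * exp (- INR n * (d / 2) ^ 2))) with (RInt (fun _ => c / 2 * exp (- INR n * (d / 2) ^ 2)) (- (d / 2)) (d / 2))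
        by (rewrite RInt_const; reflexivity).
      apply RInt_le; [lra|apply ex_RInt_const|now apply cont_ex_RInt|]. intros t Ht. unfold h.
      assert (Ha : Rabs t <= d / 2) by (apply Rabs_le; lra).
      apply Rmult_le_compat; [lra|apply Rlt_le, exp_pos|apply Hclose; lra|].
      apply exp_le. pose proof (pos_INR n). assert (t ^ 2 <= (d / 2) ^ 2) by (rewrite <- (pow2_abs t); pose proof (Rabs_pos t); nra). nra. }
    assert (0 <= Cmod (g 0) * Rabs C0) by (apply Rmult_le_pos; [apply Cmod_ge_0|apply Rabs_pos]).
    assert (0 < B * exp (- INR n * d ^ 2)) by (apply Rmult_lt_0_compat; [auto|apply exp_pos]).
    assert (Cmod (g 0) * Rabs C0 * exp (- INR n) <= Cmod (g 0) * Rabs C0 * exp (- INR n * d ^ 2)) by (apply Rmult_le_compat_l; auto).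
    nra. }
  (* The two rates differ by d^2 - d^2/4 = 3 d^2/4, which decides the comparison for large n. *)
  destruct (exp_tail_small (2 * T * B + Cmod (g 0) * Rabs C0) (3 * d ^ 2 / 4) ((c / 2) * d)) as (T0 & HT0 & HTs).
  { nra. } { apply Rmult_lt_0_compat; lra. }
  destruct (INR_unbounded T0) as [n Hn0].
  specialize (HTs (INR n) ltac:(lra)). specialize (Key n).
  replace (- INR n * d ^ 2) with (- INR n * (d / 2) ^ 2 + - (3 * d ^ 2 / 4) * INR n) in Key by field.
  rewrite exp_plus in Key. pose proof (exp_pos (- INR n * (d / 2) ^ 2)). nra.
Qed.

(** The retraction of R onto [a,b]. Applied to Re w it extends a function on a strip to the whole
    plane, continuously along every line parallel to an axis, as [ccont2] demands. *)
Definition clamp (a b t : R) : R := Rmax a (Rmin b t).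

Lemma clamp_in a b t : a <= b -> a <= clamp a b t <= b.
Proof. unfold clamp; intro H. split; [apply Rmax_l|]. apply Rmax_lub; [auto|apply Rmin_l]. Qed.

Lemma clamp_id a b t : a <= t <= b -> clamp a b t = t.
Proof. intros H. unfold clamp. rewrite Rmin_right, Rmax_right; lra. Qed.

Lemma clamp_lip a b s t : Rabs (clamp a b s - clamp a b t) <= Rabs (s - t).
Proof.
  unfold clamp. apply Rle_trans with (Rabs (Rmin b s - Rmin b t)).
  - generalize (Rmin b s) (Rmin b t). intros p q. unfold Rmax.
    destruct (Rle_dec a p), (Rle_dec a q); unfold Rabs;
    repeat match goal with |- context [Rcase_abs ?x] => destruct (Rcase_abs x) end; lra.
  - unfold Rmin. destruct (Rle_dec b s), (Rle_dec b t); unfold Rabs;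
    repeat match goal with |- context [Rcase_abs ?x] => destruct (Rcase_abs x) end; lra.
Qed.

Definition strip (al be : R) (z : C) : Prop := al < Re z < be.

(* Integrate F(w) exp(n (w - z0)^2) over a rectangle with left side through z0, right side where F = 0, and
   horizontal sides further from z0 than its width, so that they contribute O(exp(-n)). *)
Lemma strip_unique F al b be : al < b < be -> (forall z, strip al be z -> cdiff (strip al be) F z) ->
  (forall z, b <= Re z < be -> F z = RtoC 0) -> forall z, strip al be z -> F z = RtoC 0.
Proof.
  intros Hb Hd Hz z0 Hz0. destruct (Rle_dec b (Re z0)) as [L|L]; [apply Hz; unfold strip in Hz0; lra|].
  apply Rnot_le_lt in L. destruct z0 as [x0 y0]. unfold strip in Hz0. simpl in Hz0, L.
  set (G := fun w : C => F (clamp x0 b (Re w), Im w)).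
  assert (HG : forall (ga : R -> C), (forall s t, Cmod ((clamp x0 b (Re (ga s)), Im (ga s)) - (clamp x0 b (Re (ga t)), Im (ga t))) <= Rabs (s - t)) ->
     ccont (fun t => G (ga t))).
  { intros ga Hga. apply ccont_eps. intros t eps He.
    assert (Pg : forall s, strip al be (clamp x0 b (Re (ga s)), Im (ga s))).
    { intro s. unfold strip. simpl. pose proof (clamp_in x0 b (Re (ga s)) ltac:(lra)). lra. }
    destruct (ccontat_eps _ _ _ (cdiff_ccontat _ _ _ (Hd _ (Pg t))) eps He) as (del & Hdel & Q).
    exists del; split; auto. intros s Hs. apply Q; [apply Pg|]. eapply Rle_lt_trans; [apply Hga|exact Hs]. }
  assert (HG2 : ccont2 G).
  { split; intro c.
    - apply (HG (fun t => (t, c))). intros s t. simpl. eapply Rle_trans; [|apply (clamp_lip x0 b)].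
      eapply Rle_trans; [apply Cmod_le_abs|]. simpl. replace (c + - c) with 0 by ring. rewrite Rabs_R0, Rplus_0_r. apply Rle_refl.
    - apply (HG (fun t => (c, t))). intros s t. simpl. eapply Rle_trans; [apply Cmod_le_abs|]. simpl.
      replace (clamp x0 b c + - clamp x0 b c) with 0 by ring. rewrite Rabs_R0, Rplus_0_l. apply Rle_refl. }
  (* T^2 - W^2 = 2 W + 1 >= 1: on the horizontal sides the real part of n (w - z0)^2 is at most -
     n. *)
  set (W := b - x0). set (T := W + 1). assert (HW : 0 < W) by (unfold W; lra).
  set (z0 := (x0, y0) : C).
  set (ker := fun (n : nat) (w : C) => cexp (INR n * ((w - z0) * (w - z0)))).
  assert (Hker : forall n, ccont2 (ker n)).
  { intro n. split; intros c t; split; unfold ker, cexp, z0, Re, Im; simpl;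
      apply (ex_derive_continuous (V := R_NormedModule)); auto_derive; auto. }
  destruct (ccont_bounded (fun t => G (t, y0 - T)) x0 b (proj1 HG2 _) ltac:(lra)) as (B1 & HB1 & B1b).
  destruct (ccont_bounded (fun t => G (t, y0 + T)) x0 b (proj1 HG2 _) ltac:(lra)) as (B2 & HB2 & B2b).
  pose (Hn := fun n (w : C) => (G w * ker n w)%C).
  assert (HHn : forall n, ccont2 (Hn n)) by (intro n; apply ccont2_mult; auto).
  assert (Gz : forall n, rint (Hn n) x0 b (y0 - T) (y0 + T) = RtoC 0).
  { intro n. apply goursat; auto; [lra|unfold T; lra|]. intros x y Hx Hy.
    apply cdiff_ext with (f := fun w => (F w * ker n w)%C).
    - simpl; lra.
    - intros w [Hw1 Hw2]. unfold Hn, G. rewrite clamp_id by lra. destruct w; reflexivity.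
    - apply cdiff_mult.
      + apply cdiff_mono with (strip al be). { intros w [Hw _]. unfold strip. lra. }
        apply Hd. unfold strip; simpl; lra.
      + unfold ker. apply cdiff_cexp. apply cdiff_mult; [apply cdiff_const|].
        apply cdiff_mult; apply cdiff_minus; (apply cdiff_id || apply cdiff_const). }
  assert (Right : forall n, CInt (fun t => Hn n (b, t)) (y0 - T) (y0 + T) = RtoC 0).
  { intro n. rewrite (CInt_ext _ (fun _ => RtoC 0)).
    - apply C_ext; simpl; rewrite RInt_const; unfold scal; simpl; unfold mult; simpl; ring.
    - intros t _. unfold Hn, G. simpl. rewrite clamp_id by lra. rewrite Hz; [ring|simpl; lra]. }
  assert (KB : forall n t y, x0 <= t <= b -> (y - y0) ^ 2 = T ^ 2 -> Cmod (ker n (t, y)) <= exp (- INR n)).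
  { intros n t y Ht Hy. unfold ker. rewrite Cmod_cexp. apply exp_le. unfold z0. simpl.
    pose proof (pos_INR n). simpl in Hy. unfold T in Hy.
    assert ((t - x0) ^ 2 <= W ^ 2) by (unfold W; nra).
    replace (INR n * ((t + - x0) * (t + - x0) - (y + - y0) * (y + - y0)) - 0 * ((t + - x0) * (y + - y0) + (y + - y0) * (t + - x0)))
      with (INR n * ((t - x0) ^ 2 - (y - y0) * ((y - y0) * 1))) by ring.
    rewrite Hy. nra. }
  assert (Left : forall n, Cmod (CInt (fun t => Hn n (x0, t)) (y0 - T) (y0 + T)) <= (2 * (W * B1) + 2 * (W * B2)) * exp (- INR n)).
  { intro n. pose proof (Gz n) as E. unfold rint in E. rewrite Right in E.
    assert (E2 : (Ci * CInt (fun t => Hn n (x0, t)) (y0 - T) (y0 + T))%C = (CInt (fun t => Hn n (t, (y0 - T)%R)) x0 b - CInt (fun t => Hn n (t, (y0 + T)%R)) x0 b)%C).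
    { match type of E with (?A + _ - ?B - ?D = _)%C => replace D with (A - B - (A + Ci * 0 - B - D))%C by ring end. rewrite E. ring. }
    assert (E3 : Cmod (Ci * CInt (fun t => Hn n (x0, t)) (y0 - T) (y0 + T)) = Cmod (CInt (fun t => Hn n (x0, t)) (y0 - T) (y0 + T))).
    { rewrite Cmod_mult, Cmod_Ci. ring. }
    rewrite <- E3, E2. unfold Cminus. eapply Rle_trans; [apply Cmod_triangle|]. rewrite Cmod_opp.
    rewrite Rmult_plus_distr_r. apply Rplus_le_compat.
    - eapply Rle_trans; [apply CInt_le_const with (B := B1 * exp (- INR n)); [apply (proj1 (HHn n))|lra|]|].
      + intros t Ht. unfold Hn. rewrite Cmod_mult. apply Rmult_le_compat; try apply Cmod_ge_0; [now apply B1b|apply KB; auto; ring].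
      + unfold W. lra.
    - eapply Rle_trans; [apply CInt_le_const with (B := B2 * exp (- INR n)); [apply (proj1 (HHn n))|lra|]|].
      + intros t Ht. unfold Hn. rewrite Cmod_mult. apply Rmult_le_compat; try apply Cmod_ge_0; [now apply B2b|apply KB; auto; ring].
      + unfold W. lra. }
  set (g := fun t => G (x0, y0 + t)).
  assert (Hg : ccont g).
  { apply (ccont_comp (fun t => G (x0, t)) (fun t => y0 + t)); [apply (proj2 HG2)|].
    intro t. apply (ex_derive_continuous (fun t => y0 + t)). auto_derive; auto. }
  (* On the left side w - z0 = i t, so the kernel is exp(-n t^2). The right side contributes nothing
     and the whole boundary integral is 0, so the left side is as small as the horizontal ones. *)
  assert (g0 : g 0 = RtoC 0).
  { apply (gauss_concentration g T (2 * (W * B1) + 2 * (W * B2))); [auto|unfold T; lra|].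
    intro n. rewrite (CInt_ext _ (fun t => Hn n (x0, t + y0))).
    - rewrite (CInt_shift (fun t => Hn n (x0, t)) y0 (- T) T) by apply (proj2 (HHn n)).
      replace (- T + y0) with (y0 - T) by ring. rewrite (Rplus_comm T y0). apply Left.
    - intros t _. unfold g, Hn. rewrite (Rplus_comm t y0). f_equal. unfold ker. rewrite <- cexp_RtoC. f_equal.
      unfold z0. apply C_ext; simpl; ring. }
  unfold g, G in g0. simpl in g0. rewrite Rplus_0_r, clamp_id in g0 by lra. exact g0.
Qed.

(** * The partial fraction expansion of the cotangent *)

(** Ties the componentwise [Csin] to [cexp]; the addition formulas then become algebra in
    exponentials. *)
Lemma Csin_cexp z : Csin z = ((cexp (Ci * z) - cexp (- (Ci * z))) / (2 * Ci))%C.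
Proof.
  assert (E : (2 * Ci * Csin z)%C = (cexp (Ci * z) - cexp (- (Ci * z)))%C).
  { destruct z as [x y]. unfold Csin, cexp, cosh, sinh, Re, Im. simpl.
    replace (0 * x - 1 * y) with (- y) by ring. replace (0 * y + 1 * x) with x by ring.
    rewrite !Ropp_involutive, cos_neg, sin_neg. apply C_ext; simpl; field. }
  rewrite <- E. field. intro H. apply (f_equal Im) in H. simpl in H. lra.
Qed.

Lemma Ccos_cexp z : Ccos z = ((cexp (Ci * z) + cexp (- (Ci * z))) / 2)%C.
Proof.
  destruct z as [x y]. unfold Ccos, cexp, cosh, sinh, Re, Im. simpl.
  replace (0 * x - 1 * y) with (- y) by ring. replace (0 * y + 1 * x) with x by ring.
  rewrite !Ropp_involutive, cos_neg, sin_neg. apply C_ext; simpl; field.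
Qed.

Lemma Ci2 : (Ci * Ci)%C = (-(1))%C.
Proof. apply C_ext; simpl; ring. Qed.

Lemma Ci_neq_0 : Ci <> RtoC 0.
Proof. intro H. apply (f_equal Im) in H. simpl in H. lra. Qed.

Lemma C2_neq_0 : RtoC 2 <> RtoC 0.
Proof. intro H. apply (f_equal Re) in H. simpl in H. lra. Qed.

Lemma Csin_plus z w : Csin (z + w) = (Csin z * Ccos w + Ccos z * Csin w)%C.
Proof.
  rewrite !Csin_cexp, !Ccos_cexp. replace (Ci * (z + w))%C with (Ci * z + Ci * w)%C by ring.
  rewrite !cexp_opp, !cexp_plus. field. repeat split; (apply Ci_neq_0 || apply C2_neq_0 || apply cexp_neq_0).
Qed.

Lemma Ccos_plus z w : Ccos (z + w) = (Ccos z * Ccos w - Csin z * Csin w)%C.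
Proof.
  rewrite !Csin_cexp, !Ccos_cexp. replace (Ci * (z + w))%C with (Ci * z + Ci * w)%C by ring.
  rewrite !cexp_opp, !cexp_plus.
  replace ((cexp (Ci * z) - / cexp (Ci * z)) / (2 * Ci) * ((cexp (Ci * w) - / cexp (Ci * w)) / (2 * Ci)))%C
    with (((cexp (Ci * z) - / cexp (Ci * z)) * ((cexp (Ci * w) - / cexp (Ci * w)))) / (2 * 2 * (Ci * Ci)))%C.
  - rewrite Ci2. field. repeat split; apply cexp_neq_0.
  - field. repeat split; (apply Ci_neq_0 || apply C2_neq_0 || apply cexp_neq_0).
Qed.

Lemma Csin_opp z : Csin (- z) = (- Csin z)%C.
Proof. destruct z as [x y]. unfold Csin, cosh, sinh; simpl. rewrite sin_neg, cos_neg, Ropp_involutive. apply C_ext; simpl; field. Qed.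

Lemma Ccos_opp z : Ccos (- z) = Ccos z.
Proof. destruct z as [x y]. unfold Ccos, cosh, sinh; simpl. rewrite sin_neg, cos_neg, Ropp_involutive. apply C_ext; simpl; field. Qed.

Lemma Csin_RtoC (r : R) : Csin r = RtoC (sin r).
Proof. unfold Csin, cosh, sinh; simpl. rewrite Ropp_0, exp_0. apply C_ext; simpl; field. Qed.

Lemma Ccos_RtoC (r : R) : Ccos r = RtoC (cos r).
Proof. unfold Ccos, cosh, sinh; simpl. rewrite Ropp_0, exp_0. apply C_ext; simpl; field. Qed.

Lemma Csin_PI2 z : Csin (z + (PI / 2)%R) = Ccos z.
Proof. rewrite Csin_plus, Csin_RtoC, Ccos_RtoC, sin_PI2, cos_PI2. ring. Qed.

Lemma Ccos_PI2 z : Ccos (z + (PI / 2)%R) = (- Csin z)%C.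
Proof. rewrite Ccos_plus, Csin_RtoC, Ccos_RtoC, sin_PI2, cos_PI2. ring. Qed.

Lemma Csin_dup z : Csin (2 * z) = (2 * Csin z * Ccos z)%C.
Proof. replace (2 * z)%C with (z + z)%C by ring. rewrite Csin_plus. ring. Qed.

Lemma Csin2_Ccos2 z : (Csin z * Csin z + Ccos z * Ccos z)%C = RtoC 1.
Proof.
  assert (H : Ccos (z + - z) = RtoC 1). { replace (z + - z)%C with (RtoC 0) by ring. now rewrite Ccos_RtoC, cos_0. }
  rewrite Ccos_plus, Ccos_opp, Csin_opp in H. rewrite <- H. ring.
Qed.

Lemma Cmod_Csin z : Cmod (Csin z) ^ 2 = sin (Re z) ^ 2 + sinh (Im z) ^ 2.
Proof.
  rewrite Cmod2_alt. unfold Csin. simpl.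
  pose proof (sin2_cos2 (Re z)) as E. unfold Rsqr in E.
  assert (E2 : cosh (Im z) * cosh (Im z) = 1 + sinh (Im z) * sinh (Im z)).
  { unfold cosh, sinh. rewrite exp_Ropp. field. apply Rgt_not_eq, exp_pos. }
  assert (E3 : cos (Re z) * cos (Re z) = 1 - sin (Re z) * sin (Re z)) by lra.
  replace (sin (Re z) * cosh (Im z) * (sin (Re z) * cosh (Im z) * 1)) with (sin (Re z) * sin (Re z) * (cosh (Im z) * cosh (Im z))) by ring.
  replace (cos (Re z) * sinh (Im z) * (cos (Re z) * sinh (Im z) * 1)) with (cos (Re z) * cos (Re z) * (sinh (Im z) * sinh (Im z))) by ring.
  rewrite E2, E3. ring.
Qed.

Lemma sinh_sqr_ge y : y ^ 2 <= sinh y ^ 2.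
Proof.
  assert (P : forall y, 0 <= y -> y <= sinh y).
  { clear y. intros y Hy. unfold sinh.
    destruct (Req_dec y 0) as [->|N]; [rewrite Ropp_0, exp_0; lra|].
    destruct (MVT_cor2 (fun t => (exp t - exp (- t)) / 2 - t) (fun t => (exp t + exp (- t)) / 2 - 1) 0 y) as (d & Hd & _).
      + lra.
      + intros d _. apply is_derive_Reals. auto_derive; auto. field.
      + assert (1 <= (exp d + exp (- d)) / 2).
        { rewrite exp_Ropp. pose proof (exp_pos d). apply Rmult_le_reg_r with (2 * exp d); [lra|].
          replace ((exp d + / exp d) / 2 * (2 * exp d)) with (exp d * exp d + 1) by (field; lra). pose proof (pow2_ge_0 (exp d - 1)). simpl in *. lra. }
        rewrite Ropp_0, exp_0 in Hd. nra. }
  destruct (Rle_dec 0 y) as [H|H].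
  - specialize (P y H). nra.
  - specialize (P (- y) ltac:(lra)). assert (sinh (- y) = - sinh y) by (unfold sinh; rewrite Ropp_involutive; field). nra.
Qed.

(** The constant of sin x >= [sin_lb] x on [0, 3 pi/4]: there both sin(x/2)/(x/2) and cos(x/2) are
    at least cos(3 pi/8). The range is dictated by the arguments pi (z + k)/q with |k| <= q/2, |Re
    z| < 1 and q >= 4. *)
Definition sin_lb : R := cos (3 * PI / 8) ^ 2.

Lemma sin_lb_pos : 0 < sin_lb <= 1.
Proof.
  assert (0 < cos (3 * PI / 8)). { apply cos_gt_0; pose proof PI_RGT_0; lra. }
  pose proof (COS_bound (3 * PI / 8)). unfold sin_lb. nra.
Qed.

Lemma sin_ge_lin x : 0 <= x <= 3 * PI / 4 -> sin_lb * x <= sin x.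
Proof.
  intros Hx. pose proof PI_RGT_0.
  assert (Hc : 0 < cos (3 * PI / 8)) by (apply cos_gt_0; lra).
  destruct (Req_dec x 0) as [->|N]; [rewrite sin_0; lra|].
  replace x with (2 * (x / 2)) at 2 by field. rewrite sin_2a.
  destruct (MVT_cor2 sin cos 0 (x / 2)) as (c & E & Hcc); [lra|intros; apply derivable_pt_lim_sin|].
  rewrite sin_0 in E.
  assert (C1 : cos (3 * PI / 8) <= cos c) by (apply cos_decr_1; lra).
  assert (C2 : cos (3 * PI / 8) <= cos (x / 2)) by (apply cos_decr_1; lra).
  assert (S1 : x / 2 * cos (3 * PI / 8) <= sin (x / 2)) by nra.
  unfold sin_lb. assert (0 < x / 2 * cos (3 * PI / 8)) by (apply Rmult_lt_0_compat; lra).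
  assert (x / 2 * cos (3 * PI / 8) * cos (3 * PI / 8) <= sin (x / 2) * cos (x / 2)) by (apply Rmult_le_compat; lra).
  simpl. lra.
Qed.

(** |sin z|^2 = sin(Re z)^2 + sinh(Im z)^2; the first part is bounded below linearly in the given
    range, the second by (Im z)^2. *)
Lemma Csin_ge z : Rabs (Re z) <= 3 * PI / 4 -> sin_lb * Cmod z <= Cmod (Csin z).
Proof.
  intros H. pose proof sin_lb_pos as [L1 L2].
  assert (H1 : sin_lb * Rabs (Re z) <= Rabs (sin (Re z))).
  { destruct (Rle_dec 0 (Re z)) as [P|P].
    - rewrite Rabs_pos_eq in * by auto. eapply Rle_trans; [apply sin_ge_lin; lra|apply Rle_abs].
    - rewrite Rabs_left in * by lra. rewrite <- Rabs_Ropp, <- sin_neg. eapply Rle_trans; [apply sin_ge_lin; lra|apply Rle_abs]. }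
  assert (H2 : (sin_lb * Cmod z) ^ 2 <= Cmod (Csin z) ^ 2).
  { rewrite Cmod_Csin, Rpow_mult_distr, Cmod2_alt. pose proof (sinh_sqr_ge (Im z)).
    rewrite <- (pow2_abs (Re z)), <- (pow2_abs (sin (Re z))). pose proof (Rabs_pos (Re z)).
    assert (H3 : (sin_lb * Rabs (Re z)) ^ 2 <= Rabs (sin (Re z)) ^ 2) by (apply pow_incr; split; [nra|auto]).
    assert (sin_lb ^ 2 <= 1) by nra. pose proof (pow2_ge_0 (Im z)). rewrite Rpow_mult_distr in H3. nra. }
  pose proof (Cmod_ge_0 (Csin z)). pose proof (Cmod_ge_0 z). apply Rnot_lt_le. intro. nra.
Qed.

Lemma Csin_le z : Cmod (Csin z) <= 2 * (Cmod z * exp (Cmod z)).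
Proof.
  rewrite Csin_cexp. rewrite Cmod_div.
  2: apply Cmult_neq_0; [apply C2_neq_0|apply Ci_neq_0].
  rewrite Cmod_mult, Cmod_Ci, Cmod_R, (Rabs_pos_eq 2), Rmult_1_r by lra.
  pose proof (cexp_m1_le (Ci * z)) as H1. pose proof (cexp_m1_le (- (Ci * z))) as H2.
  rewrite Cmod_opp in H2. rewrite Cmod_mult, Cmod_Ci, Rmult_1_l in H1, H2.
  pose proof (Cmod_triangle (cexp (Ci * z) - 1) (- (cexp (- (Ci * z)) - 1))) as T.
  rewrite Cmod_opp in T. replace (cexp (Ci * z) - 1 + - (cexp (- (Ci * z)) - 1))%C with (cexp (Ci * z) - cexp (- (Ci * z)))%C in T by ring.
  lra.
Qed.

Definition ccot (z : C) : C := (Ccos z / Csin z)%C.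

Lemma ccot_dup w : Csin (2 * w) <> RtoC 0 -> (ccot w + ccot (w + (PI / 2)%R))%C = (2 * ccot (2 * w))%C.
Proof.
  intros H. rewrite Csin_dup in H.
  assert (H1 : Csin w <> RtoC 0). { intro E. apply H. rewrite E. ring. }
  assert (H2 : Ccos w <> RtoC 0). { intro E. apply H. rewrite E. ring. }
  unfold ccot. rewrite Csin_PI2, Ccos_PI2, Csin_dup. replace (2 * w)%C with (w + w)%C by ring. rewrite Ccos_plus.
  field. repeat split; auto.
Qed.

Lemma ccot_PI w : ccot (w + PI) = ccot w.
Proof.
  unfold ccot. rewrite Csin_plus, Ccos_plus, Csin_RtoC, Ccos_RtoC, sin_PI, cos_PI.
  (* At a zero of the sine both sides are 0, because / 0 = 0. *)
  destruct (Ceq_dec (Csin w) 0) as [E|E].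
  - rewrite E. replace (Ccos w * (-1)%R - 0 * 0)%C with (- Ccos w)%C by (apply C_ext; simpl; ring).
    replace (0 * (-1)%R + Ccos w * 0)%C with (RtoC 0) by ring. unfold Cdiv.
    replace (/ 0)%C with (RtoC 0); [ring|]. unfold Cinv. apply C_ext; simpl; unfold Rdiv; ring.
  - replace (RtoC (-1)) with (-(1))%C by (apply C_ext; simpl; ring).
    replace (Ccos w * - (1) - Csin w * 0)%C with (- Ccos w)%C by ring.
    replace (Csin w * - (1) + Ccos w * 0)%C with (- Csin w)%C by ring. field; auto.
Qed.

(** From sin(2w) = 2 sin w sin(w + pi/2): at the next level the arguments with k < 2^n are the w,
    the others the w + pi/2, and neither factor can vanish. *)
Lemma Csin_level_neq z n : Csin (PI * z) <> RtoC 0 -> forall k, (k < 2 ^ n)%nat ->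
  Csin ((PI / 2 ^ n)%R * (z + INR k)) <> RtoC 0.
Proof.
  intros H. induction n; intros k Hk.
  - simpl in Hk. replace k with O by lia. simpl. rewrite Rdiv_1_r. now replace (z + 0)%C with z by ring.
  - assert (P2 : 2 ^ n <> 0) by (apply pow_nonzero; lra).
    assert (Half : forall k, ((PI / 2 ^ n)%R * (z + INR k))%C = (2 * ((PI / 2 ^ S n)%R * (z + INR k)))%C).
    { intro j. replace (PI / 2 ^ n)%R with (2 * (PI / 2 ^ S n))%R by (simpl; field; auto). rewrite RtoC_mult. ring. }
    destruct (Nat.lt_ge_cases k (2 ^ n)) as [L|L].
    + specialize (IHn k L). rewrite Half, Csin_dup in IHn. intro E. apply IHn. rewrite E. ring.
    + specialize (IHn (k - 2 ^ n)%nat ltac:(simpl in Hk; lia)). rewrite Half, Csin_dup in IHn.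
      intro E. apply IHn. rewrite <- Csin_PI2.
      replace ((PI / 2 ^ S n)%R * (z + INR (k - 2 ^ n)) + (PI / 2)%R)%C with ((PI / 2 ^ S n)%R * (z + INR k))%C; [rewrite E; ring|].
      rewrite minus_INR, pow_INR by lia. replace (INR 2) with 2 by (simpl; ring). rewrite RtoC_minus.
      replace (RtoC (PI / 2)) with ((PI / 2 ^ S n)%R * (2 ^ n)%R)%C; [ring|]. rewrite <- RtoC_mult. f_equal. simpl; field; auto.
Qed.

(* Euler: iterating the duplication formula writes cot(pi z) as a mean of 2^n cotangents. *)
Lemma ccot_level z n : Csin (PI * z) <> RtoC 0 ->
  csum (fun k => ccot ((PI / 2 ^ n)%R * (z + INR k))) (2 ^ n) = ((2 ^ n)%R * ccot (PI * z))%C.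
Proof.
  intros H. induction n.
  - simpl. rewrite Rdiv_1_r. replace (z + 0)%C with z by ring. ring.
  - assert (P2 : 2 ^ n <> 0) by (apply pow_nonzero; lra).
    replace (2 ^ S n)%nat with (2 ^ n + 2 ^ n)%nat by (simpl; lia).
    rewrite csum_split, <- csum_plus.
    rewrite (csum_ext _ (fun k => (2 * ccot ((PI / 2 ^ n)%R * (z + INR k)))%C)).
    + rewrite csum_scal, IHn. simpl pow. rewrite RtoC_mult. ring.
    + intros k Hk.
      replace ((PI / 2 ^ S n)%R * (z + INR (2 ^ n + k)))%C with ((PI / 2 ^ S n)%R * (z + INR k) + (PI / 2)%R)%C.
      * replace ((PI / 2 ^ n)%R * (z + INR k))%C with (2 * ((PI / 2 ^ S n)%R * (z + INR k)))%C.
        -- apply ccot_dup.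
           replace (2 * ((PI / 2 ^ S n)%R * (z + INR k)))%C with ((PI / 2 ^ n)%R * (z + INR k))%C.
           ++ apply Csin_level_neq; auto.
           ++ replace (PI / 2 ^ n)%R with (2 * (PI / 2 ^ S n))%R by (simpl; field; auto). rewrite RtoC_mult. ring.
        -- replace (PI / 2 ^ n)%R with (2 * (PI / 2 ^ S n))%R by (simpl; field; auto). rewrite RtoC_mult. ring.
      * rewrite plus_INR, pow_INR. replace (INR 2) with 2 by (simpl; ring). rewrite RtoC_plus.
        replace (RtoC (PI / 2)) with ((PI / 2 ^ S n)%R * (2 ^ n)%R)%C; [ring|]. rewrite <- RtoC_mult. f_equal. simpl; field; auto.
Qed.

Lemma ccvg_scaled (e : nat -> R) w : is_lim_seq e 0 -> ccvg (fun n => (e n * w)%C) 0.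
Proof.
  intro H. replace (RtoC 0) with (RtoC 0 * w)%C by ring. apply ccvg_mult; [|apply ccvg_const].
  apply ccvg_RI; simpl; [exact H|apply is_lim_seq_const].
Qed.

Lemma Csin_cexp1 v : Csin v = (v * ((cexp1 (Ci * v) + cexp1 (- (Ci * v))) / 2))%C.
Proof.
  rewrite Csin_cexp, (cexp1_spec (Ci * v)), (cexp1_spec (- (Ci * v))). field.
  apply Ci_neq_0.
Qed.

Lemma ccvg_Ccos0 u : ccvg u 0 -> ccvg (fun n => Ccos (u n)) 1.
Proof.
  intro H.
  assert (H1 : ccvg (fun n => (Ci * u n)%C) 0). { replace (RtoC 0) with (Ci * 0)%C by ring. now apply ccvg_scal. }
  assert (H2 : ccvg (fun n => (- (Ci * u n))%C) 0). { replace (RtoC 0) with (- 0)%C by ring. now apply ccvg_opp. }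
  assert (G : ccvg (fun n => ((1 + (Ci * u n) * cexp1 (Ci * u n)) + (1 + (- (Ci * u n)) * cexp1 (- (Ci * u n)))) * / 2)%C
     ((1 + 0 * 1 + (1 + 0 * 1)) * / 2)%C).
  { apply ccvg_mult; [|apply ccvg_const].
    repeat (apply ccvg_plus || apply ccvg_mult || apply ccvg_const); auto; now apply cexp1_cont. }
  replace (RtoC 1) with ((1 + 0 * 1 + (1 + 0 * 1)) * / 2)%C by field.
  eapply ccvg_ext; [|exact G]. intro n. cbv beta. rewrite Ccos_cexp, <- !cexp1_spec. reflexivity.
Qed.

(** cot v = cos v / (v X) with X = (cexp1(i v) + cexp1(-i v))/2, and X tends to 1 as v tends to
    0. *)
Lemma ccot_small (e : nat -> R) w : w <> RtoC 0 -> (forall n, e n <> 0) -> is_lim_seq e 0 ->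
  ccvg (fun n => (e n * ccot (e n * w))%C) (/ w)%C.
Proof.
  intros Hw He H. pose proof (ccvg_scaled e w H) as H0.
  assert (H1 : ccvg (fun n => (Ci * (e n * w))%C) 0). { replace (RtoC 0) with (Ci * 0)%C by ring. now apply ccvg_scal. }
  assert (H2 : ccvg (fun n => (- (Ci * (e n * w)))%C) 0). { replace (RtoC 0) with (- 0)%C by ring. now apply ccvg_opp. }
  assert (G : ccvg (fun n => (Ccos (e n * w) * / (w * ((cexp1 (Ci * (e n * w)) + cexp1 (- (Ci * (e n * w)))) * / 2)))%C)
     (1 * / (w * ((1 + 1) * / 2)))%C).
  { apply ccvg_mult; [now apply ccvg_Ccos0|]. apply ccvg_inv.
    - replace (w * ((1 + 1) * / 2))%C with w by field. auto.
    - apply ccvg_mult; [apply ccvg_const|]. apply ccvg_mult; [|apply ccvg_const]. apply ccvg_plus; now apply cexp1_cont. }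
  replace (1 * / (w * ((1 + 1) * / 2)))%C with (/ w)%C in G.
  2: replace (w * ((1 + 1) * / 2))%C with w by field; ring.
  eapply ccvg_ext; [|exact G]. intro n. cbv beta. unfold ccot. rewrite Csin_cexp1. unfold Cdiv.
  assert (Hen : RtoC (e n) <> RtoC 0). { intro E. apply (f_equal Re) in E. apply (He n). exact E. }
  set (X := ((cexp1 (Ci * (e n * w)) + cexp1 (- (Ci * (e n * w)))) * / 2)%C).
  (* X is only known to be nonzero for large n; where it vanishes both sides are 0 by the convention
     / 0 = 0. *)
  destruct (Ceq_dec X 0) as [E|E].
  - rewrite E. replace (w * 0)%C with (RtoC 0) by ring. replace (e n * w * 0)%C with (RtoC 0) by ring.
    replace (/ 0)%C with (RtoC 0); [ring|]. unfold Cinv. apply C_ext; simpl; unfold Rdiv; ring.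
  - field; auto.
Qed.

Lemma is_lim_seq_pow2_inv c : is_lim_seq (fun n => c / 2 ^ n) 0.
Proof.
  replace (Finite 0) with (Rbar_mult c 0) by (simpl; f_equal; ring).
  apply is_lim_seq_ext with (fun n => c * (/ 2) ^ n); [intro n; rewrite pow_inv; reflexivity|].
  apply is_lim_seq_scal_l. apply is_lim_seq_geom. rewrite Rabs_pos_eq; lra.
Qed.

Lemma RtoC_neq_0 r : r <> 0 -> RtoC r <> RtoC 0.
Proof. intros H E. apply H. apply (f_equal Re) in E. exact E. Qed.

(** cot A + cot B = sin(A + B)/(sin A sin B), where A + B = 2 pi z/q does not depend on k while both
    sines in the denominator are at least of order k/q. The pair is thus O(1/k^2) uniformly in n; a
    single cotangent would only give O(1/k). *)
Lemma ccot_pair_le (z : C) (k n : nat) : Rabs (Re z) < 1 -> (k < 2 ^ S n)%nat -> z <> RtoC 0 ->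
  Cmod ((PI / 2 ^ S (S n))%R * (ccot ((PI / 2 ^ S (S n))%R * (z + INR (S k))) + ccot ((PI / 2 ^ S (S n))%R * (z - INR (S k)))))
   <= (4 * Cmod z * exp (2 * PI * Cmod z) / sin_lb ^ 2 / (1 - Rabs (Re z)) ^ 2) * / (INR (S k) ^ 2).
Proof.
  intros Hz Hk Hz0. set (q := 2 ^ S (S n)). assert (Hq : 4 <= q).
  { unfold q. rewrite <- !tech_pow_Rmult. pose proof (pow_R1_Rle 2 n ltac:(lra)). lra. }
  pose proof PI_RGT_0 as HPI. pose proof sin_lb_pos as [L1 L2].
  assert (Hk1 : 1 <= INR (S k)) by (rewrite S_INR; pose proof (pos_INR k); lra).
  assert (Hk2 : INR (S k) <= q / 2).
  { apply le_INR in Hk. rewrite pow_INR in Hk. replace (INR 2) with 2 in Hk by (simpl; ring).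
    unfold q. rewrite <- (tech_pow_Rmult 2 (S n)). lra. }
  set (K := INR (S k)) in *. set (rho := Rabs (Re z)) in *.
  assert (Hrho : 0 <= rho < 1) by (split; [apply Rabs_pos|auto]).
  assert (Hre : forall s, Rabs s = K -> Rabs (Re ((PI / q)%R * (z + s))) <= 3 * PI / 4 /\ (1 - rho) * K <= Cmod (z + s)).
  { intros s Hs. split.
    - replace (Re ((PI / q)%R * (z + s))) with (PI / q * (Re z + s)) by (simpl; unfold Re; ring).
      rewrite Rabs_mult, (Rabs_pos_eq (PI / q)) by (apply Rdiv_le_0_compat; lra).
      assert (Rabs (Re z + s) <= 3 * q / 4). { eapply Rle_trans; [apply Rabs_triang|]. fold rho. lra. }
      apply Rle_trans with (PI / q * (3 * q / 4)).
      + apply Rmult_le_compat_l; [apply Rdiv_le_0_compat; lra|auto].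
      + right. field. lra.
    - eapply Rle_trans; [|apply re_le_Cmod]. simpl. fold (Re z).
      assert (K <= rho + Rabs (Re z + s)).
      { rewrite <- Hs. replace s with (- Re z + (Re z + s)) at 1 by ring. eapply Rle_trans; [apply Rabs_triang|].
        rewrite Rabs_Ropp. fold rho. lra. }
      nra. }
  destruct (Hre K) as [R1 R2]. { apply Rabs_pos_eq; lra. }
  destruct (Hre (- K)) as [R3 R4]. { rewrite Rabs_Ropp. apply Rabs_pos_eq; lra. }
  assert (EK : (z + (- K)%R)%C = (z - K)%C) by (rewrite RtoC_opp; ring). rewrite EK in R3, R4.
  set (A := ((PI / q)%R * (z + K))%C) in *. set (B := ((PI / q)%R * (z - K))%C) in *.
  pose proof (Csin_ge A R1) as SA. pose proof (Csin_ge B R3) as SB.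
  assert (Mq : forall w, Cmod ((PI / q)%R * w) = PI / q * Cmod w).
  { intro w. rewrite Cmod_mult, Cmod_RtoC_pos; auto. apply Rdiv_le_0_compat; lra. }
  unfold A in SA at 1. unfold B in SB at 1. rewrite Mq in SA, SB.
  assert (Hpq : 0 < PI / q) by (apply Rdiv_lt_0_compat; lra).
  assert (Hpos : 0 < sin_lb * (PI / q * ((1 - rho) * K))).
  { apply Rmult_lt_0_compat; [auto|]. apply Rmult_lt_0_compat; [auto|]. apply Rmult_lt_0_compat; lra. }
  assert (SA' : sin_lb * (PI / q * ((1 - rho) * K)) <= Cmod (Csin A)).
  { eapply Rle_trans; [|exact SA]. apply Rmult_le_compat_l; [lra|]. apply Rmult_le_compat_l; lra. }
  assert (SB' : sin_lb * (PI / q * ((1 - rho) * K)) <= Cmod (Csin B)).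
  { eapply Rle_trans; [|exact SB]. apply Rmult_le_compat_l; [lra|]. apply Rmult_le_compat_l; lra. }
  assert (NA : Csin A <> RtoC 0) by (apply Cmod_gt_0; lra).
  assert (NB : Csin B <> RtoC 0) by (apply Cmod_gt_0; lra).
  assert (E : (ccot A + ccot B)%C = (Csin ((2 * PI / q)%R * z) / (Csin A * Csin B))%C).
  { replace ((2 * PI / q)%R * z)%C with (A + B)%C.
    - rewrite Csin_plus. unfold ccot. field; auto.
    - unfold A, B. replace (2 * PI / q) with (2 * (PI / q)) by (field; lra). rewrite RtoC_mult. ring. }
  rewrite E, Cmod_mult, Cmod_RtoC_pos, Cmod_div by (lra || (apply Cmult_neq_0; auto)). rewrite Cmod_mult.
  assert (Up : Cmod (Csin ((2 * PI / q)%R * z)) <= 2 * (2 * (PI / q) * Cmod z * exp (2 * PI * Cmod z))).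
  { eapply Rle_trans; [apply Csin_le|]. rewrite Cmod_mult, Cmod_RtoC_pos.
    2: apply Rdiv_le_0_compat; lra.
    replace (2 * PI / q) with (2 * (PI / q)) by (field; lra). apply Rmult_le_compat_l; [lra|].
    pose proof (Cmod_ge_0 z). apply Rmult_le_compat_l; [nra|]. apply exp_le. apply Rmult_le_compat_r; [auto|].
    assert (PI / q <= PI). { apply Rmult_le_reg_r with q; [lra|]. unfold Rdiv. rewrite Rmult_assoc, Rinv_l; nra. } lra. }
  set (D := sin_lb * (PI / q * ((1 - rho) * K))) in *.
  assert (Dn : D * D <= Cmod (Csin A) * Cmod (Csin B)) by (apply Rmult_le_compat; lra).
  assert (DD : 0 < D * D) by (apply Rmult_lt_0_compat; auto).
  apply Rle_trans with (PI / q * (2 * (2 * (PI / q) * Cmod z * exp (2 * PI * Cmod z)) / (D * D))).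
  - apply Rmult_le_compat_l; [lra|]. unfold Rdiv. apply Rmult_le_compat; auto; [apply Cmod_ge_0| |].
    + apply Rlt_le, Rinv_0_lt_compat; lra.
    + apply Rinv_le_contravar; auto.
  - right. unfold D. field. repeat split; lra.
Qed.

Theorem ccot_series z : Rabs (Re z) < 1 -> z <> RtoC 0 -> Csin (PI * z) <> RtoC 0 ->
  cser (fun k => (/ (z + INR (S k)) + / (z - INR (S k)))%C) (PI * ccot (PI * z) - / z)%C.
Proof.
  intros Hz Hz0 Hs. pose proof PI_RGT_0 as HPI.
  assert (Hpn : forall n, 0 < 2 ^ n) by (intro; apply pow_lt; lra).
  (* The exponent starts at 2 so that q = 2^(n+2) >= 4, as the range of [sin_lb] requires. *)
  set (e := fun n : nat => PI / 2 ^ S (S n)).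
  assert (He : forall n, e n <> 0). { intro n. unfold e. apply Rgt_not_eq. apply Rdiv_lt_0_compat; auto. }
  assert (Hlim : is_lim_seq e 0). { eapply is_lim_seq_ext; [|apply (proj1 (is_lim_seq_incr_n (fun n => PI / 2 ^ n) 2 0) (is_lim_seq_pow2_inv PI))].
    intro n. unfold e. now replace (n + 2)%nat with (S (S n)) by lia. }
  set (pr := fun n k => (e n * (ccot (e n * (z + INR (S k))) + ccot (e n * (z - INR (S k)))))%C).
  set (a := fun n k => if Nat.ltb k (2 ^ S n) then pr n k else RtoC 0).
  destruct rser_inv_sqr as [sg Hsg].
  set (C0 := 4 * Cmod z * exp (2 * PI * Cmod z) / sin_lb ^ 2 / (1 - Rabs (Re z)) ^ 2).
  assert (Hnk : forall k s, Rabs s = INR (S k) -> (z + RtoC s)%C <> RtoC 0).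
  { intros k s Hs1 E. apply (f_equal Re) in E. simpl in E. fold (Re z) in E.
    rewrite S_INR in Hs1. pose proof (pos_INR k). replace (Re z) with (- s) in Hz by lra. rewrite Rabs_Ropp in Hz. lra. }
  destruct (tannery a (fun n => csum (a n) (2 ^ S n)) (fun k => (/ (z + INR (S k)) + / (z - INR (S k)))%C)
     (fun k => C0 * / (INR (S k) ^ 2)) (C0 * sg)) as (B & HB & HAB).
  - intros n k. unfold a. destruct (Nat.ltb_spec k (2 ^ S n)).
    + unfold pr, e, C0. now apply ccot_pair_le.
    + rewrite Cmod_0. apply Rmult_le_pos.
      * unfold C0. pose proof sin_lb_pos. repeat (apply Rdiv_le_0_compat || apply Rmult_le_pos); try lra; try apply Cmod_ge_0.
        apply Rlt_le, exp_pos. apply pow_lt; lra. apply pow_lt; lra.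
      * apply Rlt_le, Rinv_0_lt_compat, pow_lt. rewrite S_INR. pose proof (pos_INR k); lra.
  - now apply rser_scal.
  - intro k. apply ccvg_ext_ev with (u := fun n => pr n k) (N0 := k).
    + intros n Hn. unfold a. destruct (Nat.ltb_spec k (2 ^ S n)) as [L|L]; auto.
      pose proof (Nat.pow_gt_lin_r 2 (S n)). lia.
    + eapply ccvg_ext; [|apply ccvg_plus; [apply (ccot_small e (z + INR (S k)))|apply (ccot_small e (z - INR (S k)))]]; auto.
      * intro n. unfold pr. cbv beta. ring.
      * apply (Hnk k). apply Rabs_pos_eq, pos_INR.
      * unfold Cminus. rewrite <- RtoC_opp. apply (Hnk k). rewrite Rabs_Ropp. apply Rabs_pos_eq, pos_INR.
  - intro n. apply cser_finite. intros k Hk. unfold a. destruct (Nat.ltb_spec k (2 ^ S n)); [lia|auto].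
  (* Half of the 2^(n+2) arguments are moved to z - k by periodicity. The one halfway, k = 2^(n+1),
     is reached from both sides and occurs twice in the pairs, whence the last term; it tends to
     0. *)
  - assert (E : forall n, csum (a n) (2 ^ S n) = (PI * ccot (PI * z) - e n * ccot (e n * z) + e n * ccot (e n * z + (PI / 2)%R))%C).
    { intro n. rewrite (csum_ext (a n) (pr n)).
      2: intros k Hk; unfold a; destruct (Nat.ltb_spec k (2 ^ S n)); [auto|lia].
      unfold pr. rewrite csum_scal, csum_plus.
      pose proof (ccot_level z (S (S n)) Hs) as E. fold (e n) in E.
      set (h := (2 ^ S n)%nat) in *. assert (Hh2 : INR h = 2 ^ S n) by (unfold h; rewrite pow_INR; f_equal; simpl; ring).
      replace (2 ^ S (S n))%nat with (h + h)%nat in E by (unfold h; simpl; lia).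
      rewrite csum_split in E.
      assert (Epi : forall j, (j < h)%nat -> ccot (e n * (z + INR (h + (h - 1 - j)))) = ccot (e n * (z - INR (S j)))).
      { intros j Hj. rewrite <- (ccot_PI (e n * (z - INR (S j)))). f_equal.
        replace (INR (h + (h - 1 - j))) with (2 ^ S (S n) - INR (S j)).
        - rewrite RtoC_minus. replace (RtoC PI) with (e n * (2 ^ S (S n))%R)%C; [ring|].
          rewrite <- RtoC_mult. f_equal. unfold e. field. apply Rgt_not_eq, Hpn.
        - replace (2 ^ S (S n)) with (INR h + INR h) by (rewrite Hh2; simpl; ring).
          rewrite plus_INR, !minus_INR, S_INR by lia. simpl. ring. }
      rewrite (csum_rev (fun k => ccot (e n * (z + INR (h + k))))) in E.
      rewrite (csum_ext (fun k => ccot (e n * (z + INR (h + (h - 1 - k))))) _ h Epi) in E.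
      assert (E0 : (csum (fun k => ccot (e n * (z + INR k))) h + ccot (e n * (z + INR h)))%C
        = (ccot (e n * (z + INR 0)) + csum (fun k => ccot (e n * (z + INR (S k)))) h)%C).
      { rewrite <- (csum_first (fun k => ccot (e n * (z + INR k)))). reflexivity. }
      replace (csum (fun k => ccot (e n * (z + INR (S k)))) h) with
        (csum (fun k => ccot (e n * (z + INR k))) h + ccot (e n * (z + INR h)) - ccot (e n * (z + INR 0)))%C by (rewrite E0; ring).
      replace (z + INR 0)%C with z by (simpl; ring).
      replace (e n * (z + INR h))%C with (e n * z + (PI / 2)%R)%C.
      - replace (RtoC PI * ccot (PI * z))%C with (e n * ((2 ^ S (S n))%R * ccot (PI * z)))%C.
        + rewrite <- E. ring.
        + rewrite Cmult_assoc, <- RtoC_mult. do 2 f_equal. unfold e. field. apply Rgt_not_eq, Hpn.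
      - rewrite Hh2. replace (RtoC (PI / 2)) with (e n * (2 ^ S n)%R)%C; [ring|]. rewrite <- RtoC_mult. f_equal.
        unfold e. simpl. field. apply Rgt_not_eq, Hpn. }
    assert (HB2 : ccvg (fun n => csum (a n) (2 ^ S n)) (PI * ccot (PI * z) - / z + 0)%C).
    { eapply ccvg_ext; [intro n; symmetry; apply E|]. apply ccvg_plus; [apply ccvg_minus; [apply ccvg_const|now apply ccot_small]|].
      replace (RtoC 0) with (0 * (- 0 * / 1))%C by ring. apply ccvg_mult.
      - apply ccvg_RI; simpl; [exact Hlim|apply is_lim_seq_const].
      - eapply ccvg_ext with (fun n => (- Csin (e n * z) * / Ccos (e n * z))%C).
        + intro n. unfold ccot. rewrite Csin_PI2, Ccos_PI2. reflexivity.
        + apply ccvg_mult; [|apply ccvg_inv; [apply RtoC_neq_0; lra|apply ccvg_Ccos0; now apply ccvg_scaled]].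
          apply ccvg_opp. apply ccvg_ext with (fun n => ((e n * z) * ((cexp1 (Ci * (e n * z)) + cexp1 (- (Ci * (e n * z)))) * / 2))%C).
          { intro n. now rewrite (Csin_cexp1 (e n * z)). }
          pose proof (ccvg_scaled e z Hlim) as H0.
          replace (RtoC 0) with (0 * ((1 + 1) * / 2))%C by ring.
          apply ccvg_mult; auto. apply ccvg_mult; [|apply ccvg_const]. apply ccvg_plus; apply cexp1_cont.
          * replace (RtoC 0) with (Ci * 0)%C by ring. now apply ccvg_scal.
          * replace (RtoC 0) with (- (Ci * 0))%C by ring. apply ccvg_opp. now apply ccvg_scal. }
    replace (PI * ccot (PI * z) - / z)%C with (PI * ccot (PI * z) - / z + 0)%C by ring.
    rewrite <- (ccvg_unique _ _ _ HAB HB2). exact HB.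
Qed.

(* Sf th u = sum_(d >= 1) sin(2 pi d th) exp(-2 pi d u) = (1/2) sin(2 pi th) / (cosh(2 pi u) - cos(2 pi th)). *)
Definition Sf (th u : R) : R := / 2 * (sin (PI * th) * cos (PI * th)) / (sin (PI * th) ^ 2 + sinh (PI * u) ^ 2).

Lemma Re_Cinv (x y : R) : Re (/ (x, y))%C = x / (x ^ 2 + y ^ 2).
Proof. reflexivity. Qed.

Lemma Im_Cinv (x y : R) : Im (/ (x, y))%C = - y / (x ^ 2 + y ^ 2).
Proof. reflexivity. Qed.

Lemma sin_PI_pos th : 0 < th < 1 -> 0 < sin (PI * th).
Proof. intro H. pose proof PI_RGT_0. apply sin_gt_0; nra. Qed.

Lemma RtoC_mult_pair (r x y : R) : (RtoC r * (x, y))%C = (r * x, r * y).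
Proof. apply C_ext; simpl; ring. Qed.

Lemma rser_ext a b l : (forall n, a n = b n) -> rser a l -> rser b l.
Proof.
  intros E. apply is_lim_seq_ext. intro n. induction n; simpl; [easy|]. now rewrite IHn, E.
Qed.

(** The real part of the cotangent series at th + i u, regrouped: [ccot_series] pairs z + m + 1 with
    z - m - 1, here m + th goes with m + 1 - th. The shift costs the boundary term A n, which tends
    to 0. At u = 0 the sum is pi cot(pi th). *)
Lemma Sf_series th u : 0 < th < 1 ->
  rser (fun m => (INR m + th) / ((INR m + th) ^ 2 + u ^ 2) - (INR m + 1 - th) / ((INR m + 1 - th) ^ 2 + u ^ 2)) (2 * PI * Sf th u).
Proof.
  intros Hth. pose proof (sin_PI_pos th Hth) as Hs. pose proof PI_RGT_0 as HPI.
  set (z := (th, u) : C).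
  assert (Hn : Csin (PI * z) <> RtoC 0).
  { intro E. pose proof (Cmod_Csin (PI * z)) as M. rewrite E, Cmod_0 in M. unfold z in M. rewrite RtoC_mult_pair in M. simpl in M. nra. }
  assert (H : cser (fun k => (/ (z + INR (S k)) + / (z - INR (S k)))%C) (PI * ccot (PI * z) - / z)%C).
  { apply ccot_series; auto.
    - simpl. rewrite Rabs_pos_eq; lra.
    - intro E. apply (f_equal Re) in E. simpl in E. lra. }
  apply cser_Re in H.
  set (A := fun m => (INR m + th) / ((INR m + th) ^ 2 + u ^ 2)).
  set (B := fun m => (INR m + 1 - th) / ((INR m + 1 - th) ^ 2 + u ^ 2)).
  assert (E1 : forall n, rsum (fun m => A m - B m) n = A O + rsum (fun k => Re (/ (z + INR (S k)) + / (z - INR (S k)))%C) n - A n).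
  { induction n; [simpl; ring|]. cbn [rsum]. rewrite IHn.
    replace (Re (/ (z + INR (S n)) + / (z - INR (S n)))%C) with (A (S n) - B n); [ring|].
    unfold z. replace ((th, u) + INR (S n))%C with ((th + INR (S n))%R, u) by (apply C_ext; simpl; ring).
    replace ((th, u) - INR (S n))%C with ((th - INR (S n))%R, u) by (apply C_ext; simpl; ring).
    change (Re (/ ((th + INR (S n))%R, u) + / ((th - INR (S n))%R, u))%C) with
      (Re (/ ((th + INR (S n))%R, u))%C + Re (/ ((th - INR (S n))%R, u))%C).
    rewrite !Re_Cinv. unfold A, B. rewrite S_INR.
    replace ((th - (INR n + 1)) ^ 2) with ((INR n + 1 - th) ^ 2) by ring.
    replace (INR n + 1 + th) with (th + (INR n + 1)) by ring.
    unfold Rdiv. ring. }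
  assert (EL : 2 * PI * Sf th u = A O + Re (PI * ccot (PI * z) - / z)%C - 0).
  { change (Re (PI * ccot (PI * z) - / z)%C) with (Re (PI * ccot (PI * z))%C - Re (/ z)%C).
    unfold z at 2. rewrite Re_Cinv. replace (A O) with (th / (th ^ 2 + u ^ 2)) by (unfold A; simpl; rewrite Rplus_0_l; reflexivity).
    unfold z, ccot. rewrite RtoC_mult_pair. unfold Ccos, Csin, Sf. cbn [Re Im fst snd].
    set (s := sin (PI * th)) in *. set (c := cos (PI * th)). set (sh := sinh (PI * u)). set (ch := cosh (PI * u)).
    assert (E2 : ch * ch = 1 + sh * sh).
    { unfold ch, sh, cosh, sinh. rewrite exp_Ropp. field. apply Rgt_not_eq, exp_pos. }
    assert (E3 : c * c = 1 - s * s). { pose proof (sin2_cos2 (PI * th)) as E. unfold Rsqr in E. fold s c in E. lra. }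
    replace (Re (PI * (((c * ch)%R, (- (s * sh))%R) / ((s * ch)%R, (c * sh)%R)))%C) with (PI * (c * s * (ch * ch - sh * sh) / (s * s * (ch * ch) + c * c * (sh * sh)))).
    - rewrite E2, E3. simpl. field. split; nra.
    - simpl. unfold Re. simpl. field.
      assert (s * s * (ch * ch) + c * c * (sh * sh) <> 0) by (rewrite E2, E3; nra). 
      simpl in *. nra. }
  rewrite EL. apply is_lim_seq_ext with (fun n => A O + rsum (fun k => Re (/ (z + INR (S k)) + / (z - INR (S k)))%C) n - A n).
  { intro n. now rewrite <- E1. }
  apply is_lim_seq_minus'; [apply is_lim_seq_plus'; [apply is_lim_seq_const|exact H]|].
  apply is_lim_seq_le_le_loc with (fun _ => 0) (fun n => / INR n); [|apply is_lim_seq_const|].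
  - exists 1%nat. intros n Hn1. assert (1 <= INR n) by (apply (le_INR 1); auto). unfold A. split.
    + apply Rdiv_le_0_compat; nra.
    + apply Rmult_le_reg_r with (((INR n + th) ^ 2 + u ^ 2) * INR n); [nra|].
      replace ((INR n + th) / ((INR n + th) ^ 2 + u ^ 2) * (((INR n + th) ^ 2 + u ^ 2) * INR n)) with ((INR n + th) * INR n) by (field; nra).
      replace (/ INR n * (((INR n + th) ^ 2 + u ^ 2) * INR n)) with ((INR n + th) ^ 2 + u ^ 2) by (field; lra). nra.
  - replace (Finite 0) with (Rbar_inv p_infty) by reflexivity. apply is_lim_seq_inv; [apply is_lim_seq_INR|easy].
Qed.

(** The cotangent series on the imaginary axis, at z = i v, multiplied by i. *)
Lemma coth_series v : 0 < v ->
  rser (fun k => 2 * v / (INR (S k) ^ 2 + v ^ 2)) (PI * (cosh (PI * v) / sinh (PI * v)) - / v).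
Proof.
  intros Hv. pose proof PI_RGT_0 as HPI. set (z := (0, v) : C).
  assert (Hsh : 0 < sinh (PI * v)). { unfold sinh. pose proof (exp_increasing (- (PI * v)) (PI * v)). nra. }
  assert (E0 : Csin (PI * z) = (0, sinh (PI * v))).
  { unfold z. rewrite RtoC_mult_pair. unfold Csin. cbn [Re Im fst snd]. rewrite Rmult_0_r, sin_0, cos_0. apply C_ext; simpl; ring. }
  assert (E1 : Ccos (PI * z) = RtoC (cosh (PI * v))).
  { unfold z. rewrite RtoC_mult_pair. unfold Ccos. cbn [Re Im fst snd]. rewrite Rmult_0_r, sin_0, cos_0. apply C_ext; simpl; ring. }
  assert (H : cser (fun k => (/ (z + INR (S k)) + / (z - INR (S k)))%C) (PI * ccot (PI * z) - / z)%C).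
  { apply ccot_series.
    - simpl. rewrite Rabs_R0; lra.
    - intro E. apply (f_equal Im) in E. simpl in E. lra.
    - rewrite E0. intro E. apply (f_equal Im) in E. simpl in E. lra. }
  apply (cser_scal Ci) in H. apply cser_Re in H.
  replace (Re (Ci * (PI * ccot (PI * z) - / z))%C) with (PI * (cosh (PI * v) / sinh (PI * v)) - / v) in H.
  - eapply rser_ext; [|exact H]. intro k. unfold z.
    replace ((0, v) + INR (S k))%C with (INR (S k), v) by (apply C_ext; simpl; ring).
    replace ((0, v) - INR (S k))%C with ((- INR (S k))%R, v) by (apply C_ext; simpl; ring).
    replace (Re (Ci * (/ (INR (S k), v) + / ((- INR (S k))%R, v)))%C) with (- (Im (/ (INR (S k), v))%C + Im (/ ((- INR (S k))%R, v))%C)).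
    2: unfold Re, Im; simpl; ring.
    rewrite !Im_Cinv. replace ((- INR (S k)) ^ 2) with (INR (S k) ^ 2) by ring. unfold Rdiv; ring.
  - unfold ccot. rewrite E0, E1. unfold z. simpl. unfold Re. simpl. field. lra.
Qed.

(** * The cosecant series *)

Definition alt (k : nat) : C := RtoC ((-1) ^ k).

Lemma alt_S k : alt (S k) = (- alt k)%C.
Proof. unfold alt. simpl. rewrite RtoC_mult. apply C_ext; simpl; ring. Qed.

Lemma alt_even J : alt (2 * J) = RtoC 1.
Proof. unfold alt. rewrite pow_1_even. reflexivity. Qed.

(* pi/sin(pi z) = pi cot(pi z/2) - pi cot(pi z); the partial sums match up to the single term 1/(z+2J). *)
Lemma csc_partial (z : C) J : 0 < Re z < 1 ->
  csum (fun k => (alt k * (/ (z + INR k) + / ((1 - z) + INR k)))%C) (2 * J) =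
  ((/ (z / 2) + csum (fun k => (/ (z / 2 + INR (S k)) + / (z / 2 - INR (S k)))%C) J)
   - (/ z + csum (fun k => (/ (z + INR (S k)) + / (z - INR (S k)))%C) (2 * J)) - / (z + INR (2 * J)))%C.
Proof.
  intros Hz.
  assert (Hz0 : z <> RtoC 0). { intro E. rewrite E in Hz. simpl in Hz. lra. }
  assert (Hp : forall r : R, 0 <= r -> (z + r)%C <> RtoC 0).
  { intros r Hr E. apply (f_equal Re) in E. simpl in E. fold (Re z) in E. lra. }
  assert (Hm : forall r : R, 1 <= r -> (z - r)%C <> RtoC 0).
  { intros r Hr E. apply (f_equal Re) in E. simpl in E. fold (Re z) in E. lra. }
  induction J.
  - simpl. replace (z + 0)%C with z by ring. field. auto.
  - replace (2 * S J)%nat with (S (S (2 * J))) by lia.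
    change (csum (fun k => (alt k * (/ (z + INR k) + / ((1 - z) + INR k)))%C) (S (S (2 * J)))) with
      (csum (fun k => (alt k * (/ (z + INR k) + / ((1 - z) + INR k)))%C) (2 * J)
        + alt (2 * J) * (/ (z + INR (2 * J)) + / ((1 - z) + INR (2 * J)))
        + alt (S (2 * J)) * (/ (z + INR (S (2 * J))) + / ((1 - z) + INR (S (2 * J)))))%C.
    rewrite IHJ, alt_S, alt_even.
    change (csum (fun k => (/ (z / 2 + INR (S k)) + / (z / 2 - INR (S k)))%C) (S J)) with
      (csum (fun k => (/ (z / 2 + INR (S k)) + / (z / 2 - INR (S k)))%C) J + (/ (z / 2 + INR (S J)) + / (z / 2 - INR (S J))))%C.
    change (csum (fun k => (/ (z + INR (S k)) + / (z - INR (S k)))%C) (S (S (2 * J)))) with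
      (csum (fun k => (/ (z + INR (S k)) + / (z - INR (S k)))%C) (2 * J) + (/ (z + INR (S (2 * J))) + / (z - INR (S (2 * J))))
         + (/ (z + INR (S (S (2 * J)))) + / (z - INR (S (S (2 * J))))))%C.
    set (n := INR (2 * J)). assert (Hn : 0 <= n) by apply pos_INR.
    rewrite !(S_INR (S (2 * J))), !(S_INR (2 * J)). fold n.
    replace (INR (S J)) with (n / 2 + 1) by (unfold n; rewrite mult_INR, (S_INR J); simpl; field).
    replace (/ ((1 - z) + n))%C with (- / (z - (n + 1)%R))%C.
    2: rewrite RtoC_plus; field; split; [replace (1 - z + n)%C with (- (z - (n + 1)%R))%C by (rewrite RtoC_plus; ring)|rewrite <- RtoC_plus];
       [intro E; apply (Hm (n + 1)); [lra|]; replace (z - (n + 1)%R)%C with (- - (z - (n + 1)%R))%C by ring; rewrite E; ring|apply Hm; lra].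
    replace (/ ((1 - z) + (n + 1)%R))%C with (- / (z - (n + 1 + 1)%R))%C.
    2: rewrite !RtoC_plus; field; split; [replace (1 - z + (n + 1))%C with (- (z - (n + 1 + 1)%R))%C by (rewrite !RtoC_plus; ring)|rewrite <- !RtoC_plus];
       [intro E; apply (Hm (n + 1 + 1)); [lra|]; replace (z - (n + 1 + 1)%R)%C with (- - (z - (n + 1 + 1)%R))%C by ring; rewrite E; ring|apply Hm; lra].
    replace (/ (z / 2 + (n / 2 + 1)%R))%C with (2 * / (z + (n + 1 + 1)%R))%C.
    2: { replace (z / 2 + (n / 2 + 1)%R)%C with ((z + (n + 1 + 1)%R) / 2)%C.
      - field. apply Hp; lra.
      - rewrite !RtoC_plus, RtoC_div by lra. field. }
    replace (/ (z / 2 - (n / 2 + 1)%R))%C with (2 * / (z - (n + 1 + 1)%R))%C.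
    2: { replace (z / 2 - (n / 2 + 1)%R)%C with ((z - (n + 1 + 1)%R) / 2)%C.
      - field. apply Hm; lra.
      - rewrite !RtoC_plus, RtoC_div by lra. field. }
    ring.
Qed.

(** Only the even partial sums are treated, because one term of the series at z/2 matches two terms
    of the series at z. *)
Lemma csc_series z : 0 < Re z < 1 ->
  ccvg (fun J => csum (fun k => (alt k * (/ (z + INR k) + / ((1 - z) + INR k)))%C) (2 * J)) (PI / Csin (PI * z))%C.
Proof.
  intros Hz. pose proof PI_RGT_0 as HPI.
  assert (Hz0 : z <> RtoC 0). { intro E. rewrite E in Hz. simpl in Hz. lra. }
  assert (Hs : forall w, 0 < Re w < 1 -> Csin (PI * w) <> RtoC 0).
  { intros w Hw E. pose proof (Cmod_Csin (PI * w)) as M. rewrite E, Cmod_0 in M.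
    replace (Re (PI * w)) with (PI * Re w) in M by (simpl; unfold Re; ring). pose proof (sin_PI_pos (Re w) Hw). nra. }
  assert (Hh : 0 < Re (z / 2) < 1).
  { replace (z / 2)%C with ((/2)%R * z)%C by (rewrite RtoC_inv by lra; field). replace (Re ((/2)%R * z)) with (/ 2 * Re z) by (simpl; unfold Re; ring). lra. }
  assert (H1 : cser (fun k => (/ (z + INR (S k)) + / (z - INR (S k)))%C) (PI * ccot (PI * z) - / z)%C).
  { apply ccot_series; auto. rewrite Rabs_pos_eq; lra. }
  assert (H2 : cser (fun k => (/ (z / 2 + INR (S k)) + / (z / 2 - INR (S k)))%C) (PI * ccot (PI * (z / 2)) - / (z / 2))%C).
  { apply ccot_series; auto. rewrite Rabs_pos_eq; lra. intro E. rewrite E in Hh. simpl in Hh. lra. }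
  assert (H3 : ccvg (fun J => csum (fun k => (/ (z + INR (S k)) + / (z - INR (S k)))%C) (2 * J)) (PI * ccot (PI * z) - / z)%C).
  { intros eps He. destruct (H1 eps He) as [N HN]. exists N. intros n Hn. apply HN. lia. }
  assert (H4 : ccvg (fun J => / (z + INR (2 * J)))%C 0).
  { apply ccvg_of_le with (fun J => / (Re z + INR (2 * J))).
    - intro J. replace (/ (z + INR (2 * J)) - 0)%C with (/ (z + INR (2 * J)))%C by ring.
      assert (Hj : Re z + INR (2 * J) <= Cmod (z + INR (2 * J))).
      { eapply Rle_trans; [|apply Re_le_Cmod]. apply Req_le. reflexivity. }
      pose proof (pos_INR (2 * J)). rewrite Cmod_inv by (apply Cmod_gt_0; lra).
      apply Rinv_le_contravar; lra.
    - replace (Finite 0) with (Rbar_inv p_infty) by reflexivity. apply is_lim_seq_inv; [|easy].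
      apply is_lim_seq_plus with (l1 := Finite (Re z)) (l2 := p_infty); [apply is_lim_seq_const| |easy].
      apply is_lim_seq_le_p_loc with (fun n => INR n); [|apply is_lim_seq_INR].
      exists O. intros n _. apply le_INR. lia. }
  assert (Fin : (PI / Csin (PI * z))%C = ((/ (z / 2) + (PI * ccot (PI * (z / 2)) - / (z / 2))) - (/ z + (PI * ccot (PI * z) - / z)) - 0)%C).
  { set (w := (PI * (z / 2))%C). assert (Ew : (PI * z)%C = (2 * w)%C) by (unfold w; field). rewrite Ew.
    assert (N2 : Csin (2 * w) <> RtoC 0) by (rewrite <- Ew; auto). rewrite Csin_dup in N2.
    assert (N3 : Csin w <> RtoC 0). { intro E. apply N2. rewrite E. ring. }
    assert (N4 : Ccos w <> RtoC 0). { intro E. apply N2. rewrite E. ring. }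
    unfold ccot. rewrite Csin_dup. replace (2 * w)%C with (w + w)%C by ring. rewrite Ccos_plus.
    replace (RtoC PI / (2 * Csin w * Ccos w))%C with (RtoC PI * (Csin w * Csin w + Ccos w * Ccos w) / (2 * Csin w * Ccos w))%C
      by (rewrite Csin2_Ccos2; field; auto).
    field. repeat split; auto. }
  rewrite Fin. eapply ccvg_ext; [intro J; symmetry; apply csc_partial; auto|].
  repeat (apply ccvg_minus || apply ccvg_plus); auto using ccvg_const.
Qed.

(** * The Mellin transforms of rational functions *)

Lemma exp_bounded_two f M1 M2 al be : 0 < al -> 0 < be -> (forall t, t <= 0 -> Cmod (f t) <= M1 * exp (al * t)) ->
  (forall t, 0 <= t -> Cmod (f t) <= M2 * exp (- be * t)) -> exp_bounded f (M1 + M2) (Rmin al be).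
Proof.
  intros Ha Hb H1 H2.
  assert (P1 : 0 <= M1). { specialize (H1 0 (Rle_refl _)). rewrite Rmult_0_r, exp_0 in H1. pose proof (Cmod_ge_0 (f 0)); lra. }
  assert (P2 : 0 <= M2). { specialize (H2 0 (Rle_refl _)). rewrite Rmult_0_r, exp_0 in H2. pose proof (Cmod_ge_0 (f 0)); lra. }
  intro t. pose proof (Rmin_l al be). pose proof (Rmin_r al be). pose proof (exp_pos (- Rmin al be * Rabs t)).
  destruct (Rle_dec t 0) as [L|L].
  - specialize (H1 t L). rewrite (Rabs_left1 t) in * by auto.
    assert (exp (al * t) <= exp (- Rmin al be * - t)) by (apply exp_le; nra). nra.
  - specialize (H2 t ltac:(lra)). rewrite (Rabs_pos_eq t) in * by lra.
    assert (exp (- be * t) <= exp (- Rmin al be * t)) by (apply exp_le; nra). nra.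
Qed.

Lemma ccont_derivable (f : R -> R) : (forall t, ex_derive f t) -> ccont (fun t => RtoC (f t)).
Proof. intro H. apply ccont_RtoC. intro t. now apply (ex_derive_continuous (V := R_NormedModule)). Qed.

Lemma Cmod_cexp_lin (p : C) (t : R) : Cmod (cexp (p * t)) = exp (Re p * t).
Proof. rewrite Cmod_cexp. f_equal. simpl. unfold Re. ring. Qed.

Lemma lint_exp_abs q : 0 < Re q -> is_lint (fun t => cexp (- q * Rabs t)) (2 / q)%C.
Proof.
  intros Hq. assert (Hq0 : q <> RtoC 0). { intro E. rewrite E in Hq. simpl in Hq. lra. }
  assert (Hc : ccont (fun t => cexp (- q * Rabs t))).
  { apply (ccont_comp (fun t => cexp (- q * t)) Rabs); [apply ccont_cexp0|]. intro t. apply continuous_Rabs. }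
  assert (Hd : exp_bounded (fun t => cexp (- q * Rabs t)) 1 (Re q)).
  { intro t. rewrite Cmod_cexp_lin. rewrite Rmult_1_l. apply Req_le. reflexivity. }
  destruct (ex_lint _ _ _ Hq Hc Hd) as [l Hl].
  replace (2 / q)%C with l; auto.
  apply (ccvg_unique (fun n => CInt (fun t => cexp (- q * Rabs t)) (- INR n) (INR n))); [now apply is_lint_seq|].
  assert (E : forall n, CInt (fun t => cexp (- q * Rabs t)) (- INR n) (INR n) = (2 / q - 2 / q * cexp (- q * INR n))%C).
  { intro n. pose proof (pos_INR n). rewrite <- (CInt_Chasles _ (- INR n) 0 (INR n)) by auto.
    rewrite (CInt_ext _ (fun t : R => cexp (q * t)) (- INR n) 0).
    - rewrite (CInt_ext _ (fun t : R => cexp (- q * t)) 0 (INR n)).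
      + rewrite !CInt_cexp; auto.
        * rewrite RtoC_opp. replace (q * 0)%C with (RtoC 0) by ring. replace (- q * 0)%C with (RtoC 0) by ring. rewrite cexp_0.
          replace (q * - INR n)%C with (- q * INR n)%C by ring. field; auto.
        * intro E. apply Hq0. replace q with (- - q)%C by ring. rewrite E. ring.
      + intros t Ht. rewrite Rmin_left in Ht by lra. now rewrite Rabs_pos_eq by lra.
    - intros t Ht. rewrite Rmin_left, Rmax_right in Ht by lra. rewrite Rabs_left by lra. f_equal. rewrite RtoC_opp. ring. }
  eapply ccvg_ext; [intro n; symmetry; apply E|].
  replace (2 / q)%C with (2 / q - 2 / q * 0)%C at 1 by ring.
  apply ccvg_minus; [apply ccvg_const|]. apply ccvg_scal.
  intros eps He. destruct (exp_tail_small 1 (Re q) eps Hq He) as (T & HT0 & HT).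
  destruct (INR_unbounded T) as [N HN]. exists N. intros n Hn.
  replace (cexp (- q * INR n) - 0)%C with (cexp (- q * INR n)) by ring. rewrite Cmod_cexp_lin.
  specialize (HT (INR n)). rewrite Rmult_1_l in HT. replace (Re (- q)) with (- Re q) by reflexivity. apply HT.
  apply le_INR in Hn. lra.
Qed.

(** The Mellin integrand of 1/(1 + u^2), that is u^p/(1 + u^2) du/u at u = e^t. *)
Definition gJ (p : C) (t : R) : C := (cexp (p * t) * RtoC (/ (1 + exp (2 * t))))%C.

Lemma ccont_gJ p : ccont (gJ p).
Proof.
  apply ccont_mult; [apply ccont_cexp0|]. apply ccont_derivable. intro t. auto_derive.
  pose proof (exp_pos (2 * t)); lra.
Qed.

Lemma exp_bounded_gJ p : 0 < Re p < 2 -> exp_bounded (gJ p) (1 + 1) (Rmin (Re p) (2 - Re p)).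
Proof.
  intros Hp. apply exp_bounded_two; try lra; intros t Ht; unfold gJ; rewrite Cmod_mult, Cmod_cexp_lin;
    pose proof (exp_pos (2 * t)); (rewrite Cmod_RtoC_pos by (apply Rlt_le, Rinv_0_lt_compat; lra)); rewrite Rmult_1_l.
  - pose proof (exp_pos (Re p * t)). assert (/ (1 + exp (2 * t)) <= 1).
    { rewrite <- Rinv_1. apply Rinv_le_contravar; lra. } nra.
  - replace (- (2 - Re p) * t) with (Re p * t + - (2 * t)) by ring. rewrite exp_plus, exp_Ropp.
    apply Rmult_le_compat_l; [apply Rlt_le, exp_pos|]. apply Rinv_le_contravar; lra.
Qed.

(** [gJ] folded at t = 0, so that 1/(1 + y) can be expanded at y = exp(-2 |t|) <= 1 on both half
    lines. *)
Definition GJ (p : C) (t : R) : C :=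
  ((cexp (- p * Rabs t) + cexp (- (2 - p) * Rabs t)) * RtoC (/ (1 + exp (- 2 * Rabs t))))%C.

Lemma gJ_sym p t : (gJ p t + gJ p (- t))%C = GJ p t.
Proof.
  assert (G : forall t, 0 <= t -> (gJ p t + gJ p (- t))%C = GJ p t).
  { clear t. intros t Ht. unfold gJ, GJ. rewrite Rabs_pos_eq by auto.
    pose proof (exp_pos (2 * t)) as E1. pose proof (exp_pos (- 2 * t)) as E2.
    replace (2 * - t) with (- 2 * t) by ring.
    replace (- (2 - p) * t)%C with (p * t + RtoC (- 2 * t))%C.
    2: destruct p; apply C_ext; simpl; ring.
    rewrite cexp_plus, cexp_RtoC.
    replace (/ (1 + exp (2 * t))) with (exp (- 2 * t) * / (1 + exp (- 2 * t))).
    - rewrite RtoC_mult. replace (p * (- t)%R)%C with (- p * t)%C by (rewrite RtoC_opp; ring). ring.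
    - replace (-2 * t) with (- (2 * t)) by ring. rewrite exp_Ropp. field. lra. }
  destruct (Rle_dec 0 t) as [H|H]; [now apply G|].
  specialize (G (- t) ltac:(lra)). rewrite Ropp_involutive, Cplus_comm in G. rewrite G.
  unfold GJ. now rewrite Rabs_Ropp.
Qed.

Lemma geom_alt (x : R) K : 0 < x -> csum (fun k => (alt k * RtoC (x ^ k))%C) K = (RtoC (/ (1 + x)) - alt K * RtoC (x ^ K) * RtoC (/ (1 + x)))%C.
Proof.
  intros Hx. assert (H : (RtoC (/ (1 + x)) * (1 + x))%C = RtoC 1).
  { rewrite <- RtoC_plus, <- RtoC_mult. f_equal. field. lra. }
  induction K.
  - unfold alt. simpl. ring.
  - simpl csum. rewrite IHK, alt_S. simpl pow. rewrite RtoC_mult.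
    replace (alt K * RtoC (x ^ K))%C with (alt K * RtoC (x ^ K) * (RtoC (/ (1 + x)) * (1 + x)))%C at 2 by (rewrite H; ring). ring.
Qed.

(** The alternating geometric series diverges at t = 0, so [lint_series] does not apply; instead the
    exact remainder, whose decay rate grows by 2K, is integrated. *)
Lemma GJ_expand p t K : (GJ p t - csum (fun k => (alt k * (cexp (- (p + 2 * INR k) * Rabs t) + cexp (- ((2 - p) + 2 * INR k) * Rabs t)))%C) K)%C
  = (alt K * RtoC (exp (- (2 * INR K) * Rabs t)) * GJ p t)%C.
Proof.
  set (a := Rabs t). set (x := exp (- 2 * a)).
  assert (Ex : forall k, exp (- (2 * INR k) * a) = x ^ k).
  { intro k. unfold x. rewrite <- Rpower_pow by apply exp_pos. unfold Rpower. rewrite ln_exp. f_equal. ring. }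
  assert (Ec : forall q (k : nat), cexp (- (q + 2 * INR k) * a) = (cexp (- q * a) * RtoC (x ^ k))%C).
  { intros q k. rewrite <- Ex, <- cexp_RtoC, <- cexp_plus. f_equal. rewrite !RtoC_mult, RtoC_opp, RtoC_mult. ring. }
  rewrite (csum_ext _ (fun k => ((cexp (- p * a) + cexp (- (2 - p) * a)) * (alt k * RtoC (x ^ k)))%C)).
  - rewrite csum_scal, geom_alt by apply exp_pos. rewrite Ex. unfold GJ. fold a x. ring.
  - intros k _. rewrite !Ec. ring.
Qed.

Lemma sin_neq_of_strip w : 0 < Re w < 1 -> Csin (PI * w) <> RtoC 0.
Proof.
  intros Hw E. pose proof (Cmod_Csin (PI * w)) as M. rewrite E, Cmod_0 in M.
  replace (Re (PI * w)) with (PI * Re w) in M by (simpl; unfold Re; ring). pose proof (sin_PI_pos (Re w) Hw). nra.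
Qed.

Lemma Re_half z : Re (z / 2)%C = Re z / 2.
Proof. replace (z / 2)%C with ((/2)%R * z)%C by (rewrite RtoC_inv by lra; field). simpl. unfold Re. field. Qed.

Lemma exp_bounded_GJ p : 0 < Re p < 2 -> exp_bounded (GJ p) 2 (Rmin (Re p) (2 - Re p)).
Proof.
  intros Hp t. unfold GJ. rewrite Cmod_mult.
  assert (E2 : 0 < exp (- 2 * Rabs t)) by apply exp_pos. rewrite Cmod_RtoC_pos by (apply Rlt_le, Rinv_0_lt_compat; lra).
  assert (/ (1 + exp (- 2 * Rabs t)) <= 1). { rewrite <- Rinv_1. apply Rinv_le_contravar; lra. }
  assert (0 < / (1 + exp (- 2 * Rabs t))) by (apply Rinv_0_lt_compat; lra).
  assert (Cmod (cexp (- p * Rabs t) + cexp (- (2 - p) * Rabs t)) <= 2 * exp (- Rmin (Re p) (2 - Re p) * Rabs t)).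
  { eapply Rle_trans; [apply Cmod_triangle|]. rewrite !Cmod_cexp_lin.
    pose proof (Rmin_l (Re p) (2 - Re p)). pose proof (Rmin_r (Re p) (2 - Re p)). pose proof (Rabs_pos t).
    assert (exp (Re (- p) * Rabs t) <= exp (- Rmin (Re p) (2 - Re p) * Rabs t)) by (apply exp_le; change (Re (- p)) with (- Re p); nra).
    assert (exp (Re (- (2 - p)) * Rabs t) <= exp (- Rmin (Re p) (2 - Re p) * Rabs t)) by (apply exp_le; change (Re (- (2 - p))) with (- (2 - Re p)); nra).
    lra. }
  pose proof (Cmod_ge_0 (cexp (- p * Rabs t) + cexp (- (2 - p) * Rabs t))).
  nra.
Qed.

(** Twice the integral is the limit of all partial sums of the cosecant series, the remainder being
    O(1/K); its value is read off along the even ones. *)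
Theorem lint_gJ p : 0 < Re p < 2 -> is_lint (gJ p) ((PI / 2)%R / Csin ((PI / 2)%R * p))%C.
Proof.
  intros Hp. set (m := Rmin (Re p) (2 - Re p)).
  assert (Hm : 0 < m) by (apply Rmin_glb_lt; lra).
  destruct (ex_lint _ _ _ Hm (ccont_gJ p) (exp_bounded_gJ p Hp)) as [l Hl].
  pose proof (is_lint_plus _ _ _ _ Hl (is_lint_reflect _ _ Hl)) as H2.
  assert (HG : is_lint (GJ p) (l + l)%C) by (eapply is_lint_ext; [intro t; apply gJ_sym|exact H2]). clear H2.
  set (z := (p / 2)%C).
  assert (Hz : 0 < Re z < 1) by (unfold z; rewrite Re_half; lra).
  pose proof (csc_series z Hz) as Hc.
  assert (Hcv : ccvg (fun K => csum (fun k => (alt k * (/ (z + INR k) + / ((1 - z) + INR k)))%C) K) (l + l)%C).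
  { apply ccvg_of_le with (fun K => 4 * (2 / (2 * INR K + m))).
    - intro K. rewrite Cmod_sub_sym. pose proof (pos_INR K).
      apply (is_lint_le (fun t => (GJ p t - csum (fun k => (alt k * (cexp (- (p + 2 * INR k) * Rabs t) + cexp (- ((2 - p) + 2 * INR k) * Rabs t)))%C) K)%C)); [lra| |].
      + intro t. rewrite GJ_expand, Cmod_mult, Cmod_mult. unfold alt. rewrite Cmod_R, pow_1_abs, Rmult_1_l.
        rewrite Cmod_RtoC_pos by apply Rlt_le, exp_pos.
        pose proof (exp_bounded_GJ p Hp t) as G. fold m in G.
        replace (- (2 * INR K + m) * Rabs t) with (- (2 * INR K) * Rabs t + - m * Rabs t) by ring. rewrite exp_plus.
        pose proof (exp_pos (- (2 * INR K) * Rabs t)). nra.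
      + apply is_lint_minus; auto. apply is_lint_csum. intros k _. apply is_lint_scal.
        pose proof (pos_INR k).
        assert (Q1 : forall q, 0 < Re q -> is_lint (fun t => cexp (- (q + 2 * INR k) * Rabs t)) (/ (q / 2 + INR k))%C).
        { intros q Hq. assert (HR : 0 < Re (q + 2 * INR k)).
          { replace (Re (q + 2 * INR k)) with (Re q + 2 * INR k); [lra|]. simpl. unfold Re. ring. }
          replace (/ (q / 2 + INR k))%C with (2 / (q + 2 * INR k))%C; [now apply lint_exp_abs|].
          assert ((q + 2 * INR k)%C <> RtoC 0). { intro E. rewrite E in HR. simpl in HR. lra. }
          field. intro E. match goal with H : (q + _)%C <> _ |- _ => apply H end. rewrite <- E. ring. }
        replace (1 - z)%C with ((2 - p) / 2)%C by (unfold z; field).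
        apply is_lint_plus; apply Q1; [apply Hp|]. replace (Re (2 - p)) with (2 - Re p) by reflexivity. lra.
    - replace (Finite 0) with (Rbar_mult 4 (Rbar_mult 2 0)) by (simpl; f_equal; ring).
      apply is_lim_seq_scal_l. apply is_lim_seq_scal_l. replace (Finite 0) with (Rbar_inv p_infty) by reflexivity.
      apply is_lim_seq_inv; [|easy]. apply is_lim_seq_plus with (l1 := p_infty) (l2 := Finite m); [|apply is_lim_seq_const|easy].
      apply is_lim_seq_le_p_loc with (fun n => INR n); [|apply is_lim_seq_INR].
      exists O. intros n _. pose proof (pos_INR n). lra. }
  assert (Hsub : ccvg (fun J => csum (fun k => (alt k * (/ (z + INR k) + / ((1 - z) + INR k)))%C) (2 * J)) (l + l)%C).
  { intros eps He. destruct (Hcv eps He) as [N HN]. exists N. intros n Hn. apply HN. lia. }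
  pose proof (ccvg_unique _ _ _ Hc Hsub) as E.
  replace (RtoC (PI / 2) * p)%C with (PI * z)%C by (unfold z; rewrite RtoC_div by lra; field).
  replace (RtoC (PI / 2) / Csin (PI * z))%C with l; auto.
  replace l with ((l + l) / 2)%C by field. rewrite <- E. rewrite RtoC_div by lra. field. now apply sin_neq_of_strip.
Qed.

(* The Mellin integrand u^p / (a^2 + u^2) du/u at u = e^t; its integral is a^(p-2) kJ p. *)
Definition qJ (p : C) (a : R) (t : R) : C := (cexp (p * t) * RtoC (/ (a ^ 2 + exp (2 * t))))%C.

Definition kJ (p : C) : C := ((PI / 2)%R / Csin ((PI / 2)%R * p))%C.

Lemma sin_half_neq p : 0 < Re p < 2 -> Csin ((PI / 2)%R * p) <> RtoC 0.
Proof.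
  intro Hp. replace (RtoC (PI / 2) * p)%C with (PI * (p / 2))%C by (rewrite RtoC_div by lra; field).
  apply sin_neq_of_strip. rewrite Re_half. lra.
Qed.

Lemma exp_2ln a : 0 < a -> exp (2 * ln a) = a ^ 2.
Proof. intro H. replace (2 * ln a) with (ln a + ln a) by ring. rewrite exp_plus, exp_ln by auto. ring. Qed.

Lemma ccont_qJ p a : ccont (qJ p a).
Proof.
  apply ccont_mult; [apply ccont_cexp0|]. apply ccont_derivable. intro t. auto_derive.
  pose proof (exp_pos (2 * t)); nra.
Qed.

Lemma lint_qJ p a : 0 < Re p < 2 -> 0 < a -> is_lint (qJ p a) (cexp ((p - 2) * ln a) * kJ p)%C.
Proof.
  intros Hp Ha. pose proof (lint_gJ p Hp) as H. apply (is_lint_shift _ _ (- ln a)) in H.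
  apply (is_lint_scal (cexp ((p - 2) * ln a))) in H. eapply is_lint_ext; [|exact H].
  intro t. cbv beta. unfold gJ, qJ.
  replace (RtoC (t + - ln a)) with (t - ln a)%C by (rewrite RtoC_plus, RtoC_opp; ring).
  replace (2 * (t + - ln a)) with (2 * t + - (2 * ln a)) by ring. rewrite exp_plus, exp_Ropp, exp_2ln by auto.
  replace (/ (1 + exp (2 * t) * / a ^ 2)) with (a ^ 2 * / (a ^ 2 + exp (2 * t))).
  2: { field. pose proof (exp_pos (2 * t)). split; nra. }
  assert (Ea : RtoC (a ^ 2) = cexp (RtoC (2 * ln a))) by (now rewrite cexp_RtoC, exp_2ln).
  rewrite RtoC_mult, Ea.
  rewrite Cmult_assoc, Cmult_assoc, <- cexp_plus, <- cexp_plus. f_equal. f_equal. rewrite RtoC_mult. ring.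
Qed.

Lemma exp_bounded_qJ p a : 0 < Re p < 2 -> 0 < a -> exp_bounded (qJ p a) (/ a ^ 2 + 1) (Rmin (Re p) (2 - Re p)).
Proof.
  intros Hp Ha. assert (Ha2 : 0 < a ^ 2) by (apply pow_lt; auto).
  apply exp_bounded_two; try lra; intros t Ht; unfold qJ; rewrite Cmod_mult, Cmod_cexp_lin;
    pose proof (exp_pos (2 * t)); (rewrite Cmod_RtoC_pos by (apply Rlt_le, Rinv_0_lt_compat; lra)).
  - rewrite Rmult_comm. apply Rmult_le_compat_r; [apply Rlt_le, exp_pos|]. apply Rinv_le_contravar; lra.
  - rewrite Rmult_1_l. replace (- (2 - Re p) * t) with (Re p * t + - (2 * t)) by ring. rewrite exp_plus, exp_Ropp.
    apply Rmult_le_compat_l; [apply Rlt_le, exp_pos|]. apply Rinv_le_contravar; lra.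
Qed.

Lemma is_lint_derive (F f : R -> C) M c : 0 < c -> exp_bounded F M c -> ccont f ->
  (forall t, is_derive (fun t => Re (F t)) t (Re (f t))) ->
  (forall t, is_derive (fun t => Im (F t)) t (Im (f t))) -> is_lint f 0.
Proof.
  intros Hc HF Hf H1 H2. split; auto. intros eps He.
  destruct (exp_tail_small M c (eps / 2) Hc ltac:(lra)) as (T & HT0 & HT). exists T. intros a b Ha Hb.
  rewrite (CInt_derive F f a b Hf H1 H2). replace (F b - F a - 0)%C with (F b + - F a)%C by ring.
  eapply Rle_lt_trans; [apply Cmod_triangle|]. rewrite Cmod_opp.
  pose proof (HF a) as Fa. pose proof (HF b) as Fb. rewrite Rabs_left1 in Fa by lra. rewrite Rabs_pos_eq in Fb by lra.
  pose proof (HT b Hb). pose proof (HT (- a) ltac:(lra)). lra.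
Qed.

(** The derivative of [qJ p a] is (p - 2) qJ + 2 a^2 qJ/(a^2 + e^(2t)), and it integrates to 0 over
    the line. The squared denominator arises when d a = x. *)
Lemma lint_qJ2 p a : 0 < Re p < 2 -> 0 < a ->
  is_lint (fun t => (qJ p a t * RtoC (/ (a ^ 2 + exp (2 * t))))%C) ((2 - p) / (2 * a ^ 2)%R * (cexp ((p - 2) * ln a) * kJ p))%C.
Proof.
  intros Hp Ha. assert (Ha2 : 0 < a ^ 2) by (apply pow_lt; auto). pose proof (lint_qJ p a Hp Ha) as H.
  set (f := fun t : R => ((p - 2) * qJ p a t + (2 * a ^ 2)%R * (qJ p a t * RtoC (/ (a ^ 2 + exp (2 * t)))))%C).
  assert (Hf : ccont f).
  { apply (ccont_plus (fun t => ((p - 2) * qJ p a t)%C)).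
    { apply (ccont_mult (fun _ => (p - 2)%C)); [apply ccont_const|apply ccont_qJ]. }
    apply (ccont_mult (fun _ => RtoC (2 * a ^ 2))); [apply ccont_const|]. apply (ccont_mult (qJ p a)); [apply ccont_qJ|].
    apply ccont_derivable. intro t. auto_derive. pose proof (exp_pos (2 * t)); nra. }
  assert (H0 : is_lint f 0).
  { apply (is_lint_derive (qJ p a) f (/ a ^ 2 + 1) (Rmin (Re p) (2 - Re p))); auto.
    - apply Rmin_glb_lt; lra.
    - now apply exp_bounded_qJ.
    - intro t. pose proof (exp_pos (2 * t)). unfold f, qJ, cexp. destruct p as [p1 p2]. unfold Re, Im. simpl.
      auto_derive; [nra|]. unfold Rminus. field. simpl in Ha2. nra.
    - intro t. pose proof (exp_pos (2 * t)). unfold f, qJ, cexp. destruct p as [p1 p2]. unfold Re, Im. simpl.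
      auto_derive; [nra|]. unfold Rminus. field. simpl in Ha2. nra. }
  apply (is_lint_scal (p - 2)) in H. pose proof (is_lint_minus _ _ _ _ H0 H) as H1.
  assert (Hn : RtoC (2 * a ^ 2) <> RtoC 0) by (apply RtoC_neq_0; lra).
  apply (is_lint_scal (/ (2 * a ^ 2)%R)) in H1.
  replace ((2 - p) / (2 * a ^ 2)%R * (cexp ((p - 2) * ln a) * kJ p))%C with (/ (2 * a ^ 2)%R * (0 - (p - 2) * (cexp ((p - 2) * ln a) * kJ p)))%C by (field; auto).
  eapply is_lint_ext; [|exact H1]. intro t. unfold f. cbv beta. field. auto.
Qed.

(** * Complex powers and the product of two rational kernels *)

Lemma cpow_mult_base a b s : 0 < a -> 0 < b -> cpow (a * b) s = (cpow a s * cpow b s)%C.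
Proof.
  intros Ha Hb. rewrite !cpow_cexp, ln_mult, <- cexp_plus by auto. f_equal. rewrite RtoC_plus. ring.
Qed.

Lemma cpow_plus b s t : cpow b (s + t) = (cpow b s * cpow b t)%C.
Proof. rewrite !cpow_cexp, <- cexp_plus. f_equal. ring. Qed.

Lemma cpow_opp b s : cpow b (- s) = (/ cpow b s)%C.
Proof. rewrite !cpow_cexp, <- cexp_opp. f_equal. ring. Qed.

Lemma cpow_1 b : 0 < b -> cpow b 1 = RtoC b.
Proof. intro H. rewrite cpow_cexp. replace (1 * ln b)%C with (RtoC (ln b)) by ring. rewrite cexp_RtoC, exp_ln; auto. Qed.

Lemma cpow_INR b n : 0 < b -> cpow b (INR n) = RtoC (b ^ n).
Proof.
  intro H. rewrite cpow_cexp, <- RtoC_mult, cexp_RtoC. f_equal. rewrite <- Rpower_pow by auto. reflexivity.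
Qed.

Lemma cpow_neq_0 b s : cpow b s <> RtoC 0.
Proof. rewrite cpow_cexp. apply cexp_neq_0. Qed.

Lemma Cmod_cpow b s : Cmod (cpow b s) = Rpower b (Re s).
Proof. rewrite cpow_cexp, Cmod_cexp_lin. reflexivity. Qed.

(** Partial fractions: with E = e^(2t), the kernel a/((a^2 + E)(x^2 + d^2 E)) is a/(d^2 a^2 - x^2)
    times 1/((x/d)^2 + E) - 1/(a^2 + E). When d a = x the two denominators coincide up to a factor
    and [lint_qJ2] yields the limiting value stored in [qfun]. The term x^(p-2)/a is split off
    because [qfun] subtracts x^p where the transform has x^(p-2) d^2 a^2. *)
Lemma lint_double p x d a : 0 < Re p < 2 -> 0 < x -> 0 < d -> 0 < a ->
  is_lint (fun t => (qJ p a t * RtoC (a * / (x ^ 2 + d ^ 2 * exp (2 * t))))%C)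
    (kJ p * (cpow d (- p) * (cpow x (p - 2) / a - d * qfun p x (d * a))))%C.
Proof.
  intros Hp Hx Hd Ha.
  assert (Ha2 : 0 < a ^ 2) by (apply pow_lt; auto). assert (Hx2 : 0 < x ^ 2) by (apply pow_lt; auto).
  assert (Hd2 : 0 < d ^ 2) by (apply pow_lt; auto).
  assert (Nx : RtoC x <> RtoC 0) by (apply RtoC_neq_0; lra).
  assert (Na : RtoC a <> RtoC 0) by (apply RtoC_neq_0; lra).
  assert (Nd : RtoC d <> RtoC 0) by (apply RtoC_neq_0; lra).
  assert (E2 : forall b, 0 < b -> cpow b (p - 2) = (cpow b p / (b * b))%C).
  { intros b Hb. unfold Cminus. replace (p + - (2))%C with (p + - (1) + - (1))%C by ring.
    rewrite !cpow_plus, cpow_opp, cpow_1 by auto. field. apply RtoC_neq_0; lra. }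
  assert (E1 : forall b, 0 < b -> cpow b (p - 1) = (cpow b p / b)%C).
  { intros b Hb. unfold Cminus. rewrite !cpow_plus, cpow_opp, cpow_1 by auto. field. apply RtoC_neq_0; lra. }
  unfold qfun. destruct (Req_EM_T (d * a) x) as [E|E].
  - pose proof (lint_qJ2 p a Hp Ha) as H. apply (is_lint_scal (a / d ^ 2)%R) in H.
    match type of H with is_lint _ ?l => match goal with |- is_lint _ ?r => replace r with l end end.
    + eapply is_lint_ext; [|exact H]. intro t. cbv beta. pose proof (exp_pos (2 * t)).
      replace (a * / (x ^ 2 + d ^ 2 * exp (2 * t))) with (a / d ^ 2 * / (a ^ 2 + exp (2 * t))).
      * rewrite !RtoC_mult. ring.
      * rewrite <- E. field. repeat split; try lra. nra.
    + rewrite E2, E1 by auto. rewrite <- (cpow_cexp a (p - 2)), E2 by auto. rewrite <- E, cpow_mult_base, cpow_opp by auto.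
      rewrite !RtoC_div by lra. rewrite !RtoC_mult, !RtoC_pow, RtoC_mult. field.
      repeat split; auto. apply cpow_neq_0.
  - assert (Hxd : 0 < x / d) by (apply Rdiv_lt_0_compat; auto).
    assert (Hne : d ^ 2 * a ^ 2 - x ^ 2 <> 0).
    { intro H. apply E. assert (0 < d * a) by (apply Rmult_lt_0_compat; auto). nra. }
    pose proof (is_lint_minus _ _ _ _ (lint_qJ p (x / d) Hp Hxd) (lint_qJ p a Hp Ha)) as H.
    apply (is_lint_scal (a / (d ^ 2 * a ^ 2 - x ^ 2))%R) in H.
    match type of H with is_lint _ ?l => match goal with |- is_lint _ ?r => replace r with l end end.
    + eapply is_lint_ext; [|exact H]. intro t. cbv beta. unfold qJ. pose proof (exp_pos (2 * t)).
      match goal with |- (?A * (?B * ?C1 - ?B * ?C2))%C = _ => replace (A * (B * C1 - B * C2))%C with (B * (A * (C1 - C2)))%C by ring end.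
      rewrite <- Cmult_assoc. f_equal. rewrite <- RtoC_minus, <- !RtoC_mult. f_equal. field.
      repeat split; try lra; try nra.
    + rewrite <- (cpow_cexp (x / d)), <- (cpow_cexp a). rewrite !E2 by auto. unfold Rdiv at 2 3 4.
      rewrite !cpow_mult_base by (auto; apply Rinv_0_lt_compat; auto).
      assert (Ed : cpow (/ d) p = (/ cpow d p)%C).
      { rewrite <- cpow_opp, !cpow_cexp. f_equal. rewrite ln_Rinv by auto. rewrite RtoC_opp. ring. }
      rewrite Ed, cpow_opp. rewrite !RtoC_div by auto. rewrite !RtoC_mult, !RtoC_minus, !RtoC_mult, !RtoC_inv by lra. 
      rewrite !RtoC_pow, RtoC_mult. field.
      assert (Hne2 : (d * d * (a * a) - x * x)%C <> RtoC 0).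
      { rewrite <- !RtoC_mult, <- RtoC_minus. apply RtoC_neq_0. intro H1. apply Hne. simpl. lra. }
      repeat split; try assumption; try apply cpow_neq_0; (intro Q; apply Hne2; rewrite <- Q; ring).
Qed.

(** * The Hurwitz zeta difference as a Mellin transform *)

(** k t - exp t is largest at t = ln k, with value k ln k - k. *)
Lemma exp_exp_decay k : 0 < k -> exists M, 0 < M /\ forall t, exp (- exp t) <= M * exp (- k * t).
Proof.
  intros Hk. exists (exp (k * ln k - k)). split; [apply exp_pos|]. intro t.
  rewrite <- exp_plus. apply exp_le.
  assert (H : forall x, 1 + x <= exp x).
  { intro x. destruct (Req_dec x 0) as [->|N]; [rewrite exp_0; lra|]. apply Rlt_le, exp_ineq1; auto. }
  specialize (H (t - ln k)). replace (exp t) with (k * exp (t - ln k)); [nra|].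
  unfold Rminus. rewrite exp_plus, exp_Ropp, exp_ln by auto. field. lra.
Qed.

Lemma Sf_bound th u : 0 < th < 1 -> Rabs (Sf th u) <= / sin (PI * th) ^ 2.
Proof.
  intro H. pose proof (sin_PI_pos th H) as Hs. unfold Sf.
  set (s := sin (PI * th)) in *. set (c := cos (PI * th)). set (h := sinh (PI * u)).
  assert (Hsc : Rabs (/ 2 * (s * c)) <= 1).
  { pose proof (sin2_cos2 (PI * th)) as E. unfold Rsqr in E. fold s c in E. apply Rabs_le. split; nra. }
  unfold Rdiv. rewrite Rabs_mult, (Rabs_pos_eq (/ _)) by (apply Rlt_le, Rinv_0_lt_compat; nra).
  apply Rle_trans with (1 * / (s ^ 2 + h ^ 2)).
  - apply Rmult_le_compat_r; auto. apply Rlt_le, Rinv_0_lt_compat; nra.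
  - rewrite Rmult_1_l. apply Rinv_le_contravar; nra.
Qed.

Lemma Sf_decay th k : 0 < th < 1 -> 0 < k -> exists M, 0 < M /\ forall t, 0 <= t -> Rabs (Sf th (exp t)) <= M * exp (- k * t).
Proof.
  intros H Hk. destruct (exp_exp_decay k Hk) as (M & HM & HMt). exists (16 * M). split; [lra|]. intros t Ht.
  apply Rle_trans with (16 * exp (- exp t)); [|specialize (HMt t); lra].
  pose proof (sin_PI_pos th H) as Hs. unfold Sf.
  (* With y = exp(pi e^t) >= 2 one has 1/y <= y/2, hence y <= 4 sinh(pi e^t); squaring gives 16. *)
  assert (Hsh : exp (exp t) <= 16 * sinh (PI * exp t) ^ 2).
  { assert (1 <= exp t) by (rewrite <- exp_0; now apply exp_le). pose proof PI2_3_2 as HP. unfold PI2 in HP.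
    assert (H1 : exp (exp t) <= exp (PI * exp t)) by (apply exp_le; nra).
    assert (H2 : 2 <= exp (PI * exp t)).
    { pose proof (exp_ineq1 1 ltac:(lra)). assert (exp 1 <= exp (PI * exp t)) by (apply exp_le; nra). lra. }
    unfold sinh. rewrite exp_Ropp. set (y := exp (PI * exp t)) in *.
    assert (/ y <= y / 2). { apply Rmult_le_reg_r with y; [lra|]. rewrite Rinv_l by lra. nra. }
    assert (y <= 4 * ((y - / y) / 2)) by lra.
    assert (1 <= exp (exp t)) by (rewrite <- exp_0; apply exp_le; lra). nra. }
  set (s := sin (PI * th)) in *. set (c := cos (PI * th)). set (h := sinh (PI * exp t)) in *.
  assert (Hsc : Rabs (/ 2 * (s * c)) <= 1).
  { pose proof (sin2_cos2 (PI * th)) as E. unfold Rsqr in E. fold s c in E. apply Rabs_le. split; nra. }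
  pose proof (exp_pos (exp t)).
  unfold Rdiv. rewrite Rabs_mult, (Rabs_pos_eq (/ _)) by (apply Rlt_le, Rinv_0_lt_compat; nra).
  apply Rle_trans with (1 * / (s ^ 2 + h ^ 2)).
  - apply Rmult_le_compat_r; auto. apply Rlt_le, Rinv_0_lt_compat; nra.
  - rewrite exp_Ropp, Rmult_1_l. replace (16 * / exp (exp t)) with (/ (exp (exp t) / 16)) by (field; lra).
    apply Rinv_le_contravar; nra.
Qed.

(** [Sf] depends on u only through sinh(pi u)^2, so it has no first order term at 0. The order 2
    lets the Mellin transform of [Df] converge up to Re s < 3. The constant comes from sinh(pi u) <=
    pi e^pi u on (0,1]. *)
Lemma Sf_near0 th : 0 < th < 1 -> exists K, 0 < K /\ forall u, 0 < u <= 1 -> Rabs (Sf th u - Sf th 0) <= K * u ^ 2.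
Proof.
  intros H. pose proof (sin_PI_pos th H) as Hs. pose proof PI_RGT_0 as HPI.
  exists ((PI * exp PI) ^ 2 / sin (PI * th) ^ 4). split.
  { apply Rdiv_lt_0_compat; apply pow_lt; auto. apply Rmult_lt_0_compat; [auto|apply exp_pos]. }
  intros u Hu. unfold Sf.
  assert (Hh : 0 <= sinh (PI * u) <= PI * exp PI * u).
  { assert (Hy : 0 < PI * u <= PI) by nra. set (y := PI * u) in *.
    pose proof (exp_ineq1 y ltac:(lra)) as E1. pose proof (exp_ineq1 (- y) ltac:(lra)) as E2.
    assert (E3 : exp y <= exp PI) by (apply exp_le; lra).
    assert (E4 : exp (- y) <= 1) by (rewrite <- exp_0; apply exp_le; lra).
    assert (E5 : exp y - 1 <= y * exp y).
    { assert (exp y * exp (- y) = 1) by (rewrite <- exp_plus, Rplus_opp_r; apply exp_0). pose proof (exp_pos y). nra. }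
    assert (1 <= exp PI) by (rewrite <- exp_0; apply exp_le; lra).
    unfold sinh. split; [lra|]. replace (PI * exp PI * u) with (y * exp PI) by (unfold y; ring).
    assert (y * exp y <= y * exp PI) by (apply Rmult_le_compat_l; lra). nra. }
  set (s := sin (PI * th)) in *. set (c := cos (PI * th)). set (h := sinh (PI * u)) in *.
  replace (sinh (PI * 0)) with 0 by (unfold sinh; rewrite Rmult_0_r, Ropp_0, exp_0; field).
  assert (Hsc : Rabs (/ 2 * (s * c)) <= 1).
  { pose proof (sin2_cos2 (PI * th)) as E. unfold Rsqr in E. fold s c in E. apply Rabs_le. split; nra. }
  replace (/ 2 * (s * c) / (s ^ 2 + h ^ 2) - / 2 * (s * c) / (s ^ 2 + 0 ^ 2)) with ((/ 2 * (s * c)) * - (h ^ 2 / (s ^ 2 * (s ^ 2 + h ^ 2)))) by (field; nra).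
  assert (Hs2 : 0 < s ^ 2) by (apply pow_lt; auto). pose proof (pow2_ge_0 h) as Hh2.
  assert (Hs4 : 0 < s ^ 2 * (s ^ 2 + h ^ 2)) by (apply Rmult_lt_0_compat; lra).
  assert (Hq : 0 <= h ^ 2 / (s ^ 2 * (s ^ 2 + h ^ 2))) by (apply Rdiv_le_0_compat; lra).
  rewrite Rabs_mult, Rabs_Ropp, (Rabs_pos_eq (h ^ 2 / (s ^ 2 * (s ^ 2 + h ^ 2)))) by auto.
  apply Rle_trans with (1 * (h ^ 2 / (s ^ 2 * (s ^ 2 + h ^ 2)))).
  - apply Rmult_le_compat_r; auto.
  - rewrite Rmult_1_l. replace ((PI * exp PI) ^ 2 / s ^ 4 * u ^ 2) with ((PI * exp PI * u) ^ 2 / (s ^ 2 * s ^ 2)) by (field; lra).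
    unfold Rdiv. apply Rmult_le_compat; [lra|apply Rlt_le, Rinv_0_lt_compat; lra|apply pow_incr; auto|].
    apply Rinv_le_contravar; [apply Rmult_lt_0_compat; lra|]. apply Rmult_le_compat_l; lra.
Qed.

Lemma ccont_Sf th : 0 < th < 1 -> ccont (fun t => RtoC (Sf th (exp t))).
Proof.
  intro H. pose proof (sin_PI_pos th H) as Hs. apply ccont_derivable. intro t. unfold Sf, sinh. auto_derive.
  assert (0 < sin (PI * th) * (sin (PI * th) * 1)) by nra.
  match goal with |- context [sin (PI * th) * (sin (PI * th) * 1) + ?q * (?q * 1)] => pose proof (Rle_0_sqr q) as Hq; unfold Rsqr in Hq end. nra.
Qed.

Lemma exp_bounded_shift_lin (p : C) W M al be : 0 < Re p + al -> Re p < be ->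
  (forall t, t <= 0 -> Cmod (W t) <= M * exp (al * t)) -> (forall t, 0 <= t -> Cmod (W t) <= M * exp (- be * t)) ->
  exp_bounded (fun t => (cexp (p * t) * W t)%C) (M + M) (Rmin (Re p + al) (be - Re p)).
Proof.
  intros H1 H2 W1 W2. apply exp_bounded_two; try lra; intros t Ht; rewrite Cmod_mult, Cmod_cexp_lin.
  - replace ((Re p + al) * t) with (Re p * t + al * t) by ring. rewrite exp_plus.
    specialize (W1 t Ht). pose proof (exp_pos (Re p * t)). nra.
  - replace (- (be - Re p) * t) with (Re p * t + - be * t) by ring. rewrite exp_plus.
    specialize (W2 t Ht). pose proof (exp_pos (Re p * t)). nra.
Qed.

Lemma sqr_le_exp y : 0 <= y -> y ^ 2 <= 4 * exp y.
Proof.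
  intro Hy. assert (H : y / 2 <= exp (y / 2)).
  { destruct (Req_dec y 0) as [->|N]; [pose proof (exp_pos (0 / 2)); lra|]. pose proof (exp_ineq1 (y / 2) ltac:(lra)); lra. }
  replace y with (y / 2 + y / 2) at 2 by field. rewrite exp_plus. nra.
Qed.

(* With u = e^t this is the integral of u^(-s) W du over (0, oo). *)
Definition mellin (W : R -> C) (s : C) : C := lint (fun t => (cexp ((1 - s) * t) * W t)%C).

Lemma mellin_correct W M al be s : ccont W -> (forall t, t <= 0 -> Cmod (W t) <= M * exp (al * t)) ->
  (forall t, 0 <= t -> Cmod (W t) <= M * exp (- be * t)) -> 1 - be < Re s < 1 + al ->
  is_lint (fun t => (cexp ((1 - s) * t) * W t)%C) (mellin W s).
Proof.
  intros Hc W1 W2 Hs. assert (HR : Re (1 - s) = 1 - Re s) by reflexivity.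
  apply (lint_correct _ (M + M) (Rmin (Re (1 - s) + al) (be - Re (1 - s)))).
  - apply Rmin_glb_lt; lra.
  - apply ccont_mult; [apply ccont_cexp0|auto].
  - apply exp_bounded_shift_lin; auto; lra.
Qed.

(** Differentiation under the integral sign: the derivative is the integral of - t times the
    integrand, and the second order remainder is at most 4 |h|^2 t^2 exp(|h| |t|) times the
    integrand. *)
Lemma mellin_cdiff P W M al be z : ccont W -> (forall t, t <= 0 -> Cmod (W t) <= M * exp (al * t)) ->
  (forall t, 0 <= t -> Cmod (W t) <= M * exp (- be * t)) -> 1 - be < Re z < 1 + al ->
  cdiff P (mellin W) z.
Proof.
  intros Hc W1 W2 Hz. apply cdiff_mono with (fun _ => True); [auto|].
  assert (HM : 0 <= M). { specialize (W1 0 (Rle_refl _)). rewrite Rmult_0_r, exp_0 in W1. pose proof (Cmod_ge_0 (W 0)); lra. }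
  set (g := Rmin (1 - Re z + al) (be - (1 - Re z))). assert (Hg : 0 < g) by (apply Rmin_glb_lt; lra).
  (* One quarter of the decay rate g pays for exp(|h| |t|), another for t^2, and the rate eta is
     still left. *)
  set (eta := g / 4). assert (Heta : 0 < eta) by (unfold eta; lra).
  assert (Hdom : exp_bounded (fun t => (cexp ((1 - z) * t) * W t)%C) (M + M) g).
  { apply exp_bounded_shift_lin; auto; change (Re (1 - z)) with (1 - Re z); lra. }
  assert (Hcz : ccont (fun t => (cexp ((1 - z) * t) * W t)%C)) by (apply ccont_mult; [apply ccont_cexp0|auto]).
  set (f1 := fun t : R => (RtoC (- t) * (cexp ((1 - z) * t) * W t))%C).
  assert (Hc1 : ccont f1).
  { apply (ccont_mult (fun t => RtoC (- t))); auto. apply ccont_derivable. intro t. auto_derive; auto. }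
  assert (Hd1 : exp_bounded f1 (/ eta * (M + M)) (g - eta)).
  { intro t. unfold f1. rewrite Cmod_mult, Cmod_R, Rabs_Ropp. specialize (Hdom t).
    assert (Ht : Rabs t <= / eta * exp (eta * Rabs t)).
    { pose proof (Rabs_pos t). apply Rmult_le_reg_l with eta; auto. rewrite <- Rmult_assoc, Rinv_r, Rmult_1_l by lra.
      destruct (Req_dec (eta * Rabs t) 0) as [->|N]; [rewrite exp_0; lra|]. pose proof (exp_ineq1 (eta * Rabs t) N); lra. }
    replace (- (g - eta) * Rabs t) with (eta * Rabs t + - g * Rabs t) by ring. rewrite exp_plus.
    replace (/ eta * (M + M) * (exp (eta * Rabs t) * exp (- g * Rabs t))) with ((/ eta * exp (eta * Rabs t)) * ((M + M) * exp (- g * Rabs t))) by ring.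
    apply Rmult_le_compat; auto; [apply Rabs_pos|apply Cmod_ge_0]. }
  assert (H1 : is_lint f1 (lint f1)) by (apply (lint_correct _ (/ eta * (M + M)) (g - eta)); auto; unfold eta; lra).
  (* 16 is the 4 of [cexp_m2_le] times the 4 of [sqr_le_exp]. *)
  set (Q := 16 * / eta ^ 2 * (M + M)).
  assert (HQ : 0 <= Q). { unfold Q. assert (0 < / eta ^ 2) by (apply Rinv_0_lt_compat, pow_lt; auto). nra. }
  assert (Main : forall w, Cmod (w - z) < eta -> Cmod (mellin W w - mellin W z - lint f1 * (w - z)) <= 4 * (Q * Cmod (w - z) ^ 2 / eta)).
  { intros w Hw. set (h := (w - z)%C) in *.
    assert (Hrew : 1 - be < Re w < 1 + al).
    { pose proof (re_le_Cmod h) as Hr. unfold h in Hr. change (Re (w - z)) with (Re w - Re z) in Hr. fold h in Hr.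
      pose proof (Rle_abs (Re w - Re z)). pose proof (Rle_abs (- (Re w - Re z))) as Hn. rewrite Rabs_Ropp in Hn.
      pose proof (Rmin_l (1 - Re z + al) (be - (1 - Re z))). pose proof (Rmin_r (1 - Re z + al) (be - (1 - Re z))).
      fold g in H0, H2. unfold eta in *. lra. }
    apply (is_lint_le (fun t => (cexp ((1 - w) * t) * W t - cexp ((1 - z) * t) * W t - h * f1 t)%C)); auto.
    - intro t.
      replace (cexp ((1 - w) * t) * W t - cexp ((1 - z) * t) * W t - h * f1 t)%C with
        ((cexp (- h * t) - 1 - (- h * t)) * (cexp ((1 - z) * t) * W t))%C.
      + rewrite Cmod_mult. specialize (Hdom t). pose proof (cexp_m2_le (- h * t)) as Hb.
        assert (EC : Cmod (- h * t) = Cmod h * Rabs t) by (rewrite Cmod_mult, Cmod_opp, Cmod_R; auto). rewrite EC in Hb.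
        pose proof (Rabs_pos t) as Ht. pose proof (Cmod_ge_0 h) as Hh.
        assert (Hb2 : exp (Cmod h * Rabs t) <= exp (eta * Rabs t)) by (apply exp_le; nra).
        assert (Hb3 : (eta * Rabs t) ^ 2 <= 4 * exp (eta * Rabs t)) by (apply sqr_le_exp; nra).
        assert (Hb4 : Rabs t ^ 2 <= / eta ^ 2 * (4 * exp (eta * Rabs t))).
        { apply Rmult_le_reg_l with (eta ^ 2); [apply pow_lt; auto|]. rewrite <- Rmult_assoc, Rinv_r, Rmult_1_l by (apply pow_nonzero; lra).
          rewrite Rpow_mult_distr in Hb3. exact Hb3. }
        replace (- eta * Rabs t) with (eta * Rabs t + eta * Rabs t + (eta * Rabs t + - g * Rabs t)) by (unfold eta; field).
        rewrite (exp_plus (_ + _)), (exp_plus (eta * Rabs t) (eta * Rabs t)), (exp_plus (eta * Rabs t) (- g * Rabs t)).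
        set (X := exp (eta * Rabs t)) in *. assert (HX : 1 <= X) by (unfold X; rewrite <- exp_0; apply exp_le; nra).
        apply Rle_trans with ((4 * ((Cmod h) ^ 2 * (/ eta ^ 2 * (4 * X)) * X)) * ((M + M) * exp (- g * Rabs t))).
        * apply Rmult_le_compat; auto; try apply Cmod_ge_0. eapply Rle_trans; [exact Hb|]. rewrite Rpow_mult_distr.
          apply Rmult_le_compat_l; [lra|]. apply Rmult_le_compat; auto.
          -- pose proof (pow2_ge_0 (Cmod h)); pose proof (pow2_ge_0 (Rabs t)). nra.
          -- apply Rlt_le, exp_pos.
          -- apply Rmult_le_compat_l; [apply pow2_ge_0|auto].
        * unfold Q.
          replace (16 * / eta ^ 2 * (M + M) * Cmod h ^ 2 * (X * X * (X * exp (- g * Rabs t)))) with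
            (4 * (Cmod h ^ 2 * (/ eta ^ 2 * (4 * X)) * X) * ((M + M) * exp (- g * Rabs t)) * X) by ring.
          rewrite <- (Rmult_1_r (4 * (Cmod h ^ 2 * (/ eta ^ 2 * (4 * X)) * X) * ((M + M) * exp (- g * Rabs t)))) at 1.
          apply Rmult_le_compat_l; auto. pose proof (exp_pos (- g * Rabs t)). pose proof (pow2_ge_0 (Cmod h)).
          assert (0 < / eta ^ 2) by (apply Rinv_0_lt_compat, pow_lt; auto).
          repeat apply Rmult_le_pos; lra.
      + unfold f1. replace ((1 - w) * t)%C with (- h * t + (1 - z) * t)%C by (unfold h; ring). rewrite cexp_plus, RtoC_opp. ring.
    - replace (lint f1 * h)%C with (h * lint f1)%C by ring.
      apply is_lint_minus; [apply is_lint_minus|apply is_lint_scal; auto]; eapply mellin_correct; eauto. }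
  apply cdiff_of_quotient with (lint f1). intros eps He.
  exists (Rmin eta (eps * eta / (4 * (Q + 1)))). split.
  { apply Rmin_glb_lt; auto. apply Rdiv_lt_0_compat; [nra|lra]. }
  intros w _ Hw. pose proof (Rlt_le_trans _ _ _ Hw (Rmin_l _ _)) as Hw1. pose proof (Rlt_le_trans _ _ _ Hw (Rmin_r _ _)) as Hw2.
  eapply Rle_trans; [apply Main; auto|]. pose proof (Cmod_ge_0 (w - z)) as Hh.
  replace (4 * (Q * Cmod (w - z) ^ 2 / eta)) with ((4 * Q / eta * Cmod (w - z)) * Cmod (w - z)) by (field; lra).
  apply Rmult_le_compat_r; auto.
  apply Rle_trans with (4 * Q / eta * (eps * eta / (4 * (Q + 1)))).
  - apply Rmult_le_compat_l; [|lra]. apply Rdiv_le_0_compat; lra.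
  - replace (4 * Q / eta * (eps * eta / (4 * (Q + 1)))) with (eps * (Q / (Q + 1))) by (field; lra).
    rewrite <- (Rmult_1_r eps) at 2. apply Rmult_le_compat_l; [lra|].
    apply Rmult_le_reg_r with (Q + 1); [lra|]. unfold Rdiv. rewrite Rmult_assoc, Rinv_l; lra.
Qed.

Lemma Rpower_neg_le a b e : 0 < b <= a -> e <= 0 -> Rpower a e <= Rpower b e.
Proof. intros H He. apply exp_le. assert (ln b <= ln a) by (apply ln_le; lra). nra. Qed.

Lemma Rpower_gt0 a e : 0 < Rpower a e.
Proof. apply exp_pos. Qed.

Lemma exp_bounded_mono f M M' c : M <= M' -> exp_bounded f M c -> exp_bounded f M' c.
Proof. intros H Hf t. specialize (Hf t). pose proof (exp_pos (- c * Rabs t)). nra. Qed.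

Lemma exp_bounded_minus f g M M' c : exp_bounded f M c -> exp_bounded g M' c -> exp_bounded (fun t => (f t - g t)%C) (M + M') c.
Proof.
  intros Hf Hg t. specialize (Hf t). specialize (Hg t). unfold Cminus.
  pose proof (Cmod_triangle (f t) (- g t)) as H. rewrite Cmod_opp in H. lra.
Qed.

(** a^2 + e^(2t) is at least the weighted geometric mean a^del e^((2-del) t). This trades decay in t
    for an extra factor a^(-del), without which the weight 1/a would not be summable over a = m +
    th. *)
Lemma exp_bounded_qJ_weighted p a del th0 : 0 < del < 1 -> 0 < Re p < 2 - del -> 0 < th0 <= a ->
  exp_bounded (fun t => (RtoC (/ a) * qJ p a t)%C) ((Rpower th0 (- 2 + del) + 1) * Rpower a (- 1 - del)) (Rmin (Re p) (2 - del - Re p)).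
Proof.
  intros Hd Hp Ha. assert (Ha0 : 0 < a) by lra.
  assert (Ea : / a = Rpower a (- 1 - del) * Rpower a del).
  { rewrite <- Rpower_plus. replace (-1 - del + del) with (- (1)) by ring. rewrite Rpower_Ropp, Rpower_1; auto. }
  rewrite Rmult_plus_distr_r, Rmult_1_l.
  apply exp_bounded_two; try lra; intros t Ht; unfold qJ; rewrite !Cmod_mult, Cmod_cexp_lin;
    rewrite !Cmod_RtoC_pos by (apply Rlt_le, Rinv_0_lt_compat; try lra; pose proof (exp_pos (2 * t)); nra); rewrite Ea;
    pose proof (Rpower_gt0 a (-1 - del)) as P1; pose proof (Rpower_gt0 a del) as P2; pose proof (exp_pos (2 * t)) as P3.
  - assert (H1 : / (a ^ 2 + exp (2 * t)) <= Rpower a (- 2)).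
    { replace (- 2) with (- INR 2) by (simpl; ring). rewrite Rpower_Ropp, Rpower_pow by auto.
      apply Rinv_le_contravar; [apply pow_lt; auto|lra]. }
    assert (H2 : Rpower a del * Rpower a (-2) <= Rpower th0 (- 2 + del)).
    { rewrite <- Rpower_plus. replace (del + -2) with (-2 + del) by ring. apply Rpower_neg_le; lra. }
    pose proof (exp_pos (Re p * t)).
    replace (Rpower a (-1 - del) * Rpower a del * (exp (Re p * t) * / (a ^ 2 + exp (2 * t)))) with
      ((Rpower a (-1 - del) * exp (Re p * t)) * (Rpower a del * / (a ^ 2 + exp (2 * t)))) by ring.
    replace (Rpower th0 (-2 + del) * Rpower a (-1 - del) * exp (Re p * t)) with ((Rpower a (-1 - del) * exp (Re p * t)) * Rpower th0 (-2 + del)) by ring.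
    apply Rmult_le_compat_l; [nra|]. eapply Rle_trans; [|exact H2]. apply Rmult_le_compat_l; lra.
  - assert (H1 : Rpower a del * exp ((2 - del) * t) <= a ^ 2 + exp (2 * t)).
    { unfold Rpower. rewrite <- exp_plus, <- exp_2ln by auto.
      pose proof (exp_pos (2 * ln a)). pose proof (exp_pos (2 * t)).
      destruct (Rle_dec (ln a) t) as [L|L].
      - assert (exp (del * ln a + (2 - del) * t) <= exp (2 * t)) by (apply exp_le; nra). lra.
      - assert (exp (del * ln a + (2 - del) * t) <= exp (2 * ln a)) by (apply exp_le; nra). lra. }
    rewrite !Rmult_assoc. apply Rmult_le_compat_l; [lra|].
    replace (- (2 - del - Re p) * t) with (Re p * t + - ((2 - del) * t)) by ring. rewrite exp_plus, exp_Ropp.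
    pose proof (exp_pos (Re p * t)). pose proof (exp_pos ((2 - del) * t)).
    replace (Rpower a del * (exp (Re p * t) * / (a ^ 2 + exp (2 * t)))) with (exp (Re p * t) * (Rpower a del * / (a ^ 2 + exp (2 * t)))) by ring.
    apply Rmult_le_compat_l; [lra|]. 
    apply Rmult_le_reg_r with ((a ^ 2 + exp (2 * t)) * exp ((2 - del) * t)); [apply Rmult_lt_0_compat; nra|].
    replace (Rpower a del * / (a ^ 2 + exp (2 * t)) * ((a ^ 2 + exp (2 * t)) * exp ((2 - del) * t))) with (Rpower a del * exp ((2 - del) * t)) by (field; nra).
    replace (/ exp ((2 - del) * t) * ((a ^ 2 + exp (2 * t)) * exp ((2 - del) * t))) with (a ^ 2 + exp (2 * t)) by (field; lra). auto.
Qed.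

(** Both families of arguments are compared with m + 1, which reduces the estimates in m to sums of
    powers of m + 1. *)
Lemma shifted_ge th m : 0 < th < 1 -> Rmin th (1 - th) * INR (S m) <= INR m + th /\ Rmin th (1 - th) * INR (S m) <= INR m + 1 - th
  /\ Rmin th (1 - th) <= INR m + th /\ Rmin th (1 - th) <= INR m + 1 - th /\ 0 < Rmin th (1 - th) <= 1.
Proof.
  intros H. pose proof (pos_INR m). rewrite S_INR. pose proof (Rmin_l th (1 - th)). pose proof (Rmin_r th (1 - th)).
  assert (0 < Rmin th (1 - th)) by (apply Rmin_glb_lt; lra). repeat split; nra.
Qed.

Lemma kJ_3 s : kJ (3 - s) = (- ((PI / 2)%R / Ccos ((PI / 2)%R * s)))%C.
Proof.
  unfold kJ. replace ((PI / 2)%R * (3 - s))%C with (- ((PI / 2)%R * s) + (PI / 2)%R + PI)%C.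
  2: { replace (RtoC PI) with (2 * (PI / 2)%R)%C by (rewrite <- RtoC_mult; f_equal; field). ring. }
  rewrite Csin_plus, Csin_RtoC, Ccos_RtoC, sin_PI, cos_PI, Csin_PI2, Ccos_opp.
  replace (Ccos ((PI / 2)%R * s) * (-1)%R + Ccos (- ((PI / 2)%R * s) + (PI / 2)%R) * 0)%C with (- Ccos ((PI / 2)%R * s))%C.
  2: apply C_ext; simpl; ring.
  destruct (Ceq_dec (Ccos ((PI / 2)%R * s)) 0) as [E|E].
  - rewrite E. unfold Cdiv. replace (- 0)%C with (RtoC 0) by ring.
    replace (/ 0)%C with (RtoC 0); [ring|]. unfold Cinv. apply C_ext; simpl; unfold Rdiv; ring.
  - field. auto.
Qed.

Lemma kJ_1 s : kJ (1 - s) = ((PI / 2)%R / Ccos ((PI / 2)%R * s))%C.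
Proof.
  unfold kJ. replace ((PI / 2)%R * (1 - s))%C with (- ((PI / 2)%R * s) + (PI / 2)%R)%C by ring.
  now rewrite Csin_PI2, Ccos_opp.
Qed.

Lemma Ccos_half_neq s : 1 < Re s < 3 -> Ccos ((PI / 2)%R * s) <> RtoC 0.
Proof.
  intros Hs E. apply (sin_half_neq (s - 1)).
  - change (Re (s - 1)) with (Re s - 1). lra.
  - replace ((PI / 2)%R * (s - 1))%C with ((PI / 2)%R * s + - (PI / 2)%R)%C by ring.
    rewrite Csin_plus, Ccos_opp, Csin_opp, Csin_RtoC, Ccos_RtoC, sin_PI2, cos_PI2, E. ring.
Qed.

(** a/(a^2 + u^2) - 1/a = - u^2/(a (a^2 + u^2)): subtracting the value at u = 0 turns each term of
    [Sf_series] into a multiple of [qJ (3 - s) a], with exponent in the strip of [lint_qJ], and its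
    integral into a multiple of a^(-s). *)
Lemma Hd_lint_right th s H : 0 < th < 1 -> 1 < Re s < 2 ->
  cser (fun m => (cpow (INR m + th) (- s) - cpow (INR m + 1 - th) (- s))%C) H ->
  exists l, is_lint (fun t => (cexp ((1 - s) * t) * RtoC (Sf th (exp t) - Sf th 0))%C) l /\ H = (4 * Ccos ((PI / 2)%R * s) * l)%C.
Proof.
  intros Hth Hs HH. pose proof PI_RGT_0 as HPI.
  set (p := (3 - s)%C). assert (Hp : 1 < Re p < 2) by (unfold p; change (Re (3 - s)) with (3 - Re s); lra).
  assert (Hpr : Re p = 3 - Re s) by reflexivity.
  (* Any del with 0 < del < Re s - 1 gives Re p < 2 - del. *)
  set (del := (Re s - 1) / 2). set (th0 := Rmin th (1 - th)).
  assert (Hdel : 0 < del < 1) by (unfold del; lra).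
  set (c := Rmin (Re p) (2 - del - Re p)). assert (Hc : 0 < c) by (apply Rmin_glb_lt; unfold del; lra).
  set (K := Rpower th0 (- 2 + del) + 1).
  assert (HK : 0 < K) by (unfold K; pose proof (Rpower_gt0 th0 (-2 + del)); lra).
  destruct (rser_pseries del ltac:(lra)) as [sg Hsg].
  set (fk := fun (m : nat) t => (RtoC (/ (INR m + 1 - th)) * qJ p (INR m + 1 - th) t - RtoC (/ (INR m + th)) * qJ p (INR m + th) t)%C).
  set (lk := fun (m : nat) => (((PI / 2)%R / Ccos ((PI / 2)%R * s)) * (cpow (INR m + th) (- s) - cpow (INR m + 1 - th) (- s)))%C).
  assert (Hl1 : forall a, 0 < a -> is_lint (fun t => (RtoC (/ a) * qJ p a t)%C) (- ((PI / 2)%R / Ccos ((PI / 2)%R * s)) * cpow a (- s))%C).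
  { intros a Ha. pose proof (is_lint_scal (RtoC (/ a)) _ _ (lint_qJ p a ltac:(lra) Ha)) as Hq.
    replace (- ((PI / 2)%R / Ccos ((PI / 2)%R * s)) * cpow a (- s))%C with (RtoC (/ a) * (cexp ((p - 2) * ln a) * kJ p))%C; auto.
    unfold p at 2. rewrite kJ_3. rewrite <- (cpow_cexp a). unfold p. replace (3 - s - 2)%C with (1 + - s)%C by ring.
    rewrite cpow_plus, cpow_1 by auto. rewrite RtoC_inv by lra.
    replace (/ a * (a * cpow a (- s) * - ((PI / 2)%R / Ccos ((PI / 2)%R * s))))%C with
     ((/ a * a) * (cpow a (- s) * - ((PI / 2)%R / Ccos ((PI / 2)%R * s))))%C by ring.
    rewrite Cinv_l by (apply RtoC_neq_0; lra). ring. }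
  destruct (lint_series fk (fun t => ((2 * PI)%R * (cexp ((1 - s) * t) * RtoC (Sf th (exp t) - Sf th 0)))%C) lk
    (fun m => (2 * K * Rpower th0 (- 1 - del)) * Rpower (INR (S m)) (- 1 - del)) (2 * K * Rpower th0 (- 1 - del) * sg) c) as (l & Hl & Hser); auto.
  - intro m. destruct (shifted_ge th m Hth) as (S1 & S2 & S3 & S4 & S5). fold th0 in S1, S2, S3, S4, S5.
    unfold fk, lk.
    replace ((PI / 2)%R / Ccos ((PI / 2)%R * s) * (cpow (INR m + th) (- s) - cpow (INR m + 1 - th) (- s)))%C with
      (- ((PI / 2)%R / Ccos ((PI / 2)%R * s)) * cpow (INR m + 1 - th) (- s) - - ((PI / 2)%R / Ccos ((PI / 2)%R * s)) * cpow (INR m + th) (- s))%C by ring.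
    apply is_lint_minus; apply Hl1; lra.
  - intro m. destruct (shifted_ge th m Hth) as (S1 & S2 & S3 & S4 & S5). fold th0 in S1, S2, S3, S4, S5.
    assert (HS : 0 < INR (S m)) by (apply lt_0_INR; lia).
    assert (B : forall a, th0 * INR (S m) <= a -> th0 <= a ->
      exp_bounded (fun t => (RtoC (/ a) * qJ p a t)%C) (K * Rpower th0 (- 1 - del) * Rpower (INR (S m)) (- 1 - del)) c).
    { intros a A1 A2. eapply exp_bounded_mono; [|apply (exp_bounded_qJ_weighted p a del th0)]; try lra; [|unfold del in *; lra].
      fold K. rewrite Rmult_assoc. apply Rmult_le_compat_l; [lra|].
      rewrite Rpower_mult_distr by lra. apply Rpower_neg_le; [|lra]. split; [|auto]. nra. }
    replace (2 * K * Rpower th0 (-1 - del) * Rpower (INR (S m)) (-1 - del)) with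
     (K * Rpower th0 (-1 - del) * Rpower (INR (S m)) (-1 - del) + K * Rpower th0 (-1 - del) * Rpower (INR (S m)) (-1 - del)) by ring.
    apply exp_bounded_minus; apply B; auto.
  - now apply rser_scal.
  - apply (ccont_mult (fun _ => RtoC (2 * PI))); [apply ccont_const|]. apply (ccont_mult (fun t : R => cexp ((1 - s) * t))); [apply ccont_cexp0|].
    apply ccont_ext with (fun t => (RtoC (Sf th (exp t)) - RtoC (Sf th 0))%C); [intro; now rewrite RtoC_minus|].
    apply (ccont_minus (fun t => RtoC (Sf th (exp t)))); [now apply ccont_Sf|apply ccont_const].
  - intro t. pose proof (Sf_series th (exp t) Hth) as A1. pose proof (Sf_series th 0 Hth) as A2.
    apply cser_RtoC in A1. apply cser_RtoC in A2. pose proof (cser_minus _ _ _ _ A1 A2) as A3.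
    apply (cser_scal (cexp ((1 - s) * t))) in A3.
    replace ((2 * PI)%R * (cexp ((1 - s) * t) * (Sf th (exp t) - Sf th 0)%R))%C with (cexp ((1 - s) * t) * ((2 * PI * Sf th (exp t))%R - (2 * PI * Sf th 0)%R))%C.
    2: rewrite !RtoC_minus, !RtoC_mult; ring.
    eapply cser_ext; [|exact A3]. intro m. cbv beta. unfold fk, qJ.
    destruct (shifted_ge th m Hth) as (S1 & S2 & S3 & S4 & S5). fold th0 in S1, S2, S3, S4, S5.
    replace (p * t)%C with ((1 - s) * t + RtoC (2 * t))%C by (unfold p; rewrite RtoC_mult; ring).
    rewrite cexp_plus, cexp_RtoC.
    replace (exp t ^ 2) with (exp (2 * t)) by (replace (2 * t) with (t + t) by ring; rewrite exp_plus; ring).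
    pose proof (exp_pos (2 * t)) as P.
    match goal with |- (cexp ?X * ?A)%C = ?Z => replace Z with (cexp X * (RtoC (/ (INR m + 1 - th)) * (RtoC (exp (2 * t)) * RtoC (/ ((INR m + 1 - th) ^ 2 + exp (2 * t))))
       - RtoC (/ (INR m + th)) * (RtoC (exp (2 * t)) * RtoC (/ ((INR m + th) ^ 2 + exp (2 * t))))))%C by ring end.
    f_equal. rewrite <- !RtoC_mult, <- !RtoC_minus. f_equal. field. repeat split; nra.
  - assert (E : l = ((PI / 2)%R / Ccos ((PI / 2)%R * s) * H)%C).
    { apply (cser_unique lk); auto. unfold lk. now apply cser_scal. }
    apply (is_lint_scal (/ (2 * PI)%R)) in Hl. exists (/ (2 * PI)%R * l)%C.
    assert (N1 : RtoC (2 * PI) <> RtoC 0) by (apply RtoC_neq_0; lra).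
    assert (N2 : Ccos ((PI / 2)%R * s) <> RtoC 0) by (apply Ccos_half_neq; lra).
    split.
    + eapply is_lint_ext; [|exact Hl]. intro t. cbv beta. field. auto.
    + rewrite E. clear - N2 HPI. set (X := Ccos ((PI / 2)%R * s)) in *. rewrite RtoC_mult, RtoC_div by lra. field.
      repeat split; auto. apply RtoC_neq_0; lra.
Qed.

(* Subtracting Sf th 0 / (1 + u^2) makes the Mellin transform converge on -1 < Re s < 3, across the pole s = 1. *)
Definition Df (th : R) (t : R) : C := RtoC (Sf th (exp t) - Sf th 0 * / (1 + exp (2 * t))).

Lemma ccont_Df th : 0 < th < 1 -> ccont (Df th).
Proof.
  intro H. pose proof (sin_PI_pos th H) as Hs. apply ccont_derivable. intro t. unfold Sf, sinh. auto_derive.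
  assert (0 < sin (PI * th) * (sin (PI * th) * 1)) by nra. pose proof (exp_pos (2 * t)).
  repeat split; match goal with |- context [sin (PI * th) * (sin (PI * th) * 1) + ?q * (?q * 1)] => pose proof (Rle_0_sqr q) as Hq; unfold Rsqr in Hq | _ => idtac end; nra.
Qed.

Lemma Df_bounds th : 0 < th < 1 -> exists M, 0 < M /\ (forall t, t <= 0 -> Cmod (Df th t) <= M * exp (2 * t)) /\
  (forall t, 0 <= t -> Cmod (Df th t) <= M * exp (- (2) * t)).
Proof.
  intros H. destruct (Sf_near0 th H) as (K & HK & HKb). destruct (Sf_decay th 2 H ltac:(lra)) as (M & HM & HMb).
  pose proof (Sf_bound th 0 H) as HB. set (B := / sin (PI * th) ^ 2) in *.
  assert (HB0 : 0 < B) by (apply Rinv_0_lt_compat, pow_lt, sin_PI_pos; auto).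
  exists (K + M + B). split; [lra|]. split; intros t Ht; unfold Df; rewrite Cmod_R; pose proof (exp_pos (2 * t)) as P.
  - assert (E2 : exp (2 * t) = exp t ^ 2) by (replace (2 * t) with (t + t) by ring; rewrite exp_plus; ring).
    replace (Sf th (exp t) - Sf th 0 * / (1 + exp (2 * t))) with ((Sf th (exp t) - Sf th 0) + Sf th 0 * (exp (2 * t) * / (1 + exp (2 * t)))) by (field; lra).
    eapply Rle_trans; [apply Rabs_triang|]. rewrite Rabs_mult.
    assert (Q : 0 <= exp (2 * t) * / (1 + exp (2 * t)) <= exp (2 * t)).
    { assert (0 < / (1 + exp (2 * t)) <= 1). { split; [apply Rinv_0_lt_compat; lra|]. rewrite <- Rinv_1. apply Rinv_le_contravar; lra. } nra. }
    rewrite (Rabs_pos_eq (exp (2 * t) * _)) by apply Q.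
    assert (exp t <= 1) by (rewrite <- exp_0; now apply exp_le). pose proof (exp_pos t).
    specialize (HKb (exp t) ltac:(lra)). rewrite <- E2 in HKb. pose proof (Rabs_pos (Sf th 0)).
    assert (Rabs (Sf th 0) * (exp (2 * t) * / (1 + exp (2 * t))) <= B * exp (2 * t)) by (apply Rmult_le_compat; lra).
    assert (0 <= M * exp (2 * t)) by nra. lra.
  - specialize (HMb t Ht). eapply Rle_trans; [apply Rabs_triang|]. rewrite Rabs_Ropp, Rabs_mult.
    assert (Q : 0 < / (1 + exp (2 * t)) <= exp (- (2) * t)).
    { split; [apply Rinv_0_lt_compat; lra|]. replace (- (2) * t) with (- (2 * t)) by ring. rewrite exp_Ropp. apply Rinv_le_contravar; lra. }
    rewrite (Rabs_pos_eq (/ _)) by lra. pose proof (Rabs_pos (Sf th 0)).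
    assert (Rabs (Sf th 0) * / (1 + exp (2 * t)) <= B * exp (- (2) * t)) by (apply Rmult_le_compat; lra).
    assert (0 <= K * exp (- (2) * t)) by (pose proof (exp_pos (- (2) * t)); nra). lra.
Qed.

(** Passing from Sf - Sf(0) to [Df] adds Sf(0) u^2/(1 + u^2), whose transform is - Sf(0)
    (pi/2)/cos(pi s/2). The factor 4 cos(pi s/2) makes a constant of it, so nothing singular remains
    at s = 1. *)
Lemma Hd_E4 th s H : 0 < th < 1 -> 1 < Re s < 2 ->
  cser (fun m => (cpow (INR m + th) (- s) - cpow (INR m + 1 - th) (- s))%C) H ->
  H = (4 * Ccos ((PI / 2)%R * s) * mellin (Df th) s + (2 * PI * Sf th 0)%R)%C.
Proof.
  intros Hth Hs HH. destruct (Hd_lint_right th s H Hth Hs HH) as (l & Hl & ->).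
  assert (Hp : 0 < Re (3 - s) < 2) by (change (Re (3 - s)) with (3 - Re s); lra).
  pose proof (is_lint_plus _ _ _ _ Hl (is_lint_scal (RtoC (Sf th 0)) _ _ (lint_gJ (3 - s) Hp))) as H1.
  fold (kJ (3 - s)) in H1. rewrite kJ_3 in H1.
  assert (E : mellin (Df th) s = (l + Sf th 0 * - ((PI / 2)%R / Ccos ((PI / 2)%R * s)))%C).
  { apply is_lint_lint. eapply is_lint_ext; [|exact H1]. intro t. cbv beta. unfold gJ, Df.
    replace ((3 - s) * t)%C with ((1 - s) * t + RtoC (2 * t))%C by (rewrite RtoC_mult; ring).
    rewrite cexp_plus, cexp_RtoC.
    match goal with |- (?X * ?A + ?S * (?X * ?E * ?G))%C = _ => replace (X * A + S * (X * E * G))%C with (X * (A + S * (E * G)))%C by ring end.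
    f_equal. rewrite <- !RtoC_mult, <- RtoC_plus. f_equal. field. pose proof (exp_pos (2 * t)). lra. }
  rewrite E. assert (N2 : Ccos ((PI / 2)%R * s) <> RtoC 0) by (apply Ccos_half_neq; lra).
  clear - N2. set (X := Ccos ((PI / 2)%R * s)) in *. rewrite !RtoC_mult, RtoC_div by lra. field. auto.
Qed.

Lemma filterlim_eps (f : C -> C) (L : C) :
  filterlim f (within (fun s => s <> RtoC 1) (locally (RtoC 1))) (locally L) ->
  forall eps, 0 < eps -> exists del, 0 < del /\ forall w, w <> RtoC 1 -> Cmod (w - 1) < del -> Cmod (f w - L) < eps.
Proof.
  intros H eps He.
  assert (HP : locally L (fun y => Cmod (y - L) < eps)).
  { assert (He2 : 0 < eps / 2) by lra. exists (mkposreal _ He2). intros y [H1 H2].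
    change (Rabs (Re y - Re L) < eps / 2) in H1. change (Rabs (Im y - Im L) < eps / 2) in H2.
    eapply Rle_lt_trans; [apply Cmod_le_abs|].
    change (Re (y - L)) with (Re y - Re L). change (Im (y - L)) with (Im y - Im L). lra. }
  specialize (H _ HP). destruct H as [d Hd]. exists d. split; [apply cond_pos|]. intros w Hw1 Hw.
  apply (Hd w); auto. split.
  - eapply Rle_lt_trans; [|exact Hw]. apply (re_le_Cmod (w - 1)).
  - eapply Rle_lt_trans; [|exact Hw]. apply (Im_le_Cmod (w - 1)).
Qed.

Lemma cdiff_Ccos P z : cdiff P (fun w => Ccos ((PI / 2)%R * w)) z.
Proof.
  assert (H : cdiff P (fun w => ((cexp (Ci * ((PI / 2)%R * w)) + cexp (- (1) * (Ci * ((PI / 2)%R * w)))) * / 2)%C) z).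
  { apply cdiff_mult; [|apply cdiff_const]. apply cdiff_plus; apply cdiff_cexp;
    repeat (apply cdiff_mult || apply cdiff_const || apply cdiff_id). }
  destruct H as (phi & H1 & H2). exists phi. split; auto. intros w Hw. specialize (H2 w Hw).
  assert (E : forall w, Ccos ((PI / 2)%R * w) = ((cexp (Ci * ((PI / 2)%R * w)) + cexp (- (1) * (Ci * ((PI / 2)%R * w)))) * / 2)%C).
  { intro y. rewrite Ccos_cexp. replace (- (1) * (Ci * ((PI / 2)%R * y)))%C with (- (Ci * ((PI / 2)%R * y)))%C by ring. reflexivity. }
  rewrite !E. exact H2.
Qed.

Definition Sc (th t : R) : C := RtoC (Sf th (exp t)).

Lemma ccont_Sc th : 0 < th < 1 -> ccont (Sc th).
Proof. apply ccont_Sf. Qed.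

Section HurwitzDifference.
Variables (Zh : C -> R -> C) (th : R) (L : C).
Hypothesis HZ : is_hurwitz_zeta Zh.
Hypothesis Hth : 0 < th < 1.
Hypothesis HL : filterlim (fun s => Cminus (Zh s th) (Zh s (1 - th)))
    (within (fun s => s <> RtoC 1) (locally (RtoC 1))) (locally L).

Let Hd (s : C) : C := (Zh s th - Zh s (1 - th))%C.

Lemma Hd_cser s : 1 < Re s -> cser (fun m => (cpow (INR m + th) (- s) - cpow (INR m + 1 - th) (- s))%C) (Hd s).
Proof.
  intros Hs. destruct (HZ th ltac:(lra)) as [H1 _]. destruct (HZ (1 - th) ltac:(lra)) as [H2 _].
  specialize (H1 s Hs). specialize (H2 s Hs). apply Cis_series_cser in H1. apply Cis_series_cser in H2.
  eapply cser_ext; [|apply (cser_minus _ _ _ _ H1 H2)]. intro m. cbv beta.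
  now replace (INR m + (1 - th)) with (INR m + 1 - th) by ring.
Qed.

Lemma Hd_cdiff P s : s <> RtoC 1 -> cdiff P Hd s.
Proof.
  intros Hs. destruct (HZ th ltac:(lra)) as [_ H1]. destruct (HZ (1 - th) ltac:(lra)) as [_ H2].
  apply cdiff_mono with (fun _ => True); auto.
  apply cdiff_minus; apply C_differentiable_cdiff; auto.
Qed.

Lemma mellin_Df_cdiff P z : -1 < Re z < 3 -> cdiff P (mellin (Df th)) z.
Proof.
  intros Hz. destruct (Df_bounds th Hth) as (M & HM & B1 & B2).
  apply mellin_cdiff with M 2 2; auto; [now apply ccont_Df|lra].
Qed.

Let E4 (s : C) : C := (4 * Ccos ((PI / 2)%R * s) * mellin (Df th) s + (2 * PI * Sf th 0)%R)%C.

Lemma E4_cdiff P z : -1 < Re z < 3 -> cdiff P E4 z.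
Proof.
  intros Hz. apply cdiff_plus; [|apply cdiff_const]. apply cdiff_mult; [|now apply mellin_Df_cdiff].
  apply cdiff_mult; [apply cdiff_const|apply cdiff_Ccos].
Qed.

(* The hypothesis on L makes the singularity of the difference at s = 1 removable. *)
Lemma cdiff_at_1 : cdiff (strip 0 2) (fun s => ((s - 1) * (Hd s - E4 s))%C) 1.
Proof.
  exists (fun w => if Ceq_dec w 1 then (L - E4 1)%C else (Hd w - E4 w)%C). split.
  - apply eps_ccontat. intros eps He.
    destruct (filterlim_eps _ _ HL (eps / 2) ltac:(lra)) as (d1 & Hd1 & G1).
    assert (HE : ccontat (strip 0 2) E4 1).
    { apply cdiff_ccontat, E4_cdiff. simpl. lra. }
    destruct (ccontat_eps _ _ _ HE (eps / 2) ltac:(lra)) as (d2 & Hd2 & G2).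
    exists (Rmin d1 d2). split; [now apply Rmin_glb_lt|]. intros w Hw Hwd.
    destruct (Ceq_dec 1 1) as [_|N]; [|easy]. destruct (Ceq_dec w 1) as [->|N].
    + replace (L - E4 1 - (L - E4 1))%C with (RtoC 0) by ring. rewrite Cmod_0. auto.
    + specialize (G1 w N (Rlt_le_trans _ _ _ Hwd (Rmin_l _ _))).
      specialize (G2 w Hw (Rlt_le_trans _ _ _ Hwd (Rmin_r _ _))).
      replace (Hd w - E4 w - (L - E4 1))%C with ((Hd w - L) + - (E4 w - E4 1))%C by ring.
      eapply Rle_lt_trans; [apply Cmod_triangle|]. rewrite Cmod_opp. unfold Hd. lra.
  - intros w _. destruct (Ceq_dec w 1) as [->|N]; ring.
Qed.

(** [E4] is differentiable on -1 < Re s < 3 and agrees with the zeta difference for 1 < Re s < 2.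
    The factor s - 1 makes the discrepancy differentiable at 1 as well, so that uniqueness applies
    in the whole strip. *)
Lemma hurwitz_diff_right s : strip 0 2 s -> s <> RtoC 1 -> Hd s = E4 s.
Proof.
  intros Hs Hs1.
  assert (H : ((s - 1) * (Hd s - E4 s))%C = RtoC 0).
  { apply (strip_unique (fun s => ((s - 1) * (Hd s - E4 s))%C) 0 (3 / 2) 2); [lra| | |exact Hs].
    - intros z Hz. destruct (Ceq_dec z 1) as [->|N]; [apply cdiff_at_1|].
      apply cdiff_mult; [apply cdiff_minus; [apply cdiff_id|apply cdiff_const]|].
      apply cdiff_minus; [now apply Hd_cdiff|apply E4_cdiff]. unfold strip in Hz. lra.
    - intros z Hz. unfold E4. rewrite <- (Hd_E4 th z (Hd z)); [ring|auto|lra|]. apply Hd_cser. lra. }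
  assert (Hn : (s - 1)%C <> RtoC 0). { intro E. apply Hs1. replace s with ((s - 1) + 1)%C by ring. rewrite E. ring. }
  replace (Hd s) with ((Hd s - E4 s) + E4 s)%C by ring.
  replace (Hd s - E4 s)%C with (/ (s - 1) * ((s - 1) * (Hd s - E4 s)))%C by (field; auto). rewrite H. ring.
Qed.

(** At s = 1 the cosine vanishes and [E4] reduces to its constant; the limit is taken along 1 +
    1/(n+2), which stays in the strip and off 1. *)
Lemma hurwitz_diff_at_1 : L = RtoC (2 * PI * Sf th 0).
Proof.
  assert (HE : ccontat (strip 0 2) E4 1) by (apply cdiff_ccontat, E4_cdiff; simpl; lra).
  assert (E1 : E4 1 = RtoC (2 * PI * Sf th 0)).
  { unfold E4. replace (RtoC (PI / 2) * 1)%C with (RtoC (PI / 2)) by ring. rewrite Ccos_RtoC, cos_PI2. ring. }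
  rewrite <- E1.
  set (u := fun n : nat => (1 + RtoC (/ (INR n + 2)))%C).
  assert (Hu : forall n, 0 < / (INR n + 2) < 1).
  { intro n. pose proof (pos_INR n). split; [apply Rinv_0_lt_compat; lra|]. rewrite <- Rinv_1. apply Rinv_lt_contravar; lra. }
  assert (Hlim : is_lim_seq (fun n => / (INR n + 2)) 0).
  { replace (Finite 0) with (Rbar_inv p_infty) by reflexivity. apply is_lim_seq_inv; [|easy].
    apply is_lim_seq_plus with (l1 := p_infty) (l2 := Finite 2); [apply is_lim_seq_INR|apply is_lim_seq_const|easy]. }
  assert (Hus : forall n, strip 0 2 (u n)). { intro n. specialize (Hu n). unfold strip, u. simpl. lra. }
  assert (Hu1 : forall n, u n <> RtoC 1). { intros n E. apply (f_equal Re) in E. unfold u in E. simpl in E. specialize (Hu n). lra. }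
  assert (Huc : ccvg u 1).
  { apply ccvg_of_le with (fun n => / (INR n + 2)); auto. intro n. unfold u.
    replace (1 + RtoC (/ (INR n + 2)) - 1)%C with (RtoC (/ (INR n + 2))) by ring. rewrite Cmod_RtoC_pos; [lra|]. specialize (Hu n). lra. }
  apply (ccvg_unique (fun n => Hd (u n))).
  - intros eps He. destruct (filterlim_eps _ _ HL eps He) as (d & Hd0 & G). destruct (Huc d Hd0) as [N HN].
    exists N. intros n Hn. apply G; auto.
  - eapply ccvg_ext; [intro n; symmetry; apply hurwitz_diff_right; auto|]. apply HE; auto.
Qed.

(** Near u = 0 the function is merely bounded, which confines its Mellin transform to Re s < 1; at
    infinity any rate is available. *)
Lemma Sc_bounds k : 0 < k -> exists M, 0 < M /\ (forall t, t <= 0 -> Cmod (Sc th t) <= M * exp (0 * t)) /\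
  (forall t, 0 <= t -> Cmod (Sc th t) <= M * exp (- k * t)).
Proof.
  intros Hk. destruct (Sf_decay th k Hth Hk) as (M & HM & HMb).
  assert (HB0 : 0 < / sin (PI * th) ^ 2) by (apply Rinv_0_lt_compat, pow_lt, sin_PI_pos; auto).
  exists (M + / sin (PI * th) ^ 2). split; [lra|]. split; intros t Ht; unfold Sc; rewrite Cmod_R.
  - rewrite Rmult_0_l, exp_0. pose proof (Sf_bound th (exp t) Hth). lra.
  - specialize (HMb t Ht). pose proof (exp_pos (- k * t)). nra.
Qed.

Lemma mellin_Sc_correct s : Re s < 1 -> is_lint (fun t => (cexp ((1 - s) * t) * Sc th t)%C) (mellin (Sc th) s).
Proof.
  intros Hs. destruct (Sc_bounds (2 - Re s) ltac:(lra)) as (M & HM & B1 & B2).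
  apply mellin_correct with M 0 (2 - Re s); auto; [now apply ccont_Sf|lra].
Qed.

(** For -1 < Re s < 1 the part Sf(0)/(1 + u^2) subtracted in [Df] has the transform Sf(0)
    (pi/2)/cos(pi s/2), which absorbs the constant of [E4]. The agreement on 1/2 <= Re s < 1 is then
    continued to the left. *)
Theorem hurwitz_diff_mellin s : Re s < 1 -> Hd s = (4 * Ccos ((PI / 2)%R * s) * mellin (Sc th) s)%C.
Proof.
  (* Any edge to the left of both s and 0 will do. *)
  intros Hs. set (al := Rmin (Re s) 0 - 1).
  assert (Hal : al < Re s /\ al < 0) by (unfold al; pose proof (Rmin_l (Re s) 0); pose proof (Rmin_r (Re s) 0); lra).
  assert (H : (Hd s - 4 * Ccos ((PI / 2)%R * s) * mellin (Sc th) s)%C = RtoC 0).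
  { apply (strip_unique (fun s => (Hd s - 4 * Ccos ((PI / 2)%R * s) * mellin (Sc th) s)%C) al (1 / 2) 1); [lra| | |unfold strip; lra].
    - intros z Hz. unfold strip in Hz. apply cdiff_minus.
      + apply Hd_cdiff. intro E. rewrite E in Hz. simpl in Hz. lra.
      + apply cdiff_mult; [apply cdiff_mult; [apply cdiff_const|apply cdiff_Ccos]|].
        destruct (Sc_bounds (1 - al) ltac:(lra)) as (M & HM & B1 & B2).
        apply mellin_cdiff with M 0 (1 - al); auto; [now apply ccont_Sf|lra].
    - intros z Hz. rewrite hurwitz_diff_right.
      2: unfold strip; lra.
      2: intro E; rewrite E in Hz; simpl in Hz; lra.
      unfold E4.
      assert (Hp : 0 < Re (1 - z) < 2) by (change (Re (1 - z)) with (1 - Re z); lra).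
      destruct (Df_bounds th Hth) as (M & HM & B1 & B2).
      assert (HD : is_lint (fun t => (cexp ((1 - z) * t) * Df th t)%C) (mellin (Df th) z)).
      { apply mellin_correct with M 2 2; auto; [now apply ccont_Df|lra]. }
      pose proof (is_lint_plus _ _ _ _ HD (is_lint_scal (RtoC (Sf th 0)) _ _ (lint_gJ (1 - z) Hp))) as H1.
      fold (kJ (1 - z)) in H1. rewrite kJ_1 in H1.
      assert (E : mellin (Sc th) z = (mellin (Df th) z + Sf th 0 * ((PI / 2)%R / Ccos ((PI / 2)%R * z)))%C).
      { apply is_lint_lint. eapply is_lint_ext; [|exact H1]. intro t. cbv beta. unfold gJ, Df, Sc.
        rewrite RtoC_minus, RtoC_mult. ring. }
      rewrite E.
      assert (N2 : Ccos ((PI / 2)%R * z) <> RtoC 0).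
      { intro E0. apply (sin_half_neq (1 - z) Hp). replace ((PI / 2)%R * (1 - z))%C with (- ((PI / 2)%R * z) + (PI / 2)%R)%C by ring.
        now rewrite Csin_PI2, Ccos_opp. }
      clear - N2. set (X := Ccos ((PI / 2)%R * z)) in *. rewrite !RtoC_mult, RtoC_div by lra. field. auto. }
  replace (Hd s) with ((Hd s - 4 * Ccos ((PI / 2)%R * s) * mellin (Sc th) s) + 4 * Ccos ((PI / 2)%R * s) * mellin (Sc th) s)%C by ring.
  rewrite H. ring.
Qed.
End HurwitzDifference.

(** * Bessel functions and the Lambert series *)

Lemma exp_exp_decay_scaled c k : 0 < c -> 0 < k -> exists M, 0 < M /\ forall t, exp (- (c * exp t)) <= M * exp (- k * t).
Proof.
  intros Hc Hk. destruct (exp_exp_decay k Hk) as (M & HM & H). exists (M * exp (- k * ln c)). split.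
  - apply Rmult_lt_0_compat; [auto|apply exp_pos].
  - intro t. specialize (H (ln c + t)). rewrite exp_plus, exp_ln in H by auto. eapply Rle_trans; [exact H|].
    right. rewrite Rmult_assoc, <- exp_plus. do 2 f_equal. ring.
Qed.

Definition bessel_kernel (nu : C) (z : R) (t : R) : C := (cexp (nu * t) * RtoC (exp (- z * cosh t)))%C.

Lemma ccont_bessel nu z : ccont (bessel_kernel nu z).
Proof. apply ccont_mult; [apply ccont_cexp0|]. apply ccont_derivable. intro t. unfold cosh. auto_derive. auto. Qed.

Lemma cosh_ge t : exp (Rabs t) / 2 <= cosh t.
Proof.
  unfold cosh. pose proof (exp_pos t). pose proof (exp_pos (- t)). unfold Rabs. destruct (Rcase_abs t); lra.
Qed.

Lemma ex_lint_bessel nu z : 0 < z -> exists l, is_lint (bessel_kernel nu z) l.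
Proof.
  intros Hz. set (k := Rabs (Re nu) + 1). assert (Hk : 0 < k) by (unfold k; pose proof (Rabs_pos (Re nu)); lra).
  destruct (exp_exp_decay_scaled (z / 2) k ltac:(lra) Hk) as (M & HM & HMb).
  apply (ex_lint _ M 1 Rlt_0_1 (ccont_bessel nu z)). intro t. unfold bessel_kernel.
  rewrite Cmod_mult, Cmod_cexp_lin, Cmod_RtoC_pos by apply Rlt_le, exp_pos.
  assert (H1 : exp (- z * cosh t) <= M * exp (- k * Rabs t)).
  { eapply Rle_trans; [|apply HMb]. apply exp_le. pose proof (cosh_ge t). nra. }
  assert (H2 : exp (Re nu * t) <= exp (Rabs (Re nu) * Rabs t)).
  { apply exp_le. rewrite <- Rabs_mult. apply Rle_abs. }
  apply Rle_trans with (exp (Rabs (Re nu) * Rabs t) * (M * exp (- k * Rabs t))).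
  - apply Rmult_le_compat; auto; apply Rlt_le, exp_pos.
  - right. replace (- (1) * Rabs t) with (Rabs (Re nu) * Rabs t + - k * Rabs t) by (unfold k; ring). rewrite exp_plus. ring.
Qed.

Lemma Lim_of_tends (f : R -> R) l : (forall eps, 0 < eps -> exists T, forall t, T < t -> Rabs (f t - l) < eps) -> real (Lim f p_infty) = l.
Proof.
  intros H. rewrite (is_lim_unique f p_infty l); auto. apply is_lim_spec. intros eps.
  destruct (H eps (cond_pos eps)) as [T HT]. exists T. exact HT.
Qed.

(** Folding t with - t turns exp(nu t) into 2 cosh(nu t), whose real and imaginary parts give the
    two integrands of [BesselK]. *)
Lemma BesselK_lint nu z : 0 < z -> is_lint (bessel_kernel nu z) (2 * BesselK nu z)%C.
Proof.
  intros Hz. destruct (ex_lint_bessel nu z Hz) as [l Hl]. replace (2 * BesselK nu z)%C with l; auto.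
  set (h := fun t => (bessel_kernel nu z t + bessel_kernel nu z (- t))%C).
  pose proof (is_lint_plus _ _ _ _ Hl (is_lint_reflect _ _ Hl)) as H2. fold h in H2. destruct H2 as [Hc H2]. change (ccont h) in Hc.
  assert (He : forall t, h (- t) = h t) by (intro t; unfold h; rewrite Ropp_involutive; ring).
  assert (Hhalf : forall T, CInt h (- T) T = (2 * CInt h 0 T)%C).
  { intro T. rewrite <- (CInt_Chasles h (- T) 0 T) by auto.
    rewrite <- (CInt_ext (fun t => h (- t)) h (- T) 0) by (intros; apply He). rewrite CInt_reflect by auto.
    rewrite Ropp_0, Ropp_involutive. ring. }
  assert (Tend : forall eps, 0 < eps -> exists T, forall t, T < t -> Cmod (CInt h 0 t - l) < eps).
  { intros eps Heps. destruct (H2 eps Heps) as [T HT]. exists T. intros t Ht. specialize (HT (- t) t ltac:(lra) ltac:(lra)).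
    rewrite Hhalf in HT. replace (2 * CInt h 0 t - (l + l))%C with (2 * (CInt h 0 t - l))%C in HT by ring.
    rewrite Cmod_mult, Cmod_RtoC_pos in HT by lra. pose proof (Cmod_ge_0 (CInt h 0 t - l)). lra. }
  assert (ER : forall t, exp (- z * cosh t) * (cosh (Re nu * t) * cos (Im nu * t)) = / 2 * Re (h t)).
  { intro t. unfold h, bessel_kernel, cexp, Re, Im. destruct nu as [a b]. simpl.
    replace (cosh (- t)) with (cosh t) by (unfold cosh; rewrite Ropp_involutive; field).
    replace (a * t - b * 0) with (a * t) by ring. replace (a * 0 + b * t) with (b * t) by ring.
    replace (a * - t - b * 0) with (- (a * t)) by ring. replace (a * 0 + b * - t) with (- (b * t)) by ring.
    rewrite cos_neg, sin_neg. unfold cosh at 2. field. }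
  assert (EI : forall t, exp (- z * cosh t) * (sinh (Re nu * t) * sin (Im nu * t)) = / 2 * Im (h t)).
  { intro t. unfold h, bessel_kernel, cexp, Re, Im. destruct nu as [a b]. simpl.
    replace (cosh (- t)) with (cosh t) by (unfold cosh; rewrite Ropp_involutive; field).
    replace (a * t - b * 0) with (a * t) by ring. replace (a * 0 + b * t) with (b * t) by ring.
    replace (a * - t - b * 0) with (- (a * t)) by ring. replace (a * 0 + b * - t) with (- (b * t)) by ring.
    rewrite cos_neg, sin_neg. unfold sinh. field. }
  clearbody h.
  assert (HR : fst (BesselK nu z) = / 2 * Re l).
  { unfold BesselK. cbn [fst]. apply Lim_of_tends. intros eps Heps. destruct (Tend eps Heps) as [T HT]. exists T. intros t Ht.
    rewrite (RInt_ext _ (fun t => / 2 * Re (h t) + 0 * 0)) by (intros s0 Hs0; rewrite Rmult_0_l, Rplus_0_r; apply ER).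
    rewrite (RInt_lin2 (fun t => Re (h t)) (fun _ => 0)) by (intro; apply Hc || apply continuous_const). rewrite Rmult_0_l, Rplus_0_r.
    specialize (HT t Ht). pose proof (re_le_Cmod (CInt h 0 t - l)) as H1.
    change (Re (CInt h 0 t - l)) with (RInt (fun t => Re (h t)) 0 t - Re l) in H1.
    rewrite <- Rmult_minus_distr_l, Rabs_mult, (Rabs_pos_eq (/ 2)) by lra.
    eapply Rle_lt_trans; [|eapply Rle_lt_trans; [exact H1|exact HT]].
    match goal with |- _ * ?A <= _ => pose proof (Rabs_pos (RInt (fun t => Re (h t)) 0 t - Re l)) as HA; change A with (Rabs (RInt (fun t => Re (h t)) 0 t - Re l)) end.
    clear - HA. lra. }
  assert (HI : snd (BesselK nu z) = / 2 * Im l).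
  { unfold BesselK. cbn [snd]. apply Lim_of_tends. intros eps Heps. destruct (Tend eps Heps) as [T HT]. exists T. intros t Ht.
    rewrite (RInt_ext _ (fun t => / 2 * Im (h t) + 0 * 0)) by (intros s0 Hs0; rewrite Rmult_0_l, Rplus_0_r; apply EI).
    rewrite (RInt_lin2 (fun t => Im (h t)) (fun _ => 0)) by (intro; apply Hc || apply continuous_const). rewrite Rmult_0_l, Rplus_0_r.
    specialize (HT t Ht). pose proof (Im_le_Cmod (CInt h 0 t - l)) as H1.
    change (Im (CInt h 0 t - l)) with (RInt (fun t => Im (h t)) 0 t - Im l) in H1.
    rewrite <- Rmult_minus_distr_l, Rabs_mult, (Rabs_pos_eq (/ 2)) by lra.
    eapply Rle_lt_trans; [|eapply Rle_lt_trans; [exact H1|exact HT]].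
    match goal with |- _ * ?A <= _ => pose proof (Rabs_pos (RInt (fun t => Im (h t)) 0 t - Im l)) as HA; change A with (Rabs (RInt (fun t => Im (h t)) 0 t - Im l)) end.
    clear - HA. lra. }
  apply C_ext; [change (Re l = 2 * fst (BesselK nu z) - 0 * snd (BesselK nu z))|change (Im l = 2 * snd (BesselK nu z) + 0 * fst (BesselK nu z))];
    rewrite HR, HI; field.
Qed.

(* exp(-2 pi (d u + k x / u)) at u = e^t. *)
Definition lambert_term (x : R) (d k : nat) (t : R) : R := exp (- (2 * PI) * (INR d * exp t + INR k * (x * exp (- t)))).

Lemma lambert_term_lint nu x d k : 0 < x -> (1 <= d)%nat -> (1 <= k)%nat ->
  is_lint (fun t => (cexp (nu * t) * RtoC (lambert_term x d k t))%C)
   (2 * (cpow x (nu / 2) * (cpow (INR (d * k)) (nu / 2) * (cpow (INR d) (- nu) * BesselK nu (4 * PI * sqrt (INR (d * k) * x))))))%C.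
Proof.
  intros Hx Hd Hk. pose proof PI_RGT_0 as HPI.
  assert (Rd : 0 < INR d) by (apply lt_0_INR; lia). assert (Rk : 0 < INR k) by (apply lt_0_INR; lia).
  rewrite mult_INR.
  (* e^v = sqrt(k x/d) is the value of e^t at which d e^t and k x e^(-t) agree, and e^r = sqrt(d k
     x) is their common value. After translation by v the exponent is - 4 pi e^r cosh t. *)
  set (v := / 2 * (ln (INR k) + ln x - ln (INR d))). set (r := / 2 * (ln (INR d) + ln (INR k) + ln x)).
  assert (Hr : sqrt (INR d * INR k * x) = exp r).
  { apply sqrt_lem_1.
    - apply Rlt_le. repeat apply Rmult_lt_0_compat; auto.
    - apply Rlt_le, exp_pos.
    - rewrite <- exp_plus. replace (r + r) with (ln (INR d) + ln (INR k) + ln x) by (unfold r; field).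
      rewrite !exp_plus, !exp_ln; auto. }
  assert (Hz : 0 < 4 * PI * sqrt (INR d * INR k * x)) by (rewrite Hr; pose proof (exp_pos r); nra).
  pose proof (BesselK_lint nu _ Hz) as H. apply (is_lint_shift _ _ (- v)) in H. apply (is_lint_scal (cexp (nu * v))) in H.
  match type of H with is_lint _ ?l => match goal with |- is_lint _ ?g => replace g with l end end.
  - eapply is_lint_ext; [|exact H]. intro t. cbv beta. unfold bessel_kernel, lambert_term.
    rewrite Cmult_assoc, <- cexp_plus.
    replace (nu * v + nu * (t + - v)%R)%C with (nu * t)%C by (rewrite RtoC_plus, RtoC_opp; ring).
    f_equal. f_equal. f_equal. rewrite Hr. unfold cosh.
    replace (INR d * exp t) with (exp r * exp (t + - v)).
    + replace (INR k * (x * exp (- t))) with (exp r * exp (- (t + - v))); [field|].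
      rewrite <- exp_plus. replace (r + - (t + - v)) with (ln (INR k) + (ln x + - t)) by (unfold r, v; field).
      rewrite !exp_plus, !exp_ln; auto.
    + rewrite <- exp_plus. replace (r + (t + - v)) with (ln (INR d) + t) by (unfold r, v; field).
      rewrite exp_plus, exp_ln; auto.
  - rewrite !cpow_cexp, ln_mult by auto.
    replace (nu * v)%C with (nu / 2 * ln x + (nu / 2 * (ln (INR d) + ln (INR k))%R + - nu * ln (INR d)))%C.
    + rewrite !cexp_plus. ring.
    + unfold v. rewrite RtoC_mult, RtoC_minus, !RtoC_plus, RtoC_inv by lra. field.
Qed.

(** * Divisor sums and the Lambert series *)

Lemma fold_right_app_csum (l : list C) z : fold_right Cplus (RtoC 0) (l ++ z :: nil) = (fold_right Cplus (RtoC 0) l + z)%C.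
Proof. induction l; simpl; [ring|rewrite IHl; ring]. Qed.

Lemma Csum_list_seq (b : nat -> bool) f n : Csum_list (map f (filter b (seq 1 n))) =
  csum (fun j => if b (S j) then f (S j) else RtoC 0) n.
Proof.
  induction n; [easy|]. rewrite seq_S, filter_app, map_app. simpl filter. cbn [csum]. rewrite <- IHn.
  replace (1 + n)%nat with (S n) by lia. destruct (b (S n)); simpl map.
  - apply fold_right_app_csum.
  - rewrite app_nil_r. ring.
Qed.

Lemma divisor_sum_csum n f : divisor_sum n f = csum (fun j => if Nat.eqb (n mod (S j)) 0 then f (S j) else RtoC 0) n.
Proof. apply (Csum_list_seq (fun d => Nat.eqb (n mod d) 0)). Qed.

Lemma Csum_1_to_csum n f : Csum_1_to n f = csum (fun j => f (S j)) n.
Proof.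
  unfold Csum_1_to. replace (seq 1 n) with (filter (fun _ => true) (seq 1 n)).
  - apply (Csum_list_seq (fun _ => true)).
  - induction (seq 1 n); simpl; congruence.
Qed.

(** Two ways of listing the pairs (d, k) with d k <= N: by the product, or by d. In the induction,
    the quotient of N + 1 by d exceeds that of N by one exactly when d divides N + 1. *)
Lemma dirichlet_hyperbola (g : nat -> nat -> C) N :
  csum (fun n => csum (fun j => if Nat.eqb (S n mod S j) 0 then g (S j) (S n / S j)%nat else RtoC 0) (S n)) N =
  csum (fun j => csum (fun k => g (S j) (S k)) (N / S j)) N.
Proof.
  set (h := fun n j => if Nat.eqb (S n mod S j) 0 then g (S j) (S n / S j)%nat else RtoC 0).
  set (G := fun N j => csum (fun k => g (S j) (S k)) (N / S j)).
  change (csum (fun n => csum (h n) (S n)) N = csum (G N) N).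
  induction N; [easy|].
  (* The column j = N is empty at level N, so both levels range over the same columns. *)
  assert (E : csum (G N) (S N) = csum (G N) N).
  { change (csum (G N) N + G N N = csum (G N) N)%C. unfold G at 2. rewrite (Nat.div_small N (S N)) by lia. simpl. ring. }
  change (csum (fun n => csum (h n) (S n)) N + csum (h N) (S N) = csum (G (S N)) (S N))%C.
  rewrite IHN, <- E, <- csum_plus.
  apply csum_ext. intros j Hj.
  pose proof (Nat.div_mod_eq (S N) (S j)) as D1. pose proof (Nat.mod_upper_bound (S N) (S j) ltac:(lia)) as D2.
  pose proof (Nat.div_mod_eq N (S j)) as D3. pose proof (Nat.mod_upper_bound N (S j) ltac:(lia)) as D4.
  destruct (Nat.eq_dec (S N mod S j) 0) as [E0|E0].
  - assert (Q : (S N / S j = S (N / S j))%nat) by nia. unfold h, G. rewrite E0, Q. reflexivity.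
  - assert (Q : (S N / S j = N / S j)%nat) by nia. unfold h, G. destruct (Nat.eqb_spec (S N mod S j) 0); [easy|]. rewrite Q. ring.
Qed.

Lemma csum_geom w n : w <> RtoC 1 -> csum (fun k => (w ^ S k)%C) n = (w * (1 - w ^ n) / (1 - w))%C.
Proof.
  intros Hw. assert (Hn : (1 - w)%C <> RtoC 0). { intro E. apply Hw. replace w with (1 - (1 - w))%C by ring. rewrite E. ring. }
  induction n; [simpl; field; auto|]. cbn [csum]. rewrite IHn. simpl. field. auto.
Qed.

Lemma ccvg_pow w : Cmod w < 1 -> ccvg (fun n => (w ^ n)%C) 0.
Proof.
  intros H. apply ccvg_of_le with (fun n => Cmod w ^ n).
  - intro n. replace (w ^ n - 0)%C with (w ^ n)%C by ring. rewrite Cmod_pow. lra.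
  - apply is_lim_seq_geom. rewrite Rabs_pos_eq; [auto|apply Cmod_ge_0].
Qed.

Lemma cser_geom w : Cmod w < 1 -> cser (fun k => (w ^ S k)%C) (w / (1 - w))%C.
Proof.
  intros H. assert (Hw : w <> RtoC 1). { intro E. rewrite E, Cmod_1 in H. lra. }
  eapply ccvg_ext; [intro n; symmetry; apply csum_geom; auto|].
  replace (w / (1 - w))%C with (w * (1 - 0) * / (1 - w))%C by (unfold Cdiv; ring).
  unfold Cdiv. apply ccvg_mult; [|apply ccvg_const]. apply ccvg_mult; [apply ccvg_const|].
  apply ccvg_minus; [apply ccvg_const|]. now apply ccvg_pow.
Qed.

Lemma cexp_pow z n : (cexp z ^ n)%C = cexp (INR n * z).
Proof.
  induction n; [simpl; replace (0 * z)%C with (RtoC 0) by ring; now rewrite cexp_0|].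
  simpl Cpow. rewrite IHn, <- cexp_plus, S_INR, RtoC_plus. f_equal. ring.
Qed.

(** The imaginary part of the geometric series in w = exp(2 pi (i th - u)). *)
Lemma Sf_sin_series th u : 0 < th < 1 -> 0 < u ->
  cser (fun j => RtoC (sin (2 * PI * INR (S j) * th) * exp (- (2 * PI) * (INR (S j) * u)))) (RtoC (Sf th u)).
Proof.
  intros Hth Hu. pose proof PI_RGT_0 as HPI.
  set (a := - (2 * PI * u)). set (b := 2 * PI * th). set (w := cexp (a, b)).
  assert (Hw : Cmod w < 1). { unfold w. rewrite Cmod_cexp. simpl. rewrite <- exp_0. apply exp_increasing. unfold a. nra. }
  pose proof (cser_geom w Hw) as H.
  assert (H1 : cser (fun k => RtoC (Im (w ^ S k)%C)) (RtoC (Im (w / (1 - w))%C))).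
  { apply ccvg_Im in H. apply cser_RtoC. eapply is_lim_seq_ext; [|exact H]. intro n.
    induction n; [easy|]. cbn [csum rsum]. rewrite <- IHn. reflexivity. }
  replace (Sf th u) with (Im (w / (1 - w))%C).
  - eapply cser_ext; [|exact H1]. intro k. cbv beta. f_equal. unfold w. rewrite cexp_pow.
    unfold cexp. cbn [Im snd]. rewrite Rmult_comm. unfold a, b.
    replace (Im (INR (S k) * (- (2 * PI * u), 2 * PI * th)%R)) with (2 * PI * INR (S k) * th) by (unfold Im, Cmult, RtoC; cbn [fst snd]; ring).
    replace (Re (INR (S k) * (- (2 * PI * u), 2 * PI * th)%R)) with (- (2 * PI) * (INR (S k) * u)) by (unfold Re, Cmult, RtoC; cbn [fst snd]; ring).
    reflexivity.
  - set (s := sin (PI * th)). set (c := cos (PI * th)).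
    assert (Esc : c * c = 1 - s * s). { pose proof (sin2_cos2 (PI * th)) as E. unfold Rsqr in E. fold s c in E. lra. }
    assert (Eb : b = PI * th + PI * th) by (unfold b; ring).
    set (g := exp (PI * u)). assert (Hg : 1 < g) by (unfold g; rewrite <- exp_0; apply exp_increasing; nra).
    assert (Ea : exp a = / (g * g)). { unfold a, g. rewrite <- exp_plus, <- exp_Ropp. f_equal. ring. }
    assert (Hs : 0 < s) by (apply sin_PI_pos; auto).
    unfold w, cexp. cbn [Re Im fst snd]. rewrite Eb, sin_plus, cos_plus. fold s c. rewrite Ea.
    unfold Sf, sinh. fold s c g. rewrite exp_Ropp. fold g.
    set (X := / (g * g) * (c * c - s * s)) in *. set (Y := / (g * g) * (s * c + c * s)).
    assert (EX : X * X + Y * Y = / (g * g) * / (g * g)).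
    { unfold X, Y. replace (/ (g * g) * (c * c - s * s) * (/ (g * g) * (c * c - s * s)) + / (g * g) * (s * c + c * s) * (/ (g * g) * (s * c + c * s)))
        with (/ (g * g) * / (g * g) * ((c * c + s * s) * (c * c + s * s))) by ring. rewrite Esc. ring. }
    assert (EX2 : X = / (g * g) * (1 - 2 * (s * s))) by (unfold X; rewrite Esc; ring).
    (* This is |1 - w|^2 = 4 (sinh(pi u)^2 + sin(pi th)^2)/g^2, which produces the denominator of
       [Sf]. *)
    assert (Hden : (1 - X) * (1 - X) + Y * Y = ((g * g - 1) * (g * g - 1) + 4 * (s * s) * (g * g)) / (g * g * (g * g))).
    { replace ((1 - X) * (1 - X) + Y * Y) with (1 - 2 * X + (X * X + Y * Y)) by ring. rewrite EX, EX2. field. lra. }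
    assert (P1 : 0 < s * s) by nra. assert (P2 : 0 < g * g) by nra.
    assert (P3 : 0 < (g * g - 1) * (g * g - 1) + 4 * (s * s) * (g * g)) by (pose proof (Rle_0_sqr (g * g - 1)) as Q; unfold Rsqr in Q; assert (0 < s * s * (g * g)) by (apply Rmult_lt_0_compat; auto); lra).
    assert (P4 : 0 < (1 - X) * (1 - X) + Y * Y).
    { rewrite Hden. apply Rdiv_lt_0_compat; [auto|]. apply Rmult_lt_0_compat; auto. }
    assert (EI : Im ((X, Y) / (1 - (X, Y)))%C = Y / ((1 - X) * (1 - X) + Y * Y)).
    { unfold Im. simpl. field. unfold Rminus in P4 |- *. intro Q. apply Rgt_not_eq in P4. apply P4. rewrite <- Q. ring. }
    transitivity (Y / ((1 - X) * (1 - X) + Y * Y)); [|].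
    + rewrite <- EI. f_equal.
    + rewrite Hden. unfold Y. field. repeat split; nra.
Qed.

(** q = exp(-2 pi x/u) at u = e^t, so that [lam] is 1/(exp(2 pi x/u) - 1). *)
Definition nome (x t : R) : R := exp (- (2 * PI) * (x * exp (- t))).
Definition lam (x t : R) : R := nome x t / (1 - nome x t).
Definition lambert_coeff (x th : R) (n : nat) (t : R) : C :=
  csum (fun j => if Nat.eqb (S n mod S j) 0
    then RtoC (sin (2 * PI * INR (S j) * th) * lambert_term x (S j) (S n / S j) t) else RtoC 0) (S n).

Lemma nome_lt1 x t : 0 < x -> 0 < nome x t < 1.
Proof.
  intro Hx. unfold nome. split; [apply exp_pos|]. rewrite <- exp_0. apply exp_increasing.
  pose proof PI_RGT_0. pose proof (exp_pos (- t)). assert (0 < x * exp (- t)) by (apply Rmult_lt_0_compat; auto). nra.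
Qed.

Lemma lambert_term_nome x d k t : lambert_term x d k t = exp (- (2 * PI) * (INR d * exp t)) * nome x t ^ k.
Proof.
  unfold lambert_term, nome. rewrite <- Rpower_pow by apply exp_pos. unfold Rpower. rewrite ln_exp, <- exp_plus.
  f_equal. ring.
Qed.

Lemma is_lim_seq_div_nat (q : R) j : 0 <= q < 1 -> is_lim_seq (fun N => q ^ (N / S j)) 0.
Proof.
  intros Hq. apply is_lim_seq_spec. intros eps.
  destruct (pow_lt_1_zero q ltac:(rewrite Rabs_pos_eq; lra) eps (cond_pos eps)) as [M HM].
  exists (M * S j)%nat. intros n Hn. rewrite Rminus_0_r. apply HM.
  apply Nat.div_le_lower_bound; lia.
Qed.

(** By [dirichlet_hyperbola] the partial sum over n < N is a sum over d <= N in which d carries a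
    geometric sum of N/d terms (integer quotient). Each geometric sum completes as N grows, and
    Tannery's theorem, with a geometric majorant in d, passes to the limit; no rearrangement of a
    double series is needed. *)
Lemma lambert_sum x th t : 0 < x -> 0 < th < 1 ->
  cser (fun n => lambert_coeff x th n t) (RtoC (Sf th (exp t) * lam x t)).
Proof.
  intros Hx Hth. pose proof PI_RGT_0 as HPI. pose proof (nome_lt1 x t Hx) as Hq. set (q := nome x t) in *.
  set (s := fun j => sin (2 * PI * INR (S j) * th) * exp (- (2 * PI) * (INR (S j) * exp t))).
  assert (Hs : cser (fun j => RtoC (s j)) (RtoC (Sf th (exp t)))) by (apply Sf_sin_series; auto; apply exp_pos).
  set (a := fun N j => if Nat.ltb j N then (RtoC (s j) * RtoC (q / (1 - q) * (1 - q ^ (N / S j))))%C else RtoC 0).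
  set (p := exp (- (2 * PI) * exp t)).
  assert (Hp : 0 < p < 1).
  { unfold p. split; [apply exp_pos|]. rewrite <- exp_0. apply exp_increasing. pose proof (exp_pos t). nra. }
  assert (Hgeo : rser (fun j => p ^ S j) (p / (1 - p))).
  { pose proof (cser_geom (RtoC p)) as H. rewrite Cmod_RtoC_pos in H by lra. specialize (H ltac:(lra)). apply cser_Re in H.
    replace (Re (p / (1 - p))%C) with (p / (1 - p)) in H.
    - eapply rser_ext; [|exact H]. intro n. cbv beta. rewrite <- RtoC_pow. reflexivity.
    - rewrite <- RtoC_minus, <- RtoC_div by lra. reflexivity. }
  assert (Hqq : 0 < q / (1 - q)) by (apply Rdiv_lt_0_compat; lra).
  destruct (tannery a (fun N => csum (fun n => lambert_coeff x th n t) N) (fun j => (RtoC (s j) * RtoC (q / (1 - q)))%C)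
    (fun j => q / (1 - q) * p ^ S j) (q / (1 - q) * (p / (1 - p)))) as (B & HB & HAB).
  - intros N j. unfold a. destruct (Nat.ltb j N).
    + rewrite Cmod_mult, !Cmod_R. unfold s. rewrite !Rabs_mult, (Rabs_pos_eq (exp _)) by apply Rlt_le, exp_pos.
      replace (exp (- (2 * PI) * (INR (S j) * exp t))) with (p ^ S j).
      2: { unfold p. rewrite <- Rpower_pow by apply exp_pos. unfold Rpower. rewrite ln_exp. f_equal. ring. }
      assert (Hpj : 0 < p ^ S j) by (apply pow_lt; lra).
      assert (Hqn : 0 <= 1 - q ^ (N / S j) <= 1).
      { assert (0 <= q ^ (N / S j)) by (apply pow_le; lra). pose proof (pow_incr q 1 (N / S j) ltac:(lra)) as H1. rewrite pow1 in H1. lra. }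
      rewrite (Rabs_pos_eq (q / (1 - q))), (Rabs_pos_eq (1 - _)) by lra.
      assert (Hsin : Rabs (sin (2 * PI * INR (S j) * th)) <= 1) by (apply Rabs_le, SIN_bound).
      pose proof (Rabs_pos (sin (2 * PI * INR (S j) * th))).
      replace (q / (1 - q) * p ^ S j) with ((1 * p ^ S j) * (q / (1 - q) * 1)) by ring.
      apply Rmult_le_compat; try (apply Rmult_le_pos; lra).
      * apply Rmult_le_compat_r; lra.
      * apply Rmult_le_compat_l; lra.
    + rewrite Cmod_0. apply Rmult_le_pos; [lra|apply pow_le; lra].
  - now apply rser_scal.
  - intro j. apply ccvg_ext_ev with (u := fun N => (RtoC (s j) * RtoC (q / (1 - q) * (1 - q ^ (N / S j))))%C) (N0 := S j).
    { intros n Hn. unfold a. destruct (Nat.ltb_spec j n); [easy|lia]. }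
    apply ccvg_scal. apply ccvg_RI; simpl; [|apply is_lim_seq_const].
    replace (Finite (q / (1 - q))) with (Rbar_mult (q / (1 - q)) (1 - 0)) by (simpl; f_equal; ring).
    apply is_lim_seq_scal_l. apply is_lim_seq_minus'; [apply is_lim_seq_const|]. apply is_lim_seq_div_nat. lra.
  - intro N. replace (csum (fun n => lambert_coeff x th n t) N) with (csum (a N) N).
    + apply cser_finite. intros k Hk. unfold a. destruct (Nat.ltb_spec k N); [lia|easy].
    + unfold lambert_coeff. symmetry.
      etransitivity; [apply (dirichlet_hyperbola (fun d k => RtoC (sin (2 * PI * INR d * th) * lambert_term x d k t)))|].
      apply csum_ext. intros j Hj. unfold a. destruct (Nat.ltb_spec j N); [|lia].
      rewrite (csum_ext _ (fun k => (RtoC (s j) * (RtoC q ^ S k))%C)).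
      * rewrite csum_scal, csum_geom.
        -- rewrite RtoC_mult, RtoC_minus, RtoC_div, RtoC_minus, RtoC_pow by lra. unfold Cdiv. ring.
        -- intro E. apply (f_equal Re) in E. simpl in E. lra.
      * intros k _. rewrite lambert_term_nome. fold q. rewrite <- RtoC_pow, <- RtoC_mult. f_equal. unfold s. ring.
  - assert (E : B = RtoC (Sf th (exp t) * lam x t)); [|now rewrite <- E].
    apply (cser_unique (fun j => (RtoC (s j) * RtoC (q / (1 - q)))%C)); auto.
    unfold lam. fold q. rewrite RtoC_mult, Cmult_comm.
    eapply cser_ext; [|apply (cser_scal (RtoC (q / (1 - q))) _ _ Hs)]. intro j. cbv beta. ring.
Qed.

Definition lhs_term (nu : C) (x th : R) (n : nat) : C :=
  Cmult (RtoC (8 * PI))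
         (Cmult (cpow x (Cdiv nu (RtoC 2)))
         (Cmult (cpow (INR (S n)) (Cdiv nu (RtoC 2)))
         (Cmult (BesselK nu (4 * PI * sqrt (INR (S n) * x)))
           (divisor_sum (S n)
              (fun d => Cmult (cpow (INR d) (Copp nu)) (RtoC (sin (2 * PI * INR d * th)))))))).

Lemma lhs_term_lint nu x th n : 0 < x ->
  is_lint (fun t => (cexp (nu * t) * (RtoC (4 * PI) * lambert_coeff x th n t))%C) (lhs_term nu x th n).
Proof.
  intros Hx.
  set (bt := (2 * (cpow x (nu / 2) * (cpow (INR (S n)) (nu / 2) * BesselK nu (4 * PI * sqrt (INR (S n) * x)))))%C).
  assert (H : is_lint (fun t => (RtoC (4 * PI) * csum (fun j => if Nat.eqb (S n mod S j) 0
      then (RtoC (sin (2 * PI * INR (S j) * th)) * (cexp (nu * t) * RtoC (lambert_term x (S j) (S n / S j) t)))%C else RtoC 0) (S n))%C)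
    (RtoC (4 * PI) * csum (fun j => if Nat.eqb (S n mod S j) 0
      then (bt * (cpow (INR (S j)) (- nu) * RtoC (sin (2 * PI * INR (S j) * th))))%C else RtoC 0) (S n))%C).
  { apply is_lint_scal. apply (is_lint_csum (fun j t => if Nat.eqb (S n mod S j) 0
      then (RtoC (sin (2 * PI * INR (S j) * th)) * (cexp (nu * t) * RtoC (lambert_term x (S j) (S n / S j) t)))%C else RtoC 0)).
    intros j Hj. destruct (Nat.eqb_spec (S n mod S j) 0) as [E|E]; [|apply is_lint_zero].
    pose proof (Nat.div_mod_eq (S n) (S j)) as D. rewrite E, Nat.add_0_r in D.
    assert (Hk : (1 <= S n / S j)%nat) by nia.
    pose proof (lambert_term_lint nu x (S j) (S n / S j) Hx ltac:(lia) Hk) as Hl. rewrite <- D in Hl.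
    apply (is_lint_scal (RtoC (sin (2 * PI * INR (S j) * th)))) in Hl.
    match type of Hl with is_lint _ ?l => match goal with |- is_lint _ ?g => replace g with l end end; [exact Hl|].
    unfold bt. ring. }
  match type of H with is_lint _ ?l => replace (lhs_term nu x th n) with l end.
  - eapply is_lint_ext; [|exact H]. intro t. cbv beta. unfold lambert_coeff.
    rewrite (Cmult_assoc (cexp _)), (Cmult_comm (cexp _)), <- Cmult_assoc. f_equal. rewrite <- csum_scal.
    apply csum_ext. intros j _. destruct (Nat.eqb (S n mod S j) 0); [|ring]. rewrite RtoC_mult. ring.
  - unfold lhs_term. rewrite divisor_sum_csum.
    rewrite (csum_ext _ (fun j => (bt * (if Nat.eqb (S n mod S j) 0 then cpow (INR (S j)) (- nu) * RtoC (sin (2 * PI * INR (S j) * th)) else RtoC 0))%C)).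
    + rewrite csum_scal. unfold bt. replace (8 * PI) with (4 * PI * 2) by ring. rewrite (RtoC_mult (4 * PI) 2). ring.
    + intros j _. destruct (Nat.eqb (S n mod S j) 0); ring.
Qed.

(** The power 6 is chosen for y of order sqrt(N): it makes N exp(-y) of order N^(-2), where the
    factor N bounds the number of divisors. *)
Lemma pow6_le_exp y : 0 < y -> y ^ 6 <= 6 ^ 6 * exp y.
Proof.
  intro Hy. assert (H : y / 6 <= exp (y / 6)) by (pose proof (exp_ineq1 (y / 6) ltac:(lra)); lra).
  replace y with (6 * (y / 6)) at 1 by field. rewrite Rpow_mult_distr. apply Rmult_le_compat_l; [lra|].
  eapply Rle_trans; [apply (pow_incr _ (exp (y / 6)) 6); lra|]. right.
  rewrite <- Rpower_pow by apply exp_pos. unfold Rpower. rewrite ln_exp. f_equal. simpl. field.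
Qed.

Lemma exp_bounded_lambert_weight (nu : C) x : 0 < x ->
  exists M, 0 < M /\ exp_bounded (fun t => (cexp (nu * t) * RtoC (exp (- PI * (exp t + x * exp (- t)))))%C) M 1.
Proof.
  intros Hx. pose proof PI_RGT_0 as HPI. set (k := Rabs (Re nu) + 1). assert (Hk : 0 < k) by (unfold k; pose proof (Rabs_pos (Re nu)); lra).
  destruct (exp_exp_decay_scaled PI k HPI Hk) as (M1 & HM1 & H1).
  destruct (exp_exp_decay_scaled (PI * x) k ltac:(apply Rmult_lt_0_compat; auto) Hk) as (M2 & HM2 & H2).
  exists (M2 + M1). split; [lra|]. replace 1 with (Rmin 1 1) by (apply Rmin_left; lra).
  pose proof (Rle_abs (Re nu)) as A1. pose proof (Rle_abs (- Re nu)) as A2. rewrite Rabs_Ropp in A2.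
  apply exp_bounded_two; try lra; intros t Ht; rewrite Cmod_mult, Cmod_cexp_lin, Cmod_RtoC_pos by apply Rlt_le, exp_pos;
    pose proof (exp_pos t); pose proof (exp_pos (- t)).
  - specialize (H2 (- t)). apply Rle_trans with (exp (Re nu * t) * (M2 * exp (- k * - t))).
    + apply Rmult_le_compat_l; [apply Rlt_le, exp_pos|]. eapply Rle_trans; [|exact H2]. apply exp_le. nra.
    + replace (exp (Re nu * t) * (M2 * exp (- k * - t))) with (M2 * (exp (Re nu * t) * exp (- k * - t))) by ring. rewrite <- exp_plus.
      apply Rmult_le_compat_l; [lra|]. apply exp_le. unfold k. nra.
  - specialize (H1 t). apply Rle_trans with (exp (Re nu * t) * (M1 * exp (- k * t))).
    + apply Rmult_le_compat_l; [apply Rlt_le, exp_pos|]. eapply Rle_trans; [|exact H1]. apply exp_le.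
      assert (0 < PI * (x * exp (- t))) by (apply Rmult_lt_0_compat; [lra|apply Rmult_lt_0_compat; lra]). nra.
    + replace (exp (Re nu * t) * (M1 * exp (- k * t))) with (M1 * (exp (Re nu * t) * exp (- k * t))) by ring. rewrite <- exp_plus.
      apply Rmult_le_compat_l; [lra|]. apply exp_le. unfold k. nra.
Qed.

(* Half of the exponent decays in n by AM-GM, d e^t + k x e^(-t) >= 2 sqrt(d k x); the other half decays in t. *)
Lemma lambert_term_le x d k t : 0 < x -> (1 <= d)%nat -> (1 <= k)%nat ->
  lambert_term x d k t <= exp (- (2 * PI) * sqrt (INR (d * k) * x)) * exp (- PI * (exp t + x * exp (- t))).
Proof.
  intros Hx Hd Hk. pose proof PI_RGT_0 as HPI. unfold lambert_term. rewrite <- exp_plus. apply exp_le.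
  assert (Rd : 1 <= INR d) by (apply (le_INR 1); auto). assert (Rk : 1 <= INR k) by (apply (le_INR 1); auto).
  pose proof (exp_pos t) as E1. pose proof (exp_pos (- t)) as E2.
  assert (E3 : 0 < x * exp (- t)) by (apply Rmult_lt_0_compat; auto).
  set (a := INR d * exp t). set (b := INR k * (x * exp (- t))).
  assert (Ha : exp t <= a) by (unfold a; nra). assert (Hb : x * exp (- t) <= b) by (unfold b; nra).
  assert (Hs : 2 * sqrt (INR (d * k) * x) <= a + b).
  { replace (INR (d * k) * x) with (a * b).
    - assert (Hab : 0 <= a * b) by nra. apply Rsqr_incr_0_var; [|lra]. unfold Rsqr.
      replace (2 * sqrt (a * b) * (2 * sqrt (a * b))) with (4 * (sqrt (a * b) * sqrt (a * b))) by ring. rewrite sqrt_sqrt by auto.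
      pose proof (Rle_0_sqr (a - b)) as Q. unfold Rsqr in Q. lra.
    - unfold a, b. rewrite mult_INR. replace (INR d * exp t * (INR k * (x * exp (- t)))) with (INR d * INR k * x * (exp t * exp (- t))) by ring.
      rewrite <- exp_plus, Rplus_opp_r, exp_0. ring. }
  nra.
Qed.

Lemma rsum_const c n : rsum (fun _ => c) n = INR n * c.
Proof. induction n; [simpl; ring|]. cbn [rsum]. rewrite IHn, S_INR. ring. Qed.

Lemma ccont_nome_lam x th : 0 < x -> 0 < th < 1 -> ccont (fun t => RtoC (Sf th (exp t) * lam x t)).
Proof.
  intros Hx Hth. apply ccont_ext with (fun t => (RtoC (Sf th (exp t)) * RtoC (lam x t))%C); [intro; now rewrite RtoC_mult|].
  apply ccont_mult; [now apply ccont_Sf|]. apply ccont_derivable. intro t. unfold lam, nome. auto_derive.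
  pose proof (nome_lt1 x t Hx) as H. unfold nome in H. lra.
Qed.

(** The n-th coefficient has at most n + 1 nonzero terms, each at most exp(-2 pi sqrt((n+1) x))
    times a weight in t that beats exp(nu t) whatever nu is. Having every complex nu here is what
    later gives continuity up to the boundary lines. *)
Theorem lhs_lint nu x th : 0 < x -> 0 < th < 1 ->
  exists l, is_lint (fun t => (cexp (nu * t) * (RtoC (4 * PI) * RtoC (Sf th (exp t) * lam x t)))%C) l /\ cser (lhs_term nu x th) l.
Proof.
  intros Hx Hth. pose proof PI_RGT_0 as HPI.
  destruct (exp_bounded_lambert_weight nu x Hx) as (M & HM & HMd).
  destruct rser_inv_sqr as [sg Hsg].
  set (Kc := 6 ^ 6 / ((2 * PI) ^ 6 * x ^ 3)).
  assert (HKc : 0 < Kc) by (unfold Kc; apply Rdiv_lt_0_compat; [lra|]; apply Rmult_lt_0_compat; apply pow_lt; lra).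
  apply (lint_series (fun n t => (cexp (nu * t) * (RtoC (4 * PI) * lambert_coeff x th n t))%C) _ _
    (fun n => (4 * PI * Kc * M) * / INR (S n) ^ 2) (4 * PI * Kc * M * sg) 1).
  - lra.
  - intro n. now apply lhs_term_lint.
  - intros n t. specialize (HMd t). cbv beta in HMd. set (N := INR (S n)). assert (HN : 1 <= N) by (apply (le_INR 1); lia).
    set (W := exp (- PI * (exp t + x * exp (- t)))) in *. set (y := 2 * PI * sqrt (N * x)).
    assert (Hy : 0 < y). { unfold y. apply Rmult_lt_0_compat; [lra|]. apply sqrt_lt_R0. nra. }
    assert (Hc : Cmod (lambert_coeff x th n t) <= N * (exp (- y) * W)).
    { unfold lambert_coeff, N. rewrite <- rsum_const. apply csum_mod_le. intros j Hj.
      destruct (Nat.eqb_spec (S n mod S j) 0) as [E|E].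
      - pose proof (Nat.div_mod_eq (S n) (S j)) as D. rewrite E, Nat.add_0_r in D. assert (Hk : (1 <= S n / S j)%nat) by nia.
        rewrite Cmod_R, Rabs_mult, (Rabs_pos_eq (lambert_term _ _ _ _)) by apply Rlt_le, exp_pos.
        pose proof (lambert_term_le x (S j) (S n / S j) t Hx ltac:(lia) Hk) as Q. rewrite <- D in Q.
        replace (- y) with (- (2 * PI) * sqrt (INR (S n) * x)) by (unfold y, N; ring).
        assert (Hsin : Rabs (sin (2 * PI * INR (S j) * th)) <= 1) by (apply Rabs_le, SIN_bound).
        assert (0 < lambert_term x (S j) (S n / S j) t) by apply exp_pos. pose proof (Rabs_pos (sin (2 * PI * INR (S j) * th))).
        fold W in Q. nra.
      - rewrite Cmod_0. apply Rmult_le_pos; apply Rlt_le, exp_pos. }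
    rewrite !Cmod_mult, (Cmod_RtoC_pos (4 * PI)) by lra.
    rewrite Cmod_mult, (Cmod_RtoC_pos W) in HMd by apply Rlt_le, exp_pos.
    assert (Hexp : N * exp (- y) <= Kc * / N ^ 2).
    { pose proof (pow6_le_exp y Hy) as P6.
      assert (Ey : y ^ 6 = (2 * PI) ^ 6 * x ^ 3 * N ^ 3).
      { unfold y. rewrite Rpow_mult_distr. replace (sqrt (N * x) ^ 6) with ((sqrt (N * x) * sqrt (N * x)) ^ 3) by ring. rewrite sqrt_sqrt by nra. ring. }
      rewrite Ey in P6. rewrite exp_Ropp. pose proof (exp_pos y). assert (P0 : 0 < (2 * PI) ^ 6 * x ^ 3) by (apply Rmult_lt_0_compat; apply pow_lt; lra).
      unfold Kc. apply Rmult_le_reg_r with (((2 * PI) ^ 6 * x ^ 3) * N ^ 2 * exp y).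
      { apply Rmult_lt_0_compat; auto. apply Rmult_lt_0_compat; [auto|apply pow_lt; lra]. }
      replace (N * / exp y * ((2 * PI) ^ 6 * x ^ 3 * N ^ 2 * exp y)) with ((2 * PI) ^ 6 * x ^ 3 * N ^ 3) by (field; lra).
      replace (6 ^ 6 / ((2 * PI) ^ 6 * x ^ 3) * / N ^ 2 * ((2 * PI) ^ 6 * x ^ 3 * N ^ 2 * exp y)) with (6 ^ 6 * exp y) by (field; repeat split; lra). auto. }
    assert (HW : 0 < W) by apply exp_pos. pose proof (exp_pos (- y)). pose proof (Cmod_ge_0 (cexp (nu * t))) as Hce.
    pose proof (Cmod_ge_0 (lambert_coeff x th n t)).
    apply Rle_trans with (4 * PI * (N * exp (- y)) * (Cmod (cexp (nu * t)) * W)).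
    + replace (4 * PI * (N * exp (- y)) * (Cmod (cexp (nu * t)) * W)) with (Cmod (cexp (nu * t)) * (4 * PI * (N * (exp (- y) * W)))) by ring.
      apply Rmult_le_compat_l; auto. apply Rmult_le_compat_l; lra.
    + replace (4 * PI * Kc * M * / N ^ 2 * exp (- (1) * Rabs t)) with (4 * PI * (Kc * / N ^ 2) * (M * exp (- (1) * Rabs t))) by ring.
      apply Rmult_le_compat; auto.
      * apply Rmult_le_pos; [lra|]. apply Rmult_le_pos; lra.
      * apply Rmult_le_pos; lra.
      * apply Rmult_le_compat_l; lra.
  - now apply rser_scal.
  - apply (ccont_mult (fun t : R => cexp (nu * t))); [apply ccont_cexp0|].
    apply (ccont_mult (fun _ => RtoC (4 * PI))); [apply ccont_const|]. now apply ccont_nome_lam.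
  - intro t. apply cser_scal. apply cser_scal. now apply lambert_sum.
Qed.

(** * Expansion of the integral *)

(** 2 pi lam + pi = pi coth(pi v) at v = x/u; this is [coth_series] rewritten in u. *)
Lemma lam_series x t : 0 < x ->
  rser (fun k => 2 * x * exp t * / (x ^ 2 + INR (S k) ^ 2 * exp (2 * t))) (2 * PI * lam x t + PI - exp t / x).
Proof.
  intros Hx. pose proof PI_RGT_0 as HPI. pose proof (exp_pos t) as Et. set (v := x * exp (- t)).
  assert (Hv : 0 < v) by (unfold v; apply Rmult_lt_0_compat; [auto|apply exp_pos]).
  pose proof (coth_series v Hv) as H.
  replace (2 * PI * lam x t + PI - exp t / x) with (PI * (cosh (PI * v) / sinh (PI * v)) - / v).
  - eapply rser_ext; [|exact H]. intro k. cbv beta. unfold v. rewrite exp_Ropp.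
    replace (2 * t) with (t + t) by ring. rewrite exp_plus.
    assert (0 < INR (S k)) by (apply lt_0_INR; lia).
    assert (0 < INR (S k) * INR (S k) * (exp t * exp t)) by (repeat apply Rmult_lt_0_compat; auto).
    field. repeat split; try lra; nra.
  - unfold lam, nome. fold v. set (g := exp (PI * v)).
    assert (Hg : 1 < g) by (unfold g; rewrite <- exp_0; apply exp_increasing; nra).
    assert (Eg : exp (- (2 * PI) * v) = / (g * g)). { unfold g. rewrite <- exp_plus, <- exp_Ropp. f_equal. ring. }
    rewrite Eg. unfold cosh, sinh. rewrite exp_Ropp. fold g.
    replace (exp t / x) with (/ v) by (unfold v; rewrite exp_Ropp; field; lra).
    field. repeat split; nra.
Qed.

(** The integrand u^p S(u)/(x^2 + d^2 u^2) du/u with S = [Sf th]. For p = nu + 1 its integral [Jl]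
    is, up to the factor 4 x, the contribution of d to the left-hand side. *)
Definition Jf (th x d : R) (p : C) (t : R) : C := (cexp (p * t) * (Sc th t * RtoC (/ (x ^ 2 + d ^ 2 * exp (2 * t)))))%C.
Definition Jl (th x d : R) (p : C) : C := lint (Jf th x d p).

Lemma Jf_correct th x d p : 0 < th < 1 -> 0 < x -> 0 < d -> 0 < Re p -> is_lint (Jf th x d p) (Jl th x d p).
Proof.
  intros Hth Hx Hd Hp. destruct (Sc_bounds th Hth (Re p + 1) ltac:(lra)) as (M & HM & B1 & B2).
  assert (Hx2 : 0 < x ^ 2) by (apply pow_lt; auto). assert (Hd2 : 0 < d ^ 2) by (apply pow_lt; auto).
  assert (Q : forall t, 0 < / (x ^ 2 + d ^ 2 * exp (2 * t)) <= / x ^ 2).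
  { intro t. pose proof (exp_pos (2 * t)). split; [apply Rinv_0_lt_compat; nra|apply Rinv_le_contravar; nra]. }
  assert (Hix : 0 < / x ^ 2) by now apply Rinv_0_lt_compat.
  apply (lint_correct _ (M * / x ^ 2 + M * / x ^ 2) (Rmin (Re p + 0) (Re p + 1 - Re p))).
  - apply Rmin_glb_lt; lra.
  - apply ccont_mult; [apply ccont_cexp0|]. apply ccont_mult; [now apply ccont_Sc|]. apply ccont_derivable.
    intro t. auto_derive. pose proof (exp_pos (2 * t)). simpl in *. nra.
  - apply exp_bounded_shift_lin; try lra; intros t Ht; rewrite Cmod_mult, (Cmod_RtoC_pos (/ _)) by (apply Rlt_le, Q);
      specialize (Q t); pose proof (Cmod_ge_0 (Sc th t)).
    + specialize (B1 t Ht). replace (M * / x ^ 2 * exp (0 * t)) with (M * exp (0 * t) * / x ^ 2) by ring. apply Rmult_le_compat; lra.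
    + specialize (B2 t Ht). replace (M * / x ^ 2 * exp (- (Re p + 1) * t)) with (M * exp (- (Re p + 1) * t) * / x ^ 2) by ring. apply Rmult_le_compat; lra.
Qed.

Lemma mellin_Sc_lint th p : 0 < th < 1 -> 0 < Re p -> is_lint (fun t => (cexp (p * t) * Sc th t)%C) (mellin (Sc th) (1 - p)).
Proof.
  intros Hth Hp. pose proof (mellin_Sc_correct th Hth (1 - p)) as H. change (Re (1 - p)) with (1 - Re p) in H.
  specialize (H ltac:(lra)). eapply is_lint_ext; [|exact H]. intro t. unfold Sc. cbv beta.
  now replace (1 - (1 - p))%C with p by ring.
Qed.

(** Comes from u^2/(x^2 + d^2 u^2) = (1 - x^2/(x^2 + d^2 u^2))/d^2. *)
Lemma Jl_rec th x d p : 0 < th < 1 -> 0 < x -> 0 < d -> 2 < Re p ->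
  Jl th x d p = (RtoC (/ d ^ 2) * (mellin (Sc th) (3 - p) - RtoC (x ^ 2) * Jl th x d (p - 2)))%C.
Proof.
  intros Hth Hx Hd Hp.
  assert (Hx2 : 0 < x ^ 2) by (apply pow_lt; auto). assert (Hd2 : 0 < d ^ 2) by (apply pow_lt; auto).
  assert (Hr : 0 < Re (p - 2)) by (change (Re (p - 2)) with (Re p - 2); lra).
  pose proof (mellin_Sc_lint th (p - 2) Hth Hr) as H1. replace (1 - (p - 2))%C with (3 - p)%C in H1 by ring.
  pose proof (is_lint_scal (RtoC (x ^ 2)) _ _ (Jf_correct th x d (p - 2) Hth Hx Hd Hr)) as H2.
  pose proof (is_lint_scal (RtoC (/ d ^ 2)) _ _ (is_lint_minus _ _ _ _ H1 H2)) as H3.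
  apply is_lint_lint. eapply is_lint_ext; [|exact H3]. intro t. cbv beta. unfold Jf.
  replace (p * t)%C with ((p - 2) * t + RtoC (2 * t))%C by (rewrite RtoC_mult; ring). rewrite cexp_plus, cexp_RtoC.
  set (E := exp (2 * t)). assert (HE : 0 < E) by apply exp_pos.
  replace (RtoC E * (Sc th t * RtoC (/ (x ^ 2 + d ^ 2 * E))))%C with (Sc th t * RtoC (E * / (x ^ 2 + d ^ 2 * E)))%C by (rewrite RtoC_mult; ring).
  replace (cexp ((p - 2) * t) * RtoC E * (Sc th t * RtoC (/ (x ^ 2 + d ^ 2 * E))))%C with (cexp ((p - 2) * t) * Sc th t * RtoC (E * / (x ^ 2 + d ^ 2 * E)))%C by (rewrite RtoC_mult; ring).
  replace (E * / (x ^ 2 + d ^ 2 * E)) with (/ d ^ 2 * (1 - x ^ 2 * / (x ^ 2 + d ^ 2 * E))) by (field; split; nra).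
  rewrite RtoC_mult, RtoC_minus, RtoC_mult. ring.
Qed.

(** N applications of [Jl_rec]. Each lowers the exponent by 2 and emits one Mellin transform, at a
    point of real part below 1 because 2N < Re p. *)
Lemma Jl_expand th x d p N : 0 < th < 1 -> 0 < x -> 0 < d -> 2 * INR N < Re p ->
  Jl th x d p = (csum (fun k => (alt k * RtoC (x ^ (2 * k) * / d ^ (2 * S k)) * mellin (Sc th) (2 * INR (S k) + 1 - p))%C) N
    + alt N * RtoC (x ^ (2 * N) * / d ^ (2 * N)) * Jl th x d (p - 2 * INR N))%C.
Proof.
  intros Hth Hx Hd. induction N; intros Hp.
  - simpl. unfold alt. simpl. replace (p - 2 * 0)%C with p by ring. rewrite Rinv_1, Rmult_1_l. ring.
  - rewrite S_INR in Hp. rewrite IHN by lra. cbn [csum].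
    rewrite (Jl_rec th x d (p - 2 * INR N)); auto.
    2: { replace (Re (p - 2 * INR N)) with (Re p - 2 * INR N); [lra|]. simpl. unfold Re. ring. }
    replace (3 - (p - 2 * INR N))%C with (2 * INR (S N) + 1 - p)%C by (rewrite S_INR, RtoC_plus; ring).
    replace (p - 2 * INR N - 2)%C with (p - 2 * INR (S N))%C by (rewrite S_INR, RtoC_plus; ring).
    rewrite alt_S. replace (2 * S N)%nat with (S (S (2 * N))) by lia.
    assert (N1 : d ^ (2 * N) <> 0) by (apply pow_nonzero; lra).
    replace (x ^ S (S (2 * N)) * / d ^ S (S (2 * N))) with (x ^ (2 * N) * / d ^ (2 * N) * / d ^ 2 * x ^ 2).
    2: { rewrite <- !tech_pow_Rmult. field. split; auto. lra. }
    replace (x ^ (2 * N) * / d ^ S (S (2 * N))) with (x ^ (2 * N) * / d ^ (2 * N) * / d ^ 2).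
    2: { rewrite <- !tech_pow_Rmult. field. split; auto. lra. }
    rewrite !RtoC_mult. ring.
Qed.

(** The difference equals (a - b)(u - a b)/((a^2 + u)(b^2 + u)). The bound is uniform in u and, for
    a and b of order m, it is O(1/m^2), unlike that of either term alone. *)
Lemma pair_diff_le a b u : 0 < a -> 0 < b -> Rabs (a - b) <= 1 -> 0 <= u ->
  Rabs (a * / (a ^ 2 + u) - b * / (b ^ 2 + u)) <= / (a * b).
Proof.
  intros Ha Hb Hab Hu. assert (P1 : 0 < a * b) by (apply Rmult_lt_0_compat; auto).
  assert (P2 : 0 < a ^ 2 + u) by nra. assert (P3 : 0 < b ^ 2 + u) by nra.
  assert (P4 : 0 < (a ^ 2 + u) * (b ^ 2 + u)) by (apply Rmult_lt_0_compat; auto).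
  replace (a * / (a ^ 2 + u) - b * / (b ^ 2 + u)) with ((a - b) * ((u - a * b) * / ((a ^ 2 + u) * (b ^ 2 + u)))) by (field; split; lra).
  rewrite Rabs_mult. apply Rle_trans with (1 * / (a * b)); [|lra]. apply Rmult_le_compat; auto; try apply Rabs_pos.
  rewrite Rabs_mult, (Rabs_pos_eq (/ _)) by (apply Rlt_le, Rinv_0_lt_compat; auto).
  assert (Q : Rabs (u - a * b) <= u + a * b) by (apply Rabs_le; lra).
  apply Rmult_le_reg_r with (((a ^ 2 + u) * (b ^ 2 + u)) * (a * b)); [apply Rmult_lt_0_compat; auto|].
  replace (Rabs (u - a * b) * / ((a ^ 2 + u) * (b ^ 2 + u)) * ((a ^ 2 + u) * (b ^ 2 + u) * (a * b))) with (Rabs (u - a * b) * (a * b)) by (field; split; lra).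
  replace (/ (a * b) * ((a ^ 2 + u) * (b ^ 2 + u) * (a * b))) with ((a ^ 2 + u) * (b ^ 2 + u)) by (field; split; lra).
  apply Rle_trans with ((u + a * b) * (a * b)); [apply Rmult_le_compat_r; lra|].
  assert (a * b <= a ^ 2 + b ^ 2) by (pose proof (Rle_0_sqr (a - b)) as Z; unfold Rsqr in Z; nra).
  assert (u * (a * b) <= u * (a ^ 2 + b ^ 2)) by (apply Rmult_le_compat_l; auto). nra.
Qed.

(** [Sf] is expanded in partial fractions under the integral and each term is evaluated by
    [lint_double]. The pieces x^(p-2)/a, taken in pairs, sum to x^(p-2) 2 pi Sf(0) by [Sf_series] at
    u = 0; what remains is the inner series, whose convergence is thereby established. *)
Lemma Jl_inner th x n p : 0 < th < 1 -> 0 < x -> (1 <= n)%nat -> 0 < Re p < 2 ->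
  exists inner, cser (fun m => inner_term p x th n m) inner /\
   (RtoC (2 * PI) * Jl th x (INR n) p = kJ p * (cpow (INR n) (- p) * (cpow x (p - 2) * RtoC (2 * PI * Sf th 0) - inner)))%C.
Proof.
  intros Hth Hx Hn Hp. pose proof PI_RGT_0 as HPI. set (d := INR n).
  assert (Hd : 0 < d) by (apply lt_0_INR; lia).
  assert (Hx2 : 0 < x ^ 2) by (apply pow_lt; auto). assert (Hd2 : 0 < d ^ 2) by (apply pow_lt; auto).
  set (th0 := Rmin th (1 - th)).
  set (f := fun a t => (qJ p a t * RtoC (a * / (x ^ 2 + d ^ 2 * exp (2 * t))))%C).
  set (V := fun a : R => (kJ p * (cpow d (- p) * (cpow x (p - 2) / a - d * qfun p x (d * a)%R)))%C).
  assert (Hf : forall a, 0 < a -> is_lint (f a) (V a)) by (intros a Ha; now apply lint_double).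
  destruct rser_inv_sqr as [sg Hsg].
  assert (Hxd : 0 < x / d) by (apply Rdiv_lt_0_compat; auto).
  pose proof (exp_bounded_qJ p (x / d) Hp Hxd) as Hq.
  set (c := Rmin (Re p) (2 - Re p)) in *. assert (Hc : 0 < c) by (apply Rmin_glb_lt; lra).
  set (Mq := / (x / d) ^ 2 + 1) in *.
  assert (HMq : 0 < Mq). { unfold Mq. assert (0 < / (x / d) ^ 2) by (apply Rinv_0_lt_compat, pow_lt; auto). lra. }
  assert (Hth0 : 0 < th0) by (apply Rmin_glb_lt; lra).
  set (Kc := / d ^ 2 * / th0 ^ 2 * Mq).
  destruct (lint_series (fun m t => (f (INR m + th)%R t - f (INR m + 1 - th)%R t)%C)
     (fun t => (RtoC (2 * PI) * Jf th x d p t)%C) (fun m => (V (INR m + th)%R - V (INR m + 1 - th)%R)%C)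
     (fun m => Kc * / INR (S m) ^ 2) (Kc * sg) c) as (l & Hl & Hser); auto.
  - intro m. destruct (shifted_ge th m Hth) as (S1 & S2 & S3 & S4 & S5). apply is_lint_minus; apply Hf; lra.
  - intros m t. destruct (shifted_ge th m Hth) as (S1 & S2 & S3 & S4 & S5). fold th0 in S1, S2, S3, S4, S5.
    set (a := INR m + th) in *. set (b := INR m + 1 - th) in *. set (u := exp (2 * t)). assert (Hu : 0 < u) by apply exp_pos.
    assert (HS : 0 < INR (S m)) by (apply lt_0_INR; lia).
    (* The factor [qJ p (x / d)] carries the decay in t and the difference of the pair the decay in
       m. *)
    replace (f a t - f b t)%C with (RtoC (a * / (a ^ 2 + u) - b * / (b ^ 2 + u)) * (RtoC (/ d ^ 2) * qJ p (x / d) t))%C.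
    + rewrite !Cmod_mult, Cmod_R, (Cmod_RtoC_pos (/ d ^ 2)) by (apply Rlt_le, Rinv_0_lt_compat; auto).
      assert (Hab : Rabs (a * / (a ^ 2 + u) - b * / (b ^ 2 + u)) <= / (a * b)).
      { apply pair_diff_le; try lra. unfold a, b. apply Rabs_le. lra. }
      assert (Hab2 : / (a * b) <= / th0 ^ 2 * / INR (S m) ^ 2).
      { rewrite <- Rinv_mult. apply Rinv_le_contravar; [apply Rmult_lt_0_compat; apply pow_lt; auto|].
        replace (th0 ^ 2 * INR (S m) ^ 2) with ((th0 * INR (S m)) * (th0 * INR (S m))) by ring.
        assert (0 < th0 * INR (S m)) by (apply Rmult_lt_0_compat; auto). apply Rmult_le_compat; lra. }
      specialize (Hq t). pose proof (Cmod_ge_0 (qJ p (x / d) t)).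
      replace (Kc * / INR (S m) ^ 2 * exp (- c * Rabs t)) with ((/ th0 ^ 2 * / INR (S m) ^ 2) * (/ d ^ 2 * (Mq * exp (- c * Rabs t)))) by (unfold Kc; ring).
      assert (0 < / d ^ 2) by now apply Rinv_0_lt_compat.
      apply Rmult_le_compat; [apply Rabs_pos|apply Rmult_le_pos; lra|lra|]. apply Rmult_le_compat_l; lra.
    + unfold f, qJ. fold u.
      replace (/ ((x / d) ^ 2 + u)) with (d ^ 2 * / (x ^ 2 + d ^ 2 * u)) by (field; repeat split; try lra; nra).
      rewrite RtoC_minus, !RtoC_mult.
      replace (RtoC (/ d ^ 2)) with (/ RtoC (d ^ 2))%C by (rewrite RtoC_inv; auto; lra).
      field. apply RtoC_neq_0. lra.
  - now apply rser_scal.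
  - apply (ccont_mult (fun _ => RtoC (2 * PI))); [apply ccont_const|]. apply (Jf_correct th x d p); auto. lra.
  - intro t. pose proof (Sf_series th (exp t) Hth) as A1. apply cser_RtoC in A1.
    apply (cser_scal (cexp (p * t) * RtoC (/ (x ^ 2 + d ^ 2 * exp (2 * t))))%C) in A1.
    unfold Jf, Sc. rewrite RtoC_mult in A1.
    replace (RtoC (2 * PI) * (cexp (p * t) * (RtoC (Sf th (exp t)) * RtoC (/ (x ^ 2 + d ^ 2 * exp (2 * t))))))%C with
      (cexp (p * t) * RtoC (/ (x ^ 2 + d ^ 2 * exp (2 * t))) * (RtoC (2 * PI) * RtoC (Sf th (exp t))))%C by ring.
    eapply cser_ext; [|exact A1]. intro m. cbv beta. unfold f, qJ. unfold Rdiv.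
    replace (exp t ^ 2) with (exp (2 * t)) by (replace (2 * t) with (t + t) by ring; rewrite exp_plus; ring).
    rewrite RtoC_minus, !RtoC_mult. ring.
  - assert (EJ : l = (RtoC (2 * PI) * Jl th x d p)%C).
    { eapply is_lint_unique; [exact Hl|]. apply is_lint_scal. apply Jf_correct; auto. lra. }
    rewrite EJ in Hser. clear EJ Hl l.
    pose proof (Sf_series th 0 Hth) as A0. apply cser_RtoC in A0.
    assert (Nk : kJ p <> RtoC 0).
    { unfold kJ. intro E. assert (Hs := sin_half_neq p Hp).
      apply (RtoC_neq_0 (PI / 2)); [lra|]. replace (RtoC (PI / 2)) with (RtoC (PI / 2) / Csin ((PI / 2)%R * p) * Csin ((PI / 2)%R * p))%C by (field; auto).
      rewrite E. ring. }
    assert (Nd : cpow d (- p) <> RtoC 0) by apply cpow_neq_0.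
    apply (cser_scal (/ (kJ p * cpow d (- p)))) in Hser. apply (cser_scal (cpow x (p - 2))) in A0.
    pose proof (cser_minus _ _ _ _ A0 Hser) as H3.
    exists (cpow x (p - 2) * RtoC (2 * PI * Sf th 0) - / (kJ p * cpow d (- p)) * (RtoC (2 * PI) * Jl th x d p))%C. split.
    + eapply cser_ext; [|exact H3]. intro m. cbv beta. unfold inner_term, V. fold d.
      destruct (shifted_ge th m Hth) as (S1 & S2 & S3 & S4 & S5). fold th0 in S1, S2, S3, S4, S5.
      replace ((INR m + th) / ((INR m + th) ^ 2 + 0 ^ 2)) with (/ (INR m + th)) by (field; lra).
      replace ((INR m + 1 - th) / ((INR m + 1 - th) ^ 2 + 0 ^ 2)) with (/ (INR m + 1 - th)) by (field; lra).
      rewrite RtoC_minus, !RtoC_inv by lra.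
      assert (N1 : RtoC (INR m + th) <> RtoC 0) by (apply RtoC_neq_0; lra).
      assert (N2 : RtoC (INR m + 1 - th) <> RtoC 0) by (apply RtoC_neq_0; lra).
      field. repeat split; auto.
    + field. split; auto.
Qed.

(** 4 pi lam is - 2 pi + 2 u/x plus the sum over d of 4 x u/(x^2 + d^2 u^2). As S(0) need not
    vanish, integrating u^(nu-1) S(u) separately requires Re nu > 0. *)
Lemma strict_split nu x th : 0 < x -> 0 < th < 1 -> 0 < Re nu ->
  exists l lR, cser (lhs_term nu x th) l /\ cser (fun k => (RtoC (4 * x) * Jl th x (INR (S k)) (nu + 1))%C) lR /\
    l = (RtoC (- (2 * PI)) * mellin (Sc th) (1 - nu) + RtoC (2 / x) * mellin (Sc th) (- nu) + lR)%C.
Proof.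
  intros Hx Hth Hnu. pose proof PI_RGT_0 as HPI. destruct (lhs_lint nu x th Hx Hth) as (l & Hl & Hser).
  assert (Hnu1 : Re (nu + 1) = Re nu + 1) by reflexivity.
  assert (Hx2 : 0 < x ^ 2) by (apply pow_lt; auto).
  pose proof (mellin_Sc_lint th nu Hth Hnu) as HA. pose proof (mellin_Sc_lint th (nu + 1) Hth ltac:(lra)) as HB.
  replace (1 - (nu + 1))%C with (- nu)%C in HB by ring.
  set (R0 := fun t : R => (cexp (nu * t) * (RtoC (4 * PI) * RtoC (Sf th (exp t) * lam x t)) -
    (RtoC (- (2 * PI)) * (cexp (nu * t) * Sc th t) + RtoC (2 / x) * (cexp ((nu + 1) * t) * Sc th t)))%C).
  pose proof (is_lint_minus _ _ _ _ Hl (is_lint_plus _ _ _ _ (is_lint_scal (RtoC (- (2 * PI))) _ _ HA) (is_lint_scal (RtoC (2 / x)) _ _ HB))) as HR.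
  cbv beta in HR. fold R0 in HR.
  (* The bound x^2 + d^2 u^2 >= c0 (d u)^(1+del) leaves d^(-1-del), summable over d, and the
     exponent nu - del, still of positive real part. *)
  set (del := Rmin (Re nu) 1 / 2).
  assert (Hdel : 0 < del < 1 /\ del < Re nu).
  { unfold del. pose proof (Rmin_l (Re nu) 1). pose proof (Rmin_r (Re nu) 1). assert (0 < Rmin (Re nu) 1) by (apply Rmin_glb_lt; lra). lra. }
  destruct Hdel as [Hdel1 Hdel2].
  destruct (rser_pseries del ltac:(lra)) as [sg Hsg].
  set (q := RtoC (Re nu - del)). assert (Hq : Re q = Re nu - del) by reflexivity.
  destruct (Sc_bounds th Hth (Re q + 1) ltac:(lra)) as (M & HM & B1 & B2).
  assert (Hed : exp_bounded (fun t => (cexp (q * t) * Sc th t)%C) (M + M) (Rmin (Re q + 0) (Re q + 1 - Re q))).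
  { apply exp_bounded_shift_lin; auto; lra. }
  set (c := Rmin (Re q + 0) (Re q + 1 - Re q)) in *. assert (Hc : 0 < c) by (apply Rmin_glb_lt; lra).
  set (c0 := Rmin 1 (x ^ 2)). assert (Hc0 : 0 < c0) by (apply Rmin_glb_lt; lra).
  (* If d u >= 1 the power 2 dominates the power 1 + del; otherwise x^2 alone suffices. *)
  assert (Low : forall d t, 0 < d -> c0 * (Rpower d (1 + del) * exp ((1 + del) * t)) <= x ^ 2 + d ^ 2 * exp (2 * t)).
  { intros d t Hd. unfold Rpower. rewrite <- exp_plus. rewrite <- (exp_2ln d), <- exp_plus by auto.
    replace ((1 + del) * ln d + (1 + del) * t) with ((1 + del) * (ln d + t)) by ring.
    replace (2 * ln d + 2 * t) with (2 * (ln d + t)) by ring. set (y := ln d + t).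
    pose proof (exp_pos (2 * y)). pose proof (exp_pos ((1 + del) * y)). pose proof (Rmin_l 1 (x ^ 2) : c0 <= _). pose proof (Rmin_r 1 (x ^ 2) : c0 <= _).
    destruct (Rle_dec 0 y) as [L|L].
    - assert (G : exp ((1 + del) * y) <= exp (2 * y)) by (apply exp_le; nra). assert (c0 * exp ((1 + del) * y) <= 1 * exp (2 * y)) by (apply Rmult_le_compat; lra). lra.
    - apply Rnot_le_lt in L. assert (G0 : (1 + del) * y <= 0) by (assert (0 < 1 + del) by lra; nra).
      pose proof (exp_le _ _ G0) as G. rewrite exp_0 in G.
      assert (c0 * exp ((1 + del) * y) <= c0 * 1) by (apply Rmult_le_compat_l; lra). lra. }
  set (Kc := 4 * x * / c0 * (M + M)).
  destruct (lint_series (fun k t => (RtoC (4 * x) * Jf th x (INR (S k)) (nu + 1) t)%C) R0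
     (fun k => (RtoC (4 * x) * Jl th x (INR (S k)) (nu + 1))%C) (fun k => Kc * Rpower (INR (S k)) (- 1 - del)) (Kc * sg) c) as (lR & HlR & HserR); auto.
  - intro k. apply is_lint_scal. apply Jf_correct; auto; [apply lt_0_INR; lia|lra].
  - intros k t. set (d := INR (S k)). assert (Hd : 0 < d) by (apply lt_0_INR; lia). specialize (Hed t). specialize (Low d t Hd).
    cbv beta in Hed. unfold Jf. rewrite !Cmod_mult, Cmod_cexp_lin in *. rewrite Hq in Hed. rewrite Hnu1.
    pose proof (exp_pos (2 * t)) as P2. assert (Hd2 : 0 < d ^ 2) by (apply pow_lt; auto).
    rewrite (Cmod_RtoC_pos (4 * x)) by lra. rewrite (Cmod_RtoC_pos (/ _)) by (apply Rlt_le, Rinv_0_lt_compat; nra).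
    pose proof (Rpower_gt0 d (1 + del)) as P3. pose proof (exp_pos ((1 + del) * t)) as P4.
    assert (P5 : 0 < Rpower d (1 + del) * exp ((1 + del) * t)) by (apply Rmult_lt_0_compat; auto).
    assert (Inv : / (x ^ 2 + d ^ 2 * exp (2 * t)) <= / c0 * (Rpower d (- 1 - del) * exp (- ((1 + del) * t)))).
    { replace (- 1 - del) with (- (1 + del)) by ring. rewrite Rpower_Ropp, exp_Ropp, <- !Rinv_mult. apply Rinv_le_contravar; auto.
      apply Rmult_lt_0_compat; auto. }
    pose proof (Cmod_ge_0 (Sc th t)) as P6. pose proof (exp_pos ((Re nu + 1) * t)) as P7.
    apply Rle_trans with (4 * x * (exp ((Re nu + 1) * t) * (Cmod (Sc th t) * (/ c0 * (Rpower d (- 1 - del) * exp (- ((1 + del) * t))))))).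
    + apply Rmult_le_compat_l; [lra|]. apply Rmult_le_compat_l; [lra|]. apply Rmult_le_compat_l; auto.
    + replace (4 * x * (exp ((Re nu + 1) * t) * (Cmod (Sc th t) * (/ c0 * (Rpower d (-1 - del) * exp (- ((1 + del) * t))))))) with
        ((4 * x * / c0 * Rpower d (-1 - del)) * ((exp ((Re nu + 1) * t) * exp (- ((1 + del) * t))) * Cmod (Sc th t))) by ring.
      rewrite <- exp_plus. replace ((Re nu + 1) * t + - ((1 + del) * t)) with ((Re nu - del) * t) by ring.
      replace (Kc * Rpower d (-1 - del) * exp (- c * Rabs t)) with ((4 * x * / c0 * Rpower d (-1 - del)) * ((M + M) * exp (- c * Rabs t))) by (unfold Kc; ring).
      apply Rmult_le_compat_l; auto. pose proof (Rpower_gt0 d (-1 - del)). assert (0 < / c0) by now apply Rinv_0_lt_compat.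
      apply Rmult_le_pos; [|lra]. apply Rmult_le_pos; lra.
  - now apply rser_scal.
  - apply HR.
  - intro t. pose proof (lam_series x t Hx) as A1. apply cser_RtoC in A1.
    apply (cser_scal (RtoC 2 * (cexp (nu * t) * Sc th t))%C) in A1.
    match type of A1 with cser _ ?s => replace (R0 t) with s end.
    + eapply cser_ext; [|exact A1]. intro k. cbv beta. unfold Jf.
      replace ((nu + 1) * t)%C with (nu * t + t)%C by ring. rewrite cexp_plus, cexp_RtoC.
      replace (2 * x * exp t * / (x ^ 2 + INR (S k) ^ 2 * exp (2 * t))) with (2 * x * exp t * (/ (x ^ 2 + INR (S k) ^ 2 * exp (2 * t)))) by ring.
      replace (4 * x) with (2 * (2 * x)) by ring. rewrite !RtoC_mult. ring.
    + unfold R0. replace ((nu + 1) * t)%C with (nu * t + t)%C by ring. rewrite cexp_plus, cexp_RtoC. unfold Sc.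
      replace (2 * PI * lam x t + PI - exp t / x) with (2 * PI * lam x t + PI - exp t * / x) by reflexivity.
      replace (2 / x) with (2 * / x) by reflexivity. replace (4 * PI) with (2 * 2 * PI) by ring.
      rewrite !RtoC_minus, !RtoC_opp, !RtoC_plus, !RtoC_mult. ring.
  - exists l, lR. split; auto. split; auto.
    pose proof (is_lint_unique _ _ _ HlR HR) as E. rewrite E. ring.
Qed.

(** * The identity for |Re nu - 2N| < 1 *)

Definition cos_pi_half (nu : C) : C := Ccos (Cmult (RtoC (PI / 2)) nu).
Definition sin_pi_half (nu : C) : C := Csin (Cmult (RtoC (PI / 2)) nu).
Definition hdiff (Zh : C -> R -> C) (th : R) (s : C) : C := Cminus (Zh s th) (Zh s (1 - th)).

(** The value T of the double series is a parameter, so that the right-hand sides for different N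
    can be compared. The index j counts from 0, hence [S j] and the exponent 2 j + 1. *)
Definition rhs (Zh : C -> R -> C) (L : C) (x th : R) (nu : C) (N : nat) (T : C) : C :=
  (Cminus (Cminus (Cplus (Cminus
        (Cmult (Cdiv (RtoC 1) (cos_pi_half nu)) (Cmult (Zh (Cplus nu (RtoC 1)) 1) (Cmult L (cpow x nu))))
        (Cmult (Cdiv (RtoC PI) (Cmult (RtoC 2) (sin_pi_half nu))) (hdiff Zh th (Cminus (RtoC 1) nu))))
        (Cmult (Cdiv (RtoC 1) (Cmult (RtoC (2 * x)) (cos_pi_half nu))) (hdiff Zh th (Copp nu))))
        (Cmult (Cdiv (RtoC 1) (cos_pi_half nu))
           (csum (fun j => Cmult (Zh (RtoC (2 * INR (S j))) 1)
                 (Cmult (hdiff Zh th (Cminus (RtoC (2 * INR (S j))) nu)) (RtoC (x ^ (2 * j + 1))))) N)))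
        (Cmult (Cdiv (RtoC 1) (cos_pi_half nu)) (Cmult (RtoC (x ^ (2 * N + 1))) T))).

Definition summed (x th : R) (nu : C) (N : nat) (inner : nat -> C) (T : C) : Prop :=
  (forall d, cser (fun m => inner_term (nu + 1 - 2 * INR N)%C x th (S d) m) (inner d)) /\
  cser (fun d => (cpow (INR (S d)) (- nu - 1) * inner d)%C) T.

Lemma alt_sqr N : (alt N * alt N)%C = RtoC 1.
Proof.
  unfold alt. rewrite <- RtoC_mult, <- pow_add. replace (N + N)%nat with (2 * N)%nat by lia. now rewrite pow_1_even.
Qed.

Lemma Ccos_reflect w N : Ccos ((PI * INR N)%R - w) = (alt N * Ccos w)%C.
Proof.
  induction N.
  - unfold alt. simpl. rewrite Rmult_0_r. replace (0 - w)%C with (- w)%C by ring. rewrite Ccos_opp. ring.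
  - rewrite alt_S, S_INR. replace ((PI * (INR N + 1))%R - w)%C with ((PI * INR N)%R - w + PI)%C.
    2: rewrite !RtoC_mult, RtoC_plus; ring.
    rewrite Ccos_plus, Csin_RtoC, Ccos_RtoC, sin_PI, cos_PI, IHN.
    apply C_ext; simpl; ring.
Qed.

Lemma kJ_shift nu N : kJ (nu + 1 - 2 * INR N) = ((PI / 2)%R / (alt N * cos_pi_half nu))%C.
Proof.
  unfold kJ, cos_pi_half. rewrite <- Ccos_reflect. f_equal.
  rewrite <- (Ccos_opp (_ - _)). rewrite <- Csin_PI2. f_equal.
  replace (RtoC (PI * INR N)) with (2 * (RtoC (PI / 2) * INR N))%C; [ring|].
  rewrite <- !RtoC_mult. f_equal. field.
Qed.

Lemma Cmult_reg_l_eq (a b c : C) : a <> RtoC 0 -> (a * b)%C = (a * c)%C -> b = c.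
Proof.
  intros Ha E. replace b with (/ a * (a * b))%C by (field; auto). rewrite E. field. auto.
Qed.

Section Strict.
Variables (Zh : C -> R -> C) (th x : R) (L : C).
Hypothesis HZ : is_hurwitz_zeta Zh.
Hypothesis Hth : 0 < th < 1.
Hypothesis Hx : 0 < x.
Hypothesis HL : filterlim (fun s => Cminus (Zh s th) (Zh s (1 - th)))
    (within (fun s => s <> RtoC 1) (locally (RtoC 1))) (locally L).

Lemma hdiff_mellin s : Re s < 1 -> hdiff Zh th s = (4 * Ccos ((PI / 2)%R * s) * mellin (Sc th) s)%C.
Proof. exact (hurwitz_diff_mellin Zh th L HZ Hth HL s). Qed.

Lemma zeta_cser s : 1 < Re s -> cser (fun n => cpow (INR (S n)) (- s)) (Zh s 1).
Proof.
  intro Hs. destruct (HZ 1 ltac:(lra)) as [H _]. specialize (H s Hs). apply Cis_series_cser in H.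
  eapply cser_ext; [|exact H]. intro n. cbv beta. now rewrite S_INR.
Qed.

Lemma cos_pi_half_neq nu N : -1 < Re nu - 2 * INR N < 1 -> cos_pi_half nu <> RtoC 0.
Proof.
  intros H E. apply (sin_half_neq (nu + 1 - 2 * INR N)).
  - replace (Re (nu + 1 - 2 * INR N)) with (Re nu + 1 - 2 * INR N); [lra|]. simpl. unfold Re. ring.
  - replace ((PI / 2)%R * (nu + 1 - 2 * INR N))%C with (- ((PI * INR N)%R - (PI / 2)%R * nu) + (PI / 2)%R)%C.
    + rewrite Csin_PI2, Ccos_opp, Ccos_reflect. fold (cos_pi_half nu). rewrite E. ring.
    + replace (RtoC (PI * INR N)) with (2 * (RtoC (PI / 2) * INR N))%C; [ring|]. rewrite <- !RtoC_mult. f_equal. field.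
Qed.

(** At s = 2(k+1) - nu the factor cos(pi s/2) is (-1)^(k+1) cos(pi nu/2): the alternating sign of
    the expansion cancels and a single minus sign survives. *)
Lemma hdiff_even nu k : Re (2 * INR (S k) - nu) < 1 -> cos_pi_half nu <> RtoC 0 ->
  (4 * (alt k * mellin (Sc th) (2 * INR (S k) - nu)))%C = (- (hdiff Zh th (2 * INR (S k) - nu) / cos_pi_half nu))%C.
Proof.
  intros Hs Nc. rewrite (hdiff_mellin _ Hs).
  replace ((PI / 2)%R * (2 * INR (S k) - nu))%C with ((PI * INR (S k))%R - (PI / 2)%R * nu)%C.
  - rewrite Ccos_reflect, alt_S. fold (cos_pi_half nu). field. auto.
  - replace (RtoC (PI * INR (S k))) with (2 * (RtoC (PI / 2) * INR (S k)))%C; [ring|]. rewrite <- !RtoC_mult. f_equal. field.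
Qed.

Lemma cpow_inv_even (d : R) j : 0 < d -> cpow d (- (2 * INR j)) = RtoC (/ d ^ (2 * j)).
Proof.
  intro Hd. rewrite cpow_opp. replace (2 * INR j)%C with (RtoC (INR (2 * j))) by (rewrite mult_INR, RtoC_mult; reflexivity).
  rewrite cpow_INR, RtoC_inv; auto. apply pow_nonzero. lra.
Qed.

(** For each d, [Jl_expand] and [Jl_inner] combine into one linear relation, which is solved for the
    inner sum. Everything else in it is summable over d, to zeta(nu+1), to the zeta(2k) and to the
    series of [strict_split], so the outer series converges without any estimate of its own. *)
Theorem koshliakov_interior nu N : 0 < Re nu -> -1 < Re nu - 2 * INR N < 1 -> sin_pi_half nu <> RtoC 0 ->
  exists inner T, summed x th nu N inner T /\ cser (lhs_term nu x th) (rhs Zh L x th nu N T).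
Proof.
  intros Hnu HN Ns. pose proof PI_RGT_0 as HPI. pose proof (cos_pi_half_neq nu N HN) as Nc.
  set (e := (nu + 1 - 2 * INR N)%C).
  assert (He : 0 < Re e < 2).
  { unfold e. replace (Re (nu + 1 - 2 * INR N)) with (Re nu + 1 - 2 * INR N); [lra|]. simpl. unfold Re. ring. }
  destruct (strict_split nu x th Hx Hth Hnu) as (l & lR & Hl & HlR & El).
  assert (Hinn : forall d, exists inner, cser (fun m => inner_term e x th (S d) m) inner /\
   (RtoC (2 * PI) * Jl th x (INR (S d)) e = kJ e * (cpow (INR (S d)) (- e) * (cpow x (e - 2) * L - inner)))%C).
  { intro d. rewrite (hurwitz_diff_at_1 Zh th L HZ Hth HL). apply Jl_inner; auto. lia. }
  destruct (choice _ Hinn) as [inner Hinner]. clear Hinn.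
  pose proof (zeta_cser (nu + 1) ltac:(change (Re (nu + 1)) with (Re nu + 1); lra)) as HZ1.
  assert (HZk : forall k, cser (fun n => RtoC (/ INR (S n) ^ (2 * S k))) (Zh (2 * INR (S k))%C 1)).
  { intro k. assert (HR : Re (2 * INR (S k)) = 2 * INR (S k)) by (simpl; unfold Re; ring).
    pose proof (zeta_cser (2 * INR (S k))) as H. rewrite HR, S_INR in H. pose proof (pos_INR k). specialize (H ltac:(lra)). rewrite <- S_INR in H.
    eapply cser_ext; [|exact H]. intro n. cbv beta. apply cpow_inv_even. apply lt_0_INR. lia. }
  set (c := cos_pi_half nu) in *. set (X := cpow x nu). set (xN := RtoC (x ^ (2 * N + 1))).
  assert (NxN : xN <> RtoC 0) by (apply RtoC_neq_0, pow_nonzero; lra).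
  set (hk := fun k => (hdiff Zh th (2 * INR (S k) - nu) * RtoC (x ^ (2 * k + 1)))%C).
  (* The relation for a single d; the factor d^(2N) of the exponent e cancels the d^(-2N) of the
     expansion and leaves the weight d^(-nu-1). *)
  assert (Per : forall d, (c / xN * (X / c * (L * cpow (INR (S d)) (- (nu + 1))) -
       csum (fun k => (hk k / c * RtoC (/ INR (S d) ^ (2 * S k)))%C) N - RtoC (4 * x) * Jl th x (INR (S d)) (nu + 1)))%C
       = (cpow (INR (S d)) (- nu - 1) * inner d)%C).
  { intro d0. destruct (Hinner d0) as [_ HJ]. set (d := INR (S d0)) in *. assert (Hd : 0 < d) by (apply lt_0_INR; lia).
    assert (HJe := Jl_expand th x d (nu + 1) N Hth Hx Hd). 
    replace (Re (nu + 1)) with (Re nu + 1) in HJe by reflexivity. specialize (HJe ltac:(lra)). fold e in HJe.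
    assert (E1 : (RtoC (4 * x) * csum (fun k => (alt k * RtoC (x ^ (2 * k) * / d ^ (2 * S k)) * mellin (Sc th) (2 * INR (S k) + 1 - (nu + 1)))%C) N)%C
       = (- csum (fun k => (hk k / c * RtoC (/ d ^ (2 * S k)))%C) N)%C).
    { rewrite <- csum_scal. replace (- csum (fun k => (hk k / c * RtoC (/ d ^ (2 * S k)))%C) N)%C with (- (1) * csum (fun k => (hk k / c * RtoC (/ d ^ (2 * S k)))%C) N)%C by ring.
      rewrite <- csum_scal. apply csum_ext. intros k Hk.
      replace (2 * INR (S k) + 1 - (nu + 1))%C with (2 * INR (S k) - nu)%C by ring.
      assert (Hs : Re (2 * INR (S k) - nu) < 1).
      { replace (Re (2 * INR (S k) - nu)) with (2 * INR (S k) - Re nu) by (simpl; unfold Re; ring). apply le_INR in Hk. lra. }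
      pose proof (hdiff_even nu k Hs Nc) as Hev. fold c in Hev. unfold hk.
      rewrite pow_add, pow_1, !RtoC_mult.
      replace (4 * x * (alt k * (RtoC (x ^ (2 * k)) * RtoC (/ d ^ (2 * S k))) * mellin (Sc th) (2 * INR (S k) - nu)))%C with
        (x * RtoC (x ^ (2 * k)) * RtoC (/ d ^ (2 * S k)) * (4 * (alt k * mellin (Sc th) (2 * INR (S k) - nu))))%C by ring.
      rewrite Hev. field. auto. }
    assert (Nx : RtoC x <> RtoC 0) by (apply RtoC_neq_0; lra).
    assert (Nd : RtoC d <> RtoC 0) by (apply RtoC_neq_0; lra).
    assert (NP : RtoC PI <> RtoC 0) by (apply RtoC_neq_0; lra).
    assert (NdN : RtoC (d ^ (2 * N)) <> RtoC 0) by (apply RtoC_neq_0, pow_nonzero; lra).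
    assert (NxN' : RtoC (x ^ (2 * N)) <> RtoC 0) by (apply RtoC_neq_0, pow_nonzero; lra).
    assert (Na : alt N <> RtoC 0). { intro E. pose proof (alt_sqr N) as E2. rewrite E in E2. apply (f_equal Re) in E2. simpl in E2. lra. }
    assert (I2N : (2 * INR N)%C = RtoC (INR (2 * N))) by (rewrite mult_INR, RtoC_mult; reflexivity).
    assert (Ed : cpow d (- e) = (cpow d (- nu - 1) * RtoC (d ^ (2 * N)))%C).
    { rewrite <- cpow_INR, <- cpow_plus, <- I2N by auto. f_equal. unfold e. ring. }
    assert (Ex : (cpow x (e - 2) * xN)%C = X).
    { unfold xN, X. rewrite <- cpow_INR, <- cpow_plus by auto. f_equal. rewrite plus_INR, RtoC_plus, <- I2N. unfold e. simpl. ring. }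
    assert (Ex2 : cpow x (e - 2) = (X / xN)%C) by (rewrite <- Ex; field; auto).
    rewrite Ed, Ex2 in HJ. unfold e at 2 in HJ. rewrite kJ_shift in HJ. fold c in HJ.
    assert (HJ2 : Jl th x d e = (/ (4 * (alt N * c)) * (cpow d (- nu - 1) * RtoC (d ^ (2 * N)) * (X / xN * L - inner d0)))%C).
    { apply (Cmult_reg_l_eq (RtoC (2 * PI))); [apply RtoC_neq_0; lra|]. rewrite HJ. rewrite RtoC_mult, RtoC_div by lra. field. repeat split; auto. }
    replace (- (nu + 1))%C with (- nu - 1)%C by ring.
    replace (RtoC (4 * x) * Jl th x d (nu + 1))%C with (- csum (fun k => (hk k / c * RtoC (/ d ^ (2 * S k)))%C) N +
       RtoC (4 * x) * (alt N * RtoC (x ^ (2 * N) * / d ^ (2 * N)) * Jl th x d e))%C.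
    2: { rewrite HJe, <- E1. ring. }
    rewrite HJ2. rewrite !RtoC_mult, RtoC_inv by (apply pow_nonzero; lra).
    assert (ExN : xN = (RtoC (x ^ (2 * N)) * x)%C) by (unfold xN; rewrite pow_add, pow_1, RtoC_mult; reflexivity).
    rewrite ExN. field. repeat split; auto. }
  (* The sum over d of the left-hand side of [Per]. *)
  set (T := (c / xN * (X / c * (L * Zh (nu + 1) 1) - csum (fun k => (hk k / c * Zh (2 * INR (S k))%C 1)%C) N - lR))%C).
  exists inner, T. split; [split|].
  - intro d. apply Hinner.
  - eapply cser_ext; [intro d; apply Per|]. unfold T. apply cser_scal. apply cser_minus; [apply cser_minus|exact HlR].
    + apply cser_scal. apply cser_scal. exact HZ1.
    + apply (cser_csum (fun k d => (hk k / c * RtoC (/ INR (S d) ^ (2 * S k)))%C)). intros k _. apply cser_scal. apply HZk.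
  - replace (rhs Zh L x th nu N T) with l; auto. rewrite El. unfold rhs. fold c X xN.
    assert (EA : (RtoC (- (2 * PI)) * mellin (Sc th) (1 - nu))%C = (- (PI / (2 * sin_pi_half nu) * hdiff Zh th (1 - nu)))%C).
    { rewrite hdiff_mellin by (change (Re (1 - nu)) with (1 - Re nu); lra).
      replace ((PI / 2)%R * (1 - nu))%C with (- ((PI / 2)%R * nu) + (PI / 2)%R)%C by ring.
      rewrite Ccos_PI2, Csin_opp. fold (sin_pi_half nu). rewrite RtoC_opp, RtoC_mult. field. auto. }
    assert (EB : (RtoC (2 / x) * mellin (Sc th) (- nu))%C = (1 / (RtoC (2 * x) * c) * hdiff Zh th (- nu))%C).
    { rewrite hdiff_mellin by (change (Re (- nu)) with (- Re nu); lra).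
      replace ((PI / 2)%R * - nu)%C with (- ((PI / 2)%R * nu))%C by ring.
      rewrite Ccos_opp. fold (cos_pi_half nu). fold c. rewrite RtoC_mult, RtoC_div by lra. field. split; auto. apply RtoC_neq_0. lra. }
    rewrite EA, EB.
    assert (EC : csum (fun k => (hk k / c * Zh (2 * INR (S k))%C 1)%C) N = (/ c * csum (fun j => (Zh (RtoC (2 * INR (S j))) 1 * (hdiff Zh th (RtoC (2 * INR (S j)) - nu) * RtoC (x ^ (2 * j + 1))))%C) N)%C).
    { rewrite <- csum_scal. apply csum_ext. intros k _. unfold hk. rewrite <- !RtoC_mult. unfold Cdiv. ring. }
    unfold T. rewrite EC. field. repeat split; auto. apply RtoC_neq_0. lra.
Qed.
End Strict.

(** * Continuity in nu *)

Definition lhs_weight (x th : R) (t : R) : C := (RtoC (4 * PI) * RtoC (Sf th (exp t) * lam x t))%C.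

(** Near u = 0 the factor [lam] decays like exp(-2 pi x/u). At infinity it grows at most like u/(2
    pi x), while [Sf] decays faster than any power; the rate k + 1 asked of [Sf] pays for that
    growth. *)
Lemma lhs_weight_bounds x th k : 0 < x -> 0 < th < 1 -> 0 < k -> exists M, 0 < M /\
  (forall t, t <= 0 -> Cmod (lhs_weight x th t) <= M * exp (k * t)) /\
  (forall t, 0 <= t -> Cmod (lhs_weight x th t) <= M * exp (- k * t)).
Proof.
  intros Hx Hth Hk. pose proof PI_RGT_0 as HPI.
  assert (Hc : 0 < 2 * PI * x) by (apply Rmult_lt_0_compat; lra).
  destruct (exp_exp_decay_scaled (2 * PI * x) k Hc Hk) as (M1 & HM1 & H1).
  destruct (Sf_decay th (k + 1) Hth ltac:(lra)) as (M2 & HM2 & H2).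
  set (B := / sin (PI * th) ^ 2). assert (HB : 0 < B) by (apply Rinv_0_lt_compat, pow_lt, sin_PI_pos; auto).
  set (q0 := exp (- (2 * PI * x))). assert (Hq0 : 0 < q0 < 1).
  { unfold q0. split; [apply exp_pos|]. rewrite <- exp_0. apply exp_increasing. lra. }
  assert (E1 : 0 < 4 * PI * B * M1 / (1 - q0)) by (apply Rdiv_lt_0_compat; [|lra]; apply Rmult_lt_0_compat; [apply Rmult_lt_0_compat|]; lra).
  assert (E2 : 0 < 4 * PI * M2 / (2 * PI * x)) by (apply Rdiv_lt_0_compat; [|lra]; apply Rmult_lt_0_compat; lra).
  exists (4 * PI * B * M1 / (1 - q0) + 4 * PI * M2 / (2 * PI * x)). split; [lra|].
  assert (Hl0 : forall t, 0 < lam x t). { intro t. pose proof (nome_lt1 x t Hx). unfold lam. apply Rdiv_lt_0_compat; lra. }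
  split; intros t Ht; unfold lhs_weight; rewrite Cmod_mult, !Cmod_R, (Rabs_pos_eq (4 * PI)), Rabs_mult, (Rabs_pos_eq (lam x t)) by (try lra; apply Rlt_le; auto);
    pose proof (Hl0 t) as Hlt; pose proof (nome_lt1 x t Hx) as Hn.
  - apply Rle_trans with ((4 * PI * B * M1 / (1 - q0)) * exp (k * t)); [|pose proof (exp_pos (k * t)); nra].
    assert (Hnq : nome x t <= q0).
    { unfold nome, q0. apply exp_le. assert (1 <= exp (- t)) by (rewrite <- exp_0; apply exp_le; lra). nra. }
    assert (Hnm : nome x t <= M1 * exp (k * t)).
    { specialize (H1 (- t)). replace (k * t) with (- k * - t) by ring. unfold nome. eapply Rle_trans; [|exact H1]. apply Req_le. f_equal. ring. }
    assert (Hl : lam x t <= M1 * exp (k * t) / (1 - q0)).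
    { unfold lam, Rdiv. apply Rmult_le_compat; try lra; [apply Rlt_le, Rinv_0_lt_compat; lra|apply Rinv_le_contravar; lra]. }
    pose proof (Sf_bound th (exp t) Hth) as Hs. fold B in Hs. pose proof (Rabs_pos (Sf th (exp t))).
    replace (4 * PI * B * M1 / (1 - q0) * exp (k * t)) with (4 * PI * (B * (M1 * exp (k * t) / (1 - q0)))) by (field; lra).
    apply Rmult_le_compat_l; [lra|]. apply Rmult_le_compat; lra.
  - apply Rle_trans with ((4 * PI * M2 / (2 * PI * x)) * exp (- k * t)); [|pose proof (exp_pos (- k * t)); nra].
    specialize (H2 t Ht). pose proof (exp_pos t) as Et. set (y := 2 * PI * (x * exp (- t))).
    assert (Hy : 0 < y) by (unfold y; pose proof (exp_pos (- t)); assert (0 < x * exp (- t)) by (apply Rmult_lt_0_compat; auto); nra).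
    assert (Hl : lam x t <= exp t / (2 * PI * x)).
    { replace (exp t / (2 * PI * x)) with (/ y).
      - unfold lam. assert (En : nome x t = / exp y) by (unfold nome, y; rewrite <- exp_Ropp; f_equal; ring). rewrite En.
        pose proof (exp_ineq1 y ltac:(lra)). replace (/ exp y / (1 - / exp y)) with (/ (exp y - 1)) by (field; lra).
        apply Rinv_le_contravar; lra.
      - unfold y. rewrite exp_Ropp. field. repeat split; lra. }
    replace (4 * PI * M2 / (2 * PI * x) * exp (- k * t)) with (4 * PI * ((M2 * exp (- (k + 1) * t)) * (exp t / (2 * PI * x)))).
    + pose proof (Rabs_pos (Sf th (exp t))). apply Rmult_le_compat_l; [lra|]. apply Rmult_le_compat; lra.
    + replace (- k * t) with (- (k + 1) * t + t) by ring. rewrite exp_plus. field. repeat split; lra.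
Qed.

Lemma lhs_sum_mellin nu x th l : 0 < x -> 0 < th < 1 -> cser (lhs_term nu x th) l -> l = mellin (lhs_weight x th) (1 - nu).
Proof.
  intros Hx Hth H. destruct (lhs_lint nu x th Hx Hth) as (l' & Hl & Hs). rewrite (cser_unique _ _ _ H Hs).
  symmetry. apply is_lint_lint. eapply is_lint_ext; [|exact Hl]. intro t. cbv beta.
  replace (1 - (1 - nu))%C with nu by ring. reflexivity.
Qed.

(** The sum is the Mellin transform of [lhs_weight] at 1 - nu, which is differentiable for every nu
    because the rate k may be as large as desired. *)
Lemma lhs_continuous x th u nu l ln : 0 < x -> 0 < th < 1 -> ccvg u nu ->
  (forall n, cser (lhs_term (u n) x th) (ln n)) -> cser (lhs_term nu x th) l -> ccvg ln l.
Proof.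
  intros Hx Hth Hu Hln Hl. rewrite (lhs_sum_mellin nu x th l Hx Hth Hl).
  eapply ccvg_ext; [intro n; symmetry; apply (lhs_sum_mellin (u n) x th (ln n) Hx Hth (Hln n))|].
  set (k := Rabs (Re nu) + 1). assert (Hk : 0 < k) by (unfold k; pose proof (Rabs_pos (Re nu)); lra).
  destruct (lhs_weight_bounds x th k Hx Hth Hk) as (M & HM & B1 & B2).
  assert (Hc : ccontat (fun _ => True) (mellin (lhs_weight x th)) (1 - nu)).
  { apply cdiff_ccontat. apply mellin_cdiff with M k k; auto.
    - apply (ccont_mult (fun _ => RtoC (4 * PI))); [apply ccont_const|now apply ccont_nome_lam].
    - change (Re (1 - nu)) with (1 - Re nu). pose proof (Rle_abs (Re nu)). pose proof (Rle_abs (- Re nu)) as H1. rewrite Rabs_Ropp in H1. unfold k. lra. }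
  apply (Hc (fun n => (1 - u n)%C)); auto. apply ccvg_minus; [apply ccvg_const|auto].
Qed.

Lemma ccvg_cexp u z : ccvg u z -> ccvg (fun n => cexp (u n)) (cexp z).
Proof.
  intros H. assert (Hc : ccontat (fun _ => True) (fun w => cexp w) z) by apply cdiff_ccontat, cdiff_cexp, cdiff_id.
  apply (Hc u); auto.
Qed.

Lemma ccvg_cpow y u z : ccvg u z -> ccvg (fun n => cpow y (u n)) (cpow y z).
Proof.
  intros H. eapply ccvg_ext; [intro n; symmetry; apply cpow_cexp|]. rewrite cpow_cexp. apply ccvg_cexp.
  apply ccvg_mult; [auto|apply ccvg_const].
Qed.

Lemma ccvg_qfun u e x y : ccvg u e -> ccvg (fun n => qfun (u n) x y) (qfun e x y).
Proof.
  intros H. unfold qfun. destruct (Req_EM_T y x) as [E|E].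
  - apply ccvg_mult; [auto|]. unfold Cdiv. apply ccvg_mult; [|apply ccvg_const]. apply ccvg_cpow. apply ccvg_minus; [auto|apply ccvg_const].
  - unfold Cdiv. apply ccvg_mult; [|apply ccvg_const]. apply ccvg_minus; now apply ccvg_cpow.
Qed.

Lemma ccvg_inner_term u e x th d m : ccvg u e -> ccvg (fun n => inner_term (u n) x th d m) (inner_term e x th d m).
Proof.
  intro H. unfold inner_term. apply ccvg_minus; apply ccvg_mult; try apply ccvg_const; now apply ccvg_qfun.
Qed.

(** * Uniform bounds and limits for the double series *)

Lemma ln_le_sub1 a : 0 < a -> ln a <= a - 1.
Proof.
  intro Ha. destruct (Req_dec (ln a) 0) as [E|E].
  - rewrite E. assert (a = 1) by (rewrite <- (exp_ln a), E, exp_0; auto). lra.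
  - pose proof (exp_ineq1 (ln a) E) as H. rewrite exp_ln in H by auto. lra.
Qed.

Lemma Rpower_le_abs x r rho : 0 <= r <= rho -> Rpower x r <= exp (rho * Rabs (ln x)).
Proof. intros H. apply exp_le. pose proof (Rle_abs (ln x)). pose proof (Rabs_pos (ln x)). nra. Qed.

(** y^e - x^e = x^e (exp(e (ln y - ln x)) - 1) and |ln y - ln x| <= 2 |y - x|/x, so the numerator
    has a factor |y - x| that cancels the zero of the denominator. *)
Lemma qfun_near e x y rho E : 0 < x -> 0 <= Re e <= rho -> Cmod e <= E -> Rabs (y - x) < x / 2 ->
  Cmod (qfun e x y) <= 8 * E * exp E * exp (rho * Rabs (ln x)) / x ^ 3.
Proof.
  intros Hx He HE Hy. pose proof (Cmod_ge_0 e) as He0. pose proof (Rpower_le_abs x (Re e) rho He) as Hr.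
  set (K2 := exp (rho * Rabs (ln x))) in *. assert (HK2 : 0 < K2) by apply exp_pos.
  assert (Hx3 : 0 < x ^ 3) by (apply pow_lt; auto).
  assert (HeE : 1 <= exp E) by (rewrite <- exp_0; apply exp_le; lra).
  apply Rabs_def2 in Hy as Hy2. destruct Hy2 as [Hy1 Hy2]. unfold qfun. destruct (Req_EM_T y x) as [Eq|Eq].
  - assert (Hx2 : 0 < 2 * x ^ 2) by (assert (0 < x ^ 2) by (apply pow_lt; auto); lra).
    rewrite Cmod_mult, Cmod_div by (apply RtoC_neq_0; lra). rewrite Cmod_cpow, Cmod_RtoC_pos by lra.
    change (Re (e - 1)) with (Re e - 1). unfold Rminus. rewrite Rpower_plus, Rpower_Ropp, Rpower_1 by auto.
    replace (Cmod e * (Rpower x (Re e) * / x / (2 * x ^ 2))) with ((Cmod e * Rpower x (Re e)) / (2 * x ^ 3)) by (field; lra).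
    apply Rle_trans with (E * K2 / (2 * x ^ 3)).
    + apply Rmult_le_compat_r; [apply Rlt_le, Rinv_0_lt_compat; lra|]. apply Rmult_le_compat; auto. apply Rlt_le, Rpower_gt0.
    + apply Rmult_le_reg_r with (x ^ 3); auto. replace (E * K2 / (2 * x ^ 3) * x ^ 3) with (E * K2 / 2) by (field; lra).
      replace (8 * E * exp E * K2 / x ^ 3 * x ^ 3) with (8 * (E * K2) * exp E) by (field; lra).
      assert (0 <= E * K2) by (apply Rmult_le_pos; lra). nra.
  - set (h := Rabs (y - x)) in *. assert (Hh : 0 < h) by (apply Rabs_pos_lt; lra).
    assert (Hy0 : x / 2 < y) by lra.
    assert (Hln : Rabs (ln y - ln x) <= 2 * h / x).
    { assert (L1 : ln y - ln x <= (y - x) / x).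
      { rewrite <- ln_div by lra. eapply Rle_trans; [apply ln_le_sub1; apply Rdiv_lt_0_compat; lra|]. right. field. lra. }
      assert (L2 : ln x - ln y <= (x - y) / y).
      { rewrite <- ln_div by lra. eapply Rle_trans; [apply ln_le_sub1; apply Rdiv_lt_0_compat; lra|]. right. field. lra. }
      pose proof (Rle_abs (y - x)) as A1. pose proof (Rle_abs (- (y - x))) as A2. rewrite Rabs_Ropp in A2. fold h in A1, A2.
      assert (Hix : 0 < / x) by (apply Rinv_0_lt_compat; auto).
      apply Rabs_le. split.
      - assert ((x - y) / y <= 2 * h / x); [|lra]. apply Rmult_le_reg_r with (x * y); [nra|].
        replace ((x - y) / y * (x * y)) with ((x - y) * x) by (field; lra). replace (2 * h / x * (x * y)) with (2 * h * y) by (field; lra). nra.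
      - eapply Rle_trans; [exact L1|]. unfold Rdiv. apply Rmult_le_compat_r; lra. }
    assert (Ec : (cpow y e - cpow x e)%C = (cpow x e * (cexp (e * (ln y - ln x)%R) - 1))%C).
    { rewrite !cpow_cexp, RtoC_minus. replace (e * ln y)%C with (e * ln x + e * (ln y - ln x))%C at 1 by ring. rewrite cexp_plus. ring. }
    assert (Hden : 0 < x * x / 2 * h) by (apply Rmult_lt_0_compat; nra).
    assert (Hden2 : x * x / 2 * h <= Rabs (y * (y ^ 2 - x ^ 2))).
    { replace (y * (y ^ 2 - x ^ 2)) with (y * (y + x) * (y - x)) by ring. rewrite Rabs_mult, (Rabs_pos_eq (y * (y + x))) by nra. fold h.
      apply Rmult_le_compat_r; [lra|]. nra. }
    rewrite Cmod_div by (apply RtoC_neq_0; intro Z; rewrite Z, Rabs_R0 in Hden2; lra). rewrite Ec, Cmod_mult, Cmod_cpow, Cmod_R.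
    assert (Hw : Cmod (e * (ln y - ln x)%R) <= E * (2 * h / x)).
    { rewrite Cmod_mult, Cmod_R. apply Rmult_le_compat; auto. apply Rabs_pos. }
    assert (Hw2 : E * (2 * h / x) <= E).
    { rewrite <- (Rmult_1_r E) at 2. apply Rmult_le_compat_l; [lra|]. apply Rmult_le_reg_r with x; auto.
      replace (2 * h / x * x) with (2 * h) by (field; lra). lra. }
    assert (Hnum : Cmod (cexp (e * (ln y - ln x)%R) - 1) <= 2 * (E * (2 * h / x) * exp E)).
    { eapply Rle_trans; [apply cexp_m1_le|]. apply Rmult_le_compat_l; [lra|].
      apply Rmult_le_compat; [apply Cmod_ge_0|apply Rlt_le, exp_pos|auto|apply exp_le; lra]. }
    apply Rle_trans with ((K2 * (2 * (E * (2 * h / x) * exp E))) / (x * x / 2 * h)).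
    + unfold Rdiv. apply Rmult_le_compat.
      * apply Rmult_le_pos; [apply Rlt_le, Rpower_gt0|apply Cmod_ge_0].
      * apply Rlt_le, Rinv_0_lt_compat. eapply Rlt_le_trans; [exact Hden|exact Hden2].
      * apply Rmult_le_compat; auto; [apply Rlt_le, Rpower_gt0|apply Cmod_ge_0].
      * apply Rinv_le_contravar; [exact Hden|exact Hden2].
    + right. field. lra.
Qed.

(** Away from x the numerator is O(y^rho) and the denominator at least y^3/3. The constant in y0
    covers small y, where lower powers of y are the larger ones. *)
Lemma qfun_far e x y y0 rho : 0 < x -> 0 <= Re e <= rho -> 0 < y0 <= y -> x / 2 <= Rabs (y - x) ->
  Cmod (qfun e x y) <= 3 * (exp (rho * Rabs (ln y0)) * (1 + exp (rho * Rabs (ln x)))) * Rpower y (rho - 3).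
Proof.
  intros Hx He Hy Hyx. pose proof (Rpower_le_abs x (Re e) rho He) as Hr.
  set (K2 := exp (rho * Rabs (ln x))) in *. set (K1 := exp (rho * Rabs (ln y0))).
  assert (HK1 : forall r, 0 <= r <= rho -> Rpower y r <= K1 * Rpower y rho).
  { intros r Hrr. unfold K1, Rpower. rewrite <- exp_plus. apply exp_le.
    assert (ln y0 <= ln y) by (apply ln_le; lra). pose proof (Rle_abs (- ln y0)) as A. rewrite Rabs_Ropp in A. pose proof (Rabs_pos (ln y0)). nra. }
  unfold qfun. destruct (Req_EM_T y x) as [Eq|Eq].
  { exfalso. rewrite Eq in Hyx. replace (x - x) with 0 in Hyx by ring. rewrite Rabs_R0 in Hyx. lra. }
  assert (Hy3 : 0 < y ^ 3) by (apply pow_lt; lra).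
  (* If y >= 3x/2 then y - x >= y/3; if y <= x/2 then x - y >= y. *)
  assert (Hden : y ^ 3 / 3 <= Rabs (y * (y ^ 2 - x ^ 2))).
  { replace (y * (y ^ 2 - x ^ 2)) with (y * ((y + x) * (y - x))) by ring. rewrite !Rabs_mult, (Rabs_pos_eq y), (Rabs_pos_eq (y + x)) by lra.
    replace (y ^ 3 / 3) with (y * (y * (y / 3))) by field. apply Rmult_le_compat_l; [lra|]. 
    apply Rmult_le_compat; try lra. revert Hyx. unfold Rabs. destruct (Rcase_abs (y - x)); lra. }
  rewrite Cmod_div by (apply RtoC_neq_0; intro Z; rewrite Z, Rabs_R0 in Hden; lra). rewrite Cmod_R.
  assert (Hnum : Cmod (cpow y e - cpow x e) <= K1 * (1 + K2) * Rpower y rho).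
  { unfold Cminus. eapply Rle_trans; [apply Cmod_triangle|]. rewrite Cmod_opp, !Cmod_cpow.
    pose proof (HK1 (Re e) He) as G1. pose proof (HK1 0 ltac:(lra)) as G2. rewrite Rpower_O in G2 by lra.
    assert (0 < K2) by apply exp_pos. nra. }
  replace (rho - 3) with (rho + - INR 3) by (simpl; ring). rewrite Rpower_plus, Rpower_Ropp, Rpower_pow by lra.
  replace (3 * (K1 * (1 + K2)) * (Rpower y rho * / y ^ 3)) with ((K1 * (1 + K2) * Rpower y rho) * / (y ^ 3 / 3)) by (field; lra).
  unfold Rdiv at 1. apply Rmult_le_compat; auto; [apply Cmod_ge_0| |].
  - apply Rlt_le, Rinv_0_lt_compat. lra.
  - apply Rinv_le_contravar; lra.
Qed.

(** Uniform for e in a bounded part of the strip 0 <= Re e <= rho. Since rho < 2, the exponent rho -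
    3 is below -1, which makes the double series absolutely convergent. K4 minorises y^(rho-3) for y
    < 3x/2 and brings the bound near x into the same form. *)
Lemma qfun_bound x y0 rho E : 0 < x -> 0 < y0 -> 0 < rho < 2 -> 0 < E -> exists K, 0 < K /\
  forall e y, 0 <= Re e <= rho -> Cmod e <= E -> y0 <= y -> Cmod (qfun e x y) <= K * Rpower y (rho - 3).
Proof.
  intros Hx Hy0 Hrho HE.
  set (K1 := 3 * (exp (rho * Rabs (ln y0)) * (1 + exp (rho * Rabs (ln x))))).
  set (K3 := 8 * E * exp E * exp (rho * Rabs (ln x)) / x ^ 3). set (K4 := Rpower (3 * x / 2) (rho - 3)).
  assert (HK1 : 0 < K1).
  { unfold K1. pose proof (exp_pos (rho * Rabs (ln y0))). pose proof (exp_pos (rho * Rabs (ln x))). nra. }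
  assert (HK3 : 0 < K3).
  { unfold K3. apply Rdiv_lt_0_compat; [|apply pow_lt; auto]. pose proof (exp_pos E). pose proof (exp_pos (rho * Rabs (ln x))).
    apply Rmult_lt_0_compat; [|auto]. apply Rmult_lt_0_compat; lra. }
  assert (HK4 : 0 < K4) by apply Rpower_gt0.
  exists (K1 + K3 / K4). split; [assert (0 < K3 / K4) by (apply Rdiv_lt_0_compat; auto); lra|].
  intros e y He HeE Hy. pose proof (Rpower_gt0 y (rho - 3)) as P.
  assert (0 < K3 / K4) by (apply Rdiv_lt_0_compat; auto).
  destruct (Rle_dec (x / 2) (Rabs (y - x))) as [F|F].
  - pose proof (qfun_far e x y y0 rho Hx He ltac:(lra) F) as G. fold K1 in G. nra.
  - apply Rnot_le_lt in F. pose proof (qfun_near e x y rho E Hx He HeE F) as G. fold K3 in G.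
    apply Rabs_def2 in F. assert (G2 : K4 <= Rpower y (rho - 3)) by (apply Rpower_neg_le; lra).
    assert (K3 <= K3 / K4 * Rpower y (rho - 3)).
    { replace K3 with (K3 / K4 * K4) at 1 by (field; lra). apply Rmult_le_compat_l; lra. }
    nra.
Qed.

(** The factor d in front of [qfun] raises its power from rho - 3 to rho - 2; the outer weight
    d^(-nu-1), at most 1/d for Re nu >= 0, restores rho - 3. *)
Lemma inner_term_bound x th rho E : 0 < x -> 0 < th < 1 -> 0 < rho < 2 -> 0 < E -> exists K, 0 < K /\
  forall e d m, 0 <= Re e <= rho -> Cmod e <= E ->
   Cmod (inner_term e x th (S d) m) <= K * Rpower (INR (S d)) (rho - 2) * Rpower (INR (S m)) (rho - 3).
Proof.
  intros Hx Hth Hrho HE. set (th0 := Rmin th (1 - th)). assert (Hth0 : 0 < th0) by (apply Rmin_glb_lt; lra).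
  destruct (qfun_bound x th0 rho E Hx Hth0 Hrho HE) as (K & HK & HKb).
  exists (2 * K * Rpower th0 (rho - 3)). split; [pose proof (Rpower_gt0 th0 (rho - 3)); nra|].
  intros e d m He HeE. destruct (shifted_ge th m Hth) as (S1 & S2 & S3 & S4 & S5). fold th0 in S1, S2, S3, S4, S5.
  set (D := INR (S d)). assert (HD : 1 <= D) by (apply (le_INR 1); lia).
  set (m1 := INR (S m)) in *. assert (Hm1 : 0 < m1) by (apply lt_0_INR; lia).
  assert (G : forall a, th0 * m1 <= a -> th0 <= a -> Cmod (RtoC D * qfun e x (D * a)%R) <= K * Rpower th0 (rho - 3) * (Rpower D (rho - 2) * Rpower m1 (rho - 3))).
  { intros a A1 A2. rewrite Cmod_mult, Cmod_RtoC_pos by lra.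
    assert (P1 : 0 < th0 * m1) by (apply Rmult_lt_0_compat; auto).
    pose proof (HKb e (D * a) He HeE ltac:(nra)) as Q.
    assert (Q2 : Rpower (D * a) (rho - 3) <= Rpower D (rho - 3) * (Rpower th0 (rho - 3) * Rpower m1 (rho - 3))).
    { rewrite <- Rpower_mult_distr by lra. apply Rmult_le_compat_l; [apply Rlt_le, Rpower_gt0|].
      rewrite Rpower_mult_distr by lra. apply Rpower_neg_le; lra. }
    replace (rho - 2) with (1 + (rho - 3)) by ring. rewrite Rpower_plus, Rpower_1 by lra.
    replace (K * Rpower th0 (rho - 3) * (D * Rpower D (rho - 3) * Rpower m1 (rho - 3))) with
      (D * (K * (Rpower D (rho - 3) * (Rpower th0 (rho - 3) * Rpower m1 (rho - 3))))) by ring.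
    apply Rmult_le_compat_l; [lra|]. eapply Rle_trans; [exact Q|]. apply Rmult_le_compat_l; lra. }
  unfold inner_term. fold D. unfold Cminus. eapply Rle_trans; [apply Cmod_triangle|]. rewrite Cmod_opp.
  pose proof (G (INR m + th) S1 S3). pose proof (G (INR m + 1 - th) S2 S4).
  replace (D * (INR m + 1 - th)) with (D * (INR m + 1 - th)) in * by ring. lra.
Qed.

(** Tannery's theorem twice, for the inner sums at fixed d and then for the outer one; both
    majorants come from the series of exponent rho - 3. *)
Lemma summed_limit x th (u : nat -> C) nu N inn Tn rho E : 0 < x -> 0 < th < 1 -> 0 < rho < 2 -> 0 < E ->
  ccvg u nu -> (forall n, 0 <= Re (u n)) -> (forall n, 0 <= Re (u n + 1 - 2 * INR N) <= rho) ->
  (forall n, Cmod (u n + 1 - 2 * INR N) <= E) -> (forall n, summed x th (u n) N (inn n) (Tn n)) ->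
  exists inner T, summed x th nu N inner T /\ ccvg Tn T.
Proof.
  intros Hx Hth Hrho HE Hu Hu0 Hre Hmod Hs.
  destruct (inner_term_bound x th rho E Hx Hth Hrho HE) as (K & HK & HKb).
  destruct (rser_pseries (2 - rho) ltac:(lra)) as [sg Hsg]. replace (-1 - (2 - rho)) with (rho - 3) in Hsg by ring.
  assert (Hsg0 : 0 <= sg). { pose proof (rser_ge _ _ 0 (fun k => Rlt_le _ _ (Rpower_gt0 _ _)) Hsg) as H. simpl in H. exact H. }
  assert (He : ccvg (fun n => (u n + 1 - 2 * INR N)%C) (nu + 1 - 2 * INR N)%C).
  { apply ccvg_minus; [apply ccvg_plus; [auto|apply ccvg_const]|apply ccvg_const]. }
  assert (Hin : forall d, exists B, cser (fun m => inner_term (nu + 1 - 2 * INR N)%C x th (S d) m) B /\ ccvg (fun n => inn n d) B).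
  { intro d. apply (tannery (fun n m => inner_term (u n + 1 - 2 * INR N)%C x th (S d) m) (fun n => inn n d) _
      (fun m => K * Rpower (INR (S d)) (rho - 2) * Rpower (INR (S m)) (rho - 3)) (K * Rpower (INR (S d)) (rho - 2) * sg)).
    - intros n m. apply HKb; auto.
    - now apply rser_scal.
    - intro m. now apply ccvg_inner_term.
    - intro n. apply (proj1 (Hs n)). }
  destruct (choice _ Hin) as [inner Hinner].
  destruct (tannery (fun n d => (cpow (INR (S d)) (- u n - 1) * inn n d)%C) Tn (fun d => (cpow (INR (S d)) (- nu - 1) * inner d)%C)
     (fun d => K * sg * Rpower (INR (S d)) (rho - 3)) (K * sg * sg)) as (T & HT & HTn).
  - intros n d. assert (HD : 1 <= INR (S d)) by (apply (le_INR 1); lia).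
    assert (Hi : Cmod (inn n d) <= K * Rpower (INR (S d)) (rho - 2) * sg).
    { apply (cser_mod_le (fun m => inner_term (u n + 1 - 2 * INR N)%C x th (S d) m) _ (fun m => K * Rpower (INR (S d)) (rho - 2) * Rpower (INR (S m)) (rho - 3))).
      - intro m. apply HKb; auto.
      - now apply rser_scal.
      - apply (proj1 (Hs n)). }
    rewrite Cmod_mult, Cmod_cpow. change (Re (- u n - 1)) with (- Re (u n) - 1).
    assert (Hp : Rpower (INR (S d)) (- Re (u n) - 1) <= Rpower (INR (S d)) (- (1))).
    { apply exp_le. assert (0 <= ln (INR (S d))) by (rewrite <- ln_1; apply ln_le; lra). specialize (Hu0 n). nra. }
    replace (rho - 3) with (- (1) + (rho - 2)) by ring. rewrite Rpower_plus.
    replace (K * sg * (Rpower (INR (S d)) (- (1)) * Rpower (INR (S d)) (rho - 2))) with (Rpower (INR (S d)) (- (1)) * (K * Rpower (INR (S d)) (rho - 2) * sg)) by ring.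
    apply Rmult_le_compat; auto; [apply Rlt_le, Rpower_gt0|apply Cmod_ge_0].
  - now apply rser_scal.
  - intro d. apply ccvg_mult; [|apply Hinner]. apply ccvg_cpow. apply ccvg_minus; [now apply ccvg_opp|apply ccvg_const].
  - intro n. apply (proj2 (Hs n)).
  - exists inner, T. split; auto. split; auto. intro d. apply Hinner.
Qed.

Lemma Csin_zero z : Csin z = RtoC 0 -> exists k : Z, z = RtoC (IZR k * PI).
Proof.
  intro E. pose proof (Cmod_Csin z) as M. rewrite E, Cmod_0 in M.
  pose proof (sinh_sqr_ge (Im z)) as S1. pose proof (pow2_ge_0 (Im z)). pose proof (pow2_ge_0 (sin (Re z))).
  assert (Hi : Im z = 0) by nra. assert (Hs : sin (Re z) = 0) by nra.
  destruct (sin_eq_0_0 _ Hs) as [k Hk]. exists k. apply C_ext; simpl; auto.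
Qed.

Lemma half_integer nu (r : R) : ((PI / 2)%R * nu)%C = RtoC r -> nu = RtoC (r * (2 / PI)).
Proof.
  intro E. pose proof PI_RGT_0. assert (N : RtoC (PI / 2) <> RtoC 0) by (apply RtoC_neq_0; lra).
  replace nu with (/ RtoC (PI / 2) * (RtoC (PI / 2) * nu))%C by (field; auto).
  rewrite E, <- RtoC_inv, <- RtoC_mult by lra. f_equal. field. lra.
Qed.

Lemma sin_pi_half_neq nu : (forall k : Z, nu <> RtoC (IZR k)) -> sin_pi_half nu <> RtoC 0.
Proof.
  intros H E. pose proof PI_RGT_0. destruct (Csin_zero _ E) as [k Hk]. apply half_integer in Hk.
  apply (H (2 * k)%Z). rewrite Hk. f_equal. rewrite mult_IZR. field. lra.
Qed.

Lemma cos_pi_half_neq_int nu : (forall k : Z, nu <> RtoC (IZR k)) -> cos_pi_half nu <> RtoC 0.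
Proof.
  intros H E. pose proof PI_RGT_0. unfold cos_pi_half in E. rewrite <- Csin_PI2 in E. destruct (Csin_zero _ E) as [k Hk].
  assert (E2 : ((PI / 2)%R * nu)%C = RtoC (IZR k * PI - PI / 2)).
  { rewrite RtoC_minus, <- Hk. ring. }
  apply half_integer in E2. apply (H (2 * k - 1)%Z). rewrite E2. f_equal. rewrite minus_IZR, mult_IZR. field. lra.
Qed.

(* Raises N by one: the difference of the two summands is the general term of a Hurwitz series. *)
Lemma qfun_rec e x y : 0 < x -> 0 < y -> qfun e x y = (RtoC (x ^ 2) * qfun (e - 2) x y + cpow y (e - 3))%C.
Proof.
  intros Hx Hy.
  assert (Nx : RtoC x <> RtoC 0) by (apply RtoC_neq_0; lra). assert (Ny : RtoC y <> RtoC 0) by (apply RtoC_neq_0; lra).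
  assert (D : forall b s, 0 < b -> cpow b (s - 1) = (cpow b s / b)%C).
  { intros b s Hb. unfold Cminus. rewrite cpow_plus, cpow_opp, cpow_1 by auto. reflexivity. }
  assert (D2 : forall b, 0 < b -> cpow b (e - 2) = (cpow b e / b / b)%C).
  { intros b Hb. replace (e - 2)%C with (e - 1 - 1)%C by ring. now rewrite !D. }
  assert (D3 : forall b, 0 < b -> cpow b (e - 3) = (cpow b e / b / b / b)%C).
  { intros b Hb. replace (e - 3)%C with (e - 1 - 1 - 1)%C by ring. now rewrite !D. }
  unfold qfun. destruct (Req_EM_T y x) as [->|E].
  - rewrite !D, D2, D3 by auto. rewrite RtoC_mult, !RtoC_pow. field. auto.
  - rewrite !D2, D3 by auto. rewrite !RtoC_mult, !RtoC_minus, !RtoC_pow. field. repeat split; auto.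
    rewrite <- !RtoC_pow, <- RtoC_minus. apply RtoC_neq_0. intro Z. apply E.
    assert (Z2 : (y - x) * (y + x) = 0) by lra. destruct (Rmult_integral _ _ Z2); lra.
Qed.

(** * The boundary lines, larger N and the conclusion *)

Section Main.
Variables (Zh : C -> R -> C) (th x : R) (L : C).
Hypothesis HZ : is_hurwitz_zeta Zh.
Hypothesis Hth : 0 < th < 1.
Hypothesis Hx : 0 < x.
Hypothesis HL : filterlim (fun s => Cminus (Zh s th) (Zh s (1 - th)))
    (within (fun s => s <> RtoC 1) (locally (RtoC 1))) (locally L).

Lemma ccvg_Zh a u s : 0 < a <= 1 -> s <> RtoC 1 -> ccvg u s -> ccvg (fun n => Zh (u n) a) (Zh s a).
Proof.
  intros Ha Hs Hu. destruct (HZ a Ha) as [_ H]. pose proof (C_differentiable_cdiff _ _ (H s Hs)) as Hd.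
  apply cdiff_ccontat in Hd. apply (Hd u); auto.
Qed.

Lemma ccvg_hdiff u s : s <> RtoC 1 -> ccvg u s -> ccvg (fun n => hdiff Zh th (u n)) (hdiff Zh th s).
Proof. intros Hs Hu. apply ccvg_minus; apply ccvg_Zh; auto; lra. Qed.

Lemma ccvg_cos_pi_half u s : ccvg u s -> ccvg (fun n => cos_pi_half (u n)) (cos_pi_half s).
Proof.
  intros Hu. pose proof (cdiff_ccontat _ _ _ (cdiff_Ccos (fun _ => True) s)) as H. apply (H u); auto.
Qed.

Lemma ccvg_sin_pi_half u s : ccvg u s -> ccvg (fun n => sin_pi_half (u n)) (sin_pi_half s).
Proof.
  intros Hu.
  assert (E : forall w, sin_pi_half w = cos_pi_half (1 - w)).
  { intro w. unfold cos_pi_half, sin_pi_half. replace ((PI / 2)%R * (1 - w))%C with (- ((PI / 2)%R * w) + (PI / 2)%R)%C by ring.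
    rewrite Ccos_PI2, Csin_opp. ring. }
  rewrite E. eapply ccvg_ext; [intro n; symmetry; apply E|]. apply ccvg_cos_pi_half. apply ccvg_minus; [apply ccvg_const|auto].
Qed.

(** For a noninteger nu none of nu + 1, 1 - nu, - nu, 2j - nu is the pole 1, and neither cos(pi
    nu/2) nor sin(pi nu/2) vanishes. *)
Lemma rhs_continuous u nu N Tn T : (forall k : Z, nu <> RtoC (IZR k)) -> ccvg u nu -> ccvg Tn T ->
  ccvg (fun n => rhs Zh L x th (u n) N (Tn n)) (rhs Zh L x th nu N T).
Proof.
  intros Hnu Hu HT. pose proof (cos_pi_half_neq_int nu Hnu) as Nc. pose proof (sin_pi_half_neq nu Hnu) as Ns.
  pose proof (ccvg_cos_pi_half u nu Hu) as Cc. pose proof (ccvg_sin_pi_half u nu Hu) as Cs.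
  assert (Hint : forall (k : Z) s, s = RtoC (IZR k) -> s <> nu) by (intros k s E1 E2; apply (Hnu k); now rewrite <- E2).
  assert (C1c : ccvg (fun n => 1 / cos_pi_half (u n))%C (1 / cos_pi_half nu)%C).
  { apply ccvg_mult; [apply ccvg_const|]. now apply ccvg_inv. }
  assert (N2x : RtoC (2 * x) <> RtoC 0) by (apply RtoC_neq_0; lra).
  unfold rhs.
  repeat match goal with |- ccvg (fun n => (_ - _)%C) _ => apply ccvg_minus | |- ccvg (fun n => (_ + _)%C) _ => apply ccvg_plus end.
  - apply ccvg_mult; auto. apply ccvg_mult.
    + apply ccvg_Zh; [lra| |apply ccvg_plus; [auto|apply ccvg_const]].
      intro E. apply (Hnu 0%Z). replace nu with (nu + 1 - 1)%C by ring. rewrite E. ring.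
    + apply ccvg_mult; [apply ccvg_const|now apply ccvg_cpow].
  - apply ccvg_mult.
    + apply ccvg_mult; [apply ccvg_const|]. apply ccvg_inv; [|apply ccvg_mult; [apply ccvg_const|auto]].
      apply Cmult_neq_0; [apply C2_neq_0|auto].
    + apply ccvg_hdiff; [|apply ccvg_minus; [apply ccvg_const|auto]].
      intro E. apply (Hnu 0%Z). replace nu with (1 - (1 - nu))%C by ring. rewrite E. ring.
  - apply ccvg_mult.
    + apply ccvg_mult; [apply ccvg_const|]. apply ccvg_inv; [|apply ccvg_mult; [apply ccvg_const|auto]].
      now apply Cmult_neq_0.
    + apply ccvg_hdiff; [|now apply ccvg_opp].
      intro E. apply (Hnu (-1)%Z). replace nu with (- (- nu))%C by ring. rewrite E. apply C_ext; simpl; ring.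
  - apply ccvg_mult; auto. apply (ccvg_csum (fun n j => (Zh (RtoC (2 * INR (S j))) 1 * (hdiff Zh th (RtoC (2 * INR (S j)) - u n) * RtoC (x ^ (2 * j + 1))))%C)).
    intros j _. apply ccvg_mult; [apply ccvg_const|]. apply ccvg_mult; [|apply ccvg_const].
    apply ccvg_hdiff; [|apply ccvg_minus; [apply ccvg_const|auto]].
    intro E. apply (Hnu (2 * Z.of_nat (S j) - 1)%Z). rewrite minus_IZR, mult_IZR, <- INR_IZR_INZ, RtoC_minus, <- E. ring.
  - apply ccvg_mult; auto. apply ccvg_mult; [apply ccvg_const|auto].
Qed.

(* The strict case applied to nu + eta/(n+k) and n -> oo covers the boundary lines Re nu = 0 and Re nu = 2N-1. *)
Theorem koshliakov_minimal nu N : (forall k : Z, nu <> RtoC (IZR k)) -> 0 <= Re nu -> -1 <= Re nu - 2 * INR N < 1 ->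
  exists inner T, summed x th nu N inner T /\ cser (lhs_term nu x th) (rhs Zh L x th nu N T).
Proof.
  (* Half the distance from Re nu - 2N to 1: adding at most eta to nu keeps it strictly inside the
     range. *)
  intros Hnu Hr HN. set (eta := (1 - (Re nu - 2 * INR N)) / 2). assert (Heta : 0 < eta <= 1) by (unfold eta; lra).
  set (w := fun n : nat => (nu + RtoC (eta * / (INR n + 1)))%C).
  assert (Hpos : forall n : nat, 0 < / (INR n + 1) <= 1).
  { intro n. pose proof (pos_INR n). split; [apply Rinv_0_lt_compat; lra|]. rewrite <- Rinv_1. apply Rinv_le_contravar; lra. }
  assert (Hw : ccvg w nu).
  { apply ccvg_of_le with (fun n => eta * / (INR n + 1)).
    - intro n. unfold w. replace (nu + RtoC (eta * / (INR n + 1)) - nu)%C with (RtoC (eta * / (INR n + 1))) by ring.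
      rewrite Cmod_RtoC_pos; [lra|]. specialize (Hpos n). nra.
    - replace (Finite 0) with (Rbar_mult eta 0) by (simpl; f_equal; ring). apply is_lim_seq_scal_l.
      replace (Finite 0) with (Rbar_inv p_infty) by reflexivity. apply is_lim_seq_inv; [|easy].
      apply is_lim_seq_plus with (l1 := p_infty) (l2 := Finite 1); [apply is_lim_seq_INR|apply is_lim_seq_const|easy]. }
  assert (Hwr : forall n, Re (w n) = Re nu + eta * / (INR n + 1)) by reflexivity.
  pose proof (sin_pi_half_neq nu Hnu) as Ns.
  (* A perturbed nu could be an integer at which sin(pi nu/2) vanishes; from index n1 on this is
     excluded by continuity. *)
  destruct (ccvg_sin_pi_half w nu Hw (Cmod (sin_pi_half nu)) (proj1 (Cmod_gt_0 _) Ns)) as [n1 Hn1].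
  set (u := fun n => w (n + n1)%nat).
  assert (Hu : ccvg u nu). { intros eps He. destruct (Hw eps He) as [M HM]. exists M. intros n Hn. apply HM. lia. }
  assert (Hur : forall n, Re nu < Re (u n) <= Re nu + eta).
  { intro n. unfold u. rewrite Hwr. specialize (Hpos (n + n1)%nat). nra. }
  assert (Hst : forall n, exists p : (nat -> C) * C, summed x th (u n) N (fst p) (snd p) /\ cser (lhs_term (u n) x th) (rhs Zh L x th (u n) N (snd p))).
  { intro n. specialize (Hur n). destruct (koshliakov_interior Zh th x L HZ Hth Hx HL (u n) N) as (inner & T & H1 & H2).
    - lra.
    - unfold eta in Hur. lra.
    - intro E. specialize (Hn1 (n + n1)%nat ltac:(lia)). fold (u n) in Hn1. rewrite E in Hn1.
      replace (0 - sin_pi_half nu)%C with (- sin_pi_half nu)%C in Hn1 by ring. rewrite Cmod_opp in Hn1. lra.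
    - exists (inner, T). auto. }
  destruct (choice _ Hst) as [p Hp].
  (* This equals 2 - eta, so the uniform bounds with rho < 2 hold along the whole sequence. *)
  set (rho := Re nu + eta + 1 - 2 * INR N).
  destruct (summed_limit x th u nu N (fun n => fst (p n)) (fun n => snd (p n)) rho (Cmod (nu + 1 - 2 * INR N) + 2)) as (inner & T & H1 & H2); auto.
  - unfold rho, eta. lra.
  - pose proof (Cmod_ge_0 (nu + 1 - 2 * INR N)). lra.
  - intro n. specialize (Hur n). lra.
  - intro n. specialize (Hur n). replace (Re (u n + 1 - 2 * INR N)) with (Re (u n) + 1 - 2 * INR N) by (simpl; unfold Re; ring).
    unfold rho. lra.
  - intro n. unfold u, w. specialize (Hpos (n + n1)%nat).
    replace (nu + RtoC (eta * / (INR (n + n1) + 1)) + 1 - 2 * INR N)%C with (nu + 1 - 2 * INR N + RtoC (eta * / (INR (n + n1) + 1)))%C by ring.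
    eapply Rle_trans; [apply Cmod_triangle|]. rewrite (Cmod_RtoC_pos (_ * _)) by nra. nra.
  - intro n. apply Hp.
  - exists inner, T. split; auto. destruct (lhs_lint nu x th Hx Hth) as (l & _ & Hl).
    replace (rhs Zh L x th nu N T) with l; auto.
    apply (ccvg_unique (fun n => rhs Zh L x th (u n) N (snd (p n)))).
    + apply (lhs_continuous x th u nu l); auto. intro n. apply Hp.
    + now apply rhs_continuous.
Qed.

(** By [qfun_rec] the inner sums for N and N + 1 differ by d^(e-2) times a Hurwitz difference at s =
    2N + 2 - nu, a convergent series because Re s > 1. Summed over d this becomes zeta(2N+2) times
    the same difference, exactly the new term of the finite sum. *)
Lemma summed_step nu N inner T : cos_pi_half nu <> RtoC 0 -> Re nu - 2 * INR N < 1 -> summed x th nu N inner T ->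
  exists inner' T', summed x th nu (S N) inner' T' /\ rhs Zh L x th nu (S N) T' = rhs Zh L x th nu N T.
Proof.
  intros Nc HN [H1 H2]. assert (Nx2 : RtoC (x ^ 2) <> RtoC 0) by (apply RtoC_neq_0, pow_nonzero; lra).
  set (e := (nu + 1 - 2 * INR N)%C) in *. set (s := (2 * INR (S N) - nu)%C).
  assert (Hs : 1 < Re s).
  { unfold s. replace (Re (2 * INR (S N) - nu)) with (2 * INR (S N) - Re nu) by (simpl; unfold Re; ring). rewrite S_INR. lra. }
  assert (Ee : (nu + 1 - 2 * INR (S N))%C = (e - 2)%C) by (unfold e; rewrite S_INR, RtoC_plus; ring).
  assert (Es : (e - 3)%C = (- s)%C) by (unfold e, s; rewrite S_INR, RtoC_plus; ring).
  pose proof (Hd_cser Zh th HZ Hth s Hs) as Hh. fold (hdiff Zh th s) in Hh.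
  assert (HRN : Re (2 * INR (S N)) = 2 * INR (S N)) by (simpl; unfold Re; ring).
  pose proof (zeta_cser Zh HZ (2 * INR (S N))) as Hz. rewrite HRN in Hz.
  assert (HSN : 1 < 2 * INR (S N)) by (rewrite S_INR; pose proof (pos_INR N); lra). specialize (Hz HSN).
  exists (fun d => (/ RtoC (x ^ 2) * (inner d - cpow (INR (S d)) (e - 2) * hdiff Zh th s))%C), (/ RtoC (x ^ 2) * (T - hdiff Zh th s * Zh (2 * INR (S N))%C 1))%C.
  split; [split|].
  - intro d. rewrite Ee. assert (HD : 0 < INR (S d)) by (apply lt_0_INR; lia).
    pose proof (cser_scal (/ RtoC (x ^ 2)) _ _ (cser_minus _ _ _ _ (H1 d) (cser_scal (cpow (INR (S d)) (e - 2)) _ _ Hh))) as H3.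
    eapply cser_ext; [|exact H3]. intro m. cbv beta. unfold inner_term.
    destruct (shifted_ge th m Hth) as (S1 & S2 & S3 & S4 & S5).
    rewrite (qfun_rec e x (INR (S d) * (INR m + th))), (qfun_rec e x (INR (S d) * (INR m + 1 - th))) by (auto; apply Rmult_lt_0_compat; lra).
    rewrite !cpow_mult_base by lra. rewrite !Es.
    replace (e - 2)%C with (1 + - s)%C by (rewrite <- Es; ring). rewrite cpow_plus, cpow_1 by auto. field. auto.
  - pose proof (cser_scal (/ RtoC (x ^ 2)) _ _ (cser_minus _ _ _ _ H2 (cser_scal (hdiff Zh th s) _ _ Hz))) as H3.
    eapply cser_ext; [|exact H3]. intro d. cbv beta.
    replace (cpow (INR (S d)) (- (2 * INR (S N)))) with (cpow (INR (S d)) (- nu - 1) * cpow (INR (S d)) (e - 2))%C; [ring|].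
    rewrite <- cpow_plus. f_equal. unfold e. rewrite S_INR, RtoC_plus. ring.
  - unfold rhs. cbn [csum].
    replace (RtoC (2 * INR (S N)) - nu)%C with s by (unfold s; rewrite RtoC_mult; reflexivity).
    replace (RtoC (2 * INR (S N))) with (2 * INR (S N))%C by (rewrite RtoC_mult; reflexivity).
    replace (2 * S N + 1)%nat with (2 * N + 1 + 2)%nat by lia. rewrite (pow_add x (2 * N + 1) 2), (RtoC_mult (x ^ (2 * N + 1)) (x ^ 2)).
    set (X := RtoC (x ^ (2 * N + 1))). set (A := csum _ N).
    match goal with |- (?P - ?Q * (A + ?Z * (?H * X)) - ?Q * (X * RtoC (x ^ 2) * (/ RtoC (x ^ 2) * (T - ?H * ?Z))))%C = _ =>
      replace (X * RtoC (x ^ 2) * (/ RtoC (x ^ 2) * (T - H * Z)))%C with (X * (T - H * Z))%C by (field; auto) end.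
    ring.
Qed.

Theorem koshliakov_all nu N0 k : (forall k : Z, nu <> RtoC (IZR k)) -> 0 <= Re nu -> -1 <= Re nu - 2 * INR N0 < 1 ->
  exists inner T, summed x th nu (N0 + k) inner T /\ cser (lhs_term nu x th) (rhs Zh L x th nu (N0 + k) T).
Proof.
  intros Hnu Hr HN. induction k.
  - rewrite Nat.add_0_r. now apply koshliakov_minimal.
  - destruct IHk as (inner & T & H1 & H2).
    destruct (summed_step nu (N0 + k) inner T) as (inner' & T' & H3 & H4); auto.
    + now apply cos_pi_half_neq_int.
    + rewrite plus_INR. pose proof (pos_INR k). lra.
    + exists inner', T'. rewrite Nat.add_succ_r. split; auto. now rewrite H4.
Qed.
End Main.

Theorem theorem3p1 (Zh : C -> R -> C) (L : C) (x theta : R) (nu : C) (N : Z) :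
  is_hurwitz_zeta Zh ->
  0 < x -> 0 < theta < 1 ->
  (forall k : Z, nu <> RtoC (IZR k)) -> 0 <= Re nu ->
  (N >= Int_part ((Re nu + 1) / 2))%Z ->
  (forall n r : nat, (1 <= n)%nat -> (1 <= r)%nat -> x <> (INR n - theta) * INR r) ->
  (* L = zeta(1,theta) - zeta(1,1-theta), understood as a limit s -> 1 *)
  filterlim (fun s => Cminus (Zh s theta) (Zh s (1 - theta)))
    (within (fun s => s <> RtoC 1) (locally (RtoC 1))) (locally L) ->
  let e := Cminus (Cplus nu (RtoC 1)) (RtoC (2 * IZR N)) in
  let cnu := Ccos (Cmult (RtoC (PI / 2)) nu) in
  let snu := Csin (Cmult (RtoC (PI / 2)) nu) in
  let Hd := fun s : C => Cminus (Zh s theta) (Zh s (1 - theta)) in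
  exists (inner : nat -> C) (T : C),
    (forall d : nat, Cis_series (fun m => inner_term e x theta (S d) m) (inner d)) /\
    Cis_series (fun d => Cmult (cpow (INR (S d)) (Cminus (Copp nu) (RtoC 1))) (inner d)) T /\
    Cis_series
      (fun n => Cmult (RtoC (8 * PI))
         (Cmult (cpow x (Cdiv nu (RtoC 2)))
         (Cmult (cpow (INR (S n)) (Cdiv nu (RtoC 2)))
         (Cmult (BesselK nu (4 * PI * sqrt (INR (S n) * x)))
           (divisor_sum (S n)
              (fun d => Cmult (cpow (INR d) (Copp nu)) (RtoC (sin (2 * PI * INR d * theta)))))))))
      (Cminus (Cminus (Cplus (Cminus
        (Cmult (Cdiv (RtoC 1) cnu) (Cmult (Zh (Cplus nu (RtoC 1)) 1) (Cmult L (cpow x nu))))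
        (Cmult (Cdiv (RtoC PI) (Cmult (RtoC 2) snu)) (Hd (Cminus (RtoC 1) nu))))
        (Cmult (Cdiv (RtoC 1) (Cmult (RtoC (2 * x)) cnu)) (Hd (Copp nu))))
        (Cmult (Cdiv (RtoC 1) cnu)
           (Csum_1_to (Z.to_nat N)
              (fun j => Cmult (Zh (RtoC (2 * INR j)) 1)
                 (Cmult (Hd (Cminus (RtoC (2 * INR j)) nu)) (RtoC (x ^ (2 * j - 1))))))))
        (Cmult (Cdiv (RtoC 1) cnu) (Cmult (RtoC (powerRZ x (2 * N + 1))) T))).
Proof.
  intros HZ Hx Hth Hnu Hr HN _ HL e cnu snu Hd.
  (* With I0 the floor of (Re nu + 1)/2 one has -1 <= Re nu - 2 I0 < 1, the range of the minimal
     case; I0 >= 0 allows the passage to natural numbers. *)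
  destruct (base_Int_part ((Re nu + 1) / 2)) as [I1 I2]. set (I0 := Int_part ((Re nu + 1) / 2)) in *.
  assert (HI0 : (0 <= I0)%Z). { apply Z.lt_pred_le. apply lt_IZR. simpl. lra. }
  set (N0 := Z.to_nat I0). set (k := (Z.to_nat N - N0)%nat). set (n := (N0 + k)%nat).
  assert (En : n = Z.to_nat N) by (unfold n, k, N0; lia).
  assert (EN0 : INR N0 = IZR I0) by (rewrite INR_IZR_INZ; f_equal; unfold N0; lia).
  assert (EN : INR n = IZR N) by (rewrite INR_IZR_INZ; f_equal; lia).
  destruct (koshliakov_all Zh theta x L HZ Hth Hx HL nu N0 k Hnu Hr ltac:(lra)) as (inner & T & [H1 H2] & H3).
  fold n in H1, H3. exists inner, T. repeat split.
  - intro d. apply Cis_series_cser. replace e with (nu + 1 - 2 * INR n)%C; [apply H1|].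
    unfold e. rewrite EN, RtoC_mult. reflexivity.
  - now apply Cis_series_cser.
  - apply Cis_series_cser.
    match goal with |- cser _ ?r => replace r with (rhs Zh L x theta nu n T); [exact H3|] end.
    unfold rhs. rewrite Csum_1_to_csum, <- En.
    replace (powerRZ x (2 * N + 1)) with (x ^ (2 * n + 1)).
    2: { rewrite pow_powerRZ. f_equal. lia. }
    rewrite (csum_ext (fun j => (Zh (RtoC (2 * INR (S j))) 1 * (Hd (RtoC (2 * INR (S j)) - nu) * RtoC (x ^ (2 * S j - 1))))%C)
      (fun j => (Zh (RtoC (2 * INR (S j))) 1 * (hdiff Zh theta (RtoC (2 * INR (S j)) - nu) * RtoC (x ^ (2 * j + 1))))%C)).
    + reflexivity.
    + intros j _. replace (2 * S j - 1)%nat with (2 * j + 1)%nat by lia. reflexivity.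
Qed.
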